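(* Let $\alpha_0=\frac12$, $s>2$, $T>0$ and $\omega_0\in H^{s+2}(\mathbb{R}^2)$. Let $\omega^{\alpha_0}$ be a solution, for $0\le t\le T$, of the SQG equation $\omega^{\alpha_0}_t+u^{\alpha_0}\cdot\nabla\omega^{\alpha_0}=0$ with $u^{\alpha_0}=\nabla^{\perp}(-\Delta)^{-1+\alpha_0}\omega^{\alpha_0}=\nabla^\perp(-\Delta)^{-1/2}\omega^{\alpha_0}$ and $\omega^{\alpha_0}(\cdot,0)=\omega_0$. Then there exists $\delta>0$ depending on $T$ and $\int_0^T\|\omega^{\alpha_0}(t)\|_{H^{s+2}}\,dt$ such that for every $0<\alpha<\frac12$ with $0<\frac12-\alpha<\delta$, the solution $\omega^{\alpha}$ of the generalized SQG equation $\omega^{\alpha}_t+u^{\alpha}\cdot\nabla\omega^{\alpha}=0$ with $u^{\alpha}=\nabla^{\perp}(-\Delta)^{-1+\alpha}\omega^{\alpha}$ and the same initial data $\omega^\alpha(\cdot,0)=\omega_0$ is smooth on $[0,T]$. Moreover, for $t\in[0,T]$, $$\|\omega^{\alpha}(t)-\omega^{\alpha_0}(t)\|_{H^{s}}\le C\left(\Big(\tfrac12-\alpha\Big)+\Big(\tfrac12-\alpha\Big)\log^2\Big(\tfrac12-\alpha\Big)\right),$$ where $C>0$ is a constant depending on $T$ and $\int_0^T\|\omega^{\alpha_0}(t)\|_{H^{s+2}}\,dt$.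
   Context: All equations are posed for $(x,t)\in\mathbb{R}^2\times\mathbb{R}^+$, with $\omega$ a scalar unknown. $\nabla^\perp=(-\partial_{x_2},\partial_{x_1})$, and $(-\Delta)^{-1+\alpha}$ is the Fourier multiplier with symbol $|\xi|^{-2+2\alpha}$; thus $u$ is divergence free and, up to a multiplicative constant that the paper omits, $u(x)=\int_{\mathbb{R}^2}\frac{(x-y)^\perp}{|x-y|^{2+2\alpha}}\omega(y)\,dy$ (principal value when $\alpha=\frac12$). $H^r=H^r(\mathbb{R}^2)$ has norm $\|f\|_{H^r}=\|(I-\Delta)^{r/2}f\|_{L^2}$. ''Solution for $0\le t\le T$'' and ''smooth on $[0,T]$'' mean that $\omega$ belongs to $C([0,T];H^{s+2}(\mathbb{R}^2))$ and satisfies the equation there; ''the solution $\omega^\alpha$'' is the unique solution in this class given by local well-posedness for initial data in $H^{s+2}$, and the assertion is that it exists on all of $[0,T]$. The parameter $s$ is fixed. *)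

(* Defs.v *)
From mathcomp Require Import all_boot all_order all_algebra.
From mathcomp Require Import all_classical all_reals all_analysis.
From mathcomp Require Import complex.
Import Order.TTheory GRing.Theory Num.Theory.
Import numFieldNormedType.Exports.

Set Implicit Arguments.
Unset Strict Implicit.
Unset Printing Implicit Defensive.

Local Open Scope classical_set_scope.
Local Open Scope complex_scope.
Local Open Scope ring_scope.

Section Plane.
Context {R : realType}.
Implicit Types (x xi : R * R).

Definition dotp x xi : R := x.1 * xi.1 + x.2 * xi.2.

(* The norm of the product normed module [R * R] is the sup norm, whence this
   Euclidean one. *)
Definition enorm x : R := Num.sqrt (dotp x x).

(* Two-dimensional Lebesgue measure. *)
Definition leb2 : {measure set (measurableTypeR R * measurableTypeR R) -> \bar R} :=
  (@lebesgue_measure R \x @lebesgue_measure R)%E.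

Definition L2 (f : R * R -> R) : Prop := f \in Lfun leb2 2%:E.

Definition L2norm (f : R * R -> R) : \bar R := 'N[leb2]_2%:E [EFin \o f]%E.

Definition L2C (F : R * R -> R[i]) : Prop :=
  L2 (fun x => complex.Re (F x)) /\ L2 (fun x => complex.Im (F x)).

Definition Cintegral (A : set (R * R)) (F : R * R -> R[i]) : R[i] :=
  (\int[leb2]_(x in A) complex.Re (F x)) +i* (\int[leb2]_(x in A) complex.Im (F x)).

Definition expi (t : R) : R[i] := cos t +i* sin t.

(* Unitary normalisation, with phase [x . xi] and no [2 pi] in the exponent, so
   that the symbol of the Laplacian is [- |xi|^2] and Plancherel's identity has
   constant 1. *)
Definition fourier_trunc (n : nat) (f : R * R -> R) xi : R[i] :=
  ((2 * pi)^-1)%:C *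
  Cintegral [set x | enorm x <= n%:R] (fun x => (f x)%:C * expi (- dotp x xi)).

(* For [f] in L^2, whose Fourier integral need not converge, the transform is
   the L^2 limit of the transforms of the (integrable) truncations of [f]. *)
Definition is_fourier (f : R * R -> R) (F : R * R -> R[i]) : Prop :=
  L2C F /\
  L2norm (fun xi => ComplexField.Normc.normc (F xi - fourier_trunc n f xi))
    @[n --> \oo] --> 0%E.

(* Determined up to a null set when [L2 f]. *)
Definition fourier (f : R * R -> R) : R * R -> R[i] :=
  xget (fun=> 0) [set F | is_fourier f F].

(* [g = (I - Delta)^(r/2) f] in L^2. *)
Definition is_bessel (r : R) (f g : R * R -> R) : Prop :=
  [/\ L2 f, L2 g &
      {ae leb2, forall xi,
        fourier g xi = ((1 + enorm xi ^+ 2) `^ (r / 2))%:C * fourier f xi}].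

(* The Sobolev space H^r, for [r >= 0]. *)
Definition Hs (r : R) (f : R * R -> R) : Prop := exists g, is_bessel r f g.

(* All the [g] with [is_bessel r f g] agree almost everywhere, so the infimum is
   the L^2 norm of [(I - Delta)^(r/2) f] if [Hs r f], and [+oo] otherwise. *)
Definition Hnorm (r : R) (f : R * R -> R) : \bar R :=
  ereal_inf [set L2norm g | g in [set g | is_bessel r f g]].

Definition perp xi : R * R := (- xi.2, xi.1).

(* The Fourier multiplier with the real symbol [m] times ['i], as an inverse
   Fourier integral; the real part only discards a zero imaginary part when [m]
   is odd. *)
Definition imultiplier (m : R * R -> R) (f : R * R -> R) x : R :=
  complex.Re (((2 * pi)^-1)%:C *
      Cintegral setT (fun xi => expi (dotp x xi) * ('i%C * (m xi)%:C * fourier f xi))).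

(* [perp grad (-Delta)^(-1 + alpha) w], of symbol
   [i (perp xi) |xi|^(-2 + 2 alpha)].  The inverse Fourier integral is absolutely
   convergent for [w] in H^r with [r > 1] and [0 < alpha <= 1/2], whereas for
   [alpha < 1/2] this field need not be in L^2 and [(-Delta)^(-1 + alpha) w] alone
   is not given by an absolutely convergent integral, because of low
   frequencies. *)
Definition velocity (alpha : R) (w : R * R -> R) x : R * R :=
  (imultiplier (fun xi => (perp xi).1 * enorm xi `^ (- 2 + 2 * alpha)) w x,
   imultiplier (fun xi => (perp xi).2 * enorm xi `^ (- 2 + 2 * alpha)) w x).

Definition grad (f : R * R -> R) x : R * R :=
  ('D_(1 : R, 0 : R) f x, 'D_(0 : R, 1 : R) f x).

Definition has_partials (f : R * R -> R) : Prop :=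
  forall x, derivable f x (1 : R, 0 : R) /\ derivable f x (0 : R, 1 : R).

(* [w] belongs to C([0, T]; H^r). *)
Definition continuous_Hs (r T : R) (w : R -> R * R -> R) : Prop :=
  forall t : R, t \in `[0, T] ->
    Hs r (w t) /\
    Hnorm r (w tau \- w t) @[tau --> within `[0, T] (nbhs t)] --> 0%E.

(* The equation holds pointwise on [0, T] x R^2 (with one-sided time derivatives
   at 0 and T), [w t] being the differentiable representative of its class; the
   initial datum is only a class. *)
Definition gsqg_solution (alpha r T : R) (w0 : R * R -> R)
    (w : R -> R * R -> R) : Prop :=
  [/\ continuous_Hs r T w,
      {ae leb2, forall x, w 0 x = w0 x},
      (forall t : R, t \in `[0, T] -> has_partials (w t)) &
      forall (t : R) x, t \in `[0, T] ->
        (tau - t)^-1 * (w tau x - w t x) @[tau --> within `[0, T] t^']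
          --> - dotp (velocity alpha (w t) x) (grad (w t) x)].

End Plane.

(* Main.v *)
(* The Fourier transform is replaced by the real Hartley transform
     h(xi) = (2 pi)^-1 int w(x) (cos (x . xi) + sin (x . xi)) dx,
   a self-inverse isometry of L^2 whose even and odd parts are the real part and minus the
   imaginary part of the Fourier transform.  In these variables the equation is an ordinary
   differential equation h' = B_q(h, h) in weighted L^2 spaces, with B_q bilinear and
   q(xi) = |xi|^(-2 + 2 alpha).  Since |xi| |q(xi)| is bounded by 1 + |xi|^(-1/2) 1_{|xi| <= 1}
   uniformly for 3/8 <= alpha <= 1/2, the product estimate for B_q (one derivative lost) and the
   energy estimate (none lost, by the antisymmetry of the transport term and a commutator
   estimate) have constants independent of alpha.  Changing q from alpha to 1/2 costs
   O(1/2 - alpha), because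
   | |xi|^(2 alpha - 1) - 1 | <= 8 (1/2 - alpha) (<xi> + |xi|^(-1/2) 1_{|xi| <= 1}).

   The integral M of the H^{s+2} norm bounds the H^{s+1} norm of the SQG solution w: some t0 has
   ||w(t0)||_{s+2} <= M/T + 1, and log ||w||_{s+1} has a derivative of size at most
   C ||w||_{s+2}.  For alpha close to 1/2, Gronwall in H^s keeps the Galerkin approximations of
   the alpha-equation at H^s distance at most 1 from w on all of [0, T], hence bounded in H^{s+2}.
   They are Cauchy in H^s, and their limit is continuous in H^{s+2} because the energy estimate
   also holds for the weights <xi>^(s+3) / (K + <xi>), which control the high frequencies
   uniformly in time.  Gronwall in H^s applied to the limit gives the distance O(1/2 - alpha), and
   also uniqueness. *)

Require Import Defs.
From HB Require Import structures.
From mathcomp Require Import all_boot all_order all_algebra.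
From mathcomp Require Import all_classical all_reals all_analysis.
From mathcomp Require Import measurable_realfun complex ring lra.
Import Order.TTheory GRing.Theory Num.Theory.
Import numFieldNormedType.Exports.
Set Implicit Arguments.
Unset Strict Implicit.
Unset Printing Implicit Defensive.
Local Open Scope classical_set_scope.
Local Open Scope ring_scope.

(** * Calculus on an interval *)

(** The statement is about pointwise solutions, the estimates only see classes. The proof therefore
    works with genuine functions under semi-definite inner products, and returns to points through
    absolutely convergent inverse transforms. The Hartley transform keeps everything real; its
    inversion rests on Abel summation tested on boxes, where the Poisson averages are arctangents.

    For [alpha < 1/2] the symbol [|xi|^(2 alpha - 1)] is unbounded near 0. One square-integrable
    function, [sing], carries this low-frequency loss, at no cost in regularity.

    The difficulty with constants is that [M] controls neither the H^(s+2) norm of the datum nor a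
    supremum in time of that norm. In the comparison of two solutions one is bounded in H^(s+1) and
    the other in H^s only, so [delta] and [C] can be built from the H^(s+1) bound that [M] does
    give. The H^(s+2) norm of the datum enters only the choice of the Galerkin cutoff, which
    disappears in the limit. *)

Section ScalarCalculus.
Context {R : realType}.
Implicit Types (f g : R -> R) (a b t e : R).

(** A derivative relative to the closed interval, one-sided at [a] and [b], multiplied out so that
    no quotient appears. In this form it restricts to subintervals and passes through bounded linear
    functionals without any filter. *)
Definition deriv_on a b f g := forall t, a <= t <= b -> forall e : R, 0 < e ->
  exists2 d : R, 0 < d & forall u, a <= u <= b -> `|u - t| <= d ->
    `|f u - f t - (u - t) * g t| <= e * `|u - t|.

Definition cont_on a b f := forall t, a <= t <= b -> forall e : R, 0 < e ->
  exists2 d : R, 0 < d & forall u, a <= u <= b -> `|u - t| <= d -> `|f u - f t| <= e.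

Lemma deriv_on_sub a b a' b' f g : a <= a' -> b' <= b ->
  deriv_on a b f g -> deriv_on a' b' f g.
Proof.
move=> aa bb H t /andP[t1 t2] e e0.
have [|d d0 Hd] := H t _ e e0; first by rewrite (le_trans aa t1) (le_trans t2 bb).
exists d => // u /andP[u1 u2]; apply: Hd.
by rewrite (le_trans aa u1) (le_trans u2 bb).
Qed.

Lemma deriv_on_cont a b f g : deriv_on a b f g -> cont_on a b f.
Proof.
move=> H t tab e e0.
have [d d0 Hd] := H t tab 1 ltr01.
have c0 : 0 < 1 + `|g t| by rewrite ltr_wpDr.
exists (Num.min d (e / (1 + `|g t|))) => [|u uab].
  by rewrite lt_min d0 divr_gt0.
rewrite le_min => /andP[ud ue].
have H1 := Hd u uab ud.
have -> : f u - f t = (f u - f t - (u - t) * g t) + (u - t) * g t by ring.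
apply: le_trans (ler_normD _ _) _; rewrite normrM.
apply: le_trans (lerD H1 (lexx _)) _.
by rewrite mul1r -{1}[`|u - t|]mulr1 -mulrDr -ler_pdivlMr.
Qed.

Lemma deriv_on_is_derive a b f g t : deriv_on a b f g -> a < t < b ->
  is_derive t (1 : R) f (g t).
Proof.
move=> H /andP[at_ tb].
have cv : (fun h : R => h^-1 *: ((f \o shift t) (h *: (1 : R)) - f t)) @ 0^' --> g t.
  apply/cvgrPdist_le => e e0.
  have [|d d0 Hd] := H t _ e e0; first by rewrite !ltW.
  near=> h.
  have h0 : h != 0 by near: h; exact: nbhs_dnbhs_neq.
  have hd : `|h| <= Num.min d (Num.min (t - a) (b - t)).
    near: h; apply: dnbhs0_le; by rewrite !lt_min d0 !subr_gt0 at_ tb.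
  move: hd; rewrite !le_min => /andP[hd /andP[h1 h2]].
  have hab : a <= h + t <= b.
    move: h1 h2; rewrite !ler_norml => /andP[? ?] /andP[? ?]; apply/andP; split; lra.
  have := Hd (h + t) hab; rewrite addrK => /(_ hd) H1.
  rewrite /= /shift/= [h *: 1]mulr1.
  have -> : g t - h^-1 *: (f (h + t) - f t) = - (h^-1 * (f (h + t) - f t - h * g t)).
    rewrite /GRing.scale/=; field; exact: h0.
  by rewrite normrN normrM normfV ler_pdivrMl ?normr_gt0// [`|h| * e]mulrC.
by apply: DeriveDef; [apply/cvg_ex; eexists; exact: cv | exact: cvg_lim cv].
Unshelve. all: by end_near. Qed.

Lemma cont_on_within a b f : a <= b -> cont_on a b f -> {within `[a, b], continuous f}.
Proof.
move=> ab H; apply/subspace_continuousP => x /=; rewrite in_itv/= => xab.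
apply/cvgrPdist_le => e e0; have [d d0 Hd] := H x xab e e0.
exists d => //= y /= xy; rewrite in_itv/= => yab; rewrite distrC; apply: Hd => //.
by rewrite distrC ltW.
Qed.

Lemma deriv_on_nonincr a b f g : a <= b -> deriv_on a b f g ->
  (forall t, a <= t <= b -> g t <= 0) -> f b <= f a.
Proof.
move=> ab H g0.
have [<-//|aNb] := eqVneq a b.
have {aNb}altb : a < b by rewrite lt_neqAle aNb.
have [x|c cab fba] := @MVT_segment R f g a b ab _ (cont_on_within ab (deriv_on_cont H)).
  by rewrite in_itv/=; exact: deriv_on_is_derive H.
rewrite in_itv/= in cab.
by rewrite -subr_le0 fba mulr_le0_ge0 ?subr_ge0 ?g0.
Qed.

Lemma is_derive_deriv_on a b f g :
  (forall t, a <= t <= b -> is_derive t (1 : R) f (g t)) -> deriv_on a b f g.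
Proof.
move=> H t tab e e0.
have [df dv] := H t tab.
have : (fun h : R => h^-1 *: ((f \o shift t) (h *: (1 : R)) - f t)) @ 0^' --> g t.
  by rewrite -dv; exact: df.
move=> /cvgrPdist_le /(_ _ e0)[d /= d0 Hd].
exists (d / 2) => [|u uab ud]; first by rewrite divr_gt0.
have [->|ut] := eqVneq u t; first by rewrite !subrr mul0r subr0 normr0 mulr0.
have := Hd (u - t); rewrite /= sub0r normrN subr_eq0 => /(_ _ ut).
rewrite (le_lt_trans ud) ?ltr_pdivrMr ?ltr_pMr ?ltr1n// => /(_ erefl).
rewrite [(u - t) *: 1]mulr1 subrK => H1.
have ut0 : u - t != 0 by rewrite subr_eq0.
have -> : f u - f t - (u - t) * g t = - ((u - t) * (g t - (u - t)^-1 *: (f u - f t))).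
  by rewrite /GRing.scale/=; field.
by rewrite normrN normrM mulrC ler_wpM2r.
Qed.

Lemma deriv_onM a b f g f' g' : deriv_on a b f f' -> deriv_on a b g g' ->
  deriv_on a b (fun t => f t * g t) (fun t => f t * g' t + f' t * g t).
Proof.
move=> Hf Hg t tab e e0.
have e4 (c : R) : 0 < e / 4 / (1 + `|c|) by rewrite !divr_gt0// ltr_wpDr.
have [d1 d10 H1] := Hf t tab _ (e4 (g t)).
have [d2 d20 H2] := Hg t tab _ (e4 (f t)).
have [d3 d30 H3] := deriv_on_cont Hf tab (e4 (g' t)).
have [d5 d50 H5] := Hg t tab 1 ltr01.
have [d4 d40 H4] := deriv_on_cont Hf tab (divr_gt0 e0 (ltr0n _ 4)).
exists (Num.min d1 (Num.min d2 (Num.min d3 (Num.min d4 d5)))) => [|u uab].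
  by rewrite !lt_min d10 d20 d30 d40.
rewrite !le_min => /andP[u1 /andP[u2 /andP[u3 /andP[u4 u5]]]].
have {}H1 := H1 u uab u1; have {}H2 := H2 u uab u2; have {}H3 := H3 u uab u3.
have {}H5 := H5 u uab u5; have {}H4 := H4 u uab u4.
have -> : f u * g u - f t * g t - (u - t) * (f t * g' t + f' t * g t) =
  (f u - f t - (u - t) * f' t) * g t + f t * (g u - g t - (u - t) * g' t) +
  ((f u - f t) * ((u - t) * g' t) + (f u - f t) * (g u - g t - (u - t) * g' t)) by ring.
have K (c x r : R) : `|x| <= e / 4 / (1 + `|c|) * r -> `|x| * `|c| <= e / 4 * r.
  move=> H.
  have c1 : 0 < 1 + `|c| by rewrite ltr_wpDr.
  apply: (@le_trans _ _ (`|x| * (1 + `|c|))); first by rewrite ler_wpM2l// lerDr.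
  by rewrite -ler_pdivlMr// [_ / _]mulrAC.
apply: le_trans (ler_normD _ _) _.
apply: le_trans (lerD (ler_normD _ _) (ler_normD _ _)) _; rewrite !normrM.
have := K _ _ _ H1; have := K _ _ _ H2.
have := K (g' t) (f u - f t) 1; rewrite !mulr1 => /(_ H3) K3.
rewrite [`|f t| * _]mulrC => K2 K1.
have K4 : `|f u - f t| * (`|u - t| * `|g' t|) <= e / 4 * `|u - t|.
  by rewrite mulrCA mulrC ler_wpM2r.
have K5 : `|f u - f t| * `|g u - g t - (u - t) * g' t| <= e / 4 * `|u - t|.
  by rewrite mul1r in H5; exact: ler_pM.
have -> : e * `|u - t| = (e / 4 * `|u - t| + e / 4 * `|u - t|) +
  (e / 4 * `|u - t| + e / 4 * `|u - t|) by field.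
exact: lerD (lerD K1 K2) (lerD K4 K5).
Qed.

Lemma deriv_onD a b f g f' g' : deriv_on a b f f' -> deriv_on a b g g' ->
  deriv_on a b (fun t => f t + g t) (fun t => f' t + g' t).
Proof.
move=> Hf Hg t tab e e0.
have e2 : 0 < e / 2 by rewrite divr_gt0.
have [d1 d10 H1] := Hf t tab _ e2; have [d2 d20 H2] := Hg t tab _ e2.
exists (Num.min d1 d2) => [|u uab]; first by rewrite lt_min d10.
rewrite le_min => /andP[u1 u2].
have {}H1 := H1 u uab u1; have {}H2 := H2 u uab u2.
have -> : f u + g u - (f t + g t) - (u - t) * (f' t + g' t) =
  (f u - f t - (u - t) * f' t) + (g u - g t - (u - t) * g' t) by ring.
apply: le_trans (ler_normD _ _) _; apply: le_trans (lerD H1 H2) _.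
by rewrite -mulrDl -splitr.
Qed.

Lemma is_derive_expM (c t : R) :
  is_derive t (1 : R) (fun t => expR (c * t)) (c * expR (c * t)).
Proof.
have H : is_derive t (1 : R) (fun t => c * t) c.
  have -> : (fun t => c * t) = (c *: id) by apply/funext.
  by apply: is_derive_eq; rewrite /GRing.scale/= mulr1.
have := @is_derive1_comp _ expR (fun t => c * t) t _ _ (is_derive_expR _) H.
by rewrite mulrC.
Qed.

(** The function [expR (- A t) f t - B t] is nonincreasing: its derivative is at most
    [(expR (- A t) - 1) B], which is nonpositive because [A t] is nonnegative. *)
Lemma gronwall b A B f f' : 0 <= b -> 0 <= A -> 0 <= B ->
  deriv_on 0 b f f' -> (forall t, 0 <= t <= b -> f' t <= A * f t + B) ->
  f b <= expR (A * b) * (f 0 + B * b).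
Proof.
move=> b0 A0 B0 H fle.
have HE := @is_derive_deriv_on 0 b _ _ (fun t _ => is_derive_expM (- A) t).
have HB : deriv_on 0 b (fun t => - (B * t)) (fun=> - B).
  move=> t _ e e0; exists 1 => // u _ _.
  have -> : - (B * u) - - (B * t) - (u - t) * - B = 0 by ring.
  by rewrite normr0 mulr_ge0// ltW.
have /deriv_on_nonincr := deriv_onD (deriv_onM HE H) HB.
move=> /(_ b0) /=; rewrite !mulr0 expR0 mul1r oppr0 addr0 => H1.
have {}H1 : expR (- A * b) * f b - B * b <= f 0.
  apply: H1 => t tb.
  have -> : expR (- A * t) * f' t + - A * expR (- A * t) * f t - B =
    expR (- A * t) * (f' t - A * f t) - B by ring.
  rewrite subr_le0; apply: (@le_trans _ _ (expR (- A * t) * B)).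
    by rewrite ler_wpM2l ?expR_ge0// lerBlDl fle.
  rewrite ler_piMl// -expR0 ler_expR mulNr oppr_le0 mulr_ge0//; by case/andP: tb.
rewrite -ler_pdivrMl ?expR_gt0// -expRN -mulNr.
by rewrite -lerBlDr.
Qed.

End ScalarCalculus.

(** * Primitives of continuous functions, and induction along an interval *)

Section Primitive.
Context {R : realType}.
Implicit Types (f g : R -> R) (a b t e : R).

Lemma clamp_itv a b t : a <= b -> a <= Num.max a (Num.min t b) <= b.
Proof. by move=> ab; rewrite le_max lexx/= ge_max ab ge_min lexx orbT. Qed.

Lemma clamp_id a b t : a <= t <= b -> Num.max a (Num.min t b) = t.
Proof. by move=> /andP[at_ tb]; rewrite (min_idPl tb) (max_idPr at_). Qed.

Lemma clamp_lip a b t u :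
  `|Num.max a (Num.min t b) - Num.max a (Num.min u b)| <= `|t - u|.
Proof.
have min_lip x y : `|Num.min x b - Num.min y b| <= `|x - y|.
  have [xb|bx] := leP x b; have [yb|yb] := leP y b; rewrite ?subrr ?normr0//.
    by rewrite !ler0_norm; lra.
  by rewrite !ger0_norm; lra.
apply: le_trans _ (min_lip _ _).
set x := Num.min t b; set y := Num.min u b.
have [xb|bx] := leP a x; have [yb|yb] := leP a y; rewrite ?subrr ?normr0//.
  by rewrite !ger0_norm; lra.
by rewrite !ler0_norm; lra.
Qed.

(** Projecting onto [[a, b]] extends [f] to a continuous function on the whole line, to which the
    fundamental theorem applies at the endpoints too. *)
Lemma cont_on_clamp a b f : a <= b -> cont_on a b f ->
  continuous (fun t => f (Num.max a (Num.min t b))).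
Proof.
move=> ab H t; apply/cvgrPdist_le => e e0.
have [d d0 Hd] := H _ (clamp_itv t ab) e e0.
near=> u; rewrite distrC; apply: Hd; first exact: clamp_itv.
apply: le_trans (clamp_lip _ _ _ _) _.
by rewrite distrC; near: u; exact: (@cvgr_dist_le _ _ _ _ _ (fun x => x) t cvg_id).
Unshelve. all: by end_near. Qed.

Lemma cont_on_primitive a b f : a <= b -> cont_on a b f -> exists G, deriv_on a b G f.
Proof.
move=> ab H.
pose psi t := f (Num.max a (Num.min t b)).
have psi_int : (@lebesgue_measure R).-integrable `[a - 1, b + 1] (EFin \o psi).
  apply: continuous_compact_integrable; first exact: segment_compact.
  exact/continuous_subspaceT/cont_on_clamp.
(* Starting at [a - 1] makes every point of [[a, b]] interior, so the derivative is two-sided even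
   at [a]. *)
exists (fun x => \int[@lebesgue_measure R]_(t in `[a - 1, x]) psi t).
apply: is_derive_deriv_on => t tab.
have [|||d1 d2] := @continuous_FTC1 R psi (BLeft (a - 1)) t (b + 1) _ psi_int.
- by case/andP: tab => _ tb; rewrite (le_lt_trans tb)// ltrDl.
- by case/andP: tab => at_ _; rewrite lte_fin (lt_le_trans _ at_)// gtrBl.
- exact: cont_on_clamp.
by apply: DeriveDef => //; rewrite -derive1E d2 /psi clamp_id.
Qed.

(** Real induction, through the supremum of the [x] such that [P] holds on [[a, x]]. The step has to
    deliver [P] at [t] as well as a margin [d] to its right; the case [t = a], where the hypothesis
    is void, is the base. *)
Lemma interval_induction a b (P : R -> Prop) : a <= b ->
  (forall t, a <= t <= b -> (forall u, a <= u < t -> P u) ->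
    exists2 d : R, 0 < d & forall u, a <= u <= b -> u <= t + d -> P u) ->
  forall t, a <= t <= b -> P t.
Proof.
move=> ab step.
pose S := [set x | a <= x <= b /\ forall u, a <= u <= x -> P u].
have Pa : S a.
  split; first by rewrite lexx.
  have [|u /andP[au]|d d0 Hd u uaa] := step a; first by rewrite lexx.
    by rewrite ltNge au.
  apply: Hd; case/andP: uaa => u1 u2; first by rewrite u1 (le_trans u2).
  by rewrite (le_trans u2)// lerDl ltW.
have supS : has_sup S by split; [exists a|exists b => x [/andP[]]].
have sab : a <= sup S <= b.
  rewrite ub_le_sup//=; last by case: supS.
  by apply: ge_sup; [exists a|move=> x [/andP[]]].
have Plt u : a <= u < sup S -> P u.
  move=> /andP[au us].
  have [|x [xab Px] ux] := @sup_adherent _ S (sup S - u) _ supS; first by rewrite subr_gt0.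
  by apply: Px; rewrite au ltW//; move: ux; rewrite opprB addrC subrK.
have [d d0 Hd] := step _ sab Plt.
have := sab => /andP[as_ sb].
have [bs|sbd] := leP b (sup S).
  move=> t /andP[at_ tb]; apply: Hd; rewrite ?at_// (le_trans tb)// (le_trans bs)//.
  by rewrite lerDl ltW.
have Sm : S (Num.min b (sup S + d)).
  split; first by rewrite ge_min lexx/= le_min ab (le_trans as_)// lerDl ltW.
  move=> u /andP[au]; rewrite le_min => /andP[ub us]; apply: Hd => //.
  by rewrite au.
have : Num.min b (sup S + d) <= sup S by apply: ub_le_sup => //; case: supS.
by rewrite ge_min leNgt sbd/= gerDl leNgt d0.
Qed.

End Primitive.

(** * Differential equations in Hilbert spaces *)

(** The domain is a predicate on an ambient space, so the same function lives in all weighted spaces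
    at once, without coercions. The form is only semi-definite: functions equal almost everywhere
    are at distance 0 without being equal, and the limit in [hcomplete] is not unique. *)
Record semiHilbert (R : realType) (V : lmodType R) := SemiHilbert {
  hdom : V -> Prop;
  hip : V -> V -> R;
  hdom0 : hdom 0;
  hdomD : forall x y, hdom x -> hdom y -> hdom (x + y);
  hdomZ : forall a x, hdom x -> hdom (a *: x);
  hipC : forall x y, hip x y = hip y x;
  hipDl : forall x y z, hdom x -> hdom y -> hdom z -> hip (x + y) z = hip x z + hip y z;
  hipZl : forall a x y, hdom x -> hdom y -> hip (a *: x) y = a * hip x y;
  hip_ge0 : forall x, 0 <= hip x x;
  hcomplete : forall u : nat -> V, (forall n, hdom (u n)) ->
    (forall e : R, 0 < e -> exists n0, forall p q, (n0 <= p)%N -> (n0 <= q)%N ->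
       hip (u p - u q) (u p - u q) <= e) ->
    exists2 v, hdom v & forall e : R, 0 < e -> exists n0, forall p, (n0 <= p)%N ->
       hip (u p - v) (u p - v) <= e }.

Section SemiHilbertTheory.
Context {R : realType} {V : lmodType R} (H : semiHilbert V).
Notation dom := (hdom H).
Notation ip := (hip H).
Implicit Types (x y z : V) (a b t e : R).

Definition hnorm x := Num.sqrt (ip x x).

Lemma hdomN x : dom x -> dom (- x).
Proof. by rewrite -scaleN1r; exact: hdomZ. Qed.

Lemma hdomB x y : dom x -> dom y -> dom (x - y).
Proof. by move=> dx dy; apply: hdomD => //; exact: hdomN. Qed.

Lemma hipDr x y z : dom x -> dom y -> dom z -> ip z (x + y) = ip z x + ip z y.
Proof. by move=> dx dy dz; rewrite !(hipC H z) hipDl. Qed.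

Lemma hipZr a x y : dom x -> dom y -> ip y (a *: x) = a * ip y x.
Proof. by move=> dx dy; rewrite !(hipC H y) hipZl. Qed.

Lemma hipNl x y : dom x -> dom y -> ip (- x) y = - ip x y.
Proof. by move=> dx dy; rewrite -scaleN1r hipZl// mulN1r. Qed.

Lemma hipBl x y z : dom x -> dom y -> dom z -> ip (x - y) z = ip x z - ip y z.
Proof. by move=> dx dy dz; rewrite hipDl ?hipNl//; exact: hdomN. Qed.

Lemma hipBr x y z : dom x -> dom y -> dom z -> ip z (x - y) = ip z x - ip z y.
Proof. by move=> dx dy dz; rewrite !(hipC H z) hipBl. Qed.

Lemma hnorm_ge0 x : 0 <= hnorm x. Proof. exact: sqrtr_ge0. Qed.

Lemma hnorm_sqr x : hnorm x ^+ 2 = ip x x. Proof. by rewrite sqr_sqrtr ?hip_ge0. Qed.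

Lemma hnorm_le x c : 0 <= c -> (hnorm x <= c) = (ip x x <= c ^+ 2).
Proof. by move=> c0; rewrite -hnorm_sqr ler_pXn2r// nnegrE hnorm_ge0. Qed.

(** The discriminant argument. As the form may be degenerate, [ip y y = 0] is treated apart: the
    quadratic is then affine in [t], and its nonnegativity for all [t] forces [ip x y = 0]. *)
Lemma hcauchy x y : dom x -> dom y -> `|ip x y| <= hnorm x * hnorm y.
Proof.
move=> dx dy.
suff : ip x y ^+ 2 <= ip x x * ip y y.
  rewrite -!hnorm_sqr -exprMn -[X in X <= _]real_normK ?num_real// ler_pXn2r ?nnegrE//.
  by rewrite mulr_ge0 ?hnorm_ge0.
have Q t : 0 <= ip x x + t * (2 * ip x y) + t ^+ 2 * ip y y.
  have := hip_ge0 H (x + t *: y).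
  have dty : dom (t *: y) by exact: hdomZ.
  rewrite hipDl ?hipDr//; last exact: hdomD.
  rewrite !hipZl ?hipZr// (hipC H y x); congr (0 <= _); ring.
have [y0|y0] := eqVneq (ip y y) 0.
  have [->|xy0] := eqVneq (ip x y) 0; first by rewrite expr0n mulr_ge0 ?hip_ge0.
  (* The point where the affine function takes the value [-1]. *)
  have := Q (- (ip x x + 1) / (2 * ip x y)); rewrite y0 mulr0 addr0.
  have -> : ip x x + - (ip x x + 1) / (2 * ip x y) * (2 * ip x y) = - 1 by field.
  by rewrite oppr_ge0 ler10.
have yp : 0 < ip y y by rewrite lt_neqAle eq_sym y0 hip_ge0.
have := Q (- ip x y / ip y y).
have -> : ip x x + - ip x y / ip y y * (2 * ip x y) + (- ip x y / ip y y) ^+ 2 * ip y y =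
  (ip x x * ip y y - ip x y ^+ 2) / ip y y by field.
by rewrite pmulr_lge0 ?invr_gt0// subr_ge0.
Qed.

Lemma hnorm_add x y : dom x -> dom y -> hnorm (x + y) <= hnorm x + hnorm y.
Proof.
move=> dx dy; rewrite hnorm_le ?addr_ge0 ?hnorm_ge0//.
rewrite hipDl ?hipDr//; last exact: hdomD.
rewrite (hipC H y x) sqrrD !hnorm_sqr.
have := le_trans (ler_norm _) (hcauchy dx dy); lra.
Qed.

Lemma hnormZ a x : dom x -> hnorm (a *: x) = `|a| * hnorm x.
Proof.
move=> dx; rewrite /hnorm hipZl ?hipZr//; last exact: hdomZ.
by rewrite mulrA -expr2 sqrtrM ?sqr_ge0// sqrtr_sqr.
Qed.

Lemma hnorm_opp x : dom x -> hnorm (- x) = hnorm x.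
Proof. by move=> dx; rewrite -scaleN1r hnormZ// normrN1 mul1r. Qed.

Lemma hnorm0 : hnorm 0 = 0.
Proof. by rewrite -(scale0r 0) hnormZ ?normr0 ?mul0r//; exact: hdom0. Qed.

Lemma hnorm_subadd x y : dom x -> dom y -> hnorm (x - y) <= hnorm x + hnorm y.
Proof. by move=> dx dy; rewrite -(hnorm_opp dy) hnorm_add//; exact: hdomN. Qed.

Lemma hnorm_distC x y : dom x -> dom y -> hnorm (x - y) = hnorm (y - x).
Proof. by move=> dx dy; rewrite -opprB hnorm_opp//; exact: hdomB. Qed.

Lemma hdist_tri x y z : dom x -> dom y -> dom z ->
  hnorm (x - z) <= hnorm (x - y) + hnorm (y - z).
Proof.
move=> dx dy dz; have -> : x - z = (x - y) + (y - z) by rewrite addrA subrK.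
by apply: hnorm_add; exact: hdomB.
Qed.

Lemma hnorm_sub x y : dom x -> dom y -> `|hnorm x - hnorm y| <= hnorm (x - y).
Proof.
move=> dx dy; rewrite ler_norml; apply/andP; split.
  rewrite lerNl opprB lerBlDr hnorm_distC//.
  by have := hnorm_add (hdomB dy dx) dx; rewrite subrK.
by rewrite lerBlDr; have := hnorm_add (hdomB dx dy) dy; rewrite subrK.
Qed.

Definition scont_on a b (g : R -> V) := forall t, a <= t <= b -> forall e : R, 0 < e ->
  exists2 d : R, 0 < d & forall u, a <= u <= b -> `|u - t| <= d -> hnorm (g u - g t) <= e.

Definition sderiv_on a b (f g : R -> V) := forall t, a <= t <= b -> forall e : R, 0 < e ->
  exists2 d : R, 0 < d & forall u, a <= u <= b -> `|u - t| <= d ->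
    hnorm (f u - f t - (u - t) *: g t) <= e * `|u - t|.

Definition dom_on a b (g : R -> V) := forall t, a <= t <= b -> dom (g t).

Definition bounded_linear (l : V -> R) (c : R) :=
  [/\ 0 <= c, forall x y, dom x -> dom y -> l (x + y) = l x + l y,
      forall r x, dom x -> l (r *: x) = r * l x &
      forall x, dom x -> `|l x| <= c * hnorm x].

Lemma bounded_linearB l c x y : bounded_linear l c -> dom x -> dom y ->
  l (x - y) = l x - l y.
Proof.
move=> [_ lD lZ _] dx dy; rewrite lD//; last exact: hdomN.
by rewrite -scaleN1r lZ// mulN1r.
Qed.

Lemma bounded_linear_ip x : dom x -> bounded_linear (ip x) (hnorm x).
Proof.
move=> dx; split; first exact: hnorm_ge0.
- by move=> y z dy dz; rewrite hipDr.
- by move=> r y dy; rewrite hipZr.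
- by move=> y dy; exact: hcauchy.
Qed.

Lemma scont_on_linear a b l c g : bounded_linear l c -> dom_on a b g ->
  scont_on a b g -> cont_on a b (l \o g).
Proof.
move=> Hl dg cg t tab e e0.
have c0 : 0 < c + 1 by case: Hl => c0 _ _ _; rewrite ltr_wpDl.
have [d d0 Hd] := cg t tab _ (divr_gt0 e0 c0); exists d => // u uab ut /=.
have := Hl => -[_ _ _ lb].
rewrite -(bounded_linearB Hl (dg _ uab) (dg _ tab)).
apply: le_trans (lb _ (hdomB (dg _ uab) (dg _ tab))) _.
apply: (@le_trans _ _ ((c + 1) * hnorm (g u - g t))).
  by rewrite ler_wpM2r ?hnorm_ge0// lerDl.
by rewrite mulrC -ler_pdivlMr// Hd.
Qed.

Lemma sderiv_on_linear a b l c f g : bounded_linear l c -> dom_on a b f -> dom_on a b g ->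
  sderiv_on a b f g -> deriv_on a b (l \o f) (l \o g).
Proof.
move=> Hl df dg fg t tab e e0.
have c0 : 0 < c + 1 by case: Hl => c0 _ _ _; rewrite ltr_wpDl.
have [d d0 Hd] := fg t tab _ (divr_gt0 e0 c0); exists d => // u uab ut /=.
have := Hl => -[_ _ lZ lb].
have dfut : dom (f u - f t) by apply: hdomB; exact: df.
have dgt : dom ((u - t) *: g t) by apply: hdomZ; exact: dg.
rewrite -lZ; last exact: dg.
rewrite -(bounded_linearB Hl (df _ uab) (df _ tab)) -(bounded_linearB Hl dfut dgt).
apply: le_trans (lb _ (hdomB dfut dgt)) _.
apply: (@le_trans _ _ ((c + 1) * hnorm (f u - f t - (u - t) *: g t))).
  by rewrite ler_wpM2r ?hnorm_ge0// lerDl.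
by rewrite mulrC -ler_pdivlMr// mulrAC Hd.
Qed.

Lemma sderiv_on_cont a b f g : dom_on a b f -> dom_on a b g ->
  sderiv_on a b f g -> scont_on a b f.
Proof.
move=> df dg fg t tab e e0.
have [d d0 Hd] := fg t tab 1 ltr01.
have c0 : 0 < 1 + hnorm (g t) by rewrite ltr_wpDr ?hnorm_ge0.
exists (Num.min d (e / (1 + hnorm (g t)))) => [|u uab].
  by rewrite lt_min d0 divr_gt0.
rewrite le_min => /andP[ud ue].
have H1 := Hd u uab ud.
have -> : f u - f t = (f u - f t - (u - t) *: g t) + (u - t) *: g t by rewrite subrK.
have dg' : dom ((u - t) *: g t) by apply: hdomZ; exact: dg.
apply: le_trans (hnorm_add (hdomB (hdomB (df _ uab) (df _ tab)) dg') dg') _.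
rewrite hnormZ; last exact: dg.
apply: le_trans (lerD H1 (lexx _)) _.
by rewrite mul1r -{1}[`|u - t|]mulr1 -mulrDr -ler_pdivlMr.
Qed.

Lemma sderiv_onB a b (P p Q q : R -> V) : dom_on a b P -> dom_on a b p ->
  dom_on a b Q -> dom_on a b q -> sderiv_on a b P p -> sderiv_on a b Q q ->
  sderiv_on a b (fun t => P t - Q t) (fun t => p t - q t).
Proof.
move=> dP dp dQ dq Pp Qq t tT e e0; have e2 : 0 < e / 2 by rewrite divr_gt0.
have [d1 d10 H1] := Pp t tT _ e2; have [d2 d20 H2] := Qq t tT _ e2.
exists (Num.min d1 d2) => [|v vT]; first by rewrite lt_min d10.
rewrite le_min => /andP[v1 v2].
have -> : P v - Q v - (P t - Q t) - (v - t) *: (p t - q t) =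
    (P v - P t - (v - t) *: p t) - (Q v - Q t - (v - t) *: q t).
  by rewrite scalerBr !opprB !addrA [LHS](ACl (1*4*6*5*3*2))/=.
have a1 := hdomB (hdomB (dP v vT) (dP t tT)) (hdomZ (v - t) (dp t tT)).
have a2 := hdomB (hdomB (dQ v vT) (dQ t tT)) (hdomZ (v - t) (dq t tT)).
apply: le_trans (hnorm_subadd a1 a2) _.
by apply: le_trans (lerD (H1 v vT v1) (H2 v vT v2)) _; rewrite -mulrDl -splitr.
Qed.

(** With [D = f u - f t], the increment of the square is [ip D D + 2 ip (f t) D]; the first term is
    quadratic in [u - t], the second one is differentiated by linearity. *)
Lemma sderiv_on_sqr a b f g : dom_on a b f -> dom_on a b g -> sderiv_on a b f g ->
  deriv_on a b (fun t => ip (f t) (f t)) (fun t => 2 * ip (f t) (g t)).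
Proof.
move=> df dg fg t tab e e0.
have c0 : 0 < 1 + hnorm (f t) by rewrite ltr_wpDr ?hnorm_ge0.
have k0 : 0 < 1 + hnorm (g t) by rewrite ltr_wpDr ?hnorm_ge0.
have [d1 d10 H1] := fg t tab 1 ltr01.
have [d2 d20 H2] := fg t tab _ (divr_gt0 (divr_gt0 e0 (ltr0n _ 4)) c0).
exists (Num.min d1 (Num.min d2 (e / 4 / (1 + hnorm (g t)) ^+ 2))) => [|u uab].
  by rewrite !lt_min d10 d20 !divr_gt0// exprn_gt0.
rewrite !le_min => /andP[u1 /andP[u2 u3]].
have {}H1 := H1 u uab u1; have {}H2 := H2 u uab u2.
have dd : dom (f u - f t) by apply: hdomB; exact: df.
have dgt : dom ((u - t) *: g t) by apply: hdomZ; exact: dg.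
have dr : dom (f u - f t - (u - t) *: g t) by exact: hdomB.
have ft := df _ tab; have gt := dg _ tab; have fu := df _ uab.
have -> : ip (f u) (f u) - ip (f t) (f t) - (u - t) * (2 * ip (f t) (g t)) =
   ip (f u - f t) (f u - f t) + 2 * ip (f t) (f u - f t - (u - t) *: g t).
  rewrite (hipBl fu ft dd) !(hipBr fu ft)// (hipBr dd dgt ft) (hipBr fu ft ft) hipZr//.
  by rewrite (hipC H (f u) (f t)); ring.
apply: le_trans (ler_normD _ _) _.
have -> : e * `|u - t| = e / 2 * `|u - t| + e / 2 * `|u - t| by field.
apply: lerD.
  rewrite ger0_norm ?hip_ge0// -hnorm_sqr.
  have : hnorm (f u - f t) <= (1 + hnorm (g t)) * `|u - t|.
    have -> : f u - f t = (f u - f t - (u - t) *: g t) + (u - t) *: g t by rewrite subrK.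
    apply: le_trans (hnorm_add dr dgt) _.
    by rewrite hnormZ// mulrDl mulrC [X in _ + X]mulrC lerD// mulrC.
  move=> Hn; apply: (@le_trans _ _ (((1 + hnorm (g t)) * `|u - t|) ^+ 2)).
    by rewrite ler_pXn2r ?nnegrE ?hnorm_ge0// mulr_ge0// ltW.
  rewrite exprMn [X in _ * X]expr2 mulrA ler_wpM2r//.
  rewrite mulrC -ler_pdivlMr ?exprn_gt0// (le_trans u3)// ler_wpM2r ?invr_ge0 ?exprn_ge0 ?ltW//.
  by rewrite ltr_pM2l// ltf_pV2 ?posrE// ltr_nat.
rewrite normrM ger0_norm//.
have := le_trans (hcauchy ft dr) (ler_wpM2l (hnorm_ge0 _) H2).
have le1 : hnorm (f t) * (e / 4 / (1 + hnorm (f t)) * `|u - t|) <= e / 4 * `|u - t|.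
  rewrite mulrA ler_wpM2r// mulrA ler_pdivrMr// [e / 4 * _]mulrC.
  by rewrite ler_wpM2r ?lerDr// divr_ge0// ltW.
by move=> /le_trans /(_ le1); lra.
Qed.

(* Testing against [x] itself turns a scalar bound for all functionals into a norm bound. *)
Lemma hnorm_le_dual x c : dom x -> 0 <= c ->
  (forall v, dom v -> ip v x <= c * hnorm v) -> hnorm x <= c.
Proof.
move=> dx c0 /(_ _ dx); rewrite -hnorm_sqr expr2.
have [->//|x0] := eqVneq (hnorm x) 0.
by rewrite ler_pM2r// lt_neqAle eq_sym x0 hnorm_ge0.
Qed.

Lemma deriv_on_linear_nonincr (l : R) a b : deriv_on a b (fun t => l * t) (fun=> l).
Proof.
move=> t _ e e0; exists 1 => // u _ _.
have -> : l * u - l * t - (u - t) * l = 0 by ring.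
by rewrite normr0 mulr_ge0// ltW.
Qed.

Lemma deriv_on_le a b (f g : R -> R) c : a <= b -> deriv_on a b f g ->
  (forall t, a <= t <= b -> g t <= c) -> f b - f a <= c * (b - a).
Proof.
move=> ab fg gc.
have /deriv_on_nonincr := deriv_onD fg (deriv_on_linear_nonincr (- c) (a:=a) (b:=b)).
move=> /(_ ab) H1; have : f b + - c * b <= f a + - c * a.
  by apply: H1 => t /gc; rewrite subr_le0.
by lra.
Qed.

Lemma deriv_on_norm_le a b (f g : R -> R) c : a <= b -> deriv_on a b f g ->
  (forall t, a <= t <= b -> `|g t| <= c) -> `|f b - f a| <= c * (b - a).
Proof.
move=> ab fg gc; rewrite ler_norml; apply/andP; split; last first.
  by apply: (deriv_on_le ab fg) => t /gc; exact: le_trans (ler_norm _).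
have fgN : deriv_on a b (fun t => - f t) (fun t => - g t).
  move=> t tab e e0; have [d d0 Hd] := fg t tab e e0; exists d => // u uab ut.
  have -> : - f u - - f t - (u - t) * - g t = - (f u - f t - (u - t) * g t) by ring.
  by rewrite normrN Hd.
have := deriv_on_le ab fgN (c := c); rewrite opprK => H1.
rewrite lerNl opprB; apply: le_trans (H1 _); first by lra.
by move=> t /gc; apply: le_trans; rewrite -normrN ler_norm.
Qed.

End SemiHilbertTheory.

(** * Integration of vector-valued functions *)

Section SemiHilbertPrimitive.
Context {R : realType} {V : lmodType R} (H : semiHilbert V).
Notation dom := (hdom H).
Notation ip := (hip H).
Notation N := (hnorm H).
Implicit Types (v : V) (a b t e x y : R).

(** Interval induction replaces compactness. Points before [t - d0 / 2] are covered by the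
    hypothesis, points from there up to [t + d0 / 4] lie within [d0] of [t], and two points at
    distance at most [d0 / 4] fall together in one of the two situations. *)
Lemma scont_on_uniform a b (g : R -> V) : a <= b -> dom_on H a b g -> scont_on H a b g ->
  forall e, 0 < e -> exists2 d : R, 0 < d &
    forall t u, a <= t <= b -> a <= u <= b -> `|t - u| <= d -> N (g t - g u) <= e.
Proof.
move=> ab dg cg e e0.
pose P x := exists2 d : R, 0 < d &
    forall t u, a <= t <= x -> a <= u <= x -> `|t - u| <= d -> N (g t - g u) <= e.
suff : forall x, a <= x <= b -> P x by move=> /(_ b); rewrite ab lexx => /(_ erefl).
apply: interval_induction => // t tab IH.
have [d0 d00 Hd0] := cg t tab (e / 2) (divr_gt0 e0 (ltr0n _ 2)).
have near2 u w : a <= u <= b -> a <= w <= b -> `|u - t| <= d0 -> `|w - t| <= d0 ->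
    N (g u - g w) <= e.
  move=> uab vab ut vt; apply: le_trans (hdist_tri (dg _ uab) (dg _ tab) (dg _ vab)) _.
  rewrite (splitr e); apply: lerD; first exact: Hd0.
  by rewrite hnorm_distC ?Hd0//; exact: dg.
exists (d0 / 4) => [|u /andP[au ub] utd]; first by rewrite divr_gt0.
have [d1 d10 Hd1] : P (t - d0 / 2).
  have [ta|ta] := leP a (t - d0 / 2); first by apply: IH; rewrite ta/= gtrBl divr_gt0.
  exists 1 => // t' u' /andP[h1 h2]; have := le_lt_trans (le_trans h1 h2) ta.
  by rewrite ltxx.
exists (Num.min d1 (d0 / 4)) => [|p q /andP[ap pu] /andP[aq qu]].
  by rewrite lt_min d10 divr_gt0.
rewrite le_min => /andP[pq1 pq2].
have pab : a <= p <= b by rewrite ap (le_trans pu).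
have qab : a <= q <= b by rewrite aq (le_trans qu).
have [p1|p1] := leP p (t - d0 / 2); have [q1|q1] := leP q (t - d0 / 2).
- by apply: Hd1; rewrite ?ap ?aq.
- by apply: near2 => //; move: pq2; rewrite !ler_norml => /andP[? ?]; apply/andP; split; lra.
- by apply: near2 => //; move: pq2; rewrite !ler_norml => /andP[? ?]; apply/andP; split; lra.
- by apply: near2 => //; rewrite !ler_norml; apply/andP; split; lra.
Qed.

(** Left Riemann sums on the dyadic partition with [2 ^ n] pieces. The recursion bisects the
    interval, so the estimates go by induction on [n] over all intervals at once. *)
Fixpoint rsum (g : R -> V) n a b : V :=
  if n is m.+1 then rsum g m a ((a + b) / 2) + rsum g m ((a + b) / 2) b
  else (b - a) *: g a.

Lemma mid_itv a b : a <= b -> a <= (a + b) / 2 <= b.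
Proof. by move=> ab; apply/andP; split; lra. Qed.

Lemma rsum_dom g n a b : a <= b -> dom_on H a b g -> dom (rsum g n a b).
Proof.
elim: n a b => [|n IH] a b ab dg /=.
  by apply: hdomZ; apply: dg; rewrite lexx.
have /andP[am mb] := mid_itv ab.
apply: hdomD; apply: IH => // t /andP[t1 t2]; apply: dg.
  by rewrite t1 (le_trans t2).
by rewrite t2 andbT (le_trans am).
Qed.

Lemma rsum_close g v e n a b : a <= b -> dom v -> dom_on H a b g ->
  (forall x, a <= x <= b -> N (g x - v) <= e) ->
  N (rsum g n a b - (b - a) *: v) <= (b - a) * e.
Proof.
move=> + dv; elim: n a b => [|n IH] a b ab dg gv /=.
  have aab : a <= a <= b by rewrite lexx.
  rewrite -scalerBr hnormZ; last by apply: hdomB => //; exact: dg.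
  by rewrite ger0_norm ?subr_ge0// ler_wpM2l ?subr_ge0// gv.
have /andP[am mb] := mid_itv ab; set m := (a + b) / 2.
have g1 : dom_on H a m g by move=> t /andP[t1 t2]; apply: dg; rewrite t1 (le_trans t2).
have g2 : dom_on H m b g by move=> t /andP[t1 t2]; apply: dg; rewrite t2 andbT (le_trans am).
have -> : rsum g n a m + rsum g n m b - (b - a) *: v =
  (rsum g n a m - (m - a) *: v) + (rsum g n m b - (b - m) *: v).
  by rewrite addrACA -opprD -scalerDl; congr (_ - _ *: _); ring.
apply: le_trans (hnorm_add _ _) _; try by apply: hdomB; [exact: rsum_dom|exact: hdomZ].
have -> : (b - a) * e = (m - a) * e + (b - m) * e by ring.
apply: lerD; apply: IH => // x /andP[x1 x2]; apply: gv.
  by rewrite x1 (le_trans x2).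
by rewrite x2 andbT (le_trans am).
Qed.

Lemma rsum_cauchy g e n p a b : a <= b -> dom_on H a b g ->
  (forall x y, a <= x <= b -> a <= y <= b -> `|x - y| <= (b - a) / 2 ^+ n ->
    N (g x - g y) <= e) ->
  N (rsum g (n + p) a b - rsum g n a b) <= (b - a) * e.
Proof.
elim: n a b => [|n IH] a b ab dg gv /=.
  have aab : a <= a <= b by rewrite lexx.
  apply: rsum_close => //; first exact: dg.
  move=> x /andP[ax xb]; apply: gv => //; first by rewrite ax.
  by rewrite expr0 divr1 ger0_norm ?subr_ge0// lerD2r.
have /andP[am mb] := mid_itv ab; set m := (a + b) / 2.
have g1 : dom_on H a m g by move=> t /andP[t1 t2]; apply: dg; rewrite t1 (le_trans t2).
have g2 : dom_on H m b g by move=> t /andP[t1 t2]; apply: dg; rewrite t2 andbT (le_trans am).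
rewrite opprD addrACA.
apply: le_trans (hnorm_add _ _) _; try by apply: hdomB; exact: rsum_dom.
have -> : (b - a) * e = (m - a) * e + (b - m) * e by ring.
have half : (b - a) / 2 ^+ n.+1 = (b - a) / 2 / 2 ^+ n.
  by rewrite exprS invfM mulrA.
apply: lerD; apply: IH => // x y /andP[x1 x2] /andP[y1 y2] xy; apply: gv;
  rewrite ?x1 ?y1 ?(le_trans x2) ?(le_trans y2) ?x2 ?y2 ?(le_trans am)//;
  by rewrite half (le_trans xy)// ler_wpM2r// ?invr_ge0 ?exprn_ge0// /m; lra.
Qed.

Lemma rsum_functional g l c G e n a b : a <= b -> dom_on H a b g -> bounded_linear H l c ->
  deriv_on a b G (l \o g) ->
  (forall x y, a <= x <= b -> a <= y <= b -> `|x - y| <= (b - a) / 2 ^+ n ->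
    N (g x - g y) <= e) ->
  `|G b - G a - l (rsum g n a b)| <= (b - a) * (c * e).
Proof.
move=> + + Hl; have [c0 lD lZ lb] := Hl.
elim: n a b => [|n IH] a b ab dg dG gv /=.
  have aab : a <= a <= b by rewrite lexx.
  have dGa := deriv_onD dG (deriv_on_linear_nonincr (- l (g a)) (a:=a) (b:=b)).
  rewrite lZ; last exact: dg.
  have := deriv_on_norm_le (c := c * e) ab dGa.
  have -> : G b + - l (g a) * b - (G a + - l (g a) * a) = G b - G a - (b - a) * l (g a) by ring.
  move=> H1; rewrite [leRHS]mulrC; apply: H1 => t tab /=.
  rewrite -(bounded_linearB Hl (dg _ tab) (dg _ aab)).
  apply: le_trans (lb _ (hdomB (dg _ tab) (dg _ aab))) _.
  rewrite ler_wpM2l// gv// expr0 divr1 ger0_norm ?subr_ge0; last by case/andP: tab.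
  by rewrite lerD2r; case/andP: tab.
have /andP[am mb] := mid_itv ab; set m := (a + b) / 2.
have g1 : dom_on H a m g by move=> t /andP[t1 t2]; apply: dg; rewrite t1 (le_trans t2).
have g2 : dom_on H m b g by move=> t /andP[t1 t2]; apply: dg; rewrite t2 andbT (le_trans am).
rewrite lD; try exact: rsum_dom.
have -> : G b - G a - (l (rsum g n a m) + l (rsum g n m b)) =
  (G m - G a - l (rsum g n a m)) + (G b - G m - l (rsum g n m b)) by ring.
apply: le_trans (ler_normD _ _) _.
have -> : (b - a) * (c * e) = (m - a) * (c * e) + (b - m) * (c * e) by ring.
have half : (b - a) / 2 ^+ n.+1 = (b - a) / 2 / 2 ^+ n.
  by rewrite exprS invfM mulrA.
apply: lerD; apply: IH => //; try exact: deriv_on_sub dG;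
  move=> x y /andP[x1 x2] /andP[y1 y2] xy; apply: gv;
  rewrite ?x1 ?y1 ?(le_trans x2) ?(le_trans y2) ?x2 ?y2 ?(le_trans am)//;
  by rewrite half (le_trans xy)// ler_wpM2r// ?invr_ge0 ?exprn_ge0// /m; lra.
Qed.

Lemma geom_small (c d : R) : 0 < d -> exists n0, forall n, (n0 <= n)%N -> c / 2 ^+ n <= d.
Proof.
move=> d0.
have [N0 _ HN] : \forall n \near \oo, `|c / d| <= n%:R by exact: nbhs_infty_ger.
exists N0 => n n0; have {}HN := HN n n0.
rewrite ler_pdivrMr ?exprn_gt0// -ler_pdivrMl// mulrC.
apply: le_trans (ler_norm _) _; apply: le_trans HN _.
by rewrite -natrX ler_nat ltnW// ltn_expl.
Qed.

(** Characterising the vector integral by its image under every bounded functional makes its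
    additivity in the endpoint a fact about the scalar primitives [G]. *)
Lemma rsum_limit g a b : a <= b -> dom_on H a b g -> scont_on H a b g ->
  exists2 v, dom v & forall l c G, bounded_linear H l c -> deriv_on a b G (l \o g) ->
    l v = G b - G a.
Proof.
move=> ab dg cg.
have unif e : 0 < e -> exists n0, forall n, (n0 <= n)%N ->
  forall x y, a <= x <= b -> a <= y <= b -> `|x - y| <= (b - a) / 2 ^+ n -> N (g x - g y) <= e.
  move=> e0; have [d d0 Hd] := scont_on_uniform ab dg cg e0.
  have [n0 Hn0] := geom_small (b - a) d0.
  by exists n0 => n nn0 x y xab yab xy; apply: Hd => //; exact: le_trans xy (Hn0 _ nn0).
have k0 : 0 < b - a + 1 by rewrite ltr_wpDl ?subr_ge0.
have [n|e e0|v dv Hv] := @hcomplete _ _ H (fun n => rsum g n a b).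
- exact: rsum_dom.
- have e1 : 0 < Num.sqrt e / 2 / (b - a + 1) by rewrite !divr_gt0 ?sqrtr_gt0.
  have [n0 Hn0] := unif _ e1; exists n0 => p q pn qn.
  rewrite -hnorm_sqr -(sqr_sqrtr (ltW e0)) ler_pXn2r ?nnegrE ?hnorm_ge0 ?sqrtr_ge0//.
  have one p' : (n0 <= p')%N -> N (rsum g p' a b - rsum g n0 a b) <= Num.sqrt e / 2.
    move=> /subnKC <-; apply: le_trans (rsum_cauchy _ ab dg (Hn0 _ (leqnn _))) _.
    rewrite mulrA ler_pdivrMr// mulrC ler_wpM2l ?divr_ge0 ?sqrtr_ge0//.
    by rewrite lerDl.
  have dd k : dom (rsum g k a b) by exact: rsum_dom.
  apply: le_trans (hdist_tri (dd p) (dd n0) (dd q)) _.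
  by rewrite (splitr (Num.sqrt e)) lerD ?one// hnorm_distC ?one.
- exists v => // l c G Hl dG; have [c0 lD lZ lb] := Hl.
  apply/eqP; rewrite eq_sym -subr_eq0 -normr_eq0 eq_le normr_ge0 andbT.
  apply/ler_addgt0Pr => e e0; rewrite add0r.
  have e1 : 0 < e / 2 / (b - a + 1) / (c + 1) by rewrite !divr_gt0// ltr_wpDl.
  have e2 : 0 < (e / 2 / (c + 1)) ^+ 2 by rewrite exprn_gt0// !divr_gt0// ltr_wpDl.
  have [n1 Hn1] := unif _ e1; have [n2 Hn2] := Hv _ e2.
  pose n := maxn n1 n2.
  have dn : dom (rsum g n a b) by exact: rsum_dom.
  have H1 := rsum_functional ab dg Hl dG (Hn1 n (leq_maxl _ _)).
  have {}H2 : N (rsum g n a b - v) <= e / 2 / (c + 1).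
    rewrite hnorm_le ?Hn2 ?leq_maxr//; first by rewrite !divr_ge0 ?addr_ge0// ltW.
  have -> : G b - G a - l v = (G b - G a - l (rsum g n a b)) + (l (rsum g n a b) - l v) by ring.
  apply: le_trans (ler_normD _ _) _; rewrite (splitr e); apply: lerD.
    apply: le_trans H1 _.
    have c1 : c / (c + 1) <= 1 by rewrite ler_pdivrMr ?mul1r ?lerDl// ltr_wpDl.
    have b1 : (b - a) / (b - a + 1) <= 1 by rewrite ler_pdivrMr// mul1r lerDl.
    have -> : (b - a) * (c * (e / 2 / (b - a + 1) / (c + 1))) =
      e / 2 * ((b - a) / (b - a + 1) * (c / (c + 1))).
      by field; rewrite !gt_eqF// ltr_wpDl.
    rewrite ler_piMr//; first by rewrite divr_ge0// ltW.
    rewrite -[leRHS]mulr1; apply: ler_pM => //; rewrite divr_ge0// ?subr_ge0//.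
      exact: ltW.
    by rewrite addr_ge0.
  rewrite -(bounded_linearB Hl dn dv); apply: le_trans (lb _ (hdomB dn dv)) _.
  apply: (@le_trans _ _ ((c + 1) * (e / 2 / (c + 1)))).
    by apply: ler_pM => //; rewrite ?hnorm_ge0 ?lerDl.
  by rewrite mulrC divfK// gt_eqF// ltr_wpDl.
Qed.

(** Tested against [v], the remainder of the derivative becomes the remainder for a scalar primitive
    of [ip v \o g]. The bound obtained is proportional to the norm of [v], hence a bound on the norm
    of the remainder. *)
Lemma sprimitive g b : 0 <= b -> dom_on H 0 b g -> scont_on H 0 b g ->
  exists P, [/\ dom_on H 0 b P, sderiv_on H 0 b P g & P 0 = 0].
Proof.
move=> b0 dg cg.
have ex t : exists v, 0 <= t <= b -> dom v /\
    forall l c G, bounded_linear H l c -> deriv_on 0 b G (l \o g) -> l v = G t - G 0.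
  have [/andP[t0 tb]|] := boolP (0 <= t <= b); last by exists 0.
  have sub : forall u, 0 <= u <= t -> 0 <= u <= b.
    by move=> u /andP[-> ut]; rewrite (le_trans ut).
  have cgt : scont_on H 0 t g.
    move=> u ut e e0; have [d d0 Hd] := cg u (sub _ ut) e e0.
    by exists d => // w /sub; exact: Hd.
  have [v dv Hv] := rsum_limit t0 (fun u ut => dg u (sub u ut)) cgt.
  exists v => _; split=> // l c G Hl dG; apply: (Hv l c G) => //.
  exact: deriv_on_sub dG.
have [P HP] := boolp.choice ex.
(* The integral over [[0, 0]] is only determined up to a vector of norm 0; its value is reset to be
   exactly 0. *)
pose Q t := if t == 0 then 0 else P t.
have QP t l c G : 0 <= t <= b -> bounded_linear H l c -> deriv_on 0 b G (l \o g) ->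
    l (Q t) = G t - G 0.
  move=> tb Hl dG; rewrite /Q; case: ifPn => [/eqP ->|_].
    by have [_ _ lZ _] := Hl; rewrite subrr -(scale0r 0) lZ ?mul0r//; exact: hdom0.
  by have [_ HPt] := HP t tb; exact: HPt Hl dG.
have dQ : dom_on H 0 b Q.
  move=> t tb; rewrite /Q; case: ifPn => _; first exact: hdom0.
  by have [] := HP t tb.
exists Q; split=> //; last by rewrite /Q eqxx.
move=> t tb e e0; have [d d0 Hd] := cg t tb e e0; exists d => // u ub ut.
have dd : dom (Q u - Q t - (u - t) *: g t).
  by apply: hdomB; [apply: hdomB; exact: dQ|apply: hdomZ; exact: dg].
apply: hnorm_le_dual => //; first by rewrite mulr_ge0// ltW.
move=> v dv; apply: le_trans (ler_norm _) _.
have Hl := bounded_linear_ip dv.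
have [G dG] := cont_on_primitive b0 (scont_on_linear Hl dg cg).
rewrite hipBr//; [|by apply: hdomB; exact: dQ|by apply: hdomZ; exact: dg].
rewrite hipBr; [|exact: dQ|exact: dQ|by []].
rewrite !(QP _ _ _ _ _ Hl dG)// hipZr//; last exact: dg.
wlog tu : / Num.min t u <= Num.max t u by apply; rewrite ge_min !le_max !lexx.
set p := Num.min t u in tu; set q := Num.max t u in tu.
have pq w : p <= w <= q -> 0 <= w <= b /\ `|w - t| <= d.
  rewrite /p /q; move: tb ub ut => /andP[t0 tb'] /andP[u0 ub'] ut /andP[pw wq].
  have [le_tu|lt_ut] := leP t u.
    move: pw wq; rewrite (min_idPl le_tu) (max_idPr le_tu) => pw wq.
    split; first by rewrite (le_trans t0)// (le_trans wq).
    by apply: le_trans ut; rewrite !ger0_norm ?subr_ge0// lerD2r.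
  move: pw wq; rewrite (min_idPr (ltW lt_ut)) (max_idPl (ltW lt_ut)) => pw wq.
  split; first by rewrite (le_trans u0)// (le_trans wq).
  by apply: le_trans ut; rewrite !ler0_norm ?subr_le0//; [lra|exact: ltW].
have dG' : deriv_on p q G (ip v \o g).
  move=> w wpq e' e'0; have [wb _] := pq w wpq; have [d' d'0 Hd'] := dG w wb e' e'0.
  by exists d' => // z /pq[zb _]; exact: Hd'.
have dGa := deriv_onD dG' (deriv_on_linear_nonincr (- ip v (g t)) (a:=p) (b:=q)).
have := deriv_on_norm_le (c := e * N v) tu dGa.
have -> : `|G q + - ip v (g t) * q - (G p + - ip v (g t) * p)| =
  `|G u - G 0 - (G t - G 0) - (u - t) * ip v (g t)|.
  rewrite /p /q; have [le_tu|lt_ut] := leP t u; first by congr (`| _ |); ring.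
  by rewrite -normrN; congr (`| _ |); ring.
have -> : q - p = `|u - t|.
  rewrite /p /q; have [le_tu|lt_ut] := leP t u; first by rewrite ger0_norm// subr_ge0.
  by rewrite ltr0_norm ?subr_lt0// opprB.
rewrite mulrAC; apply => w /pq[wb wt] /=.
rewrite -(bounded_linearB Hl (dg _ wb) (dg _ tb)).
apply: le_trans (hcauchy dv (hdomB (dg _ wb) (dg _ tb))) _.
by rewrite mulrC ler_wpM2r ?hnorm_ge0// Hd.
Qed.

End SemiHilbertPrimitive.

(** * Global solutions of Lipschitz equations *)

Section Picard.
Context {R : realType} {V : lmodType R} (H : semiHilbert V).
Notation dom := (hdom H).
Notation N := (hnorm H).
Variables (f : V -> V) (L T : R) (x0 : V).
Hypotheses (T0 : 0 <= T) (L0 : 0 < L) (dx0 : dom x0).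
Hypothesis domf : forall v, dom v -> dom (f v).
Hypothesis lipf : forall v w, dom v -> dom w -> N (f v - f w) <= L * N (v - w).

Lemma scont_on_lip g : dom_on H 0 T g -> scont_on H 0 T g -> scont_on H 0 T (f \o g).
Proof.
move=> dg cg t tT e e0; have [d d0 Hd] := cg t tT _ (divr_gt0 e0 L0).
exists d => // u uT ut /=; apply: le_trans (lipf (dg _ uT) (dg _ tT)) _.
by rewrite mulrC -ler_pdivlMr// Hd.
Qed.

(** The bound [c (2 L) expR (2 L t)] integrates to [c expR (2 L t)], up to a constant of the right
    sign. As the field has Lipschitz constant [L], each Picard iteration gains a factor 1/2 in this
    exponential norm, on an interval of any length. *)
Lemma sderiv_on_dist (P Q p q : R -> V) (c : R) : 0 <= c ->
  dom_on H 0 T P -> dom_on H 0 T Q -> dom_on H 0 T p -> dom_on H 0 T q ->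
  sderiv_on H 0 T P p -> sderiv_on H 0 T Q q -> P 0 = Q 0 ->
  (forall t, 0 <= t <= T -> N (p t - q t) <= c * (2 * L) * expR (2 * L * t)) ->
  forall t, 0 <= t <= T -> N (P t - Q t) <= c * expR (2 * L * t).
Proof.
move=> c0 dP dQ dp dq Pp Qq PQ0 pq t tT.
have dPQ u : 0 <= u <= T -> dom (P u - Q u) by move=> ?; apply: hdomB; [exact: dP|exact: dQ].
apply: hnorm_le_dual; [exact: dPQ|by rewrite mulr_ge0// expR_ge0|move=> v dv].
have Hl := bounded_linear_ip dv.
have [t0 tT'] := andP tT.
have restr g g' : deriv_on 0 T g g' -> deriv_on 0 t g g' by exact: deriv_on_sub.
have HP := restr _ _ (sderiv_on_linear Hl dP dp Pp).
have HQ := restr _ _ (sderiv_on_linear Hl dQ dq Qq).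
have HE := @is_derive_deriv_on _ 0 t _ _ (fun t _ => is_derive_expM (2 * L) t).
have cst k : deriv_on 0 t (fun=> k) (fun=> 0 : R).
  by move=> u _ e e0; exists 1 => // w _ _; rewrite mulr0 !subrr normr0 mulr_ge0// ltW.
have := deriv_onD (deriv_onD HP (deriv_onM (cst (- 1)) HQ)) (deriv_onM (cst (- (c * N v))) HE).
move=> /deriv_on_nonincr H1; have {}H1 := H1 t0; rewrite /= in H1.
rewrite hipBr//; [|exact: dP|exact: dQ].
have {}H1 : hip H v (P t) - hip H v (Q t) - c * N v * expR (2 * L * t) <= - (c * N v).
  have -> : - (c * N v) = hip H v (P 0) + -1 * hip H v (Q 0) + - (c * N v) * expR (2 * L * 0).
    by rewrite mulr0 expR0 mulr1 PQ0; ring.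
  apply: le_trans (H1 _); first by rewrite mulN1r mulNr.
  move=> u /andP[u0 ut]; have uT : 0 <= u <= T by rewrite u0 (le_trans ut).
  rewrite !mul0r !addr0 mulN1r -hipBr//; [|exact: dp|exact: dq].
  rewrite mulNr subr_le0; apply: le_trans (ler_norm _) _.
  apply: le_trans (hcauchy dv (hdomB (dp _ uT) (dq _ uT))) _.
  rewrite [leLHS]mulrC [leRHS](_ : _ = c * (2 * L) * expR (2 * L * u) * N v); last by ring.
  by rewrite ler_wpM2r ?hnorm_ge0// pq.
have := mulr_ge0 c0 (hnorm_ge0 H v); rewrite mulrAC; lra.
Qed.

Lemma picard : exists x, [/\ dom_on H 0 T x, sderiv_on H 0 T x (f \o x) & x 0 = x0].
Proof.
pose ok (x : R -> V) := dom_on H 0 T x /\ scont_on H 0 T x.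
have okf x : ok x -> dom_on H 0 T (f \o x) by move=> [dx _] t tT; exact/domf/dx.
have step x : exists y, ok x ->
    [/\ ok y, sderiv_on H 0 T y (f \o x) & y 0 = x0].
  have [okx|nok] := pselect (ok x); last by exists x.
  have [P [dP HP P0]] := sprimitive T0 (okf _ okx) (scont_on_lip okx.1 okx.2).
  exists (fun t => x0 + P t) => _.
  have dy : dom_on H 0 T (fun t => x0 + P t) by move=> t tT; apply: hdomD => //; exact: dP.
  have Hy : sderiv_on H 0 T (fun t => x0 + P t) (f \o x).
    move=> t tT e e0; have [d d0 Hd] := HP t tT e e0; exists d => // u uT ut.
    by rewrite opprD addrACA subrr add0r Hd.
  split=> //; last by rewrite P0 addr0.
  by split=> //; exact: sderiv_on_cont (okf _ okx) Hy.
have [Phi HPhi] := boolp.choice step.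
pose X n := iter n Phi (fun=> x0).
have okX n : ok (X n).
  elim: n => [|n IH]; last by have [] := HPhi _ IH.
  split; first by move=> t tT.
  by move=> t tT e e0; exists 1 => // u _ _ /=; rewrite subrr hnorm0 ltW.
have XS n : [/\ ok (X n.+1), sderiv_on H 0 T (X n.+1) (f \o X n) & X n.+1 0 = x0].
  exact: HPhi.
have X0 n : X n 0 = x0 by case: n => // n; have [] := XS n.
have dX n : dom_on H 0 T (X n) by have [] := okX n.
pose c := N (f x0) / (2 * L).
have c0 : 0 <= c by rewrite divr_ge0 ?hnorm_ge0// mulr_ge0// ltW.
have L20 : 2 * L != 0 by rewrite gt_eqF// mulr_gt0.
have L2p : 0 < 2 * L by rewrite mulr_gt0.
have E1 t : 0 <= t -> 1 <= expR (2 * L * t).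
  by move=> t0; apply: le_trans (expR_ge1Dx _); rewrite lerDl mulr_ge0// ltW.
have diff n t : 0 <= t <= T -> N (X n.+1 t - X n t) <= c / 2 ^+ n * expR (2 * L * t).
  elim: n t => [|n IH] t tT.
    have sd0 : sderiv_on H 0 T (X 0%N) (fun=> 0).
      move=> u _ e e0; exists 1 => // w _ _.
      by rewrite /X/= subrr scaler0 subr0 hnorm0 mulr_ge0// ltW.
    have [_ sX _] := XS 0%N.
    rewrite expr0 divr1.
    apply: (sderiv_on_dist c0 (dX 1%N) (dX 0%N) (okf _ (okX 0%N)) _ sX sd0) => //.
    - by move=> u _; exact: hdom0.
    - move=> u /andP[u0 _] /=; rewrite subr0 /c divfK//.
      by rewrite ler_peMr ?hnorm_ge0// E1.
  have [_ sX _] := XS n.+1; have [_ sX' _] := XS n.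
  apply: (sderiv_on_dist _ (dX n.+2) (dX n.+1) (okf _ (okX n.+1)) (okf _ (okX n)) sX sX') => //.
  - by rewrite divr_ge0.
  - by rewrite !X0.
  - move=> u uT; apply: le_trans (lipf (dX n.+1 _ uT) (dX n _ uT)) _.
    apply: le_trans (ler_wpM2l (ltW L0) (IH _ uT)) _.
    rewrite exprS; have p2 : 2 ^+ n != 0 :> R by rewrite gt_eqF// exprn_gt0.
    by rewrite le_eqVlt; apply/orP; left; apply/eqP; field.
pose E := expR (2 * L * T).
have E0 : 0 < E by exact: expR_gt0.
have leE t : 0 <= t <= T -> expR (2 * L * t) <= E.
  by move=> /andP[_ tT]; rewrite ler_expR ler_wpM2l// ltW.
have k0 : 0 <= 2 * c * E by apply: mulr_ge0; [exact: mulr_ge0|exact: ltW].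
have far n p t : 0 <= t <= T -> N (X (n + p)%N t - X n t) <= 2 * c * E / 2 ^+ n.
  move=> tT.
  (* The induction on [p] needs the bound from which the remaining geometric tail is subtracted. *)
  suff : N (X (n + p)%N t - X n t) <= 2 * c * E / 2 ^+ n - 2 * c * E / 2 ^+ (n + p).
    by move=> /le_trans; apply; rewrite gerBl divr_ge0.
  elim: p => [|p IH]; first by rewrite addn0 !subrr hnorm0.
  rewrite addnS; apply: le_trans (hdist_tri (dX _ _ tT) (dX (n + p)%N _ tT) (dX _ _ tT)) _.
  apply: le_trans (lerD (le_trans (diff _ _ tT) (ler_wpM2l _ (leE _ tT))) IH) _.
    by rewrite divr_ge0.
  have p2 : 2 ^+ (n + p) != 0 :> R by rewrite gt_eqF// exprn_gt0.
  have p3 : 2 ^+ n != 0 :> R by rewrite gt_eqF// exprn_gt0.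
  by rewrite exprS le_eqVlt; apply/orP; left; apply/eqP; field; rewrite p2.
have ex t : exists v, 0 <= t <= T -> dom v /\ forall n, N (X n t - v) <= 2 * c * E / 2 ^+ n.
  have [tT|tT] := boolP (0 <= t <= T); last by exists 0.
  have [n|e e0|v dv Hv] := @hcomplete _ _ H (fun n => X n t).
  - exact: dX.
  - have s0 : 0 < Num.sqrt e / 2 by rewrite divr_gt0// sqrtr_gt0.
    have [n0 Hn0] := geom_small (2 * c * E) s0; exists n0 => p q pn qn.
    rewrite -hnorm_sqr -(sqr_sqrtr (ltW e0)) ler_pXn2r ?nnegrE ?hnorm_ge0 ?sqrtr_ge0//.
    apply: le_trans (hdist_tri (dX _ _ tT) (dX n0 _ tT) (dX _ _ tT)) _.
    rewrite (splitr (Num.sqrt e)) lerD//.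
      by rewrite -(subnKC pn); apply: le_trans (far _ _ _ tT) _; exact: Hn0.
    rewrite (hnorm_distC (dX _ _ tT) (dX _ _ tT)).
    by rewrite -(subnKC qn); apply: le_trans (far _ _ _ tT) _; exact: Hn0.
  - exists v => _; split=> // n; apply/ler_addgt0Pr => e e0.
    have [n0 Hn0] := Hv _ (exprn_gt0 2 e0).
    have := Hn0 (n + n0)%N (leq_addl _ _); rewrite -hnorm_le ?(ltW e0)// => H1.
    apply: le_trans (hdist_tri (dX _ _ tT) (dX (n + n0)%N _ tT) dv) _.
    rewrite lerD// (hnorm_distC (dX _ _ tT) (dX _ _ tT)); exact: far.
have [x Hx] := boolp.choice ex.
have dx : dom_on H 0 T x by move=> t /Hx[].
have xX n t : 0 <= t <= T -> N (X n t - x t) <= 2 * c * E / 2 ^+ n by move=> /Hx[].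
have okx : ok x.
  split=> // t tT e e0.
  have [n0 Hn0] := geom_small (2 * c * E) (divr_gt0 e0 (ltr0n _ 3)).
  have [d d0 Hd] := (okX n0).2 t tT _ (divr_gt0 e0 (ltr0n _ 3)).
  exists d => // u uT ut.
  apply: le_trans (hdist_tri (dx _ uT) (dX n0 _ uT) (dx _ tT)) _.
  apply: le_trans (lerD (lexx _) (hdist_tri (dX n0 _ uT) (dX n0 _ tT) (dx _ tT))) _.
  have h1 := le_trans (xX n0 u uT) (Hn0 n0 (leqnn _)).
  have h2 := le_trans (xX n0 t tT) (Hn0 n0 (leqnn _)).
  rewrite (hnorm_distC (dx _ uT) (dX _ _ uT)).
  have := Hd u uT ut; lra.
(* The pointwise limit [x] is determined up to norm 0 only and need not have an exact initial value.
   Its Picard image [y] is a true primitive of [f \o x] starting at [x0], and turns out to be at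
   distance 0 from [x]; so [y] is the solution. *)
have [[y_dom _] y_der y0] := HPhi _ okx.
set y := Phi x in y_dom y_der y0.
have yx t : 0 <= t <= T -> N (y t - x t) = 0.
  move=> tT; apply/eqP; rewrite eq_le hnorm_ge0 andbT.
  apply/ler_addgt0Pr => e e0; rewrite add0r.
  have [n0 Hn0] := geom_small (2 * c * E * E + 2 * c * E) e0.
  have [_ sX _] := XS n0.
  have h2 := xX n0.+1 t tT.
  have h1 : N (X n0.+1 t - y t) <= c * E / 2 ^+ n0 * expR (2 * L * t).
    apply: (sderiv_on_dist _ (dX n0.+1) y_dom (okf _ (okX n0)) (okf _ okx) sX y_der) => //.
    - by rewrite divr_ge0// mulr_ge0// ltW.
    - by rewrite (X0 n0.+1) y0.
    - move=> u uT; apply: le_trans (lipf (dX n0 _ uT) (dx _ uT)) _.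
      apply: le_trans (ler_wpM2l (ltW L0) (xX _ _ uT)) _.
      have -> : L * (2 * c * E / 2 ^+ n0) = c * E / 2 ^+ n0 * (2 * L) by ring.
      rewrite ler_peMr//; last by apply: E1; case/andP: uT.
      by apply: mulr_ge0; [rewrite divr_ge0// mulr_ge0// ltW|exact: ltW].
  apply: le_trans (hdist_tri (y_dom _ tT) (dX n0.+1 _ tT) (dx _ tT)) _.
  rewrite (hnorm_distC (y_dom _ tT) (dX _ _ tT)).
  apply: le_trans (Hn0 n0 (leqnn _)); apply: le_trans (lerD h1 h2) _.
  have p0 : 0 < (2 ^+ n0)^-1 :> R by rewrite invr_gt0 exprn_gt0.
  rewrite [leRHS]mulrDl; apply: lerD.
    have -> : 2 * c * E * E / 2 ^+ n0 = c * E / 2 ^+ n0 * (2 * E) by ring.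
    rewrite ler_wpM2l//; first by apply: mulr_ge0; [apply: mulr_ge0|]; rewrite ?c0 ?ltW.
    by apply: le_trans (leE _ tT) _; rewrite ler_peMl ?ltW// ltr1n.
  by rewrite ler_wpM2l// lef_pV2 ?posrE ?exprn_gt0// ler_eXn2l ?ltr1n.
exists y; split=> // t tT e e0; have [d d0 Hd] := y_der t tT e e0.
exists d => // u uT ut; apply: le_trans (Hd u uT ut).
have dfx := okf _ okx _ tT; have dfy : dom (f (y t)) by exact/domf/y_dom.
have dyu : dom (y u - y t) by apply: hdomB; exact: y_dom.
have -> : y u - y t - (u - t) *: (f \o y) t =
  (y u - y t - (u - t) *: (f \o x) t) + (u - t) *: (f (x t) - f (y t)).
  by rewrite scalerBr addrA subrK.
apply: le_trans (hnorm_add (hdomB dyu (hdomZ _ dfx)) (hdomZ _ (hdomB dfx dfy))) _.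
rewrite (hnormZ _ (hdomB dfx dfy)).
suff -> : N (f (x t) - f (y t)) = 0 by rewrite mulr0 addr0.
apply/eqP; rewrite eq_le hnorm_ge0 andbT.
apply: le_trans (lipf (dx _ tT) (y_dom _ tT)) _.
by rewrite (hnorm_distC (dx _ tT) (y_dom _ tT)) yx// mulr0.
Qed.
End Picard.

(** * Square integrable functions on the plane *)

Notation plane R := (measurableTypeR R * measurableTypeR R)%type.
(** The set function underlying [leb2], declared sigma-finite so that Tonelli and Fubini apply to
    pairs of points of the plane. *)
Definition mu2 {R : realType} : set (plane R) -> \bar R :=
  (@lebesgue_measure R \x @lebesgue_measure R)%E.
HB.instance Definition _ (R : realType) := Measure.on (@mu2 R).
Lemma mu2_sigma_finite (R : realType) : sigma_finite setT (@mu2 R).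
Proof.
have /sigma_finiteP[F [TF ndF Foo]] := sigma_finiteT (@lebesgue_measure R).
exists (fun n => F n `*` F n).
 rewrite -setXTT {1}TF TF predeqE => -[x y]; split.
    move=> [/= [n _ Fnx] [k _ Gky]]; exists (maxn n k) => //; split.
    - by move: x Fnx; exact/subsetPset/ndF/leq_maxl.
    - by move: y Gky; exact/subsetPset/ndF/leq_maxr.
  by move=> [n _ []/= ? ?]; split; exists n.
move=> k; have [? ?] := Foo k.
split; first exact: measurableX.
by rewrite /mu2 product_measure1E// lte_mul_pinfty// ge0_fin_numE.
Qed.
HB.instance Definition _ (R : realType) := Measure_isSigmaFinite.Build _ _ _ (@mu2 R) (mu2_sigma_finite R).

Section SquareIntegrable.
Context {R : realType}.
Notation mu := (@mu2 R).
Notation T2 := (plane R).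
Implicit Types (f g h : T2 -> R).

Definition itg f : Prop := mu.-integrable setT (EFin \o f).
Definition sqint f : Prop := measurable_fun setT f /\ itg (fun x => f x ^+ 2).

Lemma itg_meas f : itg f -> measurable_fun setT f.
Proof. by move=> /integrableP[/measurable_EFinP]. Qed.

Lemma itg_dom f g : measurable_fun setT f -> (forall x, `|f x| <= g x) -> itg g -> itg f.
Proof.
move=> mf fg; apply: le_integrable => //; first exact/measurable_EFinP.
by move=> x _ /=; rewrite lee_fin (le_trans (fg x))// ler_norm.
Qed.

Lemma itgD f g : itg f -> itg g -> itg (fun x => f x + g x).
Proof. by move=> hf hg; exact: (integrableD measurableT hf hg). Qed.

Lemma itgZ a f : itg f -> itg (fun x => a * f x).
Proof. by move=> hf; exact: (integrableZl measurableT a hf). Qed.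

Lemma itgN f : itg f -> itg (fun x => - f x).
Proof.
move=> /(itgZ (-1)); congr (integrable _ _ _).
by apply/funext => x /=; rewrite mulN1r.
Qed.

Lemma itgB f g : itg f -> itg g -> itg (fun x => f x - g x).
Proof. by move=> hf /itgN; exact: itgD. Qed.

Lemma itg_abs f : itg f -> itg (fun x => `|f x|).
Proof. by move=> /integrable_abse. Qed.

Lemma itg_lty f : measurable_fun setT f -> (forall x, 0 <= f x) ->
  (\int[mu]_x (f x)%:E < +oo)%E -> itg f.
Proof.
move=> mf f0 fi; apply/integrableP; split; first exact/measurable_EFinP.
by under eq_integral => x _ do rewrite gee0_abs ?lee_fin//.
Qed.

Lemma itg_EFin f : itg f -> (\int[mu]_x (f x)%:E = (\int[mu]_x f x)%:E)%E.
Proof. by move=> hf; rewrite /Rintegral fineK//; exact: integrable_fin_num. Qed.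

Lemma sqint_mul f g : sqint f -> sqint g -> itg (fun x => f x * g x).
Proof.
move=> [mf f2] [mg g2].
apply: (@itg_dom _ (fun x => f x ^+ 2 + g x ^+ 2)); [exact: measurable_funM| |exact: itgD].
move=> x; rewrite ler_norml; apply/andP; split.
  have := sqr_ge0 (f x + g x); have := sqr_ge0 (f x); have := sqr_ge0 (g x); nra.
have := sqr_ge0 (f x - g x); have := sqr_ge0 (f x); have := sqr_ge0 (g x); nra.
Qed.

Lemma sqintD f g : sqint f -> sqint g -> sqint (fun x => f x + g x).
Proof.
move=> hf hg; split; first by apply: measurable_funD; [case: hf|case: hg].
have -> : (fun x => (f x + g x) ^+ 2) =
   (fun x => (f x ^+ 2 + g x ^+ 2) + 2 * (f x * g x)) by apply/funext => x; ring.
apply: itgD; first by apply: itgD; [case: hf|case: hg].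
by apply: itgZ; exact: sqint_mul.
Qed.

Lemma sqintZ a f : sqint f -> sqint (fun x => a * f x).
Proof.
move=> [mf hf]; split; first exact: measurable_funM.
have -> : (fun x => (a * f x) ^+ 2) = (fun x => a ^+ 2 * f x ^+ 2).
  by apply/funext => x; rewrite exprMn.
exact: itgZ.
Qed.

Lemma sqint0 : sqint (fun=> 0).
Proof.
split; first exact: measurable_cst.
by rewrite expr0n/=; exact: (integrable0 mu setT).
Qed.

Lemma sqint_dom f g : measurable_fun setT f -> (forall x, `|f x| <= `|g x|) -> sqint g -> sqint f.
Proof.
move=> mf fg [mg g2]; split=> //; apply: itg_dom g2; first exact: measurable_funX.
by move=> x; rewrite normrX -[leRHS]real_normK ?num_real// lerXn2r ?nnegrE.
Qed.

Lemma L2_sqint f : L2 f <-> sqint f.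
Proof.
split.
- move=> lf; split; last exact: Lfun2_integrable_sqr lf.
  by move: lf; rewrite /L2 inE => /andP[]; rewrite inE.
- move=> [mf f2]; rewrite /L2 inE; apply/andP; split; rewrite inE//=.
  rewrite /finite_norm unlock /= poweR_lty//.
  under eq_integral => x _ do rewrite powR_mulrn// real_normK ?num_real//.
  by have /integrable_lty := f2; apply.
Qed.

Lemma L2normE f : sqint f -> L2norm f = (Num.sqrt (\int[mu]_x (f x ^+ 2)))%:E.
Proof.
move=> [mf f2]; rewrite /L2norm unlock /=.
under eq_integral => x _ do rewrite powR_mulrn// real_normK ?num_real//.
rewrite (itg_EFin f2) poweR_EFin powR12_sqrt//.
by apply: Rintegral_ge0 => x _; exact: sqr_ge0.
Qed.

End SquareIntegrable.

(** * Fatou's lemma and completeness of L^2 *)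

Lemma abstract_fatou d (T : measurableType d) (R : realType) (mu : {measure set T -> \bar R})
    (f_ : nat -> T -> R) (f : T -> R) (c : R) :
  (forall n, measurable_fun setT (f_ n)) -> measurable_fun setT f ->
  (forall n x, 0 <= f_ n x) -> (forall x, 0 <= f x) ->
  {ae mu, forall x, f_ ^~ x @ \oo --> f x} ->
  (\forall n \near \oo, \int[mu]_x (f_ n x)%:E <= c%:E)%E ->
  (\int[mu]_x (f x)%:E <= c%:E)%E.
Proof.
move=> mf_ mf f_0 f0 f_f lec.
have mF n : measurable_fun setT (fun x => (f_ n x)%:E) by exact/measurable_EFinP.
apply: (@le_trans _ _ (\int[mu]_x limn_einf (fun n => (f_ n x)%:E))%E).
  apply: ae_ge0_le_integral => //.
  - by move=> x _; rewrite lee_fin.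
  - exact/measurable_EFinP.
  - move=> x _; rewrite limn_einf_lim; apply: lime_ge; first exact: is_cvg_einfs.
    apply: nearW => n; apply: le_ereal_inf_tmp => _ [m _ <-]; rewrite lee_fin//.
  - rewrite /limn_einf; apply: measurableT_comp => //.
    apply: measurable_fun_limn_esup => n.
    have -> : (fun x => (- (f_ n x)%:E)%E) = EFin \o (fun x => - f_ n x) by apply/funext.
    by apply/measurable_EFinP; exact: measurableT_comp (mf_ n).
  - have FF := ae_filter_ringOfSetsType mu; apply: (@filterS _ _ FF) f_f => x fx _.
    have fx' : (fun n => (f_ n x)%:E) @ \oo --> (f x)%:E by exact: cvg_EFin (nearW _ _) fx.
    by have [-> _] := cvg_limn_einf_sup fx'.
apply: le_trans; first by apply: (fatou mu measurableT mF) => n x _; rewrite lee_fin.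
rewrite limn_einf_lim; apply: lime_le; first exact: is_cvg_einfs.
by apply: filterS lec => n; apply: le_trans; apply: ereal_inf_lbound; exists n => /=.
Qed.

Section L2Complete.
Context {R : realType}.
Notation mu := (@mu2 R).
Notation T2 := (plane R).
Implicit Types (f g h : T2 -> R).

Lemma aeS (P Q : T2 -> Prop) : (forall x, P x -> Q x) ->
  {ae mu, forall x, P x} -> {ae mu, forall x, Q x}.
Proof. by move=> PQ; have F := ae_filter_ringOfSetsType mu; exact: (@filterS _ _ F). Qed.

Lemma aeS2 (P Q S : T2 -> Prop) : (forall x, P x -> Q x -> S x) ->
  {ae mu, forall x, P x} -> {ae mu, forall x, Q x} -> {ae mu, forall x, S x}.
Proof. by move=> PQ; have F := ae_filter_ringOfSetsType mu; exact: (@filterS2 _ _ F). Qed.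

Lemma fatou_real (f_ : nat -> T2 -> R) f (c : R) :
  (forall n, measurable_fun setT (f_ n)) -> measurable_fun setT f ->
  (forall n x, 0 <= f_ n x) -> (forall x, 0 <= f x) ->
  {ae mu, forall x, f_ ^~ x @ \oo --> f x} ->
  (\forall n \near \oo, \int[mu]_x (f_ n x)%:E <= c%:E)%E ->
  (\int[mu]_x (f x)%:E <= c%:E)%E.
Proof. exact: abstract_fatou. Qed.

Lemma cvg_geometric_steps (a : nat -> R) (c : R) :
  (forall j, `|a j.+1 - a j| <= c / 2 ^+ j) -> cvgn a.
Proof.
move=> ha.
have c0 : 0 <= c by have := ha 0%N; rewrite expr0 divr1; apply: le_trans.
have far n p : `|a (n + p)%N - a n| <= 2 * c / 2 ^+ n.
  suff : `|a (n + p)%N - a n| <= 2 * c / 2 ^+ n - 2 * c / 2 ^+ (n + p).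
    by move=> /le_trans; apply; rewrite gerBl divr_ge0// mulr_ge0.
  elim: p => [|p IH]; first by rewrite addn0 !subrr normr0.
  rewrite addnS.
  have -> : a (n + p).+1 - a n = (a (n + p).+1 - a (n + p)%N) + (a (n + p)%N - a n) by ring.
  apply: le_trans (ler_normD _ _) _; apply: le_trans (lerD (ha _) IH) _.
  have p2 : 2 ^+ (n + p) != 0 :> R by rewrite gt_eqF// exprn_gt0.
  have p3 : 2 ^+ n != 0 :> R by rewrite gt_eqF// exprn_gt0.
  by rewrite exprS le_eqVlt; apply/orP; left; apply/eqP; field; rewrite p2.
apply/cauchy_cvgP/cauchy_exP => e e0.
have [n0 Hn0] := geom_small (2 * c) (divr_gt0 e0 (ltr0n _ 2)).
exists (a n0); exists n0 => // n /= nn0; rewrite /ball/= distrC -(subnKC nn0).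
apply: le_lt_trans (far _ _) _; apply: le_lt_trans (Hn0 _ (leqnn _)) _.
by rewrite ltr_pdivrMr// ltr_pMr// ltr1n.
Qed.

(** Riesz-Fischer. Along a subsequence whose squared steps have integral at most [8 ^- j], the sum
    over [j] of [4 ^ j] times the squared steps is integrable, hence finite almost everywhere, which
    makes the steps geometric of ratio 1/2 there. *)
Lemma sqint_complete (u : nat -> T2 -> R) : (forall n, sqint (u n)) ->
  (forall e : R, 0 < e -> exists n0, forall p q, (n0 <= p)%N -> (n0 <= q)%N ->
     \int[mu]_x ((u p x - u q x) ^+ 2) <= e) ->
  exists2 v, sqint v & forall e : R, 0 < e -> exists n0, forall p, (n0 <= p)%N ->
     \int[mu]_x ((u p x - v x) ^+ 2) <= e.
Proof.
move=> su cu.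
have suB p q : sqint (fun x => u p x - u q x).
  have -> : (fun x => u p x - u q x) = (fun x => u p x + -1 * u q x).
    by apply/funext => x; rewrite mulN1r.
  by apply: sqintD => //; exact: sqintZ.
have ex j : exists n0, forall p q, (n0 <= p)%N -> (n0 <= q)%N ->
     \int[mu]_x ((u p x - u q x) ^+ 2) <= (8 ^+ j)^-1.
  by apply: cu; rewrite invr_gt0 exprn_gt0.
have [k Hk] := boolp.choice ex.
pose K := fix K j := if j is i.+1 then maxn (K i).+1 (k i.+1) else k 0%N.
have kK j : (k j <= K j)%N by case: j => //= j; exact: leq_maxr.
have KS j : (K j < K j.+1)%N by exact: leq_maxl.
have jK j : (j <= K j)%N by elim: j => // j IH; exact: leq_ltn_trans IH (KS j).
pose w j x := 4 ^+ j * (u (K j.+1) x - u (K j) x) ^+ 2.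
have w0 j x : 0 <= w j x by rewrite mulr_ge0 ?sqr_ge0// exprn_ge0.
have iw j : itg (w j) by apply: itgZ; have [] := suB (K j.+1) (K j).
have mw j : measurable_fun setT (w j) by exact: itg_meas.
have Iw j : (\int[mu]_x (w j x)%:E <= (2 / (2 ^ j.+1)%:R)%:E)%E.
  rewrite (itg_EFin (iw j)) lee_fin /w RintegralZl//; last by have [] := suB (K j.+1) (K j).
  have := Hk j (K j.+1) (K j) (leq_trans (kK j) (ltnW (KS j))) (kK j).
  move=> /(ler_wpM2l (exprn_ge0 j (ler0n R 4))) /le_trans; apply.
  have -> : 8 = 4 * 2 :> R by rewrite -natrM.
  rewrite exprMn natrX invfM mulrA divff ?expf_neq0// mul1r exprS invfM mulrA.
  by rewrite divff// mul1r.
pose S x := (\sum_(0 <= j <oo) (w j x)%:E)%E.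
have mS : measurable_fun setT S.
  by apply: ge0_emeasurable_sum => // j; [move=> x _ _; rewrite lee_fin|move=> _; exact/measurable_EFinP].
have S0 x : (0 <= S x)%E by apply: nneseries_ge0 => j _ _; rewrite lee_fin.
have iS : mu.-integrable setT S.
  apply/integrableP; split => //; under eq_integral => x _ do rewrite gee0_abs//.
  have mF j : measurable_fun setT (fun x => (w j x)%:E) by exact/measurable_EFinP.
  have wE j x : setT x -> (0 <= (w j x)%:E)%E by rewrite lee_fin.
  rewrite /S integral_nneseries//.
  apply: (@le_lt_trans _ _ (\sum_(0 <= j <oo) (2 / (2 ^ j.+1)%:R)%:E)%E).
    apply: lee_nneseries => [j _ _|j _]; last exact: Iw.
    by apply: integral_ge0 => x _; rewrite lee_fin.
  by apply: (le_lt_trans (epsilon_trick0 xpredT (ler0n R 2))); rewrite ltry.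
pose A := [set x | S x \is a fin_num].
have mA : measurable A by have := emeasurable_fin_num measurableT mS; rewrite setTI.
have aeA : {ae mu, forall x, A x} by have := integrable_ae measurableT iS; apply: filterS => x; exact.
(* Cutting by the set where the sum is finite makes the subsequence converge at every point, so that
   the limit is measurable. *)
pose h j x := u (K j) x * \1_A x.
have mh j : measurable_fun setT (h j).
  by apply: measurable_funM; [have [] := su (K j)|exact: measurable_indic].
have hcvg x : cvgn (h ^~ x).
  rewrite /h; have [xA|xA] := pselect (A x); last first.
    have -> : (fun j => u (K j) x * \1_A x) = cst 0; last exact: is_cvg_cst.
    by apply/funext => j; rewrite indicE memNset// mulr0.
  have -> : (fun j => u (K j) x * \1_A x) = (fun j => u (K j) x).
    by apply/funext => j; rewrite indicE mem_set// mulr1.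
  apply: (@cvg_geometric_steps _ (Num.sqrt (fine (S x)))) => j.
  have wS : w j x <= fine (S x).
    rewrite -lee_fin fineK//; apply: le_trans (nneseries_lim_ge j.+1 _); last first.
      by move=> i _; rewrite lee_fin.
    by rewrite big_nat_recr//= leeDr// sume_ge0// => i _; rewrite lee_fin.
  rewrite ler_pdivlMr ?exprn_gt0// -sqrtr_sqr.
  have -> : 2 ^+ j = Num.sqrt (4 ^+ j) :> R.
    have -> : 4 = 2 ^+ 2 :> R by rewrite -natrX.
    by rewrite exprAC sqrtr_sqr ger0_norm ?exprn_ge0.
  by rewrite -sqrtrM ?sqr_ge0// mulrC ler_wsqrtr.
pose v x := limn (h ^~ x).
have mv : measurable_fun setT v.
  by apply: (measurable_fun_cvg mh) => x _; exact: hcvg.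
(* Fatou along the subsequence transfers the Cauchy bound to the limit for every index [p] of the
   original sequence. *)
have Iv p (e : R) : (\forall j \near \oo, \int[mu]_x ((u p x - u (K j) x) ^+ 2) <= e) ->
    (\int[mu]_x ((u p x - v x) ^+ 2)%:E <= e%:E)%E.
  move=> He; apply: (@fatou_real (fun j x => (u p x - u (K j) x) ^+ 2)).
  - by move=> j; apply: measurable_funX; have [] := suB p (K j).
  - by apply/measurable_funX/measurable_funB => //; have [] := su p.
  - by move=> j x; exact: sqr_ge0.
  - by move=> x; exact: sqr_ge0.
  - apply: aeS aeA => x xA.
    have ux : (fun j => u (K j) x) @ \oo --> v x.
      have -> : (fun j => u (K j) x) = (h ^~ x); last exact: hcvg.
      by apply/funext => j; rewrite /h indicE mem_set// mulr1.
    have uv : (fun j => u p x - u (K j) x) @ \oo --> u p x - v x by apply: cvgB => //; exact: cvg_cst.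
    have -> : (fun j => (u p x - u (K j) x) ^+ 2) =
      (fun j => (u p x - u (K j) x) * (u p x - u (K j) x)) by apply/funext => j; rewrite expr2.
    rewrite expr2; exact: cvgM.
  - apply: filterS He => j Hj.
    by rewrite (itg_EFin (suB p (K j)).2) lee_fin.
have near_e (e : R) : 0 < e -> exists n0, forall p, (n0 <= p)%N ->
    (\int[mu]_x ((u p x - v x) ^+ 2)%:E <= e%:E)%E.
  move=> e0; have [n0 Hn0] := cu e e0; exists n0 => p pn; apply: Iv.
  by exists n0 => // j /= jn; apply: Hn0 => //; exact: leq_trans jn (jK j).
have siv p (e : R) : (\int[mu]_x ((u p x - v x) ^+ 2)%:E <= e%:E)%E -> itg (fun x => (u p x - v x) ^+ 2).
  move=> He; apply: itg_lty.
  - by apply/measurable_funX/measurable_funB => //; have [] := su p.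
  - by move=> x; exact: sqr_ge0.
  - by apply: le_lt_trans He _; rewrite ltry.
exists v.
  have [n0 Hn0] := near_e 1 ltr01; have {}Hn0 := siv _ _ (Hn0 n0 (leqnn _)).
  have -> : v = (fun x => u n0 x + -1 * (u n0 x - v x)).
    by apply/funext => x; rewrite mulN1r opprB addrC subrK.
  apply: sqintD => //; apply: sqintZ; split=> //.
  by apply: measurable_funB => //; have [] := su n0.
move=> e /near_e[n0 Hn0]; exists n0 => p pn.
by have := Hn0 p pn; rewrite (itg_EFin (siv _ _ (Hn0 p pn))) lee_fin.
Qed.

End L2Complete.

(** * Weighted L^2 spaces *)

Section WeightedL2.
Context {R : realType}.
Notation mu := (@mu2 R).
Notation T2 := (plane R).
Variables (om : T2 -> R).
Hypotheses (mom : measurable_fun setT om) (om0 : forall x, 0 < om x).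

Definition wdom (f : T2 -> R) : Prop := sqint (fun x => om x * f x).
Definition wip (f g : T2 -> R) : R := \int[mu]_x ((om x * f x) * (om x * g x)).

Lemma wdom_meas f : wdom f -> measurable_fun setT f.
Proof.
move=> [mf _]; have -> : f = (fun x => (om x)^-1 * (om x * f x)).
  by apply/funext => x; rewrite mulrA mulVf ?mul1r// gt_eqF.
apply: measurable_funM => //.
have -> : (fun x => (om x)^-1) = (fun x => om x `^ (-1)).
  by apply/funext => x; rewrite powR_inv1// ltW.
exact: (measurableT_comp (measurable_powR (-1))).
Qed.

Lemma wdom0 : wdom 0.
Proof.
rewrite /wdom; have -> : (fun x => om x * (0 : T2 -> R) x) = fun=> 0.
  by apply/funext => x; rewrite mulr0.
exact: sqint0.
Qed.

Lemma wdomD f g : wdom f -> wdom g -> wdom (f + g).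
Proof.
move=> hf hg; rewrite /wdom.
have -> : (fun x => om x * (f + g) x) = (fun x => om x * f x + om x * g x).
  by apply/funext => x; rewrite -mulrDr.
exact: sqintD.
Qed.

Lemma wdomZ a f : wdom f -> wdom (a *: f : T2 -> R).
Proof.
move=> hf; rewrite /wdom.
have -> : (fun x => om x * (a *: f : T2 -> R) x) = (fun x => a * (om x * f x)).
  by apply/funext => x; rewrite mulrCA.
exact: sqintZ.
Qed.

Lemma wipC f g : wip f g = wip g f.
Proof. by rewrite /wip; apply: eq_Rintegral => x _; rewrite mulrC. Qed.

Lemma wipDl f g h : wdom f -> wdom g -> wdom h -> wip (f + g) h = wip f h + wip g h.
Proof.
move=> hf hg hh; rewrite /wip -RintegralD//; try exact: sqint_mul.
by apply: eq_Rintegral => x _; rewrite -mulrDl -mulrDr.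
Qed.

Lemma wipZl a f g : wdom f -> wdom g -> wip (a *: f : T2 -> R) g = a * wip f g.
Proof.
move=> hf hg; rewrite /wip -RintegralZl//; last exact: sqint_mul.
apply: eq_Rintegral => x _.
by have -> : (a *: f : T2 -> R) x = a * f x by []; ring.
Qed.

Lemma wip_ge0 f : 0 <= wip f f.
Proof. by apply: Rintegral_ge0 => x _; rewrite -expr2 sqr_ge0. Qed.

Lemma wip_sqr f : wip f f = \int[mu]_x ((om x * f x) ^+ 2).
Proof. by apply: eq_Rintegral => x _; rewrite expr2. Qed.

(** Multiplication by the positive weight is an isometry onto L^2; the L^2 limit is divided by the
    weight. *)
Lemma wcomplete (u : nat -> T2 -> R) : (forall n, wdom (u n)) ->
    (forall e : R, 0 < e -> exists n0, forall p q, (n0 <= p)%N -> (n0 <= q)%N ->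
       wip (u p - u q) (u p - u q) <= e) ->
    exists2 v, wdom v & forall e : R, 0 < e -> exists n0, forall p, (n0 <= p)%N ->
       wip (u p - v) (u p - v) <= e.
Proof.
move=> du cu.
have [|v sv Hv] := sqint_complete du.
  move=> e /cu[n0 Hn0]; exists n0 => p q pn qn; apply: le_trans (Hn0 p q pn qn).
  rewrite wip_sqr le_eqVlt; apply/orP; left; apply/eqP.
  by apply: eq_Rintegral => x _; rewrite -mulrBr.
have vE x : om x * (v x / om x) = v x by rewrite mulrC divfK// gt_eqF.
exists (fun x => v x / om x).
  by rewrite /wdom; under eq_fun do rewrite vE.
move=> e /Hv[n0 Hn0]; exists n0 => p pn; apply: le_trans (Hn0 p pn).
rewrite wip_sqr le_eqVlt; apply/orP; left; apply/eqP.
by apply: eq_Rintegral => x _; congr (_ ^+ 2); rewrite mulrBr vE.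
Qed.

Definition wL2 : semiHilbert (T2 -> R) :=
  SemiHilbert wdom0 wdomD wdomZ wipC wipDl wipZl wip_ge0 wcomplete.

End WeightedL2.

Lemma abstract_integral_comp d (T : measurableType d) (R : realType)
    (m : {measure set T -> \bar R}) (f : T -> \bar R) (phi : T -> T) :
  (\int[m]_x f^\+ (phi x) = \int[m]_x f^\+ x)%E ->
  (\int[m]_x f^\- (phi x) = \int[m]_x f^\- x)%E ->
  (\int[m]_x f (phi x) = \int[m]_x f x)%E.
Proof.
move=> E1 E2; rewrite [RHS]integralE -E1 -E2 integralE.
by rewrite -[fun x0 => f (phi x0)]/(f \o phi) funepos_comp funeneg_comp.
Qed.

(** * Measure-preserving changes of variables in the plane *)

Section Affine.
Context {R : realType}.
Notation leb := (@lebesgue_measure R).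
Notation T1 := (measurableTypeR R).
Notation mu := (@mu2 R).
Notation T2 := (plane R).

Definition neg2 (x : T2) : T2 := (- x.1, - x.2).
Definition add2 (a x : T2) : T2 := (a.1 + x.1, a.2 + x.2).
Definition sub2 (a x : T2) : T2 := (a.1 - x.1, a.2 - x.2).

Lemma measurable_add1 (a : T1) : measurable_fun setT (fun x : T1 => a + x).
Proof. by apply: measurable_funD => //; exact: measurable_cst. Qed.

Lemma lebesgue_measureD (a : T1) (A : set T1) : measurable A ->
  pushforward leb ((fun x => a + x) : T1 -> T1) A = leb A.
Proof.
move=> mA; apply/esym.
have mf : measurable_fun setT ((fun x => a + x) : T1 -> T1).
  exact: measurable_add1.
pose m := measure_function_pushforward__canonical__measure_function_Measure leb mf.
apply: (@lebesgue_measure_unique R m) => //= _ [[b c]] _ <-; rewrite /=.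
rewrite /m /= /pushforward.
have -> : (fun x => a + x) @^-1` `]b, c]%classic = `]b - a, c - a]%classic.
  by apply/seteqP; split => x /=; rewrite !in_itv/= ltrBlDl lerBrDl.
rewrite !lebesgue_measure_itv/= !lte_fin ltrD2r.
by case: ifPn => // _; rewrite -!EFinB; congr (_%:E); ring.
Qed.
Lemma measurable_pair1 (f g : T2 -> R) : measurable_fun setT f -> measurable_fun setT g ->
  measurable_fun setT (fun x => (f x, g x)).
Proof. by move=> mf mg; exact: measurable_fun_pair. Qed.

Lemma measurable_fst2 : measurable_fun setT (fun x : T2 => x.1).
Proof. exact: measurable_fst. Qed.

Lemma measurable_snd2 : measurable_fun setT (fun x : T2 => x.2).
Proof. exact: measurable_snd. Qed.

Lemma measurable_add2 (a : T2) : measurable_fun setT (add2 a).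
Proof.
by apply: measurable_pair1; apply: measurable_funD.
Qed.

Lemma measurable_neg2 : measurable_fun setT neg2.
Proof.
by apply: measurable_pair1; apply: measurableT_comp.
Qed.

(** By uniqueness of the product measure it is enough to look at rectangles, whose preimages are
    rectangles. *)
Lemma pushforward_prod (p q : T1 -> T1) (phi : T2 -> T2) (A : set (T2)) :
  measurable_fun setT phi -> (forall x, phi x = (p x.1, q x.2)) ->
  (forall A : set T1, measurable A -> leb (p @^-1` A) = leb A) ->
  (forall A : set T1, measurable A -> leb (q @^-1` A) = leb A) ->
  measurable_fun setT p -> measurable_fun setT q ->
  measurable A -> pushforward mu phi A = mu A.
Proof.
move=> mphi phiE hp hq mp mq mA; apply/esym.
pose m := measure_function_pushforward__canonical__measure_function_Measure mu mphi.
apply: (@product_measure_unique _ _ _ _ _ (@lebesgue_measure R) (@lebesgue_measure R) m) => // B C mB mC.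
rewrite /m /= /pushforward.
have -> : phi @^-1` (B `*` C) = (p @^-1` B) `*` (q @^-1` C).
  by apply/seteqP; split => x /=; rewrite phiE.
have mpB : measurable (p @^-1` B) by rewrite -[X in measurable X]setTI; exact: mp.
have mqC : measurable (q @^-1` C) by rewrite -[X in measurable X]setTI; exact: mq.
by rewrite /mu2 product_measure1E//; congr (_ * _)%E; [exact: hp|exact: hq].
Qed.

Lemma pushforward_add2 (a : T2) (A : set (T2)) : measurable A ->
  pushforward mu (add2 a) A = mu A.
Proof.
move=> mA; apply: (@pushforward_prod (fun x => a.1 + x) (fun x => a.2 + x)) => //.
- exact: measurable_add2.
- by move=> B mB; exact: lebesgue_measureD.
- by move=> B mB; exact: lebesgue_measureD.
- exact: measurable_add1.
- exact: measurable_add1.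
Qed.

Lemma pushforward_neg2 (A : set (T2)) : measurable A ->
  pushforward mu neg2 A = mu A.
Proof.
move=> mA; apply: (@pushforward_prod -%R -%R) => //.
- exact: measurable_neg2.
- by move=> B mB; exact: lebesgue_measureN.
- by move=> B mB; exact: lebesgue_measureN.
Qed.

Definition preserving (phi : T2 -> T2) := measurable_fun setT phi /\
  forall A : set (T2), measurable A -> pushforward mu phi A = mu A.

Lemma preserving_add2 a : preserving (add2 a).
Proof. by split; [exact: measurable_add2|exact: pushforward_add2]. Qed.

Lemma preserving_neg2 : preserving neg2.
Proof. by split; [exact: measurable_neg2|exact: pushforward_neg2]. Qed.

Lemma preserving_comp phi psi : preserving phi -> preserving psi -> preserving (phi \o psi).
Proof.
move=> [mphi Hphi] [mpsi Hpsi]; split; first exact: measurableT_comp.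
move=> A mA; rewrite -Hphi// /pushforward comp_preimage; apply: Hpsi.
by rewrite -[X in measurable X]setTI; exact: mphi.
Qed.

Lemma preserving_sub2 a : preserving (sub2 a).
Proof.
have -> : sub2 a = add2 a \o neg2 by apply/funext.
by apply: preserving_comp; [exact: preserving_add2|exact: preserving_neg2].
Qed.

Lemma ge0_integral_preserving phi (f : T2 -> \bar R) : preserving phi ->
  measurable_fun setT f -> (forall x, 0 <= f x)%E ->
  (\int[mu]_x f (phi x) = \int[mu]_x f x)%E.
Proof.
move=> [mphi Hphi] mf f0.
have := ge0_integral_pushforward mphi mu measurableT mf (fun x _ => f0 x).
rewrite preimage_setT => <-.
pose m := measure_function_pushforward__canonical__measure_function_Measure mu mphi.
by apply: eq_measure_integral => A mA _; exact: Hphi.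
Qed.

Lemma integral_preserving phi (f : T2 -> R) : preserving phi ->
  measurable_fun setT f -> (\int[mu]_x (f (phi x))%:E = \int[mu]_x (f x)%:E)%E.
Proof.
move=> Hphi mf.
have mF : measurable_fun setT (fun x => (f x)%:E) by exact/measurable_EFinP.
have E1 := @ge0_integral_preserving phi (fun x => (f x)%:E)^\+%E Hphi
  (measurable_funepos mF) (fun x => funepos_ge0 _ x).
have E2 := @ge0_integral_preserving phi (fun x => (f x)%:E)^\-%E Hphi
  (measurable_funeneg mF) (fun x => funeneg_ge0 _ x).
exact: abstract_integral_comp E1 E2.
Qed.

Lemma Rintegral_preserving phi (f : T2 -> R) : preserving phi ->
  measurable_fun setT f -> \int[mu]_x (f (phi x)) = \int[mu]_x f x.
Proof. by move=> Hphi mf; rewrite /Rintegral integral_preserving. Qed.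

Lemma itg_preserving phi (f : T2 -> R) : preserving phi -> itg f -> itg (f \o phi).
Proof.
move=> Hphi hf; have mf := itg_meas hf.
apply/integrableP; split.
  by apply/measurable_EFinP; apply: measurableT_comp => //; case: Hphi.
have := hf => /integrableP[_]; apply: le_lt_trans.
rewrite -(@ge0_integral_preserving _ (fun x => `|(EFin \o f) x|)%E Hphi)//.
by apply: measurableT_comp => //; exact/measurable_EFinP.
Qed.

Lemma sqint_preserving phi (f : T2 -> R) : preserving phi -> sqint f -> sqint (f \o phi).
Proof.
move=> Hphi [mf f2]; split; last exact: (itg_preserving Hphi f2).
by apply: measurableT_comp => //; case: Hphi.
Qed.

Lemma ae_preserving phi (P : T2 -> Prop) : preserving phi ->
  {ae mu, forall x, P x} -> {ae mu, forall x, P (phi x)}.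
Proof.
move=> [mphi Hphi] [A [mA A0 PA]]; exists (phi @^-1` A); split.
- by rewrite -[X in measurable X]setTI; exact: mphi.
- by have := Hphi A mA; rewrite /pushforward A0.
- by move=> x /= nP; apply: PA.
Qed.

End Affine.

(** * Fubini and Tonelli on pairs of points *)

Section AbstractFubini.
Context d (T : measurableType d) (R : realType) (m : {sigma_finite_measure set T -> \bar R}).

(** Inner integrals are real numbers here, [fine] sending infinite values to 0. Almost every section
    is integrable, so they agree almost everywhere with the extended inner integrals of the
    classical statement. *)
Lemma abstract_fubini (F : T * T -> R) : measurable_fun setT F ->
  (\int[m]_x \int[m]_y `|F (x, y)|%:E < +oo)%E ->
  [/\ m.-integrable setT (EFin \o (fun x => \int[m]_y F (x, y))),
      {ae m, forall x, m.-integrable setT (EFin \o (fun y => F (x, y)))} &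
      \int[m]_x (\int[m]_y F (x, y)) = \int[m]_y (\int[m]_x F (x, y))].
Proof.
move=> mF iF.
have mF' : measurable_fun setT (EFin \o F) by exact/measurable_EFinP.
have mF'' : measurable_fun setT (fun z => `|F z|%:E).
  by apply/measurable_EFinP; exact: measurableT_comp.
have iFp : (m \x m)%E.-integrable setT (EFin \o F).
  apply/integrableP; split => //.
  by have := fubini_tonelli1 (m1 := m) (m2 := m) _ mF'' => -> // z; rewrite lee_fin.
have iF1 := integrable_fubini_F iFp.
have ae1 : {ae m, forall x, m.-integrable setT (EFin \o (fun y => F (x, y)))}.
  exact: (ae_integrable1 iFp).
have ae2 : {ae m, forall y, m.-integrable setT (EFin \o (fun x => F (x, y)))}.
  exact: (ae_integrable2 iFp).
have FF := ae_filter_ringOfSetsType m.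
have mG1 : measurable_fun setT (fubini_F m (EFin \o F)) by have /integrableP[] := iF1.
have mG2 : measurable_fun setT (fubini_G m (EFin \o F)) by exact: measurable_fubini_G iFp.
have mH1 : measurable_fun setT (EFin \o (fun x => \int[m]_y F (x, y))).
  by apply/measurable_EFinP; apply: (measurableT_comp _ mG1); exact: fine_measurable.
have mH2 : measurable_fun setT (EFin \o (fun y => \int[m]_x F (x, y))).
  by apply/measurable_EFinP; apply: (measurableT_comp _ mG2); exact: fine_measurable.
have E1 : ae_eq m setT (fubini_F m (EFin \o F)) (EFin \o (fun x => \int[m]_y F (x, y))).
  apply: (@filterS _ _ FF) ae1 => x hx _ /=.
  by rewrite /Rintegral fineK//; exact: integrable_fin_num hx.
have E2 : ae_eq m setT (fubini_G m (EFin \o F)) (EFin \o (fun y => \int[m]_x F (x, y))).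
  apply: (@filterS _ _ FF) ae2 => x hx _ /=.
  by rewrite /Rintegral fineK//; exact: integrable_fin_num hx.
split; [|exact: ae1|].
- apply/integrableP; split=> //; have /integrableP[_] := iF1; apply: le_lt_trans.
  rewrite le_eqVlt; apply/orP; left; apply/eqP/ae_eq_integral => //.
  + exact: measurableT_comp.
  + exact: measurableT_comp.
  + by apply: (@filterS _ _ FF) E1 => x /= h xT; rewrite h.
- have i1 := ae_eq_integral _ _ measurableT mG1 mH1 E1; have i2 := ae_eq_integral _ _ measurableT mG2 mH2 E2.
  by congr fine; apply: (etrans (esym i1)); apply: (etrans _ i2); exact: (Fubini iFp).
Qed.

End AbstractFubini.

Section Tonelli.
Context {R : realType}.
Notation mu := (@mu2 R).
Notation T2 := (plane R).

Lemma tonelli2 (F : T2 * T2 -> \bar R) : measurable_fun setT F -> (forall z, 0 <= F z)%E ->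
  (\int[mu]_x \int[mu]_y F (x, y) = \int[mu]_y \int[mu]_x F (x, y))%E.
Proof. by move=> mF F0; exact: fubini_tonelli. Qed.

Lemma tonelli_meas (F : T2 * T2 -> \bar R) : measurable_fun setT F -> (forall z, 0 <= F z)%E ->
  measurable_fun setT (fun x => \int[mu]_y F (x, y))%E.
Proof. by move=> mF F0; exact: (measurable_fun_fubini_tonelli_F (m2 := mu)). Qed.

Lemma fubini_itg (F : T2 * T2 -> R) : measurable_fun setT F ->
  (\int[mu]_x \int[mu]_y `|F (x, y)|%:E < +oo)%E ->
  [/\ itg (fun x => \int[mu]_y F (x, y)), {ae mu, forall x, itg (fun y => F (x, y))} &
    \int[mu]_x (\int[mu]_y F (x, y)) = \int[mu]_y (\int[mu]_x F (x, y))].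
Proof. exact: abstract_fubini. Qed.

End Tonelli.

(** * L^1 and L^2 norms of functions on the plane *)

Section Norms.
Context {R : realType}.
Notation mu := (@mu2 R).
Notation T2 := (plane R).
Implicit Types (f g h : T2 -> R).

Definition n2 f : R := Num.sqrt (\int[mu]_x (f x ^+ 2)).
Definition n1 f : R := \int[mu]_x `|f x|.

Let one_gt0 (x : T2) : 0 < 1 :> R. Proof. exact: ltr01. Qed.
(** The weight 1 brings the Cauchy-Schwarz and triangle inequalities of the abstract theory to
    [n2]. *)
Let H1 : semiHilbert (T2 -> R) := wL2 one_gt0.

Let H1dom f : sqint f -> hdom H1 f.
Proof. by rewrite /= /wdom; congr sqint; apply/funext => x; rewrite mul1r. Qed.

Let H1ip f g : hip H1 f g = \int[mu]_x (f x * g x).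
Proof. by apply: eq_Rintegral => x _; rewrite !mul1r. Qed.

Let H1n f : hnorm H1 f = n2 f.
Proof. by rewrite /hnorm H1ip /n2; congr Num.sqrt; apply: eq_Rintegral => x _; rewrite expr2. Qed.

Lemma n2_ge0 f : 0 <= n2 f. Proof. exact: sqrtr_ge0. Qed.
Lemma n1_ge0 f : 0 <= n1 f. Proof. by apply: Rintegral_ge0 => x _. Qed.

Lemma n2_sqr f : n2 f ^+ 2 = \int[mu]_x (f x ^+ 2).
Proof. by rewrite sqr_sqrtr// Rintegral_ge0// => x _; exact: sqr_ge0. Qed.

Lemma n2_cauchy f g : sqint f -> sqint g -> `|\int[mu]_x (f x * g x)| <= n2 f * n2 g.
Proof. by move=> sf sg; rewrite -H1ip -!H1n; apply: hcauchy; exact: H1dom. Qed.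

Lemma sqint_abs f : sqint f -> sqint (fun x => `|f x|).
Proof.
move=> sf; apply: (sqint_dom _ _ sf); first by apply: measurableT_comp => //; case: sf.
by move=> x; rewrite normr_id.
Qed.

Lemma n2_abs f : n2 (fun x => `|f x|) = n2 f.
Proof. by rewrite /n2; congr Num.sqrt; apply: eq_Rintegral => x _; rewrite real_normK ?num_real. Qed.

Lemma n2D f g : sqint f -> sqint g -> n2 (fun x => f x + g x) <= n2 f + n2 g.
Proof. by move=> sf sg; have := hnorm_add (H1dom sf) (H1dom sg); rewrite !H1n. Qed.

Lemma n2Z a f : sqint f -> n2 (fun x => a * f x) = `|a| * n2 f.
Proof. by move=> sf; rewrite -!H1n; exact: (hnormZ a (H1dom sf)). Qed.

Lemma itg_le f g : itg f -> itg g -> (forall x, f x <= g x) ->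
  \int[mu]_x f x <= \int[mu]_x g x.
Proof. by move=> hf hg fg; apply: le_Rintegral. Qed.

Lemma n2_le f g : sqint f -> sqint g -> (forall x, `|f x| <= `|g x|) -> n2 f <= n2 g.
Proof.
move=> sf sg fg; rewrite ler_wsqrtr// itg_le//; [by case: sf|by case: sg|].
by move=> x; rewrite -(real_normK (num_real (f x))) -(real_normK (num_real (g x))) lerXn2r ?nnegrE.
Qed.

Lemma ae_Rintegral f g : measurable_fun setT f -> measurable_fun setT g ->
  {ae mu, forall x, f x = g x} -> \int[mu]_x f x = \int[mu]_x g x.
Proof.
move=> mf mg fg; congr fine; apply: ae_eq_integral => //.
- exact/measurable_EFinP.
- exact/measurable_EFinP.
- by apply: aeS fg => x -> _.
Qed.

Lemma n2_ae f g : measurable_fun setT f -> measurable_fun setT g ->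
  {ae mu, forall x, f x = g x} -> n2 f = n2 g.
Proof.
move=> mf mg fg; congr Num.sqrt; apply: ae_Rintegral; try exact: measurable_funX.
by apply: aeS fg => x ->.
Qed.

Lemma itg_ae f g : measurable_fun setT g -> {ae mu, forall x, f x = g x} -> itg f -> itg g.
Proof.
move=> mg fg hf; have mf := itg_meas hf.
apply/integrableP; split; first exact/measurable_EFinP.
have /integrableP[_] := hf; apply: le_lt_trans.
rewrite le_eqVlt; apply/orP; left; apply/eqP; apply: ae_eq_integral => //.
- by apply/measurableT_comp => //; exact/measurable_EFinP.
- by apply/measurableT_comp => //; exact/measurable_EFinP.
- by apply: aeS fg => x /= -> _.
Qed.

Lemma sqint_ae f g : measurable_fun setT g -> {ae mu, forall x, f x = g x} -> sqint f -> sqint g.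
Proof.
move=> mg fg [mf f2]; split=> //; apply: itg_ae f2; first exact: measurable_funX.
by apply: aeS fg => x ->.
Qed.

Lemma n2_eq0_ae f : sqint f -> n2 f = 0 -> {ae mu, forall x, f x = 0}.
Proof.
move=> [mf f2] f0.
have I0 : \int[mu]_x (f x ^+ 2) = 0 by rewrite -n2_sqr f0 expr0n.
have := itg_EFin f2; rewrite I0 => I0'.
have mF : measurable_fun setT (fun x => (f x ^+ 2)%:E) by exact/measurable_EFinP/measurable_funX.
have : (\int[mu]_x `|(f x ^+ 2)%:E| = 0)%E.
  by under eq_integral => x _ do rewrite gee0_abs ?lee_fin ?sqr_ge0//.
move/(ae_eq_integral_abs mu measurableT mF); apply: aeS => x /= /(_ I) [/eqP].
by rewrite sqrf_eq0 => /eqP.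
Qed.

Lemma n1_bound f : itg f -> `|\int[mu]_x f x| <= n1 f.
Proof. by move=> hf; apply: le_normr_Rintegral. Qed.

Lemma n1_itg_dom f g : measurable_fun setT f -> (forall x, `|f x| <= g x) -> itg g ->
  n1 f <= \int[mu]_x g x.
Proof.
move=> mf fg hg; apply: itg_le => //; apply: itg_abs; exact: itg_dom hg.
Qed.

Lemma itg_ge0_bound f (c : R) : measurable_fun setT f -> (forall x, 0 <= f x) ->
  (\int[mu]_x (f x)%:E <= c%:E)%E -> itg f /\ \int[mu]_x f x <= c.
Proof.
move=> mf f0 fc; have hf : itg f by apply: itg_lty => //; apply: le_lt_trans fc _; rewrite ltry.
by split=> //; rewrite -lee_fin -itg_EFin.
Qed.

Lemma sqint_bound f (c : R) : measurable_fun setT f -> 0 <= c ->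
  (\int[mu]_x (f x ^+ 2)%:E <= (c ^+ 2)%:E)%E -> sqint f /\ n2 f <= c.
Proof.
move=> mf c0 fc.
have [|hf fc'] := itg_ge0_bound (measurable_funX 2 mf) _ fc; first by move=> x; exact: sqr_ge0.
by split=> //; rewrite -(ler_pXn2r (ltn0Sn 1)) ?nnegrE ?n2_ge0// n2_sqr.
Qed.

End Norms.

(** * Integral kernels of convolution type *)

Section Convolution.
Context {R : realType}.
Notation mu := (@mu2 R).
Notation T2 := (plane R).
Implicit Types (a b f g h : T2 -> R).

Lemma measurable_sub2 : measurable_fun setT (fun z : T2 * T2 => sub2 z.1 z.2).
Proof.
apply: (@measurable_fun_pair _ _ _ _ _ _ (fun z : T2 * T2 => z.1.1 - z.2.1)
  (fun z : T2 * T2 => z.1.2 - z.2.2)); apply: measurable_funB.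
- exact: (measurableT_comp measurable_fst measurable_fst).
- exact: (measurableT_comp measurable_fst measurable_snd).
- exact: (measurableT_comp measurable_snd measurable_fst).
- exact: (measurableT_comp measurable_snd measurable_snd).
Qed.

Lemma sub2K (x y : T2) : sub2 x (sub2 x y) = y.
Proof. by case: x y => [x1 x2] [y1 y2]; rewrite /sub2/= !subKr. Qed.

(* [D z] dominates a kernel in [z = (xi, eta)] whose integral in [eta] has L^2 norm at most [C]. *)
Definition kbound (D : T2 * T2 -> R) (C : R) : Prop :=
  [/\ measurable_fun setT D, forall z, 0 <= D z,
      {ae mu, forall x, itg (fun y => D (x, y))},
      sqint (fun x => \int[mu]_y D (x, y)) & n2 (fun x => \int[mu]_y D (x, y)) <= C].

Lemma Rintegral_meas (D : T2 * T2 -> R) : measurable_fun setT D -> (forall z, 0 <= D z) ->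
  measurable_fun setT (fun x => \int[mu]_y D (x, y)).
Proof.
move=> mD D0; have mD' : measurable_fun setT (fun z => (D z)%:E) by exact/measurable_EFinP.
have := tonelli_meas mD' (fun z => _ (D0 z)) => H.
by apply: (measurableT_comp _ (H _)); [exact: fine_measurable|move=> z; rewrite lee_fin].
Qed.

(** The integrals of the two parts are measurable by Tonelli, so is their extended difference, and
    so is [fine]; sections of infinite integral do no harm. *)
Lemma Rintegral_meas_signed (D : T2 * T2 -> R) : measurable_fun setT D ->
  measurable_fun setT (fun x => \int[mu]_y D (x, y)).
Proof.
move=> mD.
have mD' : measurable_fun setT (EFin \o D) by exact/measurable_EFinP.
have H1 := tonelli_meas (measurable_funepos mD') (fun z => funepos_ge0 _ z).
have H2 := tonelli_meas (measurable_funeneg mD') (fun z => funeneg_ge0 _ z).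
rewrite /Rintegral; apply: (measurableT_comp (fine_measurable measurableT)).
have -> : (fun x => \int[mu]_y (D (x, y))%:E)%E =
  (fun x => \int[mu]_y (EFin \o D)^\+ (x, y) - \int[mu]_y (EFin \o D)^\- (x, y))%E.
  apply/funext => x; rewrite integralE -[fun y => (D (x, y))%:E]/((EFin \o D) \o (fun y => (x, y))).
  by rewrite funepos_comp funeneg_comp.
exact: emeasurable_funB.
Qed.

(** Young's inequality for L^1 and L^2. Cauchy-Schwarz for the measure [a dy] bounds the squared
    inner integral by [A] times the integral of [a b^2], and Tonelli computes the double integral of
    [a b^2] as [A B]. *)
Lemma kbound_young a b : itg a -> (forall x, 0 <= a x) -> sqint b -> (forall x, 0 <= b x) ->
  kbound (fun z => a z.2 * b (sub2 z.1 z.2)) ((\int[mu]_x a x) * n2 b).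
Proof.
move=> ha a0 sb b0; have [mb b2] := sb; have ma := itg_meas ha.
have mbs : measurable_fun setT (fun z : T2 * T2 => b (sub2 z.1 z.2)).
  exact: (measurableT_comp mb measurable_sub2).
have mas : measurable_fun setT (fun z : T2 * T2 => a z.2).
  exact: (measurableT_comp ma measurable_snd).
have mab2 : measurable_fun setT (fun z : T2 * T2 => a z.2 * b (sub2 z.1 z.2) ^+ 2).
  by apply: measurable_funM => //; exact: measurable_funX.
pose A := \int[mu]_x a x; pose B := \int[mu]_x (b x ^+ 2).
have A0 : 0 <= A by apply: Rintegral_ge0 => x _.
have ab20 (z : T2 * T2) : 0 <= a z.2 * b (sub2 z.1 z.2) ^+ 2 by rewrite mulr_ge0 ?sqr_ge0.
have IT : (\int[mu]_x \int[mu]_y (a y * b (sub2 x y) ^+ 2)%:E = (A * B)%:E)%E.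
  have := @tonelli2 _ (fun z => (a z.2 * b (sub2 z.1 z.2) ^+ 2)%:E).
  move=> -> /=; [|exact/measurable_EFinP|by move=> z; rewrite lee_fin].
  transitivity (\int[mu]_y ((a y)%:E * B%:E))%E.
    apply: eq_integral => y _.
    under eq_integral => x _ do rewrite EFinM.
    rewrite ge0_integralZl_EFin//; [|by move=> x _; rewrite lee_fin sqr_ge0|].
      congr (_ * _)%E; rewrite -itg_EFin//.
      have -> : (fun x => (b (sub2 x y) ^+ 2)%:E) = (fun x => (b (add2 (neg2 y) x) ^+ 2)%:E).
        by apply/funext => x; congr ((b _ ^+ 2)%:E); rewrite /sub2 /add2 /neg2/= ![- _ + _]addrC.
      rewrite (integral_preserving (preserving_add2 (neg2 y)) (f := fun x => b x ^+ 2))//.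
      exact: measurable_funX.
    by apply/measurable_EFinP/measurable_funX; exact: (measurable_fun_pair1 _ mbs).
  rewrite ge0_integralZr//; [|exact/measurable_EFinP|by move=> x _; rewrite lee_fin|].
    by rewrite EFinM (itg_EFin ha).
  by rewrite lee_fin; apply: Rintegral_ge0 => x _; exact: sqr_ge0.
have [|iG aeG _] := fubini_itg mab2.
  have H : forall x y, `|a y * b (sub2 x y) ^+ 2|%:E = (a y * b (sub2 x y) ^+ 2)%:E.
    by move=> x y; rewrite ger0_norm// mulr_ge0 ?sqr_ge0.
  apply: (@le_lt_trans _ _ (A * B)%:E); last exact: ltry.
  rewrite -IT le_eqVlt; apply/orP; left; apply/eqP; apply: eq_integral => x _.
  by apply: eq_integral => y _; exact: H.
have mD : measurable_fun setT (fun z : T2 * T2 => a z.2 * b (sub2 z.1 z.2)).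
  exact: measurable_funM.
have D0 (z : T2 * T2) : 0 <= a z.2 * b (sub2 z.1 z.2) by rewrite mulr_ge0.
have mc := Rintegral_meas mD D0.
have aeD : {ae mu, forall x, itg (fun y => a y * b (sub2 x y))}.
  apply: aeS aeG => x hx; apply: (@itg_dom _ _ (fun y => a y + a y * b (sub2 x y) ^+ 2)).
  - exact: (measurable_fun_pair2 _ mD).
  - move=> y; rewrite ger0_norm ?mulr_ge0//.
    have := sqr_ge0 (b (sub2 x y) - 1); have := a0 y; nra.
  - exact: itgD.
have cs : {ae mu, forall x, (\int[mu]_y (a y * b (sub2 x y))) ^+ 2 <=
    A * \int[mu]_y (a y * b (sub2 x y) ^+ 2)}.
  apply: aeS aeG => x hx.
  have s1 : sqint (fun y => Num.sqrt (a y)).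
    split; last by have -> : (fun y => Num.sqrt (a y) ^+ 2) = a;
      [apply/funext => y; rewrite sqr_sqrtr|].
    by have -> : (fun y => Num.sqrt (a y)) = (fun y => a y `^ 2^-1);
      [apply/funext => y; rewrite powR12_sqrt|exact: (measurableT_comp (measurable_powR _) ma)].
  have s2 : sqint (fun y => Num.sqrt (a y) * b (sub2 x y)).
    split.
      by apply: measurable_funM; [case: s1|exact: (measurable_fun_pair2 _ mbs)].
    have -> // : (fun y => (Num.sqrt (a y) * b (sub2 x y)) ^+ 2) = (fun y => a y * b (sub2 x y) ^+ 2).
    by apply/funext => y; rewrite exprMn sqr_sqrtr.
  have := n2_cauchy s1 s2.
  have -> : \int[mu]_y (Num.sqrt (a y) * (Num.sqrt (a y) * b (sub2 x y))) =
    \int[mu]_y (a y * b (sub2 x y)).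
    by apply: eq_Rintegral => y _; rewrite mulrA -expr2 sqr_sqrtr.
  move=> H; have : `|\int[mu]_y (a y * b (sub2 x y))| ^+ 2 <=
     (n2 (fun y => Num.sqrt (a y)) * n2 (fun y => Num.sqrt (a y) * b (sub2 x y))) ^+ 2.
    by rewrite ler_pXn2r ?nnegrE// mulr_ge0 ?n2_ge0.
  rewrite real_normK ?num_real// exprMn !n2_sqr => /le_trans; apply.
  rewrite le_eqVlt; apply/orP; left; apply/eqP; congr (_ * _).
    by apply: eq_Rintegral => y _; rewrite sqr_sqrtr.
  by apply: eq_Rintegral => y _; rewrite exprMn sqr_sqrtr.
have [] := @sqint_bound _ (fun x => \int[mu]_y (a y * b (sub2 x y))) (A * n2 b) mc.
- by rewrite mulr_ge0 ?n2_ge0.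
- apply: (@le_trans _ _ (\int[mu]_x (A * \int[mu]_y (a y * b (sub2 x y) ^+ 2))%:E)%E).
    apply: ae_ge0_le_integral => //.
    + by move=> x _; rewrite lee_fin sqr_ge0.
    + exact/measurable_EFinP/measurable_funX.
    + by move=> x _; rewrite lee_fin mulr_ge0// Rintegral_ge0// => y _; rewrite mulr_ge0 ?sqr_ge0.
    + by apply/measurable_EFinP; apply: measurable_funM => //; exact: itg_meas iG.
    + by apply: aeS cs => x h _; rewrite lee_fin.
  rewrite exprMn n2_sqr expr2 -mulrA -[A * (A * B)]/(A * (A * B)).
  under eq_integral => x _ do rewrite EFinM.
  rewrite ge0_integralZl_EFin//; last first.
  + by apply/measurable_EFinP; exact: itg_meas iG.
  + by move=> x _; rewrite lee_fin Rintegral_ge0// => y _; rewrite mulr_ge0 ?sqr_ge0.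
  rewrite EFinM lee_wpmul2l ?lee_fin// -/B -IT.
  apply: ae_ge0_le_integral => //.
  + by move=> x _; rewrite lee_fin Rintegral_ge0// => y _; rewrite mulr_ge0 ?sqr_ge0.
  + by apply/measurable_EFinP; exact: itg_meas iG.
  + by move=> x _; apply: integral_ge0 => y _; rewrite lee_fin mulr_ge0 ?sqr_ge0.
  + by apply: (tonelli_meas (F := fun z => (a z.2 * b (sub2 z.1 z.2) ^+ 2)%:E));
      [exact/measurable_EFinP|move=> z; rewrite lee_fin].
  + by apply: aeS aeG => x hx _; rewrite -itg_EFin.
by move=> sc nc; split.
Qed.

(** The substitution [y -> x - y] exchanges the two factors. *)
Lemma kbound_youngC a b : itg a -> (forall x, 0 <= a x) -> sqint b -> (forall x, 0 <= b x) ->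
  kbound (fun z => b z.2 * a (sub2 z.1 z.2)) ((\int[mu]_x a x) * n2 b).
Proof.
move=> ha a0 sb b0; have [mD D0 aeD sD nD] := kbound_young ha a0 sb b0.
have [mb b2] := sb; have ma := itg_meas ha.
have mE : measurable_fun setT (fun z : T2 * T2 => b z.2 * a (sub2 z.1 z.2)).
  by apply: measurable_funM; [exact: (measurableT_comp mb measurable_snd)|
     exact: (measurableT_comp ma measurable_sub2)].
have E x : (fun y => b y * a (sub2 x y)) \o sub2 x = (fun y => a y * b (sub2 x y)).
  by apply/funext => y /=; rewrite sub2K mulrC.
have eqI x : \int[mu]_y (b y * a (sub2 x y)) = \int[mu]_y (a y * b (sub2 x y)).
  rewrite -(Rintegral_preserving (preserving_sub2 x)); last exact: (measurable_fun_pair2 _ mE).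
  by apply: eq_Rintegral => y _; rewrite sub2K mulrC.
split.
- exact: mE.
- by move=> z; rewrite mulr_ge0.
- apply: aeS aeD => x hx; have := itg_preserving (preserving_sub2 x) hx.
  congr itg; apply/funext => y /=; by rewrite sub2K mulrC.
- by have -> : (fun x => \int[mu]_y (b y * a (sub2 x y))) = (fun x => \int[mu]_y (a y * b (sub2 x y)));
    [apply/funext => x; exact: eqI|exact: sD].
- by have -> : (fun x => \int[mu]_y (b y * a (sub2 x y))) = (fun x => \int[mu]_y (a y * b (sub2 x y)));
    [apply/funext => x; exact: eqI|exact: nD].
Qed.

Lemma kboundD D1 D2 C1 C2 : kbound D1 C1 -> kbound D2 C2 ->
  kbound (fun z => D1 z + D2 z) (C1 + C2).
Proof.
move=> [m1 p1 a1 s1 b1] [m2 p2 a2 s2 b2].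
have mD : measurable_fun setT (fun z => D1 z + D2 z) by exact: measurable_funD.
have p z : 0 <= D1 z + D2 z by rewrite addr_ge0.
have eqI : {ae mu, forall x, \int[mu]_y D1 (x, y) + \int[mu]_y D2 (x, y) =
    \int[mu]_y (D1 (x, y) + D2 (x, y))}.
  by apply: aeS2 a1 a2 => x h1 h2; rewrite RintegralD.
have mI := Rintegral_meas mD p.
have sD := sqintD s1 s2; have nD := n2D s1 s2.
split=> //.
- by apply: aeS2 a1 a2 => x h1 h2; exact: itgD.
- exact: sqint_ae eqI sD.
- by rewrite -(n2_ae sD.1 mI eqI); apply: le_trans nD _; exact: lerD.
Qed.

Lemma kboundZ c D C : 0 <= c -> kbound D C -> kbound (fun z => c * D z) (c * C).
Proof.
move=> c0 [m1 p1 a1 s1 b1].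
have mD : measurable_fun setT (fun z => c * D z) by exact: measurable_funM.
have p z : 0 <= c * D z by rewrite mulr_ge0.
have eqI : {ae mu, forall x, c * \int[mu]_y D (x, y) = \int[mu]_y (c * D (x, y))}.
  by apply: aeS a1 => x h1; rewrite RintegralZl.
have sD := sqintZ c s1; have mI := Rintegral_meas mD p.
split=> //.
- by apply: aeS a1 => x h1; exact: itgZ.
- exact: sqint_ae eqI sD.
- by rewrite -(n2_ae sD.1 mI eqI) n2Z// ger0_norm// ler_wpM2l.
Qed.

Lemma kbound_op (ka D : T2 * T2 -> R) C : kbound D C -> measurable_fun setT ka ->
  (forall z, `|ka z| <= D z) ->
  [/\ {ae mu, forall x, itg (fun y => ka (x, y))},
      sqint (fun x => \int[mu]_y ka (x, y)) & n2 (fun x => \int[mu]_y ka (x, y)) <= C].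
Proof.
move=> [mD D0 aeD sD nD] mk kD.
have ae1 : {ae mu, forall x, itg (fun y => ka (x, y))}.
  by apply: aeS aeD => x hx; apply: itg_dom hx => //; exact: (measurable_fun_pair2 _ mk).
have mI := Rintegral_meas_signed mk.
(* off the null set where [D] is not integrable, the integral of [ka] is at most that of [D] *)
pose I x := Num.min `|\int[mu]_y ka (x, y)| (\int[mu]_y D (x, y)).
have I0 x : 0 <= I x by rewrite le_min normr_ge0 Rintegral_ge0.
have aeI : {ae mu, forall x, I x = `|\int[mu]_y ka (x, y)|}.
  apply: aeS2 ae1 aeD => x hk hD; apply/min_idPl.
  apply: le_trans (n1_bound hk) _; apply: n1_itg_dom => //; exact: (measurable_fun_pair2 _ mk).
have mIn : measurable_fun setT (fun x => `|\int[mu]_y ka (x, y)|) by exact: measurableT_comp.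
have mI' : measurable_fun setT I.
  have -> : I = (fun x => `|\int[mu]_y ka (x, y)| - Num.max 0 (`|\int[mu]_y ka (x, y)| - \int[mu]_y D (x, y))).
    apply/funext => x; rewrite /I; have [h|h] := leP `|\int[mu]_y ka (x, y)| (\int[mu]_y D (x, y)).
      by rewrite max_l ?subr0// subr_le0.
    by rewrite max_r ?subKr// subr_ge0 ltW.
  apply: measurable_funB => //; apply: measurable_maxr; first exact: measurable_cst.
  by apply: measurable_funB => //; case: sD.
have sI : sqint I.
  apply: sqint_dom sD => // x; rewrite !ger0_norm ?Rintegral_ge0//.
  by rewrite /I ge_min lexx orbT.
have sk : sqint (fun x => `|\int[mu]_y ka (x, y)|) by exact: sqint_ae aeI sI.
split; first exact: ae1.
- by apply: (sqint_dom mI _ sk) => x; rewrite normr_id.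
- rewrite -n2_abs -(n2_ae sI.1 mIn aeI); apply: le_trans nD.
  apply: n2_le => // x; rewrite !ger0_norm ?Rintegral_ge0//.
  by rewrite /I ge_min lexx orbT.
Qed.

End Convolution.

(** * Integrability on the line of the model weights *)

Section OneDim.
Context {R : realType}.
Notation leb := (@lebesgue_measure R).
Notation mu := (@mu2 R).
Notation T1 := (measurableTypeR R).
Notation T2 := (plane R).

Definition itg1 (f : R -> R) : Prop := leb.-integrable setT (EFin \o f).

Lemma FTC_is_derive (f F : R -> R) (a b : R) : a < b ->
  (forall x, a <= x <= b -> is_derive x (1 : R) F (f x)) ->
  {within `[a, b], continuous f} ->
  (\int[leb]_(x in `[a, b]) (f x)%:E = (F b - F a)%:E)%E.
Proof.
move=> ab dF cf.
have cF x : a <= x <= b -> {for x, continuous F}.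
  by move=> /dF[dx _]; apply: differentiable_continuous; exact/derivable1_diffP.
rewrite EFinB; apply: continuous_FTC2 => //.
- split.
  + by move=> x; rewrite in_itv/= => /andP[ax xb]; have [] := dF x; rewrite ?ltW.
  + by apply: cvg_at_right_filter; apply: cF; rewrite lexx ltW.
  + by apply: cvg_at_left_filter; apply: cF; rewrite lexx ltW.
- move=> x; rewrite in_itv/= => /andP[ax xb]; rewrite derive1E.
  by have [|_ ->] := dF x; rewrite ?ltW.
Qed.

Lemma itg1_ge0 (f : R -> R) (c : R) : measurable_fun setT f -> (forall x, 0 <= f x) ->
  (\int[leb]_x (f x)%:E <= c%:E)%E -> itg1 f.
Proof.
move=> mf f0 fc; apply/integrableP; split; first exact/measurable_EFinP.
under eq_integral => x _ do rewrite gee0_abs ?lee_fin//.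
by apply: le_lt_trans fc _; rewrite ltry.
Qed.

Lemma itg1_le (f g : R -> R) : measurable_fun setT f -> (forall x, `|f x| <= g x) ->
  itg1 g -> itg1 f.
Proof.
move=> mf fg; apply: le_integrable => //; first exact/measurable_EFinP.
by move=> x _ /=; rewrite lee_fin (le_trans (fg x))// ler_norm.
Qed.

Lemma itg1_tensor (u v : T1 -> R) : itg1 u -> itg1 v ->
  (forall x, 0 <= u x) -> (forall x, 0 <= v x) ->
  itg (fun x : T2 => u x.1 * v x.2).
Proof.
move=> hu hv u0 v0.
have /integrableP[/measurable_EFinP mu_ _] := hu.
have /integrableP[/measurable_EFinP mv _] := hv.
have m1 : measurable_fun setT (fun x : T2 => u x.1).
  exact: (measurableT_comp mu_ measurable_fst).
have m2 : measurable_fun setT (fun x : T2 => v x.2).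
  exact: (measurableT_comp mv measurable_snd).
apply: itg_lty; [exact: measurable_funM|by move=> x; rewrite mulr_ge0|].
rewrite /mu2 fubini_tonelli1//; last by move=> x; rewrite lee_fin mulr_ge0.
  rewrite /fubini_F/=.
  under eq_integral => x _.
    under eq_integral => y _ do rewrite EFinM.
    rewrite ge0_integralZl_EFin//; last 2 first.
    - by move=> y _; rewrite lee_fin.
    - exact/measurable_EFinP.
    over.
  rewrite ge0_integralZr//; last 3 first.
  - exact/measurable_EFinP.
  - by move=> x _; rewrite lee_fin.
  - by apply: integral_ge0 => x _; rewrite lee_fin.
  have fu : (\int[leb]_x (u x)%:E \is a fin_num)%E by exact: integrable_fin_num hu.
  have fv : (\int[leb]_x (v x)%:E \is a fin_num)%E by exact: integrable_fin_num hv.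
  by rewrite ltey_eq fin_numM.
exact/measurable_EFinP/measurable_funM.
Qed.

Lemma nat_cvg_indic (x : R) : \forall n \near \oo, 0 <= x -> x \in `[0, n%:R].
Proof.
near=> n => x0; rewrite in_itv/= x0/=; near: n.
by apply: filterS (nbhs_infty_ger x) => n.
Unshelve. all: by end_near. Qed.

(* the partial integrals over [[0, n]] are controlled by a bounded antiderivative *)
Lemma itg1_half_line (f F : R -> R) (C : R) : (forall x, 0 <= f x) ->
  (forall x : R, 0 <= x -> is_derive x (1 : R) F (f x)) ->
  (forall x : R, 0 <= x -> {for x, continuous f}) -> measurable_fun setT f ->
  (forall x : R, 0 <= x -> F x - F 0 <= C) ->
  (\int[leb]_(x in [set x | (0 <= x)%R]) (f x)%:E <= C%:E)%E.
Proof.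
move=> f0 dF cf mf FC.
have mpos : measurable [set x : R | 0 <= x] by rewrite -set_itvcy.
rewrite integral_mkcond.
pose g (n : nat) x := f x * \1_(`[0, n%:R]%classic : set T1) x.
pose h x := f x * \1_([set x : R | 0 <= x] : set T1) x.
have -> : ((fun x : R => (f x)%:E) \_ [set x : R | (0 <= x)%R] = fun x : R => (h x)%:E)%E.
  apply/funext => x; rewrite /h indicE /patch; case: (boolP (0 <= x)) => x0.
    by rewrite !mem_set// mulr1.
  by rewrite !memNset ?mulr0//= => x0'; move/negP: x0.
apply: (@abstract_fatou _ T1 R leb g h C).
- by move=> n; apply: measurable_funM => //; exact: measurable_indic.
- by apply: measurable_funM => //; exact: measurable_indic.
- by move=> n x; rewrite mulr_ge0.
- by move=> x; rewrite mulr_ge0.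
- apply: aeW => x; apply: cvg_near_cst; near=> n.
  rewrite /g /h; congr (_ * _); rewrite !indicE; congr ((_ : bool)%:R).
  apply/idP/idP; rewrite !inE/= in_itv/=; first by move=> /andP[].
  move=> x0; rewrite x0/=.
  have : 0 <= x -> x \in `[0, n%:R] by near: n; exact: nat_cvg_indic.
  by move=> /(_ x0); rewrite in_itv/= => /andP[].
- near=> n.
  have n0 : 0 < n%:R :> R by rewrite ltr0n; near: n; exists 1%N.
  have -> : (\int[leb]_x (g n x)%:E = \int[leb]_(x in `[0%R, n%:R]) (f x)%:E)%E.
    rewrite [RHS]integral_mkcond; apply: eq_integral => x _.
    rewrite /g indicE /patch; case: (boolP (x \in `[0, n%:R])) => x0.
      by rewrite !mem_set// mulr1.
    by rewrite !memNset ?mulr0//= => x0'; move/negP: x0.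
  have dF' (x : R) : 0 <= x <= n%:R -> is_derive x (1 : R) F (f x) by move=> /andP[x0 _]; exact: dF.
  have -> := @FTC_is_derive f F 0 n%:R n0 dF' _; first by rewrite lee_fin FC// ltW.
  by apply: continuous_in_subspaceT => x; rewrite inE/= in_itv/= => /andP[x0 _]; exact: cf.
Unshelve. all: by end_near. Qed.

Lemma continuous_powR (g : R -> R) (p x : R) : 0 < g x -> {for x, continuous g} ->
  {for x, continuous (fun y => g y `^ p)}.
Proof.
move=> g0 cg; apply: (@continuous_comp R R R g (fun y : R => y `^ p)) => //.
by apply: differentiable_continuous; apply/derivable1_diffP; apply: derivable_powR; rewrite in_itv/= g0.
Qed.

(** On the half line [(1 + x)^2 <= 2 (1 + x^2)] compares the integrand with [(1 + x)^(-s)], which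
    has an explicit bounded primitive. *)
Lemma itg1_jap (s : R) : 1 < s -> itg1 (fun x => (1 + x ^+ 2) `^ (- (s / 2))).
Proof.
move=> s1; have s0 : 0 < s - 1 by rewrite subr_gt0.
have p1 (x : R) : 0 < 1 + x ^+ 2 by rewrite ltr_pwDl// sqr_ge0.
pose f x : R := (1 + x) `^ (- s).
pose F (x : R) := - (s - 1)^-1 * (1 + x) `^ (- s + 1).
have mj : measurable_fun setT (fun x : R => (1 + x ^+ 2) `^ (- (s / 2))).
  by apply: (measurableT_comp (measurable_powR _)); apply: measurable_funD.
have dF (x : R) : 0 <= x -> is_derive x (1 : R) F (f x).
  move=> x0; have x1 : 0 < 1 + x by rewrite ltr_pwDl.
  have d1 : is_derive x (1 : R) (fun x => 1 + x) 1.
    have : is_derive x (1 : R) (cst (1 : R) + id) (0 + 1) by apply: is_deriveD.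
    by rewrite add0r.
  have d2 : is_derive (1 + x) (1 : R) (fun y : R => y `^ (- s + 1)) ((- s + 1) * (1 + x) `^ (- s + 1 - 1)).
    exact: is_derive1_powR.
  have d3 := @is_derive1_comp _ (fun y : R => y `^ (- s + 1)) (fun x : R => 1 + x) x _ _ d2 d1.
  have d4 := is_deriveZ (- (s - 1)^-1) d3.
  have -> : F = (- (s - 1)^-1 \*: ((fun y : R => y `^ (- s + 1)) \o (fun x : R => 1 + x))) by apply/funext.
  apply: (is_derive_eq d4); rewrite addrK /f /GRing.scale/= mulr1 mulrA.
  by rewrite (_ : - (s - 1)^-1 * (- s + 1) = 1) ?mul1r//; field; rewrite gt_eqF.
have cf (x : R) : 0 <= x -> {for x, continuous f}.
  move=> x0; have x1 : 0 < 1 + x by rewrite ltr_pwDl.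
  apply: continuous_powR => //.
  by apply: continuousD; [exact: cst_continuous|exact: cvg_id].
have mf : measurable_fun setT f.
  by apply: (measurableT_comp (measurable_powR _)); exact: measurable_funD.
have Ib := @itg1_half_line f F (s - 1)^-1 _ dF cf mf.
have {}Ib : (\int[leb]_(x in [set x | (0 <= x)%R]) (f x)%:E <= ((s - 1)^-1)%:E)%E.
  apply: Ib => [x|x x0]; first exact: powR_ge0.
  rewrite /F addr0 powR1 mulr1 opprK mulNr addrC gerBl mulr_ge0 ?powR_ge0// invr_ge0 ltW//.
apply: (@itg1_ge0 _ (2 * (2 `^ (s / 2) * (s - 1)^-1))) => //; first by move=> x; exact: powR_ge0.
rewrite ge0_symfun_integralT; last 3 first.
- by move=> x; exact: powR_ge0.
- move=> x; apply: (@continuous_powR (fun x : R => 1 + x ^+ 2)) => //.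
  by apply: continuousD; [exact: cst_continuous|exact: exprn_continuous].
- by move=> x /=; rewrite sqrrN.
rewrite EFinM lee_wpmul2l ?lee_fin//.
have mpos : measurable [set x : R | 0 <= x] by rewrite -set_itvcy.
apply: (@le_trans _ _ (\int[leb]_(x in [set x | (0 <= x)%R]) (2 `^ (s / 2) * f x)%:E)%E).
  apply: ge0_le_integral => //.
  - by move=> x _; rewrite lee_fin powR_ge0.
  - by apply/measurable_EFinP; apply: measurable_funTS.
  - by apply/measurable_EFinP; apply: measurable_funTS; exact: measurable_funM.
  - move=> x /= x0; rewrite lee_fin /f.
    have x1 : 0 < 1 + x by rewrite ltr_pwDl.
    rewrite -(@ler_pM2r _ ((1 + x ^+ 2) `^ (s / 2))) ?powR_gt0//.
    rewrite -powRD ?(gt_eqF (p1 x)) ?implybT// addNr powRr0.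
    rewrite -(@ler_pM2r _ ((1 + x) `^ s)) ?powR_gt0// mul1r.
    rewrite mulrAC -[X in _ <= X * _]mulrA -powRD ?(gt_eqF x1) ?implybT// addNr powRr0 mulr1.
    rewrite -powRM ?ler0n ?(ltW (p1 x))//.
    have -> : (1 + x) `^ s = ((1 + x) ^+ 2) `^ (s / 2).
      by rewrite -powR_mulrn ?ltW// -powRrM mulrC divfK.
    apply: ge0_ler_powR; rewrite ?nnegrE ?sqr_ge0 ?mulr_ge0 ?divr_ge0//; try lra.
      by rewrite ltW.
    by have := sqr_ge0 (1 - x); lra.
under eq_integral => x _ do rewrite EFinM.
rewrite ge0_integralZl_EFin ?powR_ge0//.
- by rewrite EFinM lee_wpmul2l ?lee_fin ?powR_ge0.
- by move=> x _; rewrite lee_fin powR_ge0.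
- by apply/measurable_EFinP; apply: measurable_funTS.
Qed.

Lemma measurable_abs_powR (p : R) (A : set T1) : measurable A ->
  measurable_fun setT (fun x : R => `|x| `^ p * \1_A x).
Proof.
move=> mA; apply: measurable_funM; last exact: measurable_indic.
by apply: (measurableT_comp (measurable_powR _)); exact: (@normr_measurable R setT).
Qed.

Lemma itg1_inv_sqrt : itg1 (fun x : R => `|x| `^ (- 2^-1) * \1_(`[-1, 1]%classic : set T1) x).
Proof.
pose f x : R := `|x| `^ (- 2^-1) * \1_(`[-1, 1]%classic : set T1) x.
pose h x : R := `|x| `^ (- 2^-1) * \1_(`]0, 1]%classic : set T1) x.
have mf : measurable_fun setT f by exact: measurable_abs_powR.
have mh : measurable_fun setT h by exact: measurable_abs_powR.
have f0 (x : R) : 0 <= f x by rewrite mulr_ge0 ?powR_ge0// indicE ler0n.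
have h0 (x : R) : 0 <= h x by rewrite mulr_ge0 ?powR_ge0// indicE ler0n.
(* truncate the singularity by the shift [x + 1/n] *)
have hb : (\int[leb]_x (h x)%:E <= 4%:E)%E.
  pose g (n : nat) x : R := `|x + n.+1%:R^-1| `^ (- 2^-1) * \1_(`[0, 1]%classic : set T1) x.
  have mg n : measurable_fun setT (g n).
    apply: measurable_funM; last exact: measurable_indic.
    apply: (measurableT_comp (measurable_powR _)); apply: measurableT_comp => //.
    by apply: measurable_funD => //; exact: measurable_cst.
  have g0 n (x : R) : 0 <= g n x by rewrite mulr_ge0 ?powR_ge0// indicE ler0n.
  apply: (@abstract_fatou _ T1 R leb (fun n x => g n x * \1_(`]0, 1]%classic : set T1) x) h 4) => //.
  - by move=> n; apply: measurable_funM; [exact: mg|exact: (@measurable_indic _ T1)].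
  - by move=> n x; rewrite mulr_ge0// indicE ler0n.
  - apply: aeW => x; rewrite /h /g !indicE; case: (boolP (x \in `]0, 1])) => x0; last first.
      rewrite (@memNset _ `]0, 1]%classic) ?mulr0//=; last by move=> x0'; move/negP: x0.
      by under eq_fun do rewrite mulr0; exact: cvg_cst.
    rewrite (@mem_set _ `]0, 1]%classic)// (@mem_set _ `[0, 1]%classic) ?mulr1/=; last first.
      by move: x0; rewrite /= !in_itv/= => /andP[/ltW-> ->].
    under eq_fun do rewrite !mulr1.
    move: x0; rewrite in_itv/= => /andP[x0 _].
    have cp : {for x, continuous (fun y : R => `|y| `^ (- 2^-1))}.
      by apply: continuous_powR; [rewrite normr_gt0 gt_eqF|exact: norm_continuous].
    apply: (@cvg_comp _ _ _ (fun n : nat => x + n.+1%:R^-1) (fun y : R => `|y| `^ (- 2^-1)) _ (nbhs x)).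
      have : x + n.+1%:R^-1 @[n --> \oo] --> x + 0 by apply: cvgD; [exact: cvg_cst|exact: cvg_harmonic].
      by rewrite addr0.
    exact: cp.
  - near=> n; pose e : R := n.+1%:R^-1.
    have e0 : 0 < e by rewrite invr_gt0 ltr0n.
    have e1 : e <= 1 by rewrite invf_le1 ?ler1n// ltr0n.
    apply: (@le_trans _ _ (\int[leb]_(x in `[0%R, 1%R]) ((x + e) `^ (- 2^-1))%:E)%E).
      rewrite [leRHS]integral_mkcond; apply: ge0_le_integral => //.
      + by move=> x _; rewrite lee_fin mulr_ge0// indicE ler0n.
      + by apply/measurable_EFinP; apply: measurable_funM; [exact: mg|exact: (@measurable_indic _ T1)].
      + apply/(measurable_restrictT _ _).1 => //; apply/measurable_EFinP; apply: measurable_funTS.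
        by apply: (measurableT_comp (measurable_powR _)); apply: measurable_funD => //; exact: measurable_cst.
      + move=> x _; rewrite /g !indicE /patch; case: (boolP (x \in `[0, 1])) => x0.
          case: ifPn => [_|/negP x1]; last by case: x1; rewrite inE.
          move: x0; rewrite in_itv/= => /andP[x0 _]; rewrite lee_fin.
          rewrite ger0_norm ?addr_ge0 ?(ltW e0)// -mulrA ler_piMr ?powR_ge0//.
          by rewrite ?mul1r; case: (_ \in _) => /=; rewrite ?mulr0 ?mulr1 ?ler01.
        case: ifPn => [x1|_]; first by case/negP: x0; move: x1; rewrite inE.
        by rewrite mulr0 mul0r.
    have pos (x : R) : 0 <= x -> 0 < x + e by move=> x0; rewrite ltr_pwDr.
    have dF (x : R) : 0 <= x <= 1 ->
        is_derive x (1 : R) (fun y : R => 2 * (y + e) `^ (2^-1)) ((x + e) `^ (- 2^-1)).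
      move=> /andP[x0 _].
      have d1 : is_derive x (1 : R) (fun y : R => y + e) 1.
        have : is_derive x (1 : R) (id + cst (e : R)) (1 + 0) by apply: is_deriveD.
        by rewrite addr0.
      have d2 : is_derive (x + e) (1 : R) (fun y : R => y `^ (2^-1)) (2^-1 * (x + e) `^ (2^-1 - 1)).
        exact: is_derive1_powR (pos x x0).
      have d3 := @is_derive1_comp _ (fun y : R => y `^ (2^-1)) (fun y : R => y + e) x _ _ d2 d1.
      have d4 := is_deriveZ 2 d3.
      apply: (is_derive_eq d4); rewrite /GRing.scale/= mulr1 mulrA divff// mul1r.
      by congr (_ `^ _); lra.
    have cf (x : R) : 0 <= x -> {for x, continuous (fun y : R => (y + e) `^ (- 2^-1))}.
      move=> x0; apply: (@continuous_powR (fun y : R => y + e)); first exact: pos.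
      by apply: continuousD; [exact: cvg_id|exact: cst_continuous].
    have -> := @FTC_is_derive (fun x => (x + e) `^ (- 2^-1)) _ 0 1 ltr01 dF _.
      rewrite lee_fin add0r -mulrBr.
      have h1 : (1 + e) `^ 2^-1 <= 2.
        have : (1 + e) `^ 2^-1 <= (1 + e) `^ 1 by apply: ler_powR; lra.
        by rewrite powRr1; lra.
      by have := powR_ge0 e 2^-1; lra.
    by apply: continuous_in_subspaceT => x; rewrite inE/= in_itv/= => /andP[x0 _]; exact: cf.
have ih : itg1 h by exact: itg1_ge0 hb.
have mN : measurable_fun setT ((fun x => - x) : T1 -> T1) by exact: (@oppr_measurable R setT).
have ihN : itg1 (fun x => h (- x)).
  apply: (@itg1_ge0 _ 4) => //.
    exact: (measurableT_comp mh mN).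
  apply: le_trans hb; rewrite le_eqVlt; apply/orP; left; apply/eqP.
  pose m := measure_function_pushforward__canonical__measure_function_Measure leb mN.
  have -> : (\int[leb]_x (h (- x))%:E = \int[m]_x (h x)%:E)%E.
    rewrite ge0_integral_pushforward//=; last by move=> x _; rewrite lee_fin.
    exact/measurable_EFinP.
  by apply: eq_measure_integral => //= A mA _; exact: lebesgue_measureN.
have hz : itg1 (fun x => h x + h (- x)).
  have := integrableD measurableT ih ihN; apply: eq_integrable => //.
apply: itg1_le hz => // x; rewrite ger0_norm// /h /f normrN !indicE.
rewrite -mulrDr; case: (ltgtP x 0) => [x0|x0|->]; last by rewrite normr0 powR0 ?mul0r// lt_eqF.
- apply: ler_wpM2l; first exact: powR_ge0.
  rewrite -natrD ler_nat; case: (boolP (x \in _)) => //; rewrite inE/= in_itv/= => /andP[x1 _].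
  by rewrite (@mem_set _ `]0, 1]%classic (- x)) ?addn1//= in_itv/= oppr_gt0 x0 lerNl.
- apply: ler_wpM2l; first exact: powR_ge0.
  rewrite -natrD ler_nat; case: (boolP (x \in _)) => //; rewrite inE/= in_itv/= => /andP[_ x1].
  by rewrite (@mem_set _ `]0, 1]%classic x)//= in_itv/= x0.
Unshelve. all: by end_near. Qed.

End OneDim.

(** * Sobolev weights *)

Section Weights.
Context {R : realType}.
Notation leb := (@lebesgue_measure R).
Notation mu := (@mu2 R).
Notation T2 := (plane R).
Implicit Types (x y z : T2).

(** The square of the Japanese bracket [<x>], so that [wt r] is [<x>^r]. *)
Definition jap x : R := 1 + dotp x x.
Definition wt (r : R) x : R := jap x `^ (r / 2).

Lemma dotp_ge0 x : 0 <= dotp x x.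
Proof. by rewrite /dotp -!expr2 addr_ge0 ?sqr_ge0. Qed.

Lemma enorm_ge0 x : 0 <= enorm x. Proof. exact: sqrtr_ge0. Qed.

Lemma enorm_sqr x : enorm x ^+ 2 = dotp x x.
Proof. by rewrite sqr_sqrtr ?dotp_ge0. Qed.

Lemma jap_gt0 x : 0 < jap x. Proof. by rewrite ltr_pwDl// dotp_ge0. Qed.

Lemma jap_ge1 x : 1 <= jap x. Proof. by rewrite lerDl dotp_ge0. Qed.

Lemma wt_gt0 r x : 0 < wt r x. Proof. by rewrite powR_gt0 ?jap_gt0. Qed.

Lemma wt_ge0 r x : 0 <= wt r x. Proof. exact/ltW/wt_gt0. Qed.

Lemma wt0 x : wt 0 x = 1. Proof. by rewrite /wt mul0r powRr0. Qed.

Lemma wtD a b x : wt (a + b) x = wt a x * wt b x.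
Proof. by rewrite /wt mulrDl powRD// (gt_eqF (jap_gt0 x)) implybT. Qed.

Lemma wt_le a b x : a <= b -> wt a x <= wt b x.
Proof. by move=> ab; apply: ler_powR; [exact: jap_ge1|rewrite ler_pM2r]. Qed.

Lemma wt_ge1 r x : 0 <= r -> 1 <= wt r x.
Proof. by move=> r0; rewrite -(wt0 x); exact: wt_le. Qed.

Lemma wtNK a x : wt (- a) x * wt a x = 1. Proof. by rewrite -wtD addNr wt0. Qed.

Lemma wt_neg r x : wt r (neg2 x) = wt r x.
Proof. by rewrite /wt /jap /dotp /neg2/= !mulrNN. Qed.

Lemma enorm_neg x : enorm (neg2 x) = enorm x.
Proof. by rewrite /enorm /dotp /neg2/= !mulrNN. Qed.

Lemma wt1_sqr x : wt 1 x ^+ 2 = jap x.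
Proof. by rewrite -powR_mulrn ?wt_ge0// /wt -powRrM div1r mulVf// powRr1// ltW ?jap_gt0. Qed.

Lemma wt2E x : wt 2 x = jap x.
Proof. by rewrite /wt divff// powRr1// ltW ?jap_gt0. Qed.

Lemma wtE r x : wt r x = wt 1 x `^ r.
Proof. by rewrite /wt -powRrM mulrAC mul1r. Qed.

Lemma enorm_wt1 x : enorm x <= wt 1 x.
Proof.
rewrite -(@ler_pXn2r _ 2)// ?nnegrE ?enorm_ge0 ?wt_ge0//.
by rewrite enorm_sqr wt1_sqr /jap lerDr.
Qed.

(** After squaring, this is [1 + x . y <= <x> <y>], Cauchy-Schwarz for the vectors [(1, x)] and
    [(1, y)]. *)
Lemma wt1_lip x y : `|wt 1 x - wt 1 y| <= enorm (sub2 x y).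
Proof.
rewrite -(@ler_pXn2r _ 2)// ?nnegrE ?enorm_ge0//.
rewrite real_normK ?num_real// enorm_sqr sqrrB !wt1_sqr.
have : 1 + (x.1 * y.1 + x.2 * y.2) <= wt 1 x * wt 1 y.
  apply: le_trans (ler_norm _) _.
  rewrite -(@ler_pXn2r _ 2)// ?nnegrE ?mulr_ge0 ?wt_ge0//.
  rewrite real_normK ?num_real// exprMn !wt1_sqr /jap /dotp.
  have := sqr_ge0 (x.1 * y.2 - x.2 * y.1); have := sqr_ge0 (x.1 - y.1); have := sqr_ge0 (x.2 - y.2).
  lra.
by rewrite /jap /dotp /sub2/= => h; lra.
Qed.

Lemma wt1_sub x y : wt 1 x <= wt 1 y + wt 1 (sub2 x y).
Proof.
have := ler_normr (wt 1 x - wt 1 y) (wt 1 x - wt 1 y); rewrite lexx/= => h1.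
by have := wt1_lip x y; have := enorm_wt1 (sub2 x y); lra.
Qed.

Lemma wt_sub r x y : 0 <= r -> wt r x <= 2 `^ r * (wt r y + wt r (sub2 x y)).
Proof.
move=> r0; set m := Num.max (wt 1 y) (wt 1 (sub2 x y)).
have m0 : 0 <= m by rewrite le_max wt_ge0.
have h : wt 1 x <= 2 * m.
  have := wt1_sub x y; have : wt 1 y <= m by rewrite le_max lexx.
  have : wt 1 (sub2 x y) <= m by rewrite le_max lexx orbT.
  lra.
apply: (@le_trans _ _ ((2 * m) `^ r)).
  by rewrite wtE; apply: ge0_ler_powR; rewrite ?nnegrE ?wt_ge0 ?mulr_ge0.
rewrite powRM// ler_wpM2l ?powR_ge0// !(wtE r) /m.
by rewrite maxEle; case: ifP => _; [rewrite lerDr|rewrite lerDl]; exact: powR_ge0.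
Qed.

Lemma perp_dotp x y : `|dotp (perp x) y| <= enorm x * enorm y.
Proof.
rewrite -(@ler_pXn2r _ 2)// ?nnegrE ?mulr_ge0 ?enorm_ge0//.
rewrite real_normK ?num_real// exprMn !enorm_sqr /dotp /perp/=.
by have := sqr_ge0 (x.1 * y.1 + x.2 * y.2); lra.
Qed.

Lemma measurable_dotp : measurable_fun setT (fun x : T2 => dotp x x).
Proof.
by apply: measurable_funD; apply: measurable_funM; first [exact: measurable_fst2|exact: measurable_snd2].
Qed.

Lemma measurable_wt r : measurable_fun setT (wt r).
Proof.
apply: (measurableT_comp (measurable_powR _)).
by apply: measurable_funD; [exact: measurable_cst|exact: measurable_dotp].
Qed.

Lemma measurable_enorm : measurable_fun setT (@enorm R : T2 -> R).
Proof.
have -> : (@enorm R : T2 -> R) = fun x => dotp x x `^ 2^-1.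
  by apply/funext => x; rewrite powR12_sqrt// dotp_ge0.
exact: (measurableT_comp (measurable_powR _) measurable_dotp).
Qed.

(** Since [(1 + x1^2) (1 + x2^2) <= <x>^4], the square is at most the tensor product of the
    one-dimensional weights [(1 + t^2)^(- s/2)], integrable for [s > 1]. *)
Lemma sqint_wt s : 1 < s -> sqint (wt (- s)).
Proof.
move=> s1; split; first exact: measurable_wt.
have h := itg1_jap s1; have p1 (t : R) : 0 < 1 + t ^+ 2 by rewrite ltr_pwDl// sqr_ge0.
have := itg1_tensor h h (fun=> powR_ge0 _ _) (fun=> powR_ge0 _ _).
apply: itg_dom => [|x]; first by apply: measurable_funX; exact: measurable_wt.
rewrite ger0_norm ?sqr_ge0// expr2 -wtD.
rewrite -powRM ?(ltW (p1 _))//.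
have -> : wt (- s + - s) x = (jap x ^+ 2) `^ (- (s / 2)).
  by rewrite -powR_mulrn ?(ltW (jap_gt0 _))// -powRrM /wt; congr (_ `^ _); lra.
rewrite !powRN lef_pV2 ?posrE ?powR_gt0 ?mulr_gt0 ?exprn_gt0 ?jap_gt0//.
apply: ge0_ler_powR; rewrite ?nnegrE ?mulr_ge0 ?exprn_ge0 ?(ltW (p1 _)) ?(ltW (jap_gt0 _)) ?(ltW s1)//.
  by lra.
rewrite /jap /dotp -!expr2.
have a0 := sqr_ge0 x.1; have b0 := sqr_ge0 x.2.
have ab := mulr_ge0 a0 b0; nra.
Qed.

(** The size of the velocity symbol at low frequencies: unbounded at the origin, yet square
    integrable in dimension 2, so that its product with an L^2 function is integrable. *)
Definition sing x : R := enorm x `^ (- 2^-1) * (enorm x <= 1)%R%:R.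

Lemma sing_ge0 x : 0 <= sing x. Proof. by rewrite mulr_ge0 ?powR_ge0. Qed.

Lemma measurable_sing : measurable_fun setT sing.
Proof.
apply: measurable_funM; first exact: (measurableT_comp (measurable_powR _) measurable_enorm).
have -> : (fun x : T2 => (enorm x <= 1)%R%:R : R) = \1_([set x : T2 | enorm x <= 1]).
  apply/funext => x; rewrite indicE; congr (nat_of_bool _)%:R.
  by apply/idP/idP; rewrite inE.
apply: measurable_indic; rewrite -[X in measurable X]setTI.
have -> : [set x : T2 | enorm x <= 1] = (@enorm R : T2 -> R) @^-1` `]-oo, 1]%classic.
  by apply/seteqP; split => x /=; rewrite in_itv.
exact: measurable_enorm.
Qed.

Lemma ae_axes : {ae mu, forall x, x.1 != 0 /\ x.2 != 0}.
Proof.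
have h0 : leb [set 0] = 0 by exact: lebesgue_measure_set1.
pose A := [set x : T2 | x.1 = 0] `|` [set x : T2 | x.2 = 0].
have eA : A = ([set 0] `*` setT) `|` (setT `*` [set 0]).
  by apply/seteqP; split => x /=; rewrite /A/=; tauto.
have mA1 : measurable ([set (0 : measurableTypeR R)] `*` [set: measurableTypeR R]).
  by apply: measurableX => //; exact: measurable_set1.
have mA2 : measurable ([set: measurableTypeR R] `*` [set (0 : measurableTypeR R)]).
  by apply: measurableX => //; exact: measurable_set1.
exists A; split.
- by rewrite eA; apply: measurableU.
- rewrite eA; apply/eqP; rewrite eq_le measure_ge0 andbT.
  apply: le_trans (measureU2 _ mA1 mA2) _.
  have e1 : (mu ([set (0%R : measurableTypeR R)] `*` [set: measurableTypeR R]) <= 0)%E.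
    apply: (@le_trans _ _ (leb [set 0%R] * leb setT)%E); last by rewrite h0 mul0e.
    by rewrite le_eqVlt; apply/orP; left; apply/eqP; apply: product_measure1E => //; exact: measurable_set1.
  have e2 : (mu ([set: measurableTypeR R] `*` [set (0%R : measurableTypeR R)]) <= 0)%E.
    apply: (@le_trans _ _ (leb setT * leb [set 0%R])%E); last by rewrite h0 mule0.
    by rewrite le_eqVlt; apply/orP; left; apply/eqP; apply: product_measure1E => //; exact: measurable_set1.
  by apply: le_trans (leeD e1 e2) _; rewrite adde0.
- move=> x /= /not_andP [] /negP; rewrite negbK => /eqP; [by left|by right].
Qed.

Lemma sqint_sing : sqint sing.
Proof.
split; first exact: measurable_sing.
have h := itg1_inv_sqrt (R := R).
have h0 (t : R) : 0 <= `|t| `^ (- 2^-1) * \1_(`[-1, 1]%classic : set (measurableTypeR R)) t.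
  by rewrite mulr_ge0 ?powR_ge0// indicE ler0n.
have ht := itg1_tensor h h h0 h0.
(* A nonzero power of 0 is 0, so the tensor bound [|x1|^(-1/2) |x2|^(-1/2)] fails on the axes; the
   function is first set to 0 on these null sets. *)
pose f x := sing x ^+ 2 * ((x.1 != 0) && (x.2 != 0))%:R.
have ma (p : T2 -> R) : measurable_fun setT p -> measurable [set x | p x != 0].
  move=> mp; rewrite -[X in measurable X]setTI.
  have -> : [set x | p x != 0] = p @^-1` (~` [set 0]).
    by apply/seteqP; split => x /= /eqP.
  by apply: mp => //; apply: measurableC; exact: measurable_set1.
have mf : measurable_fun setT f.
  apply: measurable_funM; first by apply: measurable_funX; exact: measurable_sing.
  have -> : (fun x : T2 => ((x.1 != 0) && (x.2 != 0))%:R : R) =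
      \1_([set x : T2 | x.1 != 0] `&` [set x : T2 | x.2 != 0]).
    apply/funext => x; rewrite indicE; congr (nat_of_bool _)%:R.
    by apply/andP/idP; rewrite inE.
  by apply: measurable_indic; apply: measurableI; apply: ma; [exact: measurable_fst2|exact: measurable_snd2].
apply: (@itg_ae _ f); first by apply: measurable_funX; exact: measurable_sing.
  by apply: aeS ae_axes => x [x1 x2]; rewrite /f x1 x2 mulr1.
apply: itg_dom ht => // x; rewrite ger0_norm; last by rewrite mulr_ge0 ?sqr_ge0.
rewrite /f.
have [x1|x1] := eqVneq x.1 0; first by rewrite mulr0 mulr_ge0.
have [x2|x2] := eqVneq x.2 0; first by rewrite mulr0 mulr_ge0.
rewrite mulr1 /sing.
have [e1|e1] := leP (enorm x) 1; last by rewrite mulr0 expr0n/= mulr_ge0.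
have ex : `|x.1| <= enorm x.
  rewrite -(@ler_pXn2r _ 2)// ?nnegrE ?enorm_ge0// enorm_sqr real_normK ?num_real//.
  by rewrite /dotp -!expr2 lerDl sqr_ge0.
have ey : `|x.2| <= enorm x.
  rewrite -(@ler_pXn2r _ 2)// ?nnegrE ?enorm_ge0// enorm_sqr real_normK ?num_real//.
  by rewrite /dotp -!expr2 lerDr sqr_ge0.
rewrite !indicE (@mem_set _ `[-1, 1]%classic x.1)/=; last by rewrite in_itv/= -ler_norml (le_trans ex).
rewrite (@mem_set _ `[-1, 1]%classic x.2)/=; last by rewrite in_itv/= -ler_norml (le_trans ey).
rewrite !mulr1 expr2.
have le (t : R) : t != 0 -> `|t| <= enorm x -> enorm x `^ (- 2^-1) <= `|t| `^ (- 2^-1).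
  move=> t0 te; have t1 : 0 < `|t| by rewrite normr_gt0.
  rewrite !powRN lef_pV2 ?posrE ?powR_gt0//; last exact: lt_le_trans te.
  by apply: ge0_ler_powR; rewrite ?nnegrE ?enorm_ge0.
by apply: ler_pM; rewrite ?powR_ge0 ?le.
Qed.

(* Cauchy-Schwarz turns an L^2 weight into an L^1 bound. *)
Lemma itg_weight (s : R) (v rho h : T2 -> R) : measurable_fun setT v -> (forall x, 0 <= v x) ->
  sqint rho -> (forall x, 0 <= rho x) -> (forall x, v x <= rho x * wt s x) ->
  wdom (wt s) h ->
  itg (fun x => v x * h x) /\ n1 (fun x => v x * h x) <= n2 rho * n2 (fun x => wt s x * h x).
Proof.
move=> mv v0 srho rho0 vrho hh; have mh := wdom_meas (measurable_wt s) (wt_gt0 s) hh.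
have le x : `|v x * h x| <= rho x * `|wt s x * h x|.
  rewrite !normrM (ger0_norm (v0 x)) (ger0_norm (wt_ge0 s x)) mulrA.
  by apply: ler_wpM2r => //; exact: vrho.
have mvh : measurable_fun setT (fun x => v x * h x) by exact: measurable_funM.
have ir := sqint_mul srho (sqint_abs hh).
split; first exact: itg_dom ir.
apply: le_trans (n1_itg_dom mvh le ir) _.
apply: le_trans (ler_norm _) _; rewrite -(n2_abs (fun x => wt s x * h x)).
exact: n2_cauchy srho (sqint_abs hh).
Qed.

End Weights.

(** * Product and energy estimates *)

Section Bilinear.
Context {R : realType}.
Notation mu := (@mu2 R).
Notation T2 := (plane R).
Implicit Types (h g q om : T2 -> R).

Definition wn om h : R := n2 (fun x => om x * h x).

Lemma wn_ge0 om h : 0 <= wn om h. Proof. exact: n2_ge0. Qed.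

Lemma hnorm_wL2 om (om0 : forall x, 0 < om x) h : hnorm (wL2 om0) h = wn om h.
Proof. by rewrite /hnorm /= wip_sqr. Qed.

Lemma wdom_le om1 om2 (c : R) h : measurable_fun setT om1 -> measurable_fun setT om2 ->
  (forall x, 0 < om2 x) -> (forall x, `|om1 x| <= c * om2 x) -> 0 <= c -> wdom om2 h ->
  wdom om1 h /\ wn om1 h <= c * wn om2 h.
Proof.
move=> m1 m2 p2 le c0 d2; have mh := wdom_meas m2 p2 d2.
have m1h : measurable_fun setT (fun x => om1 x * h x) by exact: measurable_funM.
have le' x : `|om1 x * h x| <= `|c * (om2 x * h x)|.
  rewrite mulrA !normrM; apply: ler_wpM2r => //.
  by apply: le_trans (le x) _; rewrite (ger0_norm c0) (gtr0_norm (p2 x)).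
have d2c := sqintZ c d2.
have d1 : wdom om1 h by exact: sqint_dom m1h le' d2c.
split; first exact: d1.
by apply: le_trans (n2_le d1 d2c le') _; rewrite n2Z// ger0_norm.
Qed.

Lemma wdom_wt (a b : R) h : a <= b -> wdom (wt b) h -> wdom (wt a) h.
Proof.
move=> ab hb; apply: (proj1 (wdom_le (c := 1) (measurable_wt a) (measurable_wt b) (wt_gt0 b) _ ler01 hb)).
by move=> x; rewrite mul1r ger0_norm ?wt_ge0// wt_le.
Qed.

Lemma wn_wt (a b : R) h : a <= b -> wdom (wt b) h -> wn (wt a) h <= wn (wt b) h.
Proof.
move=> ab hb; rewrite -[leRHS]mul1r.
apply: (proj2 (wdom_le (c := 1) (measurable_wt a) (measurable_wt b) (wt_gt0 b) _ ler01 hb)).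
by move=> x; rewrite mul1r ger0_norm ?wt_ge0// wt_le.
Qed.

(** Products in Hartley variables mix the values at [x] and [-x]; this even majorant treats both at
    once, at the price of a factor 2 in norms. *)
Definition hs h x : R := `|h x| + `|h (neg2 x)|.

Lemma hs_ge0 h x : 0 <= hs h x. Proof. by rewrite addr_ge0. Qed.

Lemma measurable_negc h : measurable_fun setT h -> measurable_fun setT (fun x => h (neg2 x)).
Proof. by move=> mh; exact: (measurableT_comp mh (@measurable_neg2 R)). Qed.

Lemma n2_neg h : measurable_fun setT h -> n2 (fun x => h (neg2 x)) = n2 h.
Proof.
move=> mh; rewrite /n2; congr Num.sqrt.
apply: (@Rintegral_preserving _ neg2 (fun x => h x ^+ 2)); first exact: preserving_neg2.
exact: measurable_funX.
Qed.

Lemma wdom_hs om h : measurable_fun setT om -> (forall x, 0 < om x) ->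
  (forall x, om (neg2 x) = om x) -> wdom om h -> wdom om (hs h) /\ wn om (hs h) <= 2 * wn om h.
Proof.
move=> mom om0 ome hh; have mh := wdom_meas mom om0 hh.
have d1 := sqint_abs hh.
have d2 : sqint (fun x => `|om x * h (neg2 x)|).
  apply: sqint_abs; have := sqint_preserving (@preserving_neg2 R) hh.
  by congr sqint; apply/funext => x /=; rewrite ome.
have E : (fun x => om x * hs h x) = (fun x => `|om x * h x| + `|om x * h (neg2 x)|).
  by apply/funext => x; rewrite /hs mulrDr !normrM (gtr0_norm (om0 x)).
rewrite /wdom /wn E; split; first exact: sqintD.
apply: le_trans (n2D d1 d2) _.
rewrite !n2_abs.
have -> : (fun x => om x * h (neg2 x)) = (fun x => (fun y => om y * h y) (neg2 x)).
  by apply/funext => x; rewrite ome.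
by rewrite (@n2_neg (fun y => om y * h y)); [rewrite mulr2n mulrDl !mul1r|case: hh].
Qed.

Lemma hs_sqint om h (v : T2 -> R) : measurable_fun setT om -> (forall x, 0 < om x) ->
  (forall x, om (neg2 x) = om x) -> wdom om h -> measurable_fun setT v ->
  (forall x, 0 <= v x <= om x) ->
  sqint (fun x => v x * hs h x) /\ n2 (fun x => v x * hs h x) <= 2 * wn om h.
Proof.
move=> mom om0 ome hh mv vom; have [d n] := wdom_hs mom om0 ome hh.
have le (x : T2) : `|v x| <= 1 * om x by have /andP[v0 v1] := vom x; rewrite mul1r ger0_norm.
have [d' n'] := wdom_le mv mom om0 le ler01 d.
by split; [exact: d'|apply: le_trans n' _; rewrite mul1r].
Qed.

Lemma hs_itg (s : R) (v rho h : T2 -> R) : measurable_fun setT v -> (forall x, 0 <= v x) ->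
  sqint rho -> (forall x, 0 <= rho x) -> (forall x, v x <= rho x * wt s x) ->
  wdom (wt s) h ->
  itg (fun x => v x * hs h x) /\
  \int[mu]_x (v x * hs h x) <= n2 rho * (2 * wn (wt s) h).
Proof.
move=> mv v0 srho rho0 vrho hh.
have [d n] := wdom_hs (measurable_wt s) (wt_gt0 s) (wt_neg s) hh.
have [i ni] := itg_weight mv v0 srho rho0 vrho d; split; first exact: i.
have -> : \int[mu]_x (v x * hs h x) = n1 (fun x => v x * hs h x).
  by apply: eq_Rintegral => x _; rewrite ger0_norm// mulr_ge0// hs_ge0.
by apply: le_trans ni _; apply: ler_wpM2l => //; exact: n2_ge0.
Qed.

Definition Kc : R := (2 * pi)^-1.

Lemma Kc_gt0 : 0 < Kc. Proof. by rewrite invr_gt0 mulr_gt0// pi_gt0. Qed.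

Lemma Kc_le1 : Kc <= 1.
Proof. by rewrite invf_le1 ?mulr_gt0 ?pi_gt0//; have := pi_ge2 R; lra. Qed.

(** The Hartley counterpart of a product: if [F] and [G] are the Fourier transforms whose real part
    minus imaginary part are [h] and [g], this is the real part minus the imaginary part of
    [F(e) G(z)]. *)
Definition pairing h g (e z : T2) : R :=
  (h e * (g z + g (neg2 z)) + h (neg2 e) * (g z - g (neg2 z))) / 2.

Definition ker q h g (z : T2 * T2) : R :=
  Kc * dotp (perp z.2) (sub2 z.1 z.2) * q z.2 * pairing h g z.2 (sub2 z.1 z.2).

(* The image under the Hartley transform of [- u . grad w], when [h] is the Hartley transform
   of the function generating the velocity with multiplier [q], and [g] the one of [w]. *)
Definition bil q h g (x : T2) : R := \int[mu]_y ker q h g (x, y).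

Lemma measurable_comp_sub2 h : measurable_fun setT h ->
  measurable_fun setT (fun z : T2 * T2 => h (sub2 z.1 z.2)).
Proof. by move=> mh; exact: (measurableT_comp mh (@measurable_sub2 R)). Qed.

Lemma measurable_comp_snd h : measurable_fun setT h ->
  measurable_fun setT (fun z : T2 * T2 => h z.2).
Proof. by move=> mh; exact: (measurableT_comp mh measurable_snd). Qed.

Lemma measurable_comp_fst h : measurable_fun setT h ->
  measurable_fun setT (fun z : T2 * T2 => h z.1).
Proof. by move=> mh; exact: (measurableT_comp mh measurable_fst). Qed.

Lemma measurable_ker q h g : measurable_fun setT q -> measurable_fun setT h ->
  measurable_fun setT g -> measurable_fun setT (ker q h g).
Proof.
move=> mq mh mg.
apply: measurable_funM; first apply: measurable_funM; first apply: measurable_funM.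
- exact: measurable_cst.
- rewrite /dotp /perp /=; apply: measurable_funD; apply: measurable_funM.
  + apply: measurableT_comp => //; exact: (measurable_comp_snd (@measurable_snd2 R)).
  + exact: (measurable_comp_sub2 (@measurable_fst2 R)).
  + exact: (measurable_comp_snd (@measurable_fst2 R)).
  + exact: (measurable_comp_sub2 (@measurable_snd2 R)).
- exact: measurable_comp_snd.
- apply: measurable_funM; last exact: measurable_cst.
  have mg1 := measurable_comp_sub2 mg; have mg2 := measurable_comp_sub2 (measurable_negc mg).
  apply: measurable_funD; apply: measurable_funM.
  + exact: measurable_comp_snd.
  + exact: measurable_funD.
  + exact: (measurable_comp_snd (measurable_negc mh)).
  + exact: measurable_funB.
Qed.

Lemma pairing_bound h g e z : `|pairing h g e z| <= hs h e * hs g z / 2.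
Proof.
rewrite /pairing normrM (@ger0_norm _ 2^-1)// ler_wpM2r//.
apply: le_trans (ler_normD _ _) _; rewrite !normrM /hs [leRHS]mulrDl.
by apply: lerD; apply: ler_wpM2l => //; [exact: ler_normD|exact: ler_normB].
Qed.

Lemma ker_bound q h g z : `|ker q h g z| <=
  enorm z.2 * `|q z.2| * hs h z.2 * (enorm (sub2 z.1 z.2) * hs g (sub2 z.1 z.2)).
Proof.
rewrite /ker 3!normrM (gtr0_norm Kc_gt0); set y := z.2; set x := sub2 _ _.
have e0 := enorm_ge0 y; have f0 := enorm_ge0 x.
have a0 := hs_ge0 h y; have b0 := hs_ge0 g x.
have p1 := perp_dotp y x; have p2 := pairing_bound h g y x.
have ab := mulr_ge0 a0 b0; have ef := mulr_ge0 e0 f0.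
have p2' : `|pairing h g y x| <= hs h y * hs g x by lra.
have -> : enorm y * `|q y| * hs h y * (enorm x * hs g x) =
   1 * (enorm y * enorm x) * `|q y| * (hs h y * hs g x) by ring.
apply: ler_pM => //; first by rewrite !mulr_ge0// ltW// Kc_gt0.
apply: ler_wpM2r => //; apply: ler_pM => //; first exact/ltW/Kc_gt0.
exact: Kc_le1.
Qed.

Lemma kop_weight om (ka D : T2 * T2 -> R) C : kbound D C -> measurable_fun setT ka ->
  measurable_fun setT om -> (forall x, 0 < om x) -> (forall z, om z.1 * `|ka z| <= D z) ->
  [/\ {ae mu, forall x, itg (fun y => ka (x, y))},
      wdom om (fun x => \int[mu]_y ka (x, y)) & wn om (fun x => \int[mu]_y ka (x, y)) <= C].
Proof.
move=> kD mk mom om0 le.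
have mok : measurable_fun setT (fun z => om z.1 * ka z).
  by apply: measurable_funM => //; exact: measurable_comp_fst.
have le' z : `|om z.1 * ka z| <= D z by rewrite normrM (gtr0_norm (om0 _)).
have [ae1 s1 b1] := kbound_op kD mok le'.
have ae2 : {ae mu, forall x, itg (fun y => ka (x, y))}.
  apply: aeS ae1 => x hx; have := itgZ (om x)^-1 hx; congr itg.
  by apply/funext => y /=; rewrite mulrA mulVf ?mul1r// gt_eqF.
have E : {ae mu, forall x, \int[mu]_y (om x * ka (x, y)) = om x * \int[mu]_y ka (x, y)}.
  by apply: aeS ae2 => x hx; rewrite RintegralZl.
have mI : measurable_fun setT (fun x => om x * \int[mu]_y ka (x, y)).
  by apply: measurable_funM => //; exact: Rintegral_meas_signed.
split; first exact: ae2.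
- exact: sqint_ae mI E s1.
- by rewrite /wn -(n2_ae s1.1 mI E).
Qed.

Lemma Rint_ge0 (f : T2 -> R) : (forall x, 0 <= f x) -> 0 <= \int[mu]_x f x.
Proof. by move=> f0; apply: Rintegral_ge0 => x _. Qed.

(** The weight [<x>^r] is split between the two frequencies, and each piece is a convolution of an
    L^1 and an L^2 function, [r > 1] putting the unweighted factor in L^1. The exponent [j] is the
    growth allowed to the symbol: 0 for a velocity symbol, 1 for the difference of two of them,
    whose smallness is kept in [c]. *)
Theorem bil_bound (r j : R) : 1 < r -> 0 <= j -> exists2 C : R, 0 <= C & forall (c : R) q h g,
  0 <= c -> measurable_fun setT q ->
  (forall x, enorm x * `|q x| <= c * (wt j x + sing x)) ->
  wdom (wt (r + j)) h -> wdom (wt (r + 1)) g ->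
  [/\ {ae mu, forall x, itg (fun y => ker q h g (x, y))}, wdom (wt r) (bil q h g) &
      wn (wt r) (bil q h g) <= C * c * wn (wt (r + j)) h * wn (wt (r + 1)) g].
Proof.
move=> r1 j0; set A1 := n2 (wt (- r) : T2 -> R); set A2 := n2 (sing : T2 -> R).
have A10 : 0 <= A1 by exact: n2_ge0.
have A20 : 0 <= A2 by exact: n2_ge0.
exists (2 `^ r * (8 * (A1 + A2))); first by rewrite !mulr_ge0 ?powR_ge0 ?addr_ge0.
move=> c q h g c0 mq qb hh hg.
have mh := wdom_meas (measurable_wt _) (wt_gt0 _) hh.
have mg := wdom_meas (measurable_wt _) (wt_gt0 _) hg.
have hhr : wdom (wt r) h by apply: wdom_wt hh; rewrite lerDl.
have nhr : wn (wt r) h <= wn (wt (r + j)) h by apply: wn_wt hh; rewrite lerDl.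
have sr := sqint_wt r1; have ssing := @sqint_sing R.
have r0 : 0 <= r := ltW (lt_trans ltr01 r1).
pose b2 x := enorm x * hs g x.
have [ia1 na1] : itg b2 /\ \int[mu]_x b2 x <= A1 * (2 * wn (wt (r + 1)) g).
  apply: (hs_itg (@measurable_enorm R) (@enorm_ge0 R) sr (wt_ge0 _) _ hg) => x.
  by rewrite -wtD; rewrite (_ : - r + (r + 1) = 1); [exact: enorm_wt1|ring].
have [sb2 nb2] : sqint b2 /\ n2 b2 <= 2 * wn (wt (r + 1)) g.
  apply: (hs_sqint (measurable_wt _) (wt_gt0 _) (wt_neg _) hg (@measurable_enorm R)) => x.
  by rewrite enorm_ge0/= (le_trans (enorm_wt1 x))// wt_le// lerDr.
pose b1 x := wt (r + j) x * hs h x.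
have [sb1 nb1] : sqint b1 /\ n2 b1 <= 2 * wn (wt (r + j)) h.
  by apply: (hs_sqint (measurable_wt _) (wt_gt0 _) (wt_neg _) hh (measurable_wt _)) => x; rewrite wt_ge0 lexx.
(* Where the symbol is singular, the weight on [h] stays in the L^1 factor: the unbounded [sing]
   could not multiply an L^2 factor. *)
pose a2 x := sing x * wt r x * hs h x.
have [ia2 na2] : itg a2 /\ \int[mu]_x a2 x <= A2 * (2 * wn (wt r) h).
  apply: (hs_itg _ _ ssing (@sing_ge0 R) _ hhr) => [|x|x].
  - by apply: measurable_funM; [exact: measurable_sing|exact: measurable_wt].
  - by rewrite mulr_ge0 ?sing_ge0 ?wt_ge0.
  - by rewrite lexx.
pose a3 x := (wt j x + sing x) * hs h x.
have [ia3 na3] : itg a3 /\ \int[mu]_x a3 x <= (A1 + A2) * (2 * wn (wt (r + j)) h).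
  have srho := sqintD sr ssing.
  have [i n] : itg a3 /\ \int[mu]_x a3 x <= n2 (fun x => wt (- r) x + sing x) * (2 * wn (wt (r + j)) h).
    apply: (hs_itg _ _ srho _ _ hh) => [|x|x|x].
    - by apply: measurable_funD; [exact: measurable_wt|exact: measurable_sing].
    - by rewrite addr_ge0 ?sing_ge0 ?wt_ge0.
    - by rewrite addr_ge0 ?sing_ge0 ?wt_ge0.
    - rewrite mulrDl -wtD addKr lerD2l ler_peMr ?sing_ge0// wt_ge1// addr_ge0//.
  split; first exact: i.
  apply: le_trans n _; apply: ler_wpM2r; first by rewrite mulr_ge0 ?wn_ge0.
  exact: n2D.
pose b3 x := wt (r + 1) x * hs g x.
have [sb3 nb3] : sqint b3 /\ n2 b3 <= 2 * wn (wt (r + 1)) g.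
  by apply: (hs_sqint (measurable_wt _) (wt_gt0 _) (wt_neg _) hg (measurable_wt _)) => x; rewrite wt_ge0 lexx.
have p1 x : 0 <= b1 x by rewrite mulr_ge0 ?wt_ge0 ?hs_ge0.
have p2 x : 0 <= b2 x by rewrite mulr_ge0 ?enorm_ge0 ?hs_ge0.
have p3 x : 0 <= b3 x by rewrite mulr_ge0 ?wt_ge0 ?hs_ge0.
have q2 x : 0 <= a2 x by exact: (mulr_ge0 (mulr_ge0 (sing_ge0 x) (wt_ge0 r x)) (hs_ge0 h x)).
have q3 x : 0 <= a3 x by exact: (mulr_ge0 (addr_ge0 (wt_ge0 j x) (sing_ge0 x)) (hs_ge0 h x)).
have k1 := kbound_youngC ia1 p2 sb1 p1.
have k2 := kbound_young ia2 q2 sb2 p2.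
have k3 := kbound_young ia3 q3 sb3 p3.
have c1 : 0 <= 2 `^ r * c by rewrite mulr_ge0// powR_ge0.
have kD := kboundZ c1 (kboundD k1 (kboundD k2 k3)).
have le (z : T2 * T2) : wt r z.1 * `|ker q h g z| <= 2 `^ r * c *
    (b1 z.2 * b2 (sub2 z.1 z.2) + (a2 z.2 * b2 (sub2 z.1 z.2) + a3 z.2 * b3 (sub2 z.1 z.2))).
  case: z => x y /=; set z := sub2 x y.
  have kb := ker_bound q h g (x, y); rewrite /= -/z in kb.
  have w1 := wt_sub x y r0; rewrite -/z in w1.
  apply: (@le_trans _ _ ((2 `^ r * (wt r y + wt r z)) * (c * (wt j y + sing y) * hs h y * b2 z))).
    apply: ler_pM => //; first exact: wt_ge0.
    apply: le_trans kb _; apply: ler_wpM2r; first exact: p2.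
    by apply: ler_wpM2r; [exact: hs_ge0|exact: qb].
  have E : 2 `^ r * (wt r y + wt r z) * (c * (wt j y + sing y) * hs h y * b2 z) =
    2 `^ r * c * (b1 y * b2 z + (a2 y * b2 z + a3 y * (wt r z * b2 z))).
    by rewrite /b1 /a2 /a3 wtD; ring.
  rewrite E; apply: ler_wpM2l => //; rewrite lerD2l lerD2l; apply: ler_wpM2l; first exact: q3.
  rewrite /b2 /b3 mulrA; apply: ler_wpM2r; first exact: hs_ge0.
  by rewrite wtD; apply: ler_wpM2l; [exact: wt_ge0|exact: enorm_wt1].
have [ae1 d1 n1] := kop_weight kD (measurable_ker mq mh mg) (measurable_wt r) (wt_gt0 r) le.
split; [exact: ae1|exact: d1|apply: le_trans n1 _].
set Nh := wn (wt (r + j)) h; set Ng := wn (wt (r + 1)) g.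
have Nh0 : 0 <= Nh by exact: wn_ge0.
have Ng0 : 0 <= Ng by exact: wn_ge0.
(* Each [hs] doubles a norm, so the three convolutions contribute [4 A1], [4 A2] and
   [4 (A1 + A2)]. *)
have -> : 2 `^ r * (8 * (A1 + A2)) * c * Nh * Ng = 2 `^ r * c *
    (A1 * (2 * Ng) * (2 * Nh) + (A2 * (2 * Nh) * (2 * Ng) + (A1 + A2) * (2 * Nh) * (2 * Ng))) by ring.
apply: ler_wpM2l; first exact: c1.
have na2' : \int[mu]_x a2 x <= A2 * (2 * Nh).
  apply: le_trans na2 _; apply: ler_wpM2l; first exact: A20.
  by apply: ler_wpM2l nhr; exact: ler0n.
apply: lerD; last apply: lerD.
- exact: ler_pM (Rint_ge0 p2) (n2_ge0 b1) na1 nb1.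
- exact: ler_pM (Rint_ge0 q2) (n2_ge0 b2) na2' nb2.
- exact: ler_pM (Rint_ge0 q3) (n2_ge0 b3) na3 nb3.
Qed.

End Bilinear.

(** * Weights for the commutator estimate *)

Section CommutatorWeight.
Context {R : realType}.
Notation T2 := (plane R).
Implicit Types (r K x y : R).

(** A weight with one power removed: [omega] is [t psi(t)] at [t = <x>]. Every constant below is
    independent of [K], which is what makes it possible to let [K] grow. *)
Definition psi r K x : R := x `^ r / (K + x).

Lemma psi_ge0 r K x : 0 <= K -> 0 < x -> 0 <= psi r K x.
Proof. by move=> K0 x0; rewrite divr_ge0 ?powR_ge0// addr_ge0// ltW. Qed.

(** After cross-multiplication this is the monotonicity of [x^r] and of [x^(r-1)], whence
    [r >= 1]. *)
Lemma psi_mono r K x y : 1 <= r -> 0 <= K -> 0 < y -> y <= x -> psi r K y <= psi r K x.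
Proof.
move=> r1 K0 y0 yx; have x0 : 0 < x by exact: lt_le_trans yx.
rewrite /psi ler_pdivrMr ?ltr_wpDl// mulrAC ler_pdivlMr ?ltr_wpDl// !mulrDr.
have E (t : R) : 0 < t -> t `^ r = t `^ (r - 1) * t.
  move=> t0; have e : r = r - 1 + 1 by ring.
  rewrite {1}e powRD; last by rewrite (gt_eqF t0) implybT.
  by rewrite powRr1// ltW.
have m1 : y `^ r <= x `^ r.
  by apply: ge0_ler_powR; rewrite ?nnegrE; first [exact: le_trans r1|exact: ltW|done].
have m2 : y `^ (r - 1) <= x `^ (r - 1).
  by apply: ge0_ler_powR; rewrite ?nnegrE ?subr_ge0; first [exact: le_trans r1|exact: ltW|done].
apply: lerD; first exact: ler_wpM2r.
rewrite (E y)// (E x)// -!mulrA [y * x]mulrC.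
by apply: ler_wpM2r => //; rewrite mulr_ge0// ltW.
Qed.

Lemma psi_double r K x : 0 <= r -> 0 <= K -> 0 < x -> psi r K (2 * x) <= 2 `^ r * psi r K x.
Proof.
move=> r0 K0 x0; rewrite /psi powRM ?(ltW x0)// -mulrA.
apply: ler_wpM2l; first exact: powR_ge0.
apply: ler_wpM2l; first exact: powR_ge0.
rewrite lef_pV2 ?posrE ?ltr_wpDl ?mulr_gt0// lerD2l; lra.
Qed.

(* Convexity of the exponential gives [(y/x)^r >= 1 - r (x - y)/y]. *)
Lemma powR_lower r x y : 0 <= r -> 0 < y -> y <= x -> x `^ r * (y - r * (x - y)) <= y * y `^ r.
Proof.
move=> r0 y0 yx; have x0 : 0 < x by exact: lt_le_trans yx.
have l1 : ln x - ln y <= x / y - 1.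
  rewrite -ln_div ?posrE// lerBrDl; apply: le_trans (expR_ge1Dx _) _.
  by rewrite lnK// posrE divr_gt0.
have l2 : 1 - r * (x / y - 1) <= expR (r * (ln y - ln x)).
  apply: le_trans (expR_ge1Dx _); rewrite lerD2l -mulrN; apply: ler_wpM2l => //.
  by rewrite lerNl opprB.
have -> : y `^ r = x `^ r * expR (r * (ln y - ln x)).
  rewrite /powR !gt_eqF// -expRD; congr expR; ring.
rewrite mulrCA; apply: ler_wpM2l; first exact: powR_ge0.
have -> : y - r * (x - y) = y * (1 - r * (x / y - 1)) by field; rewrite gt_eqF.
by apply: ler_wpM2l l2; exact: ltW.
Qed.

Lemma psi_diff r K x y : 0 <= r -> 0 <= K -> 0 < y -> y <= x ->
  x * psi r K x - y * psi r K y <= (1 + r) * (x - y) * psi r K x.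
Proof.
move=> r0 K0 y0 yx; have x0 : 0 < x by exact: lt_le_trans yx.
have h : psi r K x * (y - r * (x - y)) <= y * psi r K y.
  rewrite /psi mulrAC; apply: (@le_trans _ _ (y * y `^ r / (K + x))).
    by apply: ler_wpM2r; [rewrite invr_ge0 addr_ge0// ltW|exact: powR_lower].
  rewrite mulrA; apply: ler_wpM2l; first by rewrite mulr_ge0 ?powR_ge0// ltW.
  by rewrite lef_pV2 ?posrE ?ltr_wpDl// lerD2l.
by move: (psi r K x) (psi r K y) h => a b h; nra.
Qed.

(** The increment of [t psi(t)] is at most its length times [psi] at the larger point. As
    [x <= y + w], that point is at most twice the larger of [y] and [w], and monotonicity with
    doubling concludes. *)
Lemma psi_lip r K x y w : 1 <= r -> 0 <= K -> 0 < x -> 0 < y -> 0 < w ->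
  x <= y + w -> `|x * psi r K x - y * psi r K y| <=
  (1 + r) * 2 `^ r * `|x - y| * (psi r K y + psi r K w).
Proof.
move=> r1 K0 x0 y0 w0 xyw; have r0 : 0 <= r by exact: le_trans r1.
have key m : 0 < m -> m <= y + w -> psi r K m <= 2 `^ r * (psi r K y + psi r K w).
  move=> m0 mw; have M0 : 0 < Num.max y w by rewrite lt_max y0.
  have le2 : m <= 2 * Num.max y w.
    have := le_max y y w; rewrite lexx/= => h1; have := le_max w y w; rewrite lexx orbT => h2.
    by apply: le_trans mw _; rewrite mulr2n mulrDl !mul1r lerD.
  apply: le_trans (psi_mono r1 K0 m0 le2) _; apply: le_trans (psi_double r0 K0 M0) _.
  apply: ler_wpM2l; first exact: powR_ge0.
  by rewrite maxEle; case: ifP => _; [rewrite lerDr|rewrite lerDl]; exact: psi_ge0.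
have fin m (p : R) : 0 <= p -> psi r K m <= 2 `^ r * (psi r K y + psi r K w) ->
    (1 + r) * p * psi r K m <= (1 + r) * 2 `^ r * p * (psi r K y + psi r K w).
  move=> p0 hm; rewrite -!mulrA; apply: ler_wpM2l; first by rewrite addr_ge0.
  by rewrite [leRHS]mulrCA; apply: ler_wpM2l.
have [yx|xy] := leP y x.
  have d0 : 0 <= x * psi r K x - y * psi r K y.
    by rewrite subr_ge0; apply: ler_pM; [exact: ltW|exact: psi_ge0|exact: yx|exact: psi_mono].
  rewrite (ger0_norm d0) ger0_norm ?subr_ge0//.
  apply: le_trans (psi_diff r0 K0 y0 yx) _; apply: fin; first by rewrite subr_ge0.
  exact: key.
have d0 : 0 <= y * psi r K y - x * psi r K x.
  by rewrite subr_ge0; apply: ler_pM; [exact: ltW|exact: psi_ge0|exact: ltW|apply: psi_mono => //; exact: ltW].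
rewrite distrC (ger0_norm d0) distrC ger0_norm ?subr_ge0 ?(ltW xy)//.
apply: le_trans (psi_diff r0 K0 x0 (ltW xy)) _; apply: fin; first by rewrite subr_ge0 ltW.
by apply: key => //; rewrite lerDl ltW.
Qed.

(* [<x>^(r+1) / (K + <x>)] is the weight of H^r for [K = 0] and, for large [K], only sees the
   frequencies above [K]. *)
Definition omega r K (x : T2) : R := wt 1 x * psi r K (wt 1 x).

Lemma omega_gt0 r K (x : T2) : 0 <= K -> 0 < omega r K x.
Proof. by move=> K0; exact: (mulr_gt0 (wt_gt0 1 x) (divr_gt0 (powR_gt0 _ (wt_gt0 1 x)) (ltr_wpDl K0 (wt_gt0 1 x)))). Qed.

Lemma measurable_omega r K : 0 <= K -> measurable_fun setT (omega r K).
Proof.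
move=> K0; apply: measurable_funM; first exact: measurable_wt.
apply: measurable_funM; first exact: (measurableT_comp (measurable_powR _) (measurable_wt _)).
rewrite (_ : (fun x : T2 => _) = (fun x : T2 => (K + wt 1 x) `^ (- 1))); last first.
  by apply/funext => x; rewrite powR_inv1// addr_ge0// wt_ge0.
apply: (measurableT_comp (measurable_powR _)).
by apply: measurable_funD; [exact: measurable_cst|exact: measurable_wt].
Qed.

Lemma omega_neg r K (x : T2) : omega r K (neg2 x) = omega r K x.
Proof. by rewrite /omega wt_neg. Qed.

Lemma omega0 r (x : T2) : omega r 0 x = wt r x.
Proof. by rewrite /omega /psi add0r mulrCA divff ?mulr1 ?(gt_eqF (wt_gt0 _ _))// -wtE. Qed.

Lemma omega_le r K (x : T2) : 0 <= K -> omega r K x <= wt r x.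
Proof.
move=> K0; rewrite -omega0 /omega; apply: ler_wpM2l; first exact: wt_ge0.
rewrite /psi; apply: ler_wpM2l; first exact: powR_ge0.
by rewrite lef_pV2 ?posrE ?ltr_wpDl ?wt_gt0 ?add0r ?lerDr.
Qed.

(** Taking the difference of the weights produces a factor [|y|] and lowers the order by one. This
    is the commutator gain that saves a derivative on the transported function. *)
Lemma omega_diff r K (x y : T2) : 1 <= r -> 0 <= K ->
  `|omega r K x - omega r K (sub2 x y)| <=
  (1 + r) * 2 `^ r * enorm y * (psi r K (wt 1 (sub2 x y)) + psi r K (wt 1 y)).
Proof.
move=> r1 K0; have w0 (z : T2) : 0 < wt 1 z :> R by exact: wt_gt0.
have h : wt 1 x <= wt 1 (sub2 x y) + wt 1 y by rewrite addrC wt1_sub.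
apply: le_trans (psi_lip r1 K0 (w0 x) (w0 _) (w0 y) h) _.
apply: ler_wpM2r; first by rewrite addr_ge0// psi_ge0.
apply: ler_wpM2l; first by rewrite mulr_ge0 ?powR_ge0// addr_ge0// (le_trans _ r1).
by apply: le_trans (wt1_lip _ _) _; rewrite sub2K.
Qed.

End CommutatorWeight.

(** * Cancellation of the transport term and energy estimate *)

Section Energy.
Context {R : realType}.
Notation mu := (@mu2 R).
Notation T2 := (plane R).
Implicit Types (h g q om : T2 -> R).

(** What the estimates use of the symbol, with constants independent of [alpha]. Evenness makes the
    transport term antisymmetric. The last bound serves the commutator, where a second factor [|x|]
    removes the singularity at 0. The factors [1] and [wt 0] match [bil_bound] at [c = 1] and
    [j = 0]. *)
Definition goodq q : Prop := [/\ measurable_fun setT q, forall x, q (neg2 x) = q x,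
  forall x, enorm x * `|q x| <= 1 * (wt 0 x + sing x) &
  forall x, enorm x ^+ 2 * `|q x| <= 2 * wt 1 x].

Lemma kbound_fubini (ka D : T2 * T2 -> R) C G : kbound D C -> measurable_fun setT ka ->
  (forall z, `|ka z| <= D z) -> sqint G ->
  \int[mu]_x ((\int[mu]_y ka (x, y)) * G x) = \int[mu]_y \int[mu]_x (ka (x, y) * G x).
Proof.
move=> [mD D0 aeD sD nD] mk kD sG; have [mG _] := sG.
have mF : measurable_fun setT (fun z : T2 * T2 => ka z * G z.1).
  by apply: measurable_funM => //; exact: measurable_comp_fst.
have aek : {ae mu, forall x, itg (fun y => ka (x, y))}.
  by apply: aeS aeD => x hx; apply: itg_dom hx => //; exact: (measurable_fun_pair2 _ mk).
have iDG := sqint_mul sD (sqint_abs sG).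
have mFa : measurable_fun setT (fun z : T2 * T2 => `|ka z * G z.1|%:E).
  by apply/measurable_EFinP; exact: measurableT_comp.
have lt : (\int[mu]_x \int[mu]_y `|ka (x, y) * G x|%:E < +oo)%E.
  apply: (@le_lt_trans _ _ (\int[mu]_x ((\int[mu]_y D (x, y)) * `|G x|)%:E)%E); last first.
    by rewrite (itg_EFin iDG) ltry.
  apply: ae_ge0_le_integral.
  - exact: measurableT.
  - by move=> x _; apply: integral_ge0 => y _; rewrite lee_fin.
  - exact: (tonelli_meas mFa (fun z => normr_ge0 _)).
  - by move=> x _; rewrite lee_fin mulr_ge0// Rint_ge0.
  - by apply/measurable_EFinP; exact: itg_meas iDG.
  - apply: aeS aeD => x hx _.
    have hx' := itgZ `|G x| hx.
    rewrite [leRHS](_ : _ = \int[mu]_y (`|G x| * D (x, y))%:E)%E; last first.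
      by rewrite (itg_EFin hx') RintegralZl// mulrC.
    apply: ge0_le_integral.
    + exact: measurableT.
    + by move=> y _; rewrite lee_fin.
    + exact: (measurable_fun_pair2 _ mFa).
    + by apply/measurable_EFinP; exact: itg_meas hx'.
    + by move=> y _; rewrite lee_fin normrM mulrC; apply: ler_wpM2l.
have [_ _ <-] := fubini_itg mF lt.
apply: ae_Rintegral.
- by apply: measurable_funM => //; exact: Rintegral_meas_signed.
- exact: (Rintegral_meas_signed mF).
- by apply: aeS aek => x hx; rewrite -(RintegralZr (G x) measurableT hx).
Qed.

Lemma sub2_add2 (y : T2) : (fun x => sub2 x y) = add2 (neg2 y).
Proof. by apply/funext => x; rewrite /sub2 /add2 /neg2/= addrC [in RHS]addrC ![- _ + _]addrC. Qed.

Lemma preserving_sub2r (y : T2) : preserving (fun x => sub2 x y).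
Proof. by rewrite sub2_add2; exact: preserving_add2. Qed.

Lemma neg2_sub2 (x y : T2) : neg2 (sub2 x y) = sub2 y x.
Proof. by rewrite /neg2 /sub2/= !opprB. Qed.

Lemma measurable_perp_dotp (y : T2) : measurable_fun setT (fun x : T2 => dotp (perp y) x).
Proof.
by apply: measurable_funD; apply: measurable_funM;
  first [exact: measurable_cst|exact: measurable_fst2|exact: measurable_snd2].
Qed.

(* No integrability is needed, since [fine] sends infinite values to 0. *)
Lemma Rint_opp (f : T2 -> R) : \int[mu]_x (- f x) = - \int[mu]_x f x.
Proof.
rewrite /Rintegral integralE [in RHS]integralE.
have -> : (fun x => (- f x)%:E) = (fun x => - (EFin \o f) x)%E by [].
rewrite funeposN funenegN.
have : (0 <= \int[mu]_x (EFin \o f)^\+ x)%E by apply: integral_ge0.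
have : (0 <= \int[mu]_x (EFin \o f)^\- x)%E by apply: integral_ge0.
by move: (\int[mu]_x _)%E (\int[mu]_x _)%E => [a||] [b||] //= _ _; rewrite ?oppr0// opprB.
Qed.

(** Transport by a divergence-free field. For fixed [y] the terms in [G(y - x)] vanish, by
    antisymmetry under [x -> y - x]; the terms in [G(x - y)] are odd in [y], because [q] is even,
    and integrate to 0. *)
Lemma bil_cancel q h G : goodq q -> measurable_fun setT h ->
  itg (fun x => (wt 0 x + sing x) * hs h x) -> wdom (wt 1) G ->
  \int[mu]_x (bil q h G x * G x) = 0.
Proof.
move=> [mq qe qb _] mh ia hG.
have mG := wdom_meas (measurable_wt _) (wt_gt0 _) hG.
have sG : sqint G.
  have := wdom_wt ler01 hG; congr sqint; by apply/funext => x; rewrite wt0 mul1r.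
pose a x := (wt 0 x + sing x) * hs h x; pose b x := enorm x * hs G x.
have [sb _] : sqint b /\ n2 b <= 2 * wn (wt 1) G.
  apply: (hs_sqint (measurable_wt _) (wt_gt0 _) (wt_neg _) hG (@measurable_enorm R)) => x.
  by rewrite enorm_ge0 enorm_wt1.
have a0 x : 0 <= a x by exact: (mulr_ge0 (addr_ge0 (wt_ge0 0 x) (sing_ge0 x)) (hs_ge0 h x)).
have b0 x : 0 <= b x by exact: (mulr_ge0 (enorm_ge0 x) (hs_ge0 G x)).
have kD := kbound_young ia a0 sb b0.
have mk := measurable_ker mq mh mG.
have le z : `|ker q h G z| <= a z.2 * b (sub2 z.1 z.2).
  apply: le_trans (ker_bound _ _ _ _) _; apply: ler_wpM2r; first exact: b0.
  by apply: ler_wpM2r; [exact: hs_ge0|have := qb z.2; rewrite mul1r].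
rewrite (kbound_fubini kD mk le sG).
pose X y := \int[mu]_x (dotp (perp y) x * G x * G (sub2 x y)).
pose Z y := \int[mu]_x (dotp (perp y) x * G x * G (sub2 y x)).
have spG y : sqint (fun x => dotp (perp y) x * G x).
  have mp : measurable_fun setT (fun x : T2 => dotp (perp y) x) by exact: measurable_perp_dotp.
  have le1 (x : T2) : `|dotp (perp y) x| <= enorm y * wt 1 x.
    apply: le_trans (perp_dotp y x) _; apply: ler_wpM2l; [exact: enorm_ge0|exact: enorm_wt1].
  exact: (proj1 (wdom_le mp (measurable_wt 1) (wt_gt0 1) le1 (enorm_ge0 y) hG)).
have iX y : itg (fun x => dotp (perp y) x * G x * G (sub2 x y)).
  exact: (sqint_mul (spG y) (sqint_preserving (preserving_sub2r y) sG)).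
have iZ y : itg (fun x => dotp (perp y) x * G x * G (sub2 y x)).
  exact: (sqint_mul (spG y) (sqint_preserving (preserving_sub2 y) sG)).
have IE y : \int[mu]_x (ker q h G (x, y) * G x) =
    Kc * q y / 2 * (h y + h (neg2 y)) * X y + Kc * q y / 2 * (h y - h (neg2 y)) * Z y.
  have -> : (fun x => ker q h G (x, y) * G x) = (fun x =>
      Kc * q y / 2 * (h y + h (neg2 y)) * (dotp (perp y) x * G x * G (sub2 x y)) +
      Kc * q y / 2 * (h y - h (neg2 y)) * (dotp (perp y) x * G x * G (sub2 y x))).
    apply/funext => x; rewrite /ker /pairing /= neg2_sub2.
    have -> : dotp (perp y) (sub2 x y) = dotp (perp y) x by rewrite /dotp /perp /sub2/=; ring.
    ring.
  rewrite RintegralD//; [|exact: itgZ|exact: itgZ].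
  by rewrite (RintegralZl _ measurableT (iX y)) (RintegralZl _ measurableT (iZ y)).
have Z0 y : Z y = 0.
  suff : Z y = - Z y by lra.
  rewrite {1}/Z -(Rintegral_preserving (preserving_sub2 y) (itg_meas (iZ y))) /Z.
  rewrite -Rint_opp//; apply: eq_Rintegral => x _.
  by rewrite sub2K /dotp /perp /sub2/=; ring.
have XN y : X (neg2 y) = - X y.
  rewrite /X -(Rintegral_preserving (preserving_sub2r y) (itg_meas (iX (neg2 y)))).
  rewrite -Rint_opp//; apply: eq_Rintegral => x _.
  have -> : sub2 (sub2 x y) (neg2 y) = x by case: x => x1 x2; rewrite /sub2 /neg2/= !opprK !subrK.
  by rewrite /dotp /perp /sub2 /neg2/=; ring.
pose I y := \int[mu]_x (ker q h G (x, y) * G x).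
have mI : measurable_fun setT I.
  apply: (@Rintegral_meas_signed _ (fun z => ker q h G (z.2, z.1) * G z.2)).
  apply: measurable_funM; last exact: measurable_comp_snd.
  exact: (measurableT_comp mk (@measurable_swap _ _ T2 T2)).
have IN y : I (neg2 y) = - I y.
  rewrite /I !IE !Z0 XN !mulr0 !addr0 qe.
  have -> : neg2 (neg2 y) = y by case: y => y1 y2; rewrite /neg2/= !opprK.
  ring.
suff : \int[mu]_y I y = - \int[mu]_y I y by lra.
rewrite -{1}(Rintegral_preserving (@preserving_neg2 R) mI).
have -> : (fun y => I (neg2 y)) = (fun y => - I y) by apply/funext.
exact: Rint_opp.
Qed.

(** The weight times the nonlinearity in [g] is the nonlinearity in [omega g], orthogonal to
    [omega g], plus a commutator. The commutator kernel is dominated by two convolutions, with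
    [<y> h] or [|z| g] in L^1, whence [s > 2]. The extra derivative on [g] makes the cancelled
    integral converge and does not enter the bound. *)
Theorem bil_energy (s r : R) : 2 < s -> 1 <= r -> exists2 C : R, 0 <= C &
  forall (K : R) q h g, 0 <= K -> goodq q ->
  wdom (wt s) h -> wdom (omega r K) h -> wdom (wt s) g ->
  wdom (fun x => wt 1 x * omega r K x) g ->
  `|\int[mu]_x ((omega r K x * bil q h g x) * (omega r K x * g x))| <=
  C * (wn (wt s) h * wn (omega r K) g + wn (omega r K) h * wn (wt s) g) * wn (omega r K) g.
Proof.
move=> s2 r1; pose A := n2 (wt (- (s - 1)) : T2 -> R); have A0 : 0 <= A by exact: n2_ge0.
have r0 : 0 <= r by exact: le_trans r1.
pose c2 := 2 * ((1 + r) * 2 `^ r).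
have c20 : 0 <= c2 by rewrite !mulr_ge0 ?powR_ge0 ?addr_ge0.
exists (c2 * (4 * A)); first by apply: mulr_ge0 => //; exact: mulr_ge0.
move=> K q h g K0 gq hs_ ho gs_ g1; have [mq qe qb qb2] := gq.
have mo := measurable_omega r K0; have o0 x := omega_gt0 r x K0; have oe := omega_neg r K.
pose om : T2 -> R := omega r K; rewrite -/om.
have mh := wdom_meas (measurable_wt _) (wt_gt0 _) hs_.
have mg := wdom_meas (measurable_wt _) (wt_gt0 _) gs_.
have sr : sqint (wt (- (s - 1))) by apply: sqint_wt; rewrite ltrBrDr.
have go : wdom om g.
  have le1 (x : T2) : `|om x| <= 1 * (wt 1 x * om x).
    by rewrite mul1r (gtr0_norm (o0 x)) ler_peMl ?wt_ge1// ltW// o0.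
  have m1 : measurable_fun setT (fun x => wt 1 x * om x).
    by apply: measurable_funM; [exact: measurable_wt|exact: mo].
  exact: (proj1 (wdom_le mo m1 (fun x => mulr_gt0 (wt_gt0 1 x) (o0 x)) le1 ler01 g1)).
pose u1 x := wt 1 x * hs h x.
have w1 (x : T2) : wt 1 x <= wt (- (s - 1)) x * wt s x :> R.
  by rewrite -wtD (_ : - (s - 1) + s = 1)//; ring.
have [iu1 nu1] : itg u1 /\ \int[mu]_x u1 x <= A * (2 * wn (wt s) h).
  exact: (hs_itg (measurable_wt 1) (wt_ge0 1) sr (wt_ge0 _) w1 hs_).
pose v2 x := enorm x * hs g x.
have [iv2 nv2] : itg v2 /\ \int[mu]_x v2 x <= A * (2 * wn (wt s) g).
  apply: (hs_itg (@measurable_enorm R) (@enorm_ge0 R) sr (wt_ge0 _) _ gs_) => x.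
  exact: le_trans (enorm_wt1 x) (w1 x).
pose v1 x := om x * hs g x.
have [sv1 nv1] : sqint v1 /\ n2 v1 <= 2 * wn om g by exact: wdom_hs mo o0 oe go.
pose u2 x := om x * hs h x.
have [su2 nu2] : sqint u2 /\ n2 u2 <= 2 * wn om h by exact: wdom_hs mo o0 oe ho.
have u10 x : 0 <= u1 x by exact: (mulr_ge0 (wt_ge0 1 x) (hs_ge0 h x)).
have v20 x : 0 <= v2 x by exact: (mulr_ge0 (enorm_ge0 x) (hs_ge0 g x)).
have v10 x : 0 <= v1 x by exact: (mulr_ge0 (ltW (o0 x)) (hs_ge0 g x)).
have u20 x : 0 <= u2 x by exact: (mulr_ge0 (ltW (o0 x)) (hs_ge0 h x)).
have kD := kboundZ c20 (kboundD (kbound_young iu1 u10 sv1 v10) (kbound_youngC iv2 v20 su2 u20)).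
pose kc (z : T2 * T2) := (om z.1 - om (sub2 z.1 z.2)) * ker q h g z.
have mk := measurable_ker mq mh mg.
have mkc : measurable_fun setT kc.
  apply: measurable_funM => //; apply: measurable_funB;
    [exact: measurable_comp_fst|exact: measurable_comp_sub2].
have lec z : `|kc z| <= c2 * (u1 z.2 * v1 (sub2 z.1 z.2) + u2 z.2 * v2 (sub2 z.1 z.2)).
  case: z => x y; rewrite /kc /= normrM; set z := sub2 x y.
  have od := omega_diff x y r1 K0; rewrite -/z -/om in od.
  have kb := ker_bound q h g (x, y); rewrite /= -/z in kb.
  set B := (1 + r) * 2 `^ r in od.
  have B0 : 0 <= B by rewrite mulr_ge0 ?powR_ge0// addr_ge0.
  have pz : 0 <= psi r K (wt 1 z) by rewrite psi_ge0// wt_gt0.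
  have py : 0 <= psi r K (wt 1 y) by rewrite psi_ge0// wt_gt0.
  apply: (@le_trans _ _ (B * enorm y * (psi r K (wt 1 z) + psi r K (wt 1 y)) *
      (enorm y * `|q y| * hs h y * (enorm z * hs g z)))).
    by apply: ler_pM.
  have -> : B * enorm y * (psi r K (wt 1 z) + psi r K (wt 1 y)) *
      (enorm y * `|q y| * hs h y * (enorm z * hs g z)) =
    (B * (hs h y * hs g z)) * ((enorm y ^+ 2 * `|q y|) *
      (enorm z * psi r K (wt 1 z) + enorm z * psi r K (wt 1 y))) by ring.
  have -> : c2 * (u1 y * v1 z + u2 y * v2 z) =
    (B * (hs h y * hs g z)) * ((2 * wt 1 y) * (om z + psi r K (wt 1 y) * enorm z)).
    by rewrite /c2 -/B /u1 /v1 /u2 /v2 /om /omega; ring.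
  apply: ler_wpM2l; first exact: mulr_ge0 B0 (mulr_ge0 (hs_ge0 h y) (hs_ge0 g z)).
  apply: ler_pM; first by rewrite mulr_ge0 ?exprn_ge0 ?enorm_ge0.
  - by rewrite addr_ge0// mulr_ge0 ?enorm_ge0.
  - exact: qb2.
  - rewrite [psi r K (wt 1 y) * _]mulrC lerD2r /om /omega; apply: ler_wpM2r => //; exact: enorm_wt1.
have [aec sc nc] := kbound_op kD mkc lec.
pose G x := om x * g x; have sG : sqint G by exact: go.
have wG : wdom (wt 1) G.
  by move: g1; rewrite /wdom /G; congr sqint; apply/funext => x; rewrite mulrA.
have rho := sqintD (sqint_wt (lt_trans (ltr1n _ 2) s2)) (@sqint_sing R).
have [ia _] : itg (fun x => (wt 0 x + sing x) * hs h x) /\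
    \int[mu]_x ((wt 0 x + sing x) * hs h x) <= n2 (fun x => wt (- s) x + sing x) * (2 * wn (wt s) h).
  apply: (hs_itg _ _ rho _ _ hs_) => [|x|x|x].
  - by apply: measurable_funD; [exact: measurable_wt|exact: measurable_sing].
  - exact: (addr_ge0 (wt_ge0 0 x) (sing_ge0 x)).
  - exact: (addr_ge0 (wt_ge0 _ x) (sing_ge0 x)).
  - rewrite mulrDl -wtD addNr lerD2l; apply: ler_peMr; first exact: sing_ge0.
    by apply: wt_ge1; exact: ltW (lt_trans _ s2).
pose a x := (wt 0 x + sing x) * hs h x; pose b x := enorm x * hs G x.
have [sb _] : sqint b /\ n2 b <= 2 * wn (wt 1) G.
  apply: (hs_sqint (measurable_wt _) (wt_gt0 _) (wt_neg _) wG (@measurable_enorm R)) => x.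
  by rewrite enorm_ge0 enorm_wt1.
have a0 x : 0 <= a x by exact: (mulr_ge0 (addr_ge0 (wt_ge0 0 x) (sing_ge0 x)) (hs_ge0 h x)).
have b0 x : 0 <= b x by exact: (mulr_ge0 (enorm_ge0 x) (hs_ge0 G x)).
have leG z : `|ker q h G z| <= a z.2 * b (sub2 z.1 z.2).
  apply: le_trans (ker_bound _ _ _ _) _; apply: ler_wpM2r; first exact: b0.
  by apply: ler_wpM2r; [exact: hs_ge0|have := qb z.2; rewrite mul1r].
have mG : measurable_fun setT G by case: sG.
have mkG := measurable_ker mq mh mG.
have [aeG sBG _] := kbound_op (kbound_young ia a0 sb b0) mkG leG.
have oe' (x : T2) : om (neg2 x) = om x by exact: omega_neg.
pose C1 x := \int[mu]_y kc (x, y).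
have E : {ae mu, forall x, om x * bil q h g x = C1 x + bil q h G x}.
  apply: aeS2 aec aeG => x h1 h2.
  (* The weight is even, so it also passes to the reflected values of [g] inside [pairing]. *)
  have e : (fun y => om x * ker q h g (x, y)) = (fun y => kc (x, y) + ker q h G (x, y)).
    by apply/funext => y; rewrite /kc /ker /pairing /G /= oe'; ring.
  have ik : itg (fun y => ker q h g (x, y)).
    have := itgZ (om x)^-1 (itgD h1 h2); congr itg; apply/funext => y.
    by have := congr1 (fun f => f y) e => /= <-; rewrite mulrA mulVf ?mul1r// gt_eqF// o0.
  by rewrite /bil -RintegralZl// e RintegralD.
have mB : measurable_fun setT (bil q h g) by exact: Rintegral_meas_signed.
have mC1 : measurable_fun setT C1 by exact: Rintegral_meas_signed.
have mBG : measurable_fun setT (bil q h G) by exact: Rintegral_meas_signed.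
have -> : \int[mu]_x (om x * bil q h g x * (om x * g x)) = \int[mu]_x (C1 x * G x + bil q h G x * G x).
  apply: ae_Rintegral.
  - by apply: measurable_funM => //; exact: measurable_funM.
  - by apply: measurable_funD; exact: measurable_funM.
  - by apply: aeS E => x ->; rewrite -/(G x) mulrDl.
rewrite RintegralD//; [|exact: sqint_mul|exact: sqint_mul].
rewrite (bil_cancel gq mh ia wG) addr0.
apply: le_trans (n2_cauchy sc sG) _; apply: ler_wpM2r; first exact: n2_ge0.
apply: le_trans nc _; rewrite -mulrA; apply: ler_wpM2l => //.
set Nh := wn (wt s) h; set Ng := wn om g; set Mh := wn om h; set Mg := wn (wt s) g.
have -> : 4 * A * (Nh * Ng + Mh * Mg) = A * (2 * Nh) * (2 * Ng) + A * (2 * Mg) * (2 * Mh) by ring.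
apply: lerD.
- exact: ler_pM (Rint_ge0 u10) (n2_ge0 v1) nu1 nv1.
- exact: ler_pM (Rint_ge0 v20) (n2_ge0 u2) nv2 nu2.
Qed.

End Energy.

(** * The Hartley transform *)

Section Density.
Context d (T : measurableType d) (R : realType) (m : {measure set T -> \bar R}).

(** The proofs of measurability and positivity are arguments so that the set function can be
    declared a measure. *)
Definition dens (F : T -> R) of measurable_fun setT F & (forall x, 0 <= F x) :=
  fun E : set T => (\int[m]_(x in E) (F x)%:E)%E.

Variables (F : T -> R) (mF : measurable_fun setT F) (F0 : forall x, 0 <= F x).
Notation dF := (dens mF F0).

Let dens0 : dF set0 = 0%E. Proof. by rewrite /dens integral_set0. Qed.

Let dens_ge0 E : (0 <= dF E)%E.
Proof. by apply: integral_ge0 => x _; rewrite lee_fin. Qed.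

Let dens_sigma_additive : semi_sigma_additive dF.
Proof.
move=> A mA tA mUA; rewrite /dens ge0_integral_bigcup//.
- by apply: is_cvg_ereal_nneg_natsum => n _; exact: dens_ge0.
- by apply/measurable_EFinP; exact: measurable_funTS.
- by move=> x _; rewrite lee_fin.
Qed.

HB.instance Definition _ := isMeasure.Build _ _ _ dF dens0 dens_ge0 dens_sigma_additive.

End Density.

(** * Functions determined by their integrals over boxes *)

Section DetermineByRectangles.
Context {R : realType}.
Notation mu := (@mu2 R).
Notation T1 := (measurableTypeR R).
Notation T2 := (plane R).

Lemma half_open_unique (m1 m2 : {measure set T1 -> \bar R}) : (m1 setT < +oo)%E ->
  (forall a b : R, m1 `]a, b]%classic = m2 `]a, b]%classic) ->
  forall A, measurable A -> m1 A = m2 A.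
Proof.
move=> fin eqI A mA.
pose g (n : nat) : set T1 := [set` `]- n%:R, n%:R : R]].
apply: (@measure_unique _ R T1 (@ocitv R) g _ _ _ _ m1 m2) => //.
- exact: ocitvI.
- by move=> n; exists (- n%:R, n%:R).
- rewrite -subTset => x _; exists (Num.truncn `|x|).+1 => //=.
  have : `|x| < (Num.truncn `|x|).+1%:R by rewrite truncnS_gt.
  by rewrite ltr_norml /g/= in_itv/= => /andP[-> /ltW ->].
- by move=> _ [[a b] _ <-]; exact: eqI.
- move=> n; apply: le_lt_trans fin; apply: le_measure => //; rewrite ?inE//.
  by apply: measurable_itv.
Qed.

Definition box (a b : T2) : set T2 := `]a.1, b.1]%classic `*` `]a.2, b.2]%classic.

Lemma measurable_box a b : measurable (box a b).
Proof. by apply: measurableX; exact: measurable_itv. Qed.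

Lemma dens_box_unique (F1 F2 : T2 -> R) (m1 : measurable_fun setT F1) (m2 : measurable_fun setT F2)
    (p1 : forall x, 0 <= F1 x) (p2 : forall x, 0 <= F2 x) : itg F1 ->
  (forall a b, dens mu m1 p1 (box a b) = dens mu m2 p2 (box a b)) ->
  forall A, measurable A -> dens mu m1 p1 A = dens mu m2 p2 A.
Proof.
move=> i1 eqB.
have fin E : measurable E -> (dens mu m1 p1 E < +oo)%E.
  move=> mE; apply: (@le_lt_trans _ _ (dens mu m1 p1 setT)).
    by apply: le_measure; rewrite ?inE.
  by rewrite /dens (itg_EFin i1) ltry.
have mfst : measurable_fun setT (fst : T2 -> T1) by exact: measurable_fst.
have msnd : measurable_fun setT (snd : T2 -> T1) by exact: measurable_snd.
have mind (E : set T2) : measurable E -> measurable_fun setT (\1_E : T2 -> R).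
  by move=> mE; exact: measurable_indic.
have mcut (F : T2 -> R) E : measurable_fun setT F -> measurable E ->
    measurable_fun setT (fun x => F x * \1_E x).
  by move=> mF mE; apply: measurable_funM => //; exact: mind.
have pcut (F : T2 -> R) E : (forall x, 0 <= F x) -> forall x, 0 <= F x * \1_E x.
  by move=> F0 x; rewrite mulr_ge0// indicE.
have cutE (F : T2 -> R) E A : measurable E -> measurable A ->
    (\int[mu]_(x in A) (F x * \1_E x)%:E = \int[mu]_(x in A `&` E) (F x)%:E)%E.
  move=> mE mA; rewrite [RHS]integral_mkcondr; apply: eq_integral => x _.
  by rewrite /patch indicE; case: ifP => _; rewrite ?mulr1 ?mulr0.
(* first vary the first side of a rectangle, then the second one *)
have step1 (p q : R) (A : set T1) : measurable A ->
    dens mu m1 p1 (A `*` `]p, q]%classic) = dens mu m2 p2 (A `*` `]p, q]%classic).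
  move=> mA; pose E : set T2 := setT `*` `]p, q]%classic.
  have mE : measurable E by apply: measurableX => //; exact: measurable_itv.
  have h (F : T2 -> R) (B : set T1) : measurable B ->
      (\int[mu]_(x in B `*` `]p, q]%classic) (F x)%:E =
      \int[mu]_(x in fst @^-1` B) (F x * \1_E x)%:E)%E.
    move=> mB; have mfB : measurable ((fst : T2 -> T1) @^-1` B).
      by rewrite -[X in measurable X]setTI; exact: mfst.
    rewrite cutE//; congr (integral _ _ _); apply/seteqP; split => x /=; rewrite /E/=; tauto.
  pose n1 := dens mu (mcut F1 E m1 mE) (pcut F1 E p1).
  pose n2 := dens mu (mcut F2 E m2 mE) (pcut F2 E p2).
  pose k1 := measure_function_pushforward__canonical__measure_function_Measure n1 mfst.
  pose k2 := measure_function_pushforward__canonical__measure_function_Measure n2 mfst.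
  rewrite /dens !h//; apply: (@half_open_unique k1 k2) => //.
    apply: le_lt_trans (fin setT measurableT).
    by rewrite /k1 /= /pushforward /n1 /dens preimage_setT cutE// setTI; apply: (le_measure (dens mu m1 p1)); rewrite ?inE.
  move=> a b; rewrite /k1 /k2 /= /pushforward /n1 /n2 /dens.
  by rewrite -!h//; exact: (eqB (a, p) (b, q)).
have step2 (A B : set T1) : measurable A -> measurable B ->
    dens mu m1 p1 (A `*` B) = dens mu m2 p2 (A `*` B).
  move=> mA mB; pose E : set T2 := A `*` setT.
  have mE : measurable E by apply: measurableX.
  have h (F : T2 -> R) (C : set T1) : measurable C ->
      (\int[mu]_(x in A `*` C) (F x)%:E =
      \int[mu]_(x in snd @^-1` C) (F x * \1_E x)%:E)%E.
    move=> mC; have mfB : measurable ((snd : T2 -> T1) @^-1` C).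
      by rewrite -[X in measurable X]setTI; exact: msnd.
    rewrite cutE//; congr (integral _ _ _); apply/seteqP; split => x /=; rewrite /E/=; tauto.
  pose n1 := dens mu (mcut F1 E m1 mE) (pcut F1 E p1).
  pose n2 := dens mu (mcut F2 E m2 mE) (pcut F2 E p2).
  pose k1 := measure_function_pushforward__canonical__measure_function_Measure n1 msnd.
  pose k2 := measure_function_pushforward__canonical__measure_function_Measure n2 msnd.
  rewrite /dens !h//; apply: (@half_open_unique k1 k2) => //.
    apply: le_lt_trans (fin setT measurableT).
    by rewrite /k1 /= /pushforward /n1 /dens preimage_setT cutE// setTI; apply: (le_measure (dens mu m1 p1)); rewrite ?inE.
  move=> a b; rewrite /k1 /k2 /= /pushforward /n1 /n2 /dens.
  by rewrite -!h//; exact: step1.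
move=> A mA.
apply: (measure_unique [set A `*` B | A in (@measurable _ T1) & B in (@measurable _ T1)] (fun=> setT)) => //.
- exact: measurable_prod_measurableType.
- move=> _ _ [A1 mA1 [B1 mB1 <-]] [A2 mA2 [B2 mB2 <-]].
  exists (A1 `&` A2); first exact: measurableI.
  by exists (B1 `&` B2); [exact: measurableI|rewrite setXI].
- by move=> _; exists setT => //; exists setT => //; apply/seteqP; split.
- by rewrite bigcup_const//; exists 0%N.
- by move=> _ [A1 mA1 [B1 mB1 <-]]; exact: step2.
- by move=> _; exact: fin.
Qed.

(** The positive and negative parts have the same integral on every box, hence are densities of the
    same measure. *)
Lemma box_eq0 (h : T2 -> R) : itg h -> (forall a b, \int[mu]_x (h x * \1_(box a b) x) = 0) ->
  {ae mu, forall x, h x = 0}.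
Proof.
move=> ih hB; have mh := itg_meas ih.
pose p x := Num.max 0 (h x); pose q x := Num.max 0 (- h x).
have p0 x : 0 <= p x by rewrite le_max lexx.
have q0 x : 0 <= q x by rewrite le_max lexx.
have hE x : h x = p x - q x.
  rewrite /p /q; have [h0|h0] := leP 0 (h x).
    by rewrite max_l ?subr0// oppr_le0.
  by rewrite max_r ?sub0r ?opprK// oppr_ge0 ltW.
have mp : measurable_fun setT p by apply: measurable_maxr => //; exact: measurable_cst.
have mq : measurable_fun setT q.
  by apply: measurable_maxr; [exact: measurable_cst|exact: measurableT_comp].
have ip : itg p.
  by apply: itg_dom (itg_abs ih) => // x; rewrite ger0_norm// /p ge_max normr_ge0 ler_norm.
have iq : itg q.
  by apply: itg_dom (itg_abs ih) => // x; rewrite ger0_norm// /q ge_max normr_ge0 -normrN ler_norm.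
have mind (E : set T2) : measurable E -> measurable_fun setT (\1_E : T2 -> R).
  by move=> mE; exact: measurable_indic.
have icut (F : T2 -> R) E : itg F -> measurable E -> itg (fun x => F x * \1_E x).
  move=> iF mE; apply: itg_dom (itg_abs iF).
    by apply: measurable_funM; [exact: itg_meas|exact: mind].
  by move=> x; rewrite normrM ler_piMr// indicE; case: (_ \in _); rewrite /= ?normr1 ?normr0.
have cutE (F : T2 -> R) E : itg F -> measurable E ->
    (\int[mu]_(x in E) (F x)%:E = (\int[mu]_x (F x * \1_E x))%:E)%E.
  move=> iF mE; rewrite -(itg_EFin (icut F E iF mE)) [LHS]integral_mkcond; apply: eq_integral => x _.
  by rewrite /patch indicE; case: ifP => _; rewrite ?mulr1 ?mulr0.
have eqB a b : dens mu mp p0 (box a b) = dens mu mq q0 (box a b).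
  have mB := measurable_box a b.
  rewrite /dens !cutE//; congr (_%:E); apply/eqP; rewrite -subr_eq0 -RintegralB//; do ?exact: icut.
  by rewrite -(hB a b); apply/eqP; apply: eq_Rintegral => x _; rewrite (hE x) mulrBl.
have all := dens_box_unique ip eqB.
have : ae_eq mu setT (EFin \o p) (EFin \o q).
  apply: integral_ae_eq => //; first exact/measurable_EFinP.
  by move=> E _ mE; exact: all.
by apply: aeS => x /(_ I) [] e; rewrite hE e subrr.
Qed.

End DetermineByRectangles.

(** * Dominated convergence and tensor products *)

Section Tensor.
Context {R : realType}.
Notation leb := (@lebesgue_measure R).
Notation mu := (@mu2 R).
Notation T1 := (measurableTypeR R).
Notation T2 := (plane R).

Lemma Rint_dct (f_ : nat -> T2 -> R) (f g : T2 -> R) :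
  (forall n, measurable_fun setT (f_ n)) -> measurable_fun setT f -> itg g ->
  {ae mu, forall x, f_ ^~ x @ \oo --> f x} -> (forall n x, `|f_ n x| <= g x) ->
  (\int[mu]_x f_ n x) @[n --> \oo] --> \int[mu]_x f x.
Proof.
move=> mf_ mf ig cv le.
have mE n : measurable_fun setT (EFin \o f_ n) by exact/measurable_EFinP.
have mE' : measurable_fun setT (EFin \o f) by exact/measurable_EFinP.
have cv' : {ae mu, forall x, setT x -> (fun n => (EFin \o f_ n) x) @ \oo --> (EFin \o f) x}.
  by apply: aeS cv => x cx _; apply: cvg_EFin => //; exact: nearW.
have le' : {ae mu, forall x n, setT x -> (`|(EFin \o f_ n) x| <= (EFin \o g) x)%E}.
  by apply: aeW => x n _; rewrite lee_fin.
have [i_ _ c] := dominated_convergence measurableT mE mE' cv' ig le'.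
apply: fine_cvg; rewrite -[X in _ --> X]/(EFin (fine _)) fineK; last exact: integrable_fin_num.
exact: c.
Qed.

Lemma Rint_tensor (u v : T1 -> R) : itg1 u -> itg1 v ->
  itg (fun x : T2 => u x.1 * v x.2) /\
  \int[mu]_x (u x.1 * v x.2) = (\int[leb]_x u x) * (\int[leb]_x v x).
Proof.
move=> iu iv.
have /integrableP[/measurable_EFinP mu_ _] := iu.
have /integrableP[/measurable_EFinP mv _] := iv.
have iau : itg1 (fun x => `|u x|) by exact: (integrable_abse iu).
have iav : itg1 (fun x => `|v x|) by exact: (integrable_abse iv).
have m1 : measurable_fun setT (fun x : T2 => u x.1 * v x.2).
  apply: measurable_funM; [exact: (measurableT_comp mu_ measurable_fst)|
    exact: (measurableT_comp mv measurable_snd)].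
have ii : itg (fun x : T2 => u x.1 * v x.2).
  have := itg1_tensor iau iav (fun=> normr_ge0 _) (fun=> normr_ge0 _).
  by apply: itg_dom => // x; rewrite normrM.
split; first exact: ii.
rewrite /Rintegral -(integral12_prod_meas1 ii).
rewrite [X in fine X](_ : _ = \int[leb]_x ((u x)%:E * \int[leb]_y (v y)%:E))%E; last first.
  apply: eq_integral => x _; rewrite /fubini_F/=.
  by under eq_integral do rewrite EFinM; rewrite integralZl.
have fv : (\int[leb]_y (v y)%:E \is a fin_num)%E by exact: integrable_fin_num iv.
rewrite -(fineK fv) integralZr//= fineM//; exact: integrable_fin_num iu.
Qed.

End Tensor.

(** * Abel summation and the Poisson kernel *)

Section Poisson.
Context {R : realType}.
Notation leb := (@lebesgue_measure R).
Notation mu := (@mu2 R).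
Notation T1 := (measurableTypeR R).
Notation T2 := (plane R).
Implicit Types (d a t : R).

Lemma ge0_integral_neg1 (f : T1 -> \bar R) : measurable_fun setT f -> (forall x, 0 <= f x)%E ->
  (\int[leb]_x f (- x)%R = \int[leb]_x f x)%E.
Proof.
move=> mf f0.
have mN : measurable_fun setT ((fun x => - x) : T1 -> T1) by exact: (@oppr_measurable R setT).
pose m := measure_function_pushforward__canonical__measure_function_Measure leb mN.
transitivity (\int[m]_x f x)%E; first by rewrite ge0_integral_pushforward.
by apply: eq_measure_integral => //= A mA _; exact: lebesgue_measureN.
Qed.

Lemma Rint_odd1 (f : T1 -> R) : measurable_fun setT f -> (forall x, f (- x) = - f x) ->
  \int[leb]_x f x = 0.
Proof.
move=> mf fN.
have mF : measurable_fun setT (EFin \o f) by exact/measurable_EFinP.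
have h := @ge0_integral_neg1 _ (measurable_funepos mF) (fun x => funepos_ge0 _ x).
rewrite /Rintegral integralE -h.
have -> : (fun x : T1 => (EFin \o f)^\+ (- x)%R)%E = (EFin \o f)^\-%E.
  rewrite -[LHS]/((EFin \o f)^\+%E \o (fun x : T1 => - x)) -funepos_comp.
  by rewrite -funeposN; congr (_^\+%E); apply/funext => x /=; rewrite fN.
have : (0 <= \int[leb]_x (EFin \o f)^\- x)%E by apply: integral_ge0.
by case: (\int[leb]_x _)%E => //= r _; rewrite subrr.
Qed.

Lemma is_derive_scale (f f' : R -> R) a t : (forall x : R, is_derive x (1 : R) f (f' x)) ->
  is_derive t (1 : R) (fun s : R => f (a * s)) (a * f' (a * t)).
Proof.
move=> df.
have d1 : is_derive t (1 : R) (fun s : R => a * s) a.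
  have : is_derive t (1 : R) (a \*: (id : R -> R)) (a *: 1) by apply: is_deriveZ.
  by rewrite /GRing.scale/= mulr1.
have := @is_derive1_comp _ f (fun s : R => a * s) t _ _ (df (a * t)) d1.
by rewrite mulrC.
Qed.

Lemma is_derive_scaleM (f g : R -> R) (df dg t : R) : is_derive t (1 : R) f df ->
  is_derive t (1 : R) g dg -> is_derive t (1 : R) (fun s : R => f s * g s) (f t * dg + g t * df).
Proof. by move=> h1 h2; apply: is_deriveM. Qed.

Lemma is_derive_scaleD (f g : R -> R) (df dg t : R) : is_derive t (1 : R) f df ->
  is_derive t (1 : R) g dg -> is_derive t (1 : R) (fun s : R => f s + g s) (df + dg).
Proof. by move=> h1 h2; apply: is_deriveD. Qed.

Lemma is_derive_scaleZ (f : R -> R) (c df t : R) : is_derive t (1 : R) f df ->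
  is_derive t (1 : R) (fun s : R => c * f s) (c * df).
Proof. by move=> h1; apply: is_deriveZ. Qed.

(** Abel's convergence factor: its cosine transform is the rational function [pois d], obtained from
    an elementary primitive. *)
Definition pe d t : R := expR (- (d * `|t|)).

Lemma continuous_cosM a : continuous (fun t : R => cos (a * t)).
Proof.
move=> t; apply: (@continuous_comp R R R (fun s => a * s) cos); last exact: continuous_cos.
by apply: continuousM; [exact: cst_continuous|exact: cvg_id].
Qed.

Lemma continuous_sinM a : continuous (fun t : R => sin (a * t)).
Proof.
move=> t; apply: (@continuous_comp R R R (fun s => a * s) sin); last exact: continuous_sin.
by apply: continuousM; [exact: cst_continuous|exact: cvg_id].
Qed.

Lemma continuous_pe d : continuous (pe d).
Proof.
move=> t; apply: (@continuous_comp R R R (fun s => - (d * `|s|)) (@expR R)); last exact: continuous_expR.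
apply: continuousN; apply: continuousM; [exact: cst_continuous|exact: norm_continuous].
Qed.

Lemma pe_ge0 d t : 0 <= pe d t. Proof. exact: expR_ge0. Qed.

(* the factor [1 + cos] makes the integrand nonnegative *)
Lemma integral_pe_cos1 d a : 0 < d ->
  (\int[leb]_x (pe d x * (1 + cos (a * x)))%:E =
   (2 * (d^-1 + d / (d ^+ 2 + a ^+ 2)))%:E)%E.
Proof.
move=> d0; pose f t := pe d t * (1 + cos (a * t)).
have f0 t : 0 <= f t.
  by rewrite mulr_ge0 ?pe_ge0// -lerBlDl sub0r cos_geN1.
have cf : continuous f.
  move=> t; apply: continuousM; first exact: continuous_pe.
  by apply: continuousD; [exact: cst_continuous|exact: continuous_cosM].
have D0 : 0 < d ^+ 2 + a ^+ 2 by rewrite ltr_pwDl ?exprn_gt0 ?sqr_ge0.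
rewrite ge0_symfun_integralT//; last first.
  by move=> t /=; rewrite /f /pe normrN mulrN cosN.
have -> : [set x : R | 0 <= x] = `[0, +oo[%classic by rewrite set_itvcy.
(* The product [F] of this bounded function with [expR (- d t)] is a primitive of the integrand on
   the half line, and tends to 0 at infinity. *)
pose g (t : R) := (d ^+ 2 + a ^+ 2)^-1 * (- d * cos (a * t) + a * sin (a * t)) + (- d^-1).
pose F (t : R) := expR (- d * t) * g t.
pose C : R := (d ^+ 2 + a ^+ 2)^-1 * (d + `|a|) + d^-1.
have gC t : `|g t| <= C.
  rewrite /g /C; apply: le_trans (ler_normD _ _) _; rewrite normrN (@ger0_norm _ d^-1) ?invr_ge0 ?(ltW d0)//.
  rewrite lerD2r normrM (@ger0_norm _ (_^-1)) ?invr_ge0 ?(ltW D0)//.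
  apply: ler_wpM2l; first by rewrite invr_ge0 ltW.
  apply: le_trans (ler_normD _ _) _; rewrite !normrM normrN (gtr0_norm d0).
  by apply: lerD; [apply: ler_piMr; [exact: ltW|]|apply: ler_piMr; [exact: normr_ge0|]];
    rewrite ler_norml ?cos_geN1 ?cos_le1 ?sin_geN1 ?sin_le1.
have dF (t : R) : is_derive t (1 : R) F (expR (- d * t) * (1 + cos (a * t))).
  have dE : is_derive t (1 : R) (fun s : R => expR (- d * s)) (- d * expR (- d * t)).
    by apply: is_derive_scale => x; exact: is_derive_expR.
  have dc : is_derive t (1 : R) (fun s : R => cos (a * s)) (a * - sin (a * t)).
    by apply: (is_derive_scale (f' := fun x => - sin x)) => x; exact: is_derive_cos.
  have ds : is_derive t (1 : R) (fun s : R => sin (a * s)) (a * cos (a * t)).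
    by apply: is_derive_scale => x; exact: is_derive_sin.
  have dg := is_derive_scaleD (is_derive_scaleZ (d ^+ 2 + a ^+ 2)^-1
    (is_derive_scaleD (is_derive_scaleZ (- d) dc) (is_derive_scaleZ a ds))) (is_derive_cst (- d^-1) t 1).
  apply: (is_derive_eq (is_derive_scaleM dE dg)); rewrite /cst.
  by field; rewrite !gt_eqF.
have cvE : expR (- d * t) @[t --> +oo] --> (0 : R).
  have := @cvgr_expR R; move/cvgrPdist_lt => h; apply/cvgrPdist_lt => e e0.
  have [M [Mr HM]] := h e e0; exists (M / d); split; first exact: num_real.
  move=> t Mt; have := HM (d * t) _; rewrite mulNr; apply.
  by rewrite mulrC -ltr_pdivrMr.
have cvE' (k : R) : k * expR (- d * t) @[t --> +oo] --> (0 : R).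
  have : k * expR (- d * t) @[t --> +oo] --> k * 0 by apply: cvgM; [exact: cvg_cst|exact: cvE].
  by rewrite mulr0.
have cvF : F t @[t --> +oo] --> (0 : R).
  apply: (@squeeze_cvgr _ _ _ _ (fun t => - C * expR (- d * t)) (fun t => C * expR (- d * t))).
  - near=> t; rewrite /F; have := gC t; rewrite ler_norml => /andP[g1 g2].
    have := expR_ge0 (- d * t); nra.
  - exact: cvE' (- C).
  - exact: cvE' C.
have Fd (t : R) : derivable F t 1 by have [] := dF t.
have cF (t : R) : {for t, continuous F}.
  by apply: differentiable_continuous; exact/derivable1_diffP.
rewrite (ge0_continuous_FTC2y (F := F) (l := 0))//=.
- rewrite /F /g !mulr0 expR0 cos0 sin0 EFinM; congr (_ * _)%E; rewrite -EFinB; congr (_%:E).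
  by field; rewrite !gt_eqF.
- by move=> x _; exact: f0.
- by apply/continuous_within_itvcyP; split; [move=> x _; exact: cf|apply: cvg_at_right_filter; exact: cf].
- by apply: cvg_at_right_filter; exact: cF.
- move=> x; rewrite in_itv/= andbT => x0; rewrite derive1E (@derive_val _ _ _ _ _ _ _ (dF x)).
  by rewrite /f /pe gtr0_norm// mulNr.
Unshelve. all: by end_near. Qed.

Lemma measurable_pe d : measurable_fun setT (pe d : T1 -> R).
Proof. exact: continuous_measurable_fun (@continuous_pe d). Qed.

Lemma itg1_pe d : 0 < d -> itg1 (pe d) /\ \int[leb]_x pe d x = 2 / d.
Proof.
move=> d0; have h := integral_pe_cos1 0 d0.
have E : (fun x : R => (pe d x * (1 + cos (0 * x)))%:E) = (fun x => (2 * pe d x)%:E).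
  by apply/funext => x; rewrite mul0r cos0 mulrC.
rewrite E in h.
have h' : (\int[leb]_x (pe d x)%:E = (2 / d)%:E)%E.
  have : (2%:E * \int[leb]_x (pe d x)%:E = 2%:E * (2 / d)%:E)%E.
    rewrite -ge0_integralZl_EFin//.
    - rewrite h -EFinM; congr (_%:E); by field; rewrite gt_eqF.
    - by move=> x _; rewrite lee_fin pe_ge0.
    - by apply/measurable_EFinP; exact: measurable_pe.
  move/(congr1 (fun z => 2^-1%:E * z)%E); rewrite !muleA -!EFinM mulVf// !mul1e.
  by rewrite mul1r.
split; last by rewrite /Rintegral h'.
apply: (@itg1_ge0 _ _ (2 / d)); [exact: measurable_pe|exact: pe_ge0|by rewrite h'].
Qed.

Definition pois d a : R := 2 * d / (d ^+ 2 + a ^+ 2).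

Lemma pe_dom d (f : R -> R) : 0 < d -> continuous f -> (forall x, `|f x| <= 1) ->
  itg1 (fun x => pe d x * f x).
Proof.
move=> d0 cf f1; apply: itg1_le (itg1_pe d0).1.
  apply: measurable_funM; first exact: measurable_pe.
  exact: continuous_measurable_fun.
by move=> x; rewrite normrM (ger0_norm (pe_ge0 _ _)) ler_piMr ?pe_ge0.
Qed.

Lemma pe_cos d a : 0 < d -> itg1 (fun x => pe d x * cos (a * x)) /\
  \int[leb]_x (pe d x * cos (a * x)) = pois d a.
Proof.
move=> d0.
have ic : itg1 (fun x => pe d x * cos (a * x)).
  apply: pe_dom => //; first exact: continuous_cosM.
  by move=> x; rewrite ler_norml cos_geN1 cos_le1.
have [ip Ep] := itg1_pe d0.
split; first exact: ic.
have : \int[leb]_x (pe d x * (1 + cos (a * x))) = 2 / d + \int[leb]_x (pe d x * cos (a * x)).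
  by rewrite -Ep -RintegralD//; apply: eq_Rintegral => x _; rewrite mulrDr mulr1.
rewrite {1}/Rintegral integral_pe_cos1//= => h.
have {h} -> : \int[leb]_x (pe d x * cos (a * x)) = 2 * (d^-1 + d / (d ^+ 2 + a ^+ 2)) - 2 / d.
  by rewrite h; ring.
rewrite /pois; field; rewrite !gt_eqF// ltr_pwDl ?exprn_gt0 ?sqr_ge0//.
Qed.

Lemma pe_sin d a : 0 < d -> itg1 (fun x => pe d x * sin (a * x)) /\
  \int[leb]_x (pe d x * sin (a * x)) = 0.
Proof.
move=> d0.
have ic : itg1 (fun x => pe d x * sin (a * x)).
  apply: pe_dom => //; first exact: continuous_sinM.
  by move=> x; rewrite ler_norml sin_geN1 sin_le1.
split; first exact: ic.
apply: Rint_odd1; first by have /integrableP[/measurable_EFinP] := ic.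
by move=> x; rewrite /pe normrN mulrN sinN mulrN.
Qed.

Definition e2 d (x : T2) : R := pe d x.1 * pe d x.2.
Definition pois2 d (x : T2) : R := pois d x.1 * pois d x.2.

Lemma e2_ge0 d x : 0 <= e2 d x. Proof. by rewrite mulr_ge0 ?pe_ge0. Qed.

Lemma e2_le1 d x : 0 <= d -> e2 d x <= 1.
Proof.
move=> d0; have h (t : R) : pe d t <= 1 by rewrite -expR0 ler_expR oppr_le0 mulr_ge0.
by rewrite mulr_ile1 ?pe_ge0.
Qed.

Lemma itg_e2 d : 0 < d -> itg (e2 d).
Proof. by move=> d0; have [i _] := itg1_pe d0; have [] := Rint_tensor i i. Qed.

Definition cas (t : R) : R := cos t + sin t.

Lemma cas_mul a t : cas a * cas t = cos (a - t) + sin (a + t).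
Proof. by rewrite /cas cosB sinD; ring. Qed.

Lemma cas_bound t : `|cas t| <= 2.
Proof.
apply: le_trans (ler_normD _ _) _.
by rewrite mulr2n; apply: lerD; rewrite ler_norml ?cos_geN1 ?cos_le1 ?sin_geN1 ?sin_le1.
Qed.

(** In [cas a cas t = cos (a - t) + sin (a + t)], expanding over the coordinates leaves products of
    one-dimensional integrals. Each one with a sine is odd and vanishes; only the product of two
    cosines survives. *)
Lemma e2_cas2 d (x y : T2) : 0 < d ->
  \int[mu]_z (cas (dotp x z) * cas (dotp y z) * e2 d z) = pois2 d (sub2 x y).
Proof.
move=> d0.
pose c (b : R) t := pe d t * cos (b * t); pose s (b : R) t := pe d t * sin (b * t).
have Tc b b' : itg (fun z : T2 => c b z.1 * c b' z.2) /\
    \int[mu]_z (c b z.1 * c b' z.2) = pois d b * pois d b'.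
  have [i e] := pe_cos b d0; have [i' e'] := pe_cos b' d0.
  by have := Rint_tensor i i'; rewrite e e'.
have Tss b b' : itg (fun z : T2 => s b z.1 * s b' z.2) /\ \int[mu]_z (s b z.1 * s b' z.2) = 0.
  have [i e] := pe_sin b d0; have [i' e'] := pe_sin b' d0.
  by have := Rint_tensor i i'; rewrite e e' mul0r.
have Tsc b b' : itg (fun z : T2 => s b z.1 * c b' z.2) /\ \int[mu]_z (s b z.1 * c b' z.2) = 0.
  have [i e] := pe_sin b d0; have [i' e'] := pe_cos b' d0.
  by have := Rint_tensor i i'; rewrite e e' mul0r.
have Tcs b b' : itg (fun z : T2 => c b z.1 * s b' z.2) /\ \int[mu]_z (c b z.1 * s b' z.2) = 0.
  have [i e] := pe_cos b d0; have [i' e'] := pe_sin b' d0.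
  by have := Rint_tensor i i'; rewrite e e' mulr0.
pose m1 := x.1 - y.1; pose m2 := x.2 - y.2; pose p1 := x.1 + y.1; pose p2 := x.2 + y.2.
have [i1 e1] := Tc m1 m2; have [i2 e2'] := Tss m1 m2.
have [i3 e3] := Tsc p1 p2; have [i4 e4] := Tcs p1 p2.
transitivity (\int[mu]_z ((c m1 z.1 * c m2 z.2 - s m1 z.1 * s m2 z.2) +
    (s p1 z.1 * c p2 z.2 + c p1 z.1 * s p2 z.2))).
  apply: eq_Rintegral => z _; rewrite cas_mul.
  have -> : dotp x z - dotp y z = m1 * z.1 + m2 * z.2 by rewrite /dotp /m1 /m2; ring.
  have -> : dotp x z + dotp y z = p1 * z.1 + p2 * z.2 by rewrite /dotp /p1 /p2; ring.
  by rewrite cosD sinD /c /s /e2; ring.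
rewrite (RintegralD measurableT (itgB i1 i2) (itgD i3 i4)).
rewrite (RintegralB measurableT i1 i2) (RintegralD measurableT i3 i4).
by rewrite e1 e2' e3 e4 subr0 addr0 addr0.
Qed.

End Poisson.

(** * Poisson averages of boxes *)

Section PoissonKernel.
Context {R : realType}.
Notation leb := (@lebesgue_measure R).
Notation mu := (@mu2 R).
Notation T1 := (measurableTypeR R).
Notation T2 := (plane R).
Implicit Types (d a p q : R).

Lemma pois_den d a : 0 < d -> 0 < d ^+ 2 + a ^+ 2.
Proof. by move=> d0; rewrite ltr_pwDl ?exprn_gt0 ?sqr_ge0. Qed.

Lemma pois_ge0 d a : 0 < d -> 0 <= pois d a.
Proof. by move=> d0; rewrite divr_ge0 ?mulr_ge0 ?(ltW d0) ?(ltW (pois_den a d0)). Qed.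

Lemma continuous_pois d : 0 < d -> continuous (pois d).
Proof.
move=> d0 a; apply: (@continuousM R R (cst (2 * d)) (fun x => (d ^+ 2 + x ^+ 2)^-1)); first exact: cst_continuous.
apply: cvgV; first by rewrite gt_eqF// pois_den.
by apply: cvgD; [exact: cvg_cst|exact: exprn_continuous].
Qed.

Lemma is_derive_atan_scale d (x : R) : 0 < d ->
  is_derive x (1 : R) (fun s : R => 2 * atan (d^-1 * s)) (pois d x).
Proof.
move=> d0.
have h := is_derive_scaleZ 2 (is_derive_scale (f := atan) d^-1 x (fun y => is_derive1_atan y)).
apply: (is_derive_eq h); rewrite /pois.
have h1 : 1 + (d^-1 * x) ^+ 2 != 0 by rewrite gt_eqF// ltr_pwDl// sqr_ge0.
have e : (1 + (d^-1 * x) ^+ 2) = (d ^+ 2 + x ^+ 2) / d ^+ 2 by field; rewrite gt_eqF.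
rewrite e; field; rewrite !gt_eqF//; exact: pois_den.
Qed.

Lemma itg1_pois d : 0 < d -> itg1 (pois d) /\ \int[leb]_x pois d x <= 2 * pi.
Proof.
move=> d0; have mp : measurable_fun setT (pois d : T1 -> R) by exact: continuous_measurable_fun (continuous_pois d0).
have cp (x : R) : 0 <= x -> {for x, continuous (pois d)} by move=> _; exact: continuous_pois.
have h := @itg1_half_line R (pois d) (fun s : R => 2 * atan (d^-1 * s)) pi
  (fun x => pois_ge0 x d0) (fun x _ => is_derive_atan_scale x d0) cp mp.
have {}h : (\int[leb]_(x in [set x | (0 <= x)%R]) (pois d x)%:E <= (pi : R)%:E)%E.
  by apply: h => x x0; rewrite mulr0 atan0 mulr0 subr0; have := atan_ltpi2 (d^-1 * x); lra.
have hb : (\int[leb]_x (pois d x)%:E <= (2 * pi)%:E)%E.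
  rewrite ge0_symfun_integralT; last 3 first.
  - by move=> x; exact: pois_ge0.
  - exact: continuous_pois.
  - by move=> x /=; rewrite /pois sqrrN.
  by rewrite EFinM lee_wpmul2l ?lee_fin.
have ip : itg1 (pois d) by apply: itg1_ge0 hb => // x; exact: pois_ge0.
split; first exact: ip.
rewrite -lee_fin /Rintegral fineK//; exact: integrable_fin_num ip.
Qed.

Lemma pois2_ge0 d (x : T2) : 0 < d -> 0 <= pois2 d x.
Proof. by move=> d0; rewrite mulr_ge0 ?pois_ge0. Qed.

Lemma itg_pois2 d : 0 < d -> itg (pois2 d) /\ \int[mu]_x pois2 d x <= (2 * pi) ^+ 2.
Proof.
move=> d0; have [i b] := itg1_pois d0; have [i2 e] := Rint_tensor i i.
split; first exact: i2.
have r0 : 0 <= \int[leb]_x pois d x by apply: Rintegral_ge0 => x _; exact: pois_ge0.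
by rewrite /pois2 e expr2; apply: ler_pM.
Qed.

(** The integral over []p, q]] of the Poisson kernel centred at [x]. It is elementary, which is the
    reason for testing on boxes. *)
Definition avg d p q (x : R) : R := 2 * (atan (d^-1 * (x - p)) - atan (d^-1 * (x - q))).

Lemma pois_interval d p q (x : R) : 0 < d -> p < q ->
  itg1 (fun y => pois d (x - y) * \1_(`]p, q]%classic : set T1) y) /\
  \int[leb]_y (pois d (x - y) * \1_(`]p, q]%classic : set T1) y) = avg d p q x.
Proof.
move=> d0 pq.
have cp : continuous (fun y : R => pois d (x - y)).
  move=> y; apply: (@continuous_comp R R R (fun y => x - y) (pois d)); last exact: continuous_pois.
  by apply: continuousB; [exact: cst_continuous|exact: cvg_id].
have mp : measurable_fun setT (fun y : T1 => pois d (x - y)) by exact: continuous_measurable_fun.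
pose G (y : R) : R := -1 * (2 * atan (d^-1 * (x - y))).
have dG (y : R) : p <= y <= q -> is_derive y (1 : R) G (pois d (x - y)).
  move=> _; have di : is_derive y (1 : R) (fun s : R => x - s) (- 1).
    have : is_derive y (1 : R) (cst x - id) (0 - 1) by apply: is_deriveB.
    by rewrite sub0r.
  have h := @is_derive1_comp _ (fun s : R => 2 * atan (d^-1 * s)) (fun s : R => x - s) y _ _
     (is_derive_atan_scale (x - y) d0) di.
  by apply: (is_derive_eq (is_derive_scaleZ (-1) h)); ring.
have cp' : {within `[p, q], continuous (fun y : R => pois d (x - y))}.
  by apply: continuous_subspaceT.
have E : (\int[leb]_y (pois d (x - y) * \1_(`]p, q]%classic : set T1) y)%:E = (avg d p q x)%:E)%E.
  transitivity (\int[leb]_(y in `]p, q]) (pois d (x - y))%:E)%E.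
    rewrite [RHS]integral_mkcond; apply: eq_integral => y _.
    rewrite indicE /patch; case: (boolP (y \in `]p, q])) => y0.
      by rewrite !mem_set// mulr1.
    by rewrite !memNset ?mulr0//= => y0'; move/negP: y0.
  rewrite integral_itv_obnd_cbnd; last by apply/measurable_EFinP; exact: measurable_funTS.
  rewrite (FTC_is_derive pq dG cp'); congr (_%:E); rewrite /G /avg; ring.
split; last by rewrite /Rintegral E.
apply: (@itg1_ge0 _ _ (avg d p q x)); last by rewrite E.
- by apply: measurable_funM => //; exact: measurable_indic.
- by move=> y; rewrite mulr_ge0 ?pois_ge0// indicE.
Qed.

Lemma pois2_box d (a b x : T2) : 0 < d -> a.1 < b.1 -> a.2 < b.2 ->
  \int[mu]_y (\1_(box a b) y * pois2 d (sub2 x y)) = avg d a.1 b.1 x.1 * avg d a.2 b.2 x.2.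
Proof.
move=> d0 ab1 ab2; have [i1 e1] := pois_interval x.1 d0 ab1; have [i2 e2] := pois_interval x.2 d0 ab2.
have [_] := Rint_tensor i1 i2; rewrite e1 e2 => <-.
apply: eq_Rintegral => y _; rewrite /box /pois2 /sub2/= !indicE in_setX.
by rewrite -mulnb natrM; ring.
Qed.

Lemma avg_bound d p q (x : R) : `|Kc * avg d p q x| <= 1.
Proof.
have h1 := atan_ltpi2 (d^-1 * (x - p)); have h2 := atan_gtNpi2 (d^-1 * (x - p)).
have h3 := atan_ltpi2 (d^-1 * (x - q)); have h4 := atan_gtNpi2 (d^-1 * (x - q)).
have k0 := @Kc_gt0 R; have p0 : 0 < pi :> R by exact: pi_gt0.
rewrite normrM (gtr0_norm k0) /Kc ler_pdivrMl ?mulr_gt0// mulr1 /avg normrM ger0_norm//.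
by apply: ler_wpM2l => //; rewrite ler_norml; apply/andP; split; lra.
Qed.

Lemma cvg_atan_scale (c : R) : 0 < c -> atan (n.+1%:R * c) @[n --> \oo] --> (pi / 2 : R).
Proof.
move=> c0; apply: (@cvg_comp _ _ _ (fun n : nat => n.+1%:R * c : R) (@atan R) _ (+oo%R)); last exact: cvgy_atan.
apply/cvgryPge => A; near=> n.
rewrite -ler_pdivrMr//; apply: (@le_trans _ _ n%:R); last by rewrite ler_nat.
by near: n; exact: nbhs_infty_ger.
Unshelve. all: by end_near. Qed.

Lemma cvg_atan_scaleN (c : R) : c < 0 -> atan (n.+1%:R * c) @[n --> \oo] --> (- (pi / 2) : R).
Proof.
move=> c0; rewrite (_ : (fun n : nat => atan (n.+1%:R * c)) = (fun n => - atan (n.+1%:R * - c))).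
  by apply: cvgN; apply: cvg_atan_scale; rewrite oppr_gt0.
by apply/funext => n; rewrite mulrN atanN opprK.
Qed.

Lemma cvg_avg p q (x : R) : p < q -> x != p -> x != q ->
  Kc * avg (n.+1%:R^-1) p q x @[n --> \oo] --> (\1_(`]p, q]%classic : set T1) x : R).
Proof.
move=> pq xp xq; have p0 : 0 < pi :> R by exact: pi_gt0.
have key (l1 l2 : R) : atan (n.+1%:R * (x - p)) @[n --> \oo] --> l1 ->
    atan (n.+1%:R * (x - q)) @[n --> \oo] --> l2 ->
    Kc * avg (n.+1%:R^-1) p q x @[n --> \oo] --> Kc * (2 * (l1 - l2)).
  move=> c1 c2; rewrite /avg; under eq_fun do rewrite invrK.
  by apply: cvgM; [exact: cvg_cst|apply: cvgM; [exact: cvg_cst|exact: cvgB]].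
rewrite indicE; case: (ltgtP x p) xp => // xp _; case: (ltgtP x q) xq => // xq _.
- rewrite memNset/=; last by rewrite in_itv/= => /andP[]; lra.
  have := key _ _ (cvg_atan_scaleN (ltac:(lra) : x - p < 0)) (cvg_atan_scaleN (ltac:(lra) : x - q < 0)).
  by rewrite subrr !mulr0.
- by have := lt_trans xp pq; rewrite ltNge (ltW xq).
- rewrite mem_set/=; last by rewrite in_itv/= xp ltW.
  have := key _ _ (cvg_atan_scale (ltac:(lra) : 0 < x - p)) (cvg_atan_scaleN (ltac:(lra) : x - q < 0)).
  rewrite (_ : Kc * (2 * (pi / 2 - - (pi / 2))) = 1)//.
  by rewrite opprK -splitr /Kc mulVf// gt_eqF// mulr_gt0.
- rewrite memNset/=; last by rewrite in_itv/= => /andP[]; lra.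
  have := key _ _ (cvg_atan_scale (ltac:(lra) : 0 < x - p)) (cvg_atan_scale (ltac:(lra) : 0 < x - q)).
  by rewrite subrr !mulr0.
Qed.

End PoissonKernel.

(** * The Hartley integral of integrable functions *)

Section Hartley.
Context {R : realType}.
Notation mu := (@mu2 R).
Notation T2 := (plane R).
Implicit Types (f g h : T2 -> R).

Definition Har f (x : T2) : R := Kc * \int[mu]_y (f y * cas (dotp y x)).

Lemma dotpC (x y : T2) : dotp x y = dotp y x.
Proof. by rewrite /dotp [x.1 * _]mulrC [x.2 * _]mulrC. Qed.

Lemma measurable_dotp2 : measurable_fun setT (fun z : T2 * T2 => dotp z.1 z.2).
Proof.
apply: measurable_funD; apply: measurable_funM.
- exact: (measurable_comp_fst (@measurable_fst2 R)).
- exact: (measurable_comp_snd (@measurable_fst2 R)).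
- exact: (measurable_comp_fst (@measurable_snd2 R)).
- exact: (measurable_comp_snd (@measurable_snd2 R)).
Qed.

Lemma measurable_cas : measurable_fun setT (@cas R).
Proof.
by apply: measurable_funD; apply: continuous_measurable_fun; [exact: continuous_cos|exact: continuous_sin].
Qed.

Lemma measurable_cas2 : measurable_fun setT (fun z : T2 * T2 => cas (dotp z.1 z.2)).
Proof. exact: (measurableT_comp measurable_cas measurable_dotp2). Qed.

Lemma measurable_cas_dotp (x : T2) : measurable_fun setT (fun y : T2 => cas (dotp x y)).
Proof. exact: (measurable_fun_pair2 x measurable_cas2). Qed.

Lemma itg_bounded f (b : T2 -> R) (C : R) : itg f -> measurable_fun setT b ->
  (forall x, `|b x| <= C) -> itg (fun x => f x * b x).
Proof.
move=> hf mb bC; have hf' := itgZ C (itg_abs hf).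
apply: itg_dom hf'; first by apply: measurable_funM => //; exact: itg_meas.
by move=> x; rewrite normrM mulrC; apply: ler_wpM2r.
Qed.

Lemma itg_cas f (x : T2) : itg f -> itg (fun y => f y * cas (dotp y x)).
Proof.
move=> hf; apply: (itg_bounded hf (C := 2)); last by move=> y; exact: cas_bound.
exact: (measurable_fun_pair1 x measurable_cas2).
Qed.

Lemma measurable_Har f : measurable_fun setT f -> measurable_fun setT (Har f).
Proof.
move=> mf; apply: measurable_funM; first exact: measurable_cst.
apply: (@Rintegral_meas_signed _ (fun z : T2 * T2 => f z.2 * cas (dotp z.2 z.1))).
apply: measurable_funM; first exact: measurable_comp_snd.
exact: (measurableT_comp measurable_cas2 (@measurable_swap _ _ T2 T2)).
Qed.

Lemma Har_bound f x : itg f -> `|Har f x| <= 2 * n1 f.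
Proof.
move=> hf; rewrite /Har normrM (gtr0_norm (@Kc_gt0 R)).
have h : `|\int[mu]_y (f y * cas (dotp y x))| <= 2 * n1 f.
  apply: le_trans (n1_bound (itg_cas x hf)) _.
  rewrite -(RintegralZl 2 measurableT (itg_abs hf)); apply: n1_itg_dom.
  - exact: itg_meas (itg_cas x hf).
  - by move=> y; rewrite normrM mulrC; apply: ler_wpM2r => //; exact: cas_bound.
  - exact: itgZ (itg_abs hf).
rewrite -[leRHS]mul1r; apply: ler_pM => //; [exact: ltW (@Kc_gt0 R)|exact: Kc_le1].
Qed.

Lemma HarB f g : itg f -> itg g -> Har (fun x => f x - g x) = (fun x => Har f x - Har g x).
Proof.
move=> hf hg; apply/funext => x; rewrite /Har -mulrBr; congr (_ * _).
rewrite -(RintegralB measurableT (itg_cas x hf) (itg_cas x hg)).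
by apply: eq_Rintegral => y _; rewrite mulrBl.
Qed.

Lemma HarZ c f : itg f -> Har (fun x => c * f x) = (fun x => c * Har f x).
Proof.
move=> hf; apply/funext => x; rewrite /Har mulrCA; congr (_ * _).
rewrite -(RintegralZl c measurableT (itg_cas x hf)).
by apply: eq_Rintegral => y _; rewrite mulrA.
Qed.

Lemma Har_sym f g : itg f -> itg g ->
  \int[mu]_x (Har f x * g x) = \int[mu]_x (f x * Har g x).
Proof.
move=> hf hg; have mf := itg_meas hf; have mg := itg_meas hg.
pose F (z : T2 * T2) := f z.1 * cas (dotp z.1 z.2) * g z.2.
have mF : measurable_fun setT F.
  apply: measurable_funM; last exact: measurable_comp_snd.
  by apply: measurable_funM; [exact: measurable_comp_fst|exact: measurable_cas2].
have lt : (\int[mu]_x \int[mu]_y `|F (x, y)|%:E < +oo)%E.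
  have ig := itgZ 2 (itg_abs hg).
  apply: (@le_lt_trans _ _ (\int[mu]_x (`|f x| * \int[mu]_y (2 * `|g y|))%:E)%E); last first.
    have h := itgZ (\int[mu]_y (2 * `|g y|)) (itg_abs hf).
    rewrite [ltLHS](_ : _ = \int[mu]_x ((\int[mu]_y (2 * `|g y|)) * `|f x|)%:E)%E.
      by rewrite (itg_EFin h) ltry.
    by apply: eq_integral => x _; rewrite mulrC.
  have mFa : measurable_fun setT (fun z : T2 * T2 => `|F z|%:E).
    by apply/measurable_EFinP; exact: measurableT_comp.
  apply: ge0_le_integral.
  - exact: measurableT.
  - by move=> x _; apply: integral_ge0 => y _; rewrite lee_fin.
  - exact: (tonelli_meas mFa (fun z => normr_ge0 _)).
  - apply/measurable_EFinP; apply: measurable_funM; last exact: measurable_cst.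
    exact: measurableT_comp.
  - move=> x _; have h := itgZ `|f x| ig.
    rewrite -(RintegralZl `|f x| measurableT ig) -(itg_EFin h).
    apply: ge0_le_integral.
    + exact: measurableT.
    + by move=> y _; rewrite lee_fin.
    + exact: (measurable_fun_pair2 _ mFa).
    + by apply/measurable_EFinP; exact: itg_meas h.
    + move=> y _; rewrite lee_fin /F /= !normrM -mulrA; apply: ler_wpM2l => //.
      by apply: ler_wpM2r => //; exact: cas_bound.
have [_ _ E] := fubini_itg mF lt.
have -> : \int[mu]_x (Har f x * g x) = \int[mu]_y (Kc * \int[mu]_x F (x, y)).
  apply: eq_Rintegral => y _; rewrite /Har -mulrA; congr (_ * _).
  by rewrite -(RintegralZr (g y) measurableT (itg_cas y hf)).
have -> : \int[mu]_x (f x * Har g x) = \int[mu]_x (Kc * \int[mu]_y F (x, y)).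
  apply: eq_Rintegral => x _; rewrite /Har mulrCA; congr (_ * _).
  rewrite -(RintegralZl (f x) measurableT (itg_cas x hg)).
  by apply: eq_Rintegral => y _; rewrite /F /= dotpC; ring.
have mF' : measurable_fun setT (fun z : T2 * T2 => F (z.2, z.1)).
  exact: (measurableT_comp mF (@measurable_swap _ _ T2 T2)).
have ltK : (\int[mu]_x \int[mu]_y `|Kc * F (x, y)|%:E < +oo)%E.
  apply: le_lt_trans lt; apply: ge0_le_integral.
  - exact: measurableT.
  - by move=> x _; apply: integral_ge0 => y _; rewrite lee_fin.
  - apply: (@tonelli_meas _ (fun z => `|Kc * F z|%:E)); last by move=> z; rewrite lee_fin.
    by apply/measurable_EFinP; apply: measurableT_comp => //; exact: measurable_funM.
  - apply: (@tonelli_meas _ (fun z => `|F z|%:E)); last by move=> z; rewrite lee_fin.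
    by apply/measurable_EFinP; exact: measurableT_comp.
  - move=> x _; apply: ge0_le_integral.
    + exact: measurableT.
    + by move=> y _; rewrite lee_fin.
    + apply/measurable_EFinP; apply: measurableT_comp; first exact: (@normr_measurable R setT).
      by apply: measurable_funM; [exact: measurable_cst|exact: (measurable_fun_pair2 _ mF)].
    + by apply/measurable_EFinP; apply: measurableT_comp => //; exact: (measurable_fun_pair2 _ mF).
    + move=> y _; rewrite lee_fin normrM (gtr0_norm (@Kc_gt0 R)) ler_piMl//; exact: Kc_le1.
have mKF : measurable_fun setT (fun z => Kc * F z) by exact: measurable_funM.
have [_ aeK EK] := fubini_itg mKF ltK.
have [_ _ EK'] := fubini_itg mF lt.
have iy (y : T2) : itg (fun x => F (x, y)).
  have := itgZ (g y) (itg_cas y hf); congr itg; apply/funext => x; rewrite /F/=; ring.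
have ix (x : T2) : itg (fun y => F (x, y)).
  have := itgZ (f x) (itg_cas x hg); congr itg; apply/funext => y; rewrite /F/= dotpC; ring.
under eq_Rintegral => y _ do rewrite -(RintegralZl Kc measurableT (iy y)).
under [RHS]eq_Rintegral => x _ do rewrite -(RintegralZl Kc measurableT (ix x)).
exact/esym.
Qed.

(** An Abel-regularised Parseval identity. Symmetry, used twice, moves both transforms onto [cas]
    times the Abel factor, whose transform is the Poisson kernel. *)
Lemma Har_form d f g : 0 < d -> itg f -> itg g ->
  \int[mu]_x (Har f x * (Har g x * e2 d x)) =
  \int[mu]_x (f x * (Kc ^+ 2 * \int[mu]_y (g y * pois2 d (sub2 x y)))).
Proof.
move=> d0 hf hg; have he := itg_e2 d0.
have iG : itg (fun x => Har g x * e2 d x).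
  have := itg_bounded he (measurable_Har (itg_meas hg)) (fun x => Har_bound x hg).
  by congr itg; apply/funext => x; rewrite mulrC.
rewrite (Har_sym hf iG); apply: eq_Rintegral => x _; congr (_ * _).
rewrite /Har -/(Har g) expr2 -mulrA; congr (_ * _).
have ie : itg (fun z => e2 d z * cas (dotp x z)).
  by apply: (itg_bounded he (measurable_cas_dotp x) (C := 2)) => z; exact: cas_bound.
transitivity (\int[mu]_z (Har g z * (e2 d z * cas (dotp x z)))).
  by apply: eq_Rintegral => z _; rewrite mulrA [dotp z x]dotpC.
rewrite (Har_sym hg ie).
have igp : itg (fun y => g y * pois2 d (sub2 x y)).
  have E y : pois2 d (sub2 x y) = \int[mu]_z (e2 d z * cas (dotp x z) * cas (dotp z y)).
    rewrite -e2_cas2//; apply: eq_Rintegral => z _; rewrite [dotp y z]dotpC; ring.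
  have E' y : pois2 d (sub2 x y) = Kc^-1 * Har (fun z => e2 d z * cas (dotp x z)) y.
    by rewrite E /Har mulrA mulVf ?mul1r// gt_eqF// Kc_gt0.
  have := itg_bounded hg (measurable_Har (itg_meas ie)) (fun y => Har_bound y ie).
  move=> /(itgZ Kc^-1); congr itg; apply/funext => y; rewrite E'; ring.
rewrite -(RintegralZl Kc measurableT igp); apply: eq_Rintegral => y _.
rewrite mulrCA; congr (_ * _); rewrite /Har; congr (_ * _).
rewrite -e2_cas2//; apply: eq_Rintegral => z _; rewrite [dotp y z]dotpC; ring.
Qed.

Lemma cvg_e2 (x : T2) : e2 (n.+1%:R^-1) x @[n --> \oo] --> (1 : R).
Proof.
have h (t : R) : pe (n.+1%:R^-1) t @[n --> \oo] --> (1 : R).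
  have h : - (n.+1%:R^-1 * `|t|) @[n --> \oo] --> - (0 * `|t|).
    by apply: cvgN; apply: cvgM; [exact: cvg_harmonic|exact: cvg_cst].
  rewrite mul0r oppr0 in h.
  have : expR (- (n.+1%:R^-1 * `|t|)) @[n --> \oo] --> expR (0 : R).
    by apply: continuous_cvg; [exact: continuous_expR|exact: h].
  by rewrite expR0.
have : pe (n.+1%:R^-1) x.1 * pe (n.+1%:R^-1) x.2 @[n --> \oo] --> (1 * 1 : R).
  by apply: cvgM; [exact: h|exact: h].
by rewrite mulr1.
Qed.

Lemma measurable_e2 d : measurable_fun setT (@e2 R d).
Proof.
apply: measurable_funM; [exact: (measurableT_comp (measurable_pe d) (@measurable_fst2 R))|
  exact: (measurableT_comp (measurable_pe d) (@measurable_snd2 R))].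
Qed.

(** In the regularised identity the Poisson convolution, multiplied by [Kc ^+ 2], is a contraction
    of L^2, the kernel having mass at most [(2 pi)^2]. Fatou then removes the regularisation. *)
Lemma Har_bessel f : itg f -> sqint f -> sqint (Har f) /\ n2 (Har f) <= n2 f.
Proof.
move=> hf sf; have mH := measurable_Har (itg_meas hf).
apply: sqint_bound => //; first exact: n2_ge0.
have form (d : R) : 0 < d -> (\int[mu]_x (Har f x ^+ 2 * e2 d x)%:E <= (n2 f ^+ 2)%:E)%E.
  move=> d0; have he := itg_e2 d0.
  have i2 : itg (fun x => Har f x ^+ 2 * e2 d x).
    have h x : `|Har f x ^+ 2| <= (2 * n1 f) ^+ 2.
      by rewrite normrX lerXn2r ?nnegrE ?Har_bound// mulr_ge0 ?n1_ge0.
    have := itg_bounded he (measurable_funX 2 mH) h.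
    by congr itg; apply/funext => x; rewrite mulrC.
  rewrite (itg_EFin i2) lee_fin.
  have -> : \int[mu]_x (Har f x ^+ 2 * e2 d x) = \int[mu]_x (Har f x * (Har f x * e2 d x)).
    by apply: eq_Rintegral => x _; ring.
  rewrite (Har_form d0 hf hf).
  have [ip bp] := itg_pois2 d0.
  have kb := kbound_youngC ip (fun x => pois2_ge0 x d0) (sqint_abs sf) (fun x => normr_ge0 _).
  have mp : measurable_fun setT (fun z : T2 * T2 => f z.2 * pois2 d (sub2 z.1 z.2)).
    by apply: measurable_funM; [exact: measurable_comp_snd sf.1|exact: measurable_comp_sub2 (itg_meas ip)].
  have [|_ sI bI] := kbound_op kb mp.
    by move=> z; rewrite normrM (@ger0_norm _ (pois2 _ _)) ?pois2_ge0.
  have sK := sqintZ (Kc ^+ 2) sI.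
  apply: le_trans (ler_norm _) _; apply: le_trans (n2_cauchy sf sK) _.
  rewrite expr2; apply: ler_wpM2l; first exact: n2_ge0.
  rewrite (n2Z _ sI) ger0_norm ?sqr_ge0//.
  apply: (@le_trans _ _ (Kc ^+ 2 * ((2 * pi) ^+ 2 * n2 f))).
    apply: ler_wpM2l; first exact: sqr_ge0.
    apply: le_trans bI _; rewrite n2_abs; apply: ler_wpM2r => //; exact: n2_ge0.
  rewrite mulrA -exprMn /Kc mulVf ?expr1n ?mul1r// gt_eqF// mulr_gt0// ?pi_gt0//.
apply: (@fatou_real _ (fun n x => Har f x ^+ 2 * e2 (n.+1%:R^-1) x)).
- by move=> n; apply: measurable_funM; [exact: measurable_funX|exact: measurable_e2].
- exact: measurable_funX.
- by move=> n x; rewrite mulr_ge0 ?sqr_ge0 ?e2_ge0.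
- by move=> x; exact: sqr_ge0.
- by apply: aeW => x; rewrite -[X in _ --> X]mulr1; apply: cvgM; [exact: cvg_cst|exact: cvg_e2].
- by apply: nearW => n; apply: form; rewrite invr_gt0.
Qed.

Lemma itg_box (a b : T2) : itg (\1_(box a b) : T2 -> R).
Proof.
have m : measurable_fun setT (\1_(box a b) : T2 -> R) by apply: measurable_indic; exact: measurable_box.
pose c (n : R) := 1 + (`|a.1| + `|b.1|) ^+ 2 + (`|a.2| + `|b.2|) ^+ 2.
have s2 := (@sqint_wt R 2 (ltr1n _ 2)).
have i2 : itg (fun x => (c 0) ^+ 2 * (wt (- 2) x ^+ 2)) by apply: itgZ; case: s2.
apply: itg_dom i2 => // x; rewrite -exprMn indicE; case: (boolP (x \in _)); last first.
  by rewrite normr0 sqr_ge0.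
rewrite inE => -[] /=; rewrite !in_itv/= => /andP[h1 h2] /andP[h3 h4].
rewrite normr1 -[leLHS](expr1n _ 2) ler_pXn2r ?nnegrE ?mulr_ge0 ?wt_ge0//.
  apply: (@le_trans _ _ (wt 2 x * wt (- 2) x)); first by rewrite mulrC wtNK.
  apply: ler_wpM2r; first exact: wt_ge0.
  rewrite wt2E /jap /dotp /c -!expr2 -addrA lerD2l.
  have A (u v t : R) : u < t -> t <= v -> t ^+ 2 <= (`|u| + `|v|) ^+ 2.
    move=> ut tv; rewrite -[leLHS]real_normK ?num_real//.
    rewrite ler_pXn2r ?nnegrE ?addr_ge0// ler_norml; apply/andP; split.
      have := ler_norm (- u); rewrite normrN; have := normr_ge0 v; lra.
    have := ler_norm v; have := normr_ge0 u; lra.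
  by apply: lerD; [exact: A h1 h2|exact: A h3 h4].
by rewrite !addr_ge0 ?sqr_ge0.
Qed.

Lemma sqint_box (a b : T2) : sqint (\1_(box a b) : T2 -> R).
Proof.
split; first by apply: measurable_indic; exact: measurable_box.
have := itg_box a b; congr itg; apply/funext => x; rewrite indicE.
by case: (_ \in _); rewrite /= ?expr1n ?expr0n.
Qed.

Lemma ae_off (c : T2) : {ae mu, forall x, x.1 != c.1 /\ x.2 != c.2}.
Proof.
have := ae_preserving (preserving_sub2r c) (@ae_axes R).
by apply: aeS => x /=; rewrite !subr_eq0.
Qed.

(** The regularised identity passes to the limit on both sides by dominated convergence: on the left
    the product of two L^2 functions dominates, on the right the normalised Poisson averages are at
    most 1 and converge off the lines that carry the sides of the box. *)
Lemma Har_box f (a b : T2) : a.1 < b.1 -> a.2 < b.2 -> itg f -> sqint f ->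
  \int[mu]_x (Har f x * Har (\1_(box a b)) x) = \int[mu]_x (f x * \1_(box a b) x).
Proof.
move=> ab1 ab2 hf sf; have ib := itg_box a b; have sb := sqint_box a b.
have [sH _] := Har_bessel hf sf; have [sB _] := Har_bessel ib sb.
have iHB := sqint_mul sH sB.
have d0 n : 0 < n.+1%:R^-1 :> R by rewrite invr_gt0.
have c1 : \int[mu]_x (Har f x * (Har (\1_(box a b)) x * e2 (n.+1%:R^-1) x)) @[n --> \oo] -->
    \int[mu]_x (Har f x * Har (\1_(box a b)) x).
  apply: (Rint_dct _ _ (itg_abs iHB)) => //.
  - move=> n; apply: measurable_funM; first by case: sH.
    by apply: measurable_funM; [case: sB|exact: measurable_e2].
  - exact: itg_meas.
  - apply: aeW => x; apply: cvgM; first exact: cvg_cst.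
    by rewrite -[X in _ --> X]mulr1; apply: cvgM; [exact: cvg_cst|exact: cvg_e2].
  - move=> n x; rewrite mulrA normrM (ger0_norm (e2_ge0 _ _)) ler_piMr// e2_le1// ltW//.
have c2 : \int[mu]_x (Har f x * (Har (\1_(box a b)) x * e2 (n.+1%:R^-1) x)) @[n --> \oo] -->
    \int[mu]_x (f x * \1_(box a b) x).
  have -> : (fun n : nat => \int[mu]_x (Har f x * (Har (\1_(box a b)) x * e2 (n.+1%:R^-1) x))) =
    (fun n : nat => \int[mu]_x (f x * ((Kc * avg (n.+1%:R^-1) a.1 b.1 x.1) * (Kc * avg (n.+1%:R^-1) a.2 b.2 x.2)))).
    apply/funext => n; rewrite (Har_form (d0 n) hf ib); apply: eq_Rintegral => x _.
    by rewrite (pois2_box x (d0 n) ab1 ab2); congr (_ * _); ring.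
  apply: (Rint_dct _ _ (itg_abs hf)).
  - move=> n; have -> : (fun x : T2 => f x * ((Kc * avg (n.+1%:R^-1) a.1 b.1 x.1) * (Kc * avg (n.+1%:R^-1) a.2 b.2 x.2))) =
      (fun x : T2 => f x * (Kc ^+ 2 * \int[mu]_y (\1_(box a b) y * pois2 (n.+1%:R^-1) (sub2 x y)))).
      by apply/funext => x; rewrite (pois2_box x (d0 n) ab1 ab2); congr (_ * _); ring.
    apply: measurable_funM; first exact: itg_meas.
    apply: measurable_funM; first exact: measurable_cst.
    apply: (@Rintegral_meas_signed _ (fun z : T2 * T2 => \1_(box a b) z.2 * pois2 n.+1%:R^-1 (sub2 z.1 z.2))).
    apply: measurable_funM; first by apply: (@measurable_comp_snd _ (\1_(box a b))); case: sb.
    by apply: measurable_comp_sub2; exact: itg_meas (itg_pois2 (d0 n)).1.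
  - by apply: measurable_funM; [exact: itg_meas|case: sb].
  - apply: aeS2 (ae_off a) (ae_off b) => x [x1 x2] [y1 y2].
    apply: cvgM; first exact: cvg_cst.
    rewrite (_ : \1_(box a b) x = \1_(`]a.1, b.1]%classic : set (measurableTypeR R)) x.1 *
      \1_(`]a.2, b.2]%classic : set (measurableTypeR R)) x.2 :> R); last first.
      by rewrite /box !indicE in_setX -mulnb natrM.
    by apply: cvgM; exact: cvg_avg.
  - move=> n x; rewrite normrM ler_piMr// normrM mulr_ile1 ?avg_bound//.
exact: (cvg_unique _ c1 c2).
Qed.

End Hartley.

(** * The Hartley transform on L^2 *)

Section HartleyL2.
Context {R : realType}.
Notation mu := (@mu2 R).
Notation T2 := (plane R).
Implicit Types (f g h : T2 -> R).

(** The same disks as in [fourier_trunc], so that the two L^2 limits can be compared term by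
    term. *)
Definition disk (n : nat) : set T2 := [set x | enorm x <= n%:R].
Definition trunc (n : nat) f (x : T2) : R := f x * \1_(disk n) x.

Lemma measurable_disk n : measurable (disk n).
Proof.
rewrite -[X in measurable X]setTI.
have -> : disk n = (@enorm R : T2 -> R) @^-1` `]-oo, n%:R]%classic.
  by apply/seteqP; split => x /=; rewrite /disk/= in_itv.
exact: measurable_enorm.
Qed.

Lemma measurable_trunc n f : measurable_fun setT f -> measurable_fun setT (trunc n f).
Proof. by move=> mf; apply: measurable_funM => //; apply: measurable_indic; exact: measurable_disk. Qed.

Lemma trunc_le n f x : `|trunc n f x| <= `|f x|.
Proof. by rewrite normrM ler_piMr// indicE; case: (_ \in _); rewrite /= ?normr1 ?normr0. Qed.

Lemma trunc_sub_le n f x : `|f x - trunc n f x| <= `|f x|.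
Proof. by rewrite /trunc indicE; case: (_ \in _); rewrite /= ?mulr1 ?mulr0 ?subrr ?subr0 ?normr0. Qed.

Lemma sqint_trunc n f : sqint f -> sqint (trunc n f).
Proof.
by move=> sf; have [mf _] := sf; exact: sqint_dom (measurable_trunc n mf) (trunc_le n f) sf.
Qed.

Lemma sqintB f g : sqint f -> sqint g -> sqint (fun x => f x - g x).
Proof.
move=> sf sg; have := sqintD sf (sqintZ (-1) sg); congr sqint.
by apply/funext => x; rewrite mulN1r.
Qed.

Lemma itg_trunc n f : sqint f -> itg (trunc n f).
Proof.
move=> sf; have [mf _] := sf.
have s2 := sqint_mul (sqint_abs sf) (sqintZ (1 + n%:R ^+ 2) (@sqint_wt R 2 (ltr1n _ 2))).
apply: itg_dom s2; first exact: measurable_trunc.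
move=> x; rewrite normrM; apply: ler_wpM2l => //.
rewrite indicE; case: (boolP (x \in _)); last first.
  by rewrite normr0 mulr_ge0 ?wt_ge0 ?addr_ge0 ?sqr_ge0.
rewrite inE /disk/= normr1 => xn.
apply: (@le_trans _ _ (wt 2 x * wt (- 2) x)); first by rewrite mulrC wtNK.
apply: ler_wpM2r; first exact: wt_ge0.
by rewrite wt2E /jap -enorm_sqr lerD2l lerXn2r ?nnegrE ?enorm_ge0.
Qed.

Lemma trunc_near (x : T2) : exists n0, forall n, (n0 <= n)%N -> enorm x <= n%:R.
Proof.
exists (Num.truncn (enorm x)).+1 => n hn; apply: (@le_trans _ _ (Num.truncn (enorm x)).+1%:R).
  by apply: ltW; rewrite truncnS_gt.
by rewrite ler_nat.
Qed.

Lemma n2_cvg0 (u : nat -> T2 -> R) (g : T2 -> R) : (forall n, measurable_fun setT (u n)) -> sqint g ->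
  (forall n x, `|u n x| <= `|g x|) -> {ae mu, forall x, u ^~ x @ \oo --> 0} ->
  forall e : R, 0 < e -> exists n0, forall n, (n0 <= n)%N -> n2 (u n) <= e.
Proof.
move=> mu_ sg le cv e e0; have [_ ig] := sg.
have : (\int[mu]_x (u n x ^+ 2)) @[n --> \oo] --> \int[mu]_x (0 : R).
  apply: (Rint_dct (f := fun=> 0) _ _ ig).
  - by move=> n; exact: measurable_funX.
  - exact: measurable_cst.
  - apply: aeS cv => x cx; have : u n x * u n x @[n --> \oo] --> (0 * 0 : R) by apply: cvgM.
    by rewrite mulr0; under eq_fun do rewrite -expr2.
  - move=> n x; rewrite ger0_norm ?sqr_ge0//.
    by rewrite -[leLHS]real_normK ?num_real// -[leRHS]real_normK ?num_real// lerXn2r ?nnegrE.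
rewrite /Rintegral integral0/= => /cvgrPdist_le /(_ (e ^+ 2)) []; first by rewrite exprn_gt0.
move=> n0 _ H; exists n0 => n hn; have := H n hn; rewrite sub0r normrN => h.
rewrite -(@ler_pXn2r _ 2)// ?nnegrE ?n2_ge0 ?(ltW e0)// n2_sqr.
exact: le_trans (ler_norm _) h.
Qed.

Lemma trunc_cvg f : sqint f -> forall e : R, 0 < e -> exists n0, forall n, (n0 <= n)%N ->
  n2 (fun x => f x - trunc n f x) <= e.
Proof.
move=> sf; have [mf _] := sf.
apply: (@n2_cvg0 (fun n x => f x - trunc n f x) f) => //.
- by move=> n; apply: measurable_funB => //; exact: measurable_trunc.
- by move=> n x; exact: trunc_sub_le.
- apply: aeW => x; have [n0 Hn0] := trunc_near x.
  apply: cvg_near_cst; exists n0 => // n hn /=.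
  by rewrite /trunc indicE mem_set ?mulr1 ?subrr//; exact: Hn0.
Qed.

Definition is_hart f h : Prop := sqint h /\ forall e : R, 0 < e -> exists n0, forall n, (n0 <= n)%N ->
  n2 (fun x => h x - Har (trunc n f) x) <= e.

Lemma sqint_Har_trunc n f : sqint f -> sqint (Har (trunc n f)).
Proof. by move=> sf; have [] := Har_bessel (itg_trunc n sf) (sqint_trunc n sf). Qed.

Lemma n2_distC f g : n2 (fun x => f x - g x) = n2 (fun x => g x - f x).
Proof. by rewrite /n2; congr Num.sqrt; apply: eq_Rintegral => x _; rewrite -sqrrN opprB. Qed.

Lemma n2_tri f g h : sqint f -> sqint g -> sqint h ->
  n2 (fun x => f x - h x) <= n2 (fun x => f x - g x) + n2 (fun x => g x - h x).
Proof.
move=> sf sg sh; apply: le_trans (n2D (sqintB sf sg) (sqintB sg sh)).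
rewrite le_eqVlt; apply/orP; left; apply/eqP; congr n2; apply/funext => x; ring.
Qed.

Lemma is_hart_ex f : sqint f -> exists h, is_hart f h.
Proof.
move=> sf; have sH n := sqint_Har_trunc n sf.
have [|h sh Hh] := sqint_complete sH.
  move=> e e0; have e1 : 0 < Num.sqrt e / 2 by rewrite divr_gt0// sqrtr_gt0.
  have [n0 Hn0] := trunc_cvg sf e1; exists n0 => p q hp hq.
  rewrite -n2_sqr -[leRHS](sqr_sqrtr (ltW e0)) lerXn2r ?nnegrE ?n2_ge0 ?sqrtr_ge0//.
  rewrite -HarB; try exact: itg_trunc.
  have ii := itgB (itg_trunc p sf) (itg_trunc q sf).
  have ss := sqintB (sqint_trunc p sf) (sqint_trunc q sf).
  apply: le_trans (Har_bessel ii ss).2 _.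
  apply: le_trans (n2_tri (sqint_trunc p sf) sf (sqint_trunc q sf)) _.
  by rewrite [leRHS]splitr; apply: lerD; [rewrite n2_distC|]; exact: Hn0.
exists h; split; first exact: sh.
move=> e e0; have [n0 Hn0] := Hh (e ^+ 2) (exprn_gt0 2 e0); exists n0 => n hn.
rewrite n2_distC -(@ler_pXn2r _ 2)// ?nnegrE ?n2_ge0 ?(ltW e0)// n2_sqr.
exact: Hn0.
Qed.

Lemma n2_small_ae f g : sqint f -> sqint g -> (forall e : R, 0 < e -> n2 (fun x => f x - g x) <= e) ->
  {ae mu, forall x, f x = g x}.
Proof.
move=> sf sg h.
have n0 : n2 (fun x => f x - g x) = 0.
  apply/eqP; rewrite eq_le n2_ge0 andbT; apply/ler_addgt0Pr => e e0; rewrite add0r; exact: h.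
by apply: aeS (n2_eq0_ae (sqintB sf sg) n0) => x /eqP; rewrite subr_eq0 => /eqP.
Qed.

Lemma is_hart_uniq f h h' : sqint f -> is_hart f h -> is_hart f h' -> {ae mu, forall x, h x = h' x}.
Proof.
move=> sf [sh Hh] [sh' Hh']; apply: n2_small_ae => // e e0.
have e1 : 0 < e / 2 by rewrite divr_gt0.
have [n1 H1] := Hh _ e1; have [n2_ H2] := Hh' _ e1.
pose n := maxn n1 n2_; have sn := sqint_Har_trunc n sf.
apply: le_trans (n2_tri sh sn sh') _; rewrite [leRHS]splitr; apply: lerD.
  by apply: H1; exact: leq_maxl.
by rewrite n2_distC; apply: H2; exact: leq_maxr.
Qed.

(** One representative of the L^2 limit, determined up to a null set; identities about it hold
    almost everywhere. *)
Definition U f : T2 -> R := xget (fun=> 0) [set h | is_hart f h].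

Lemma U_hart f : sqint f -> is_hart f (U f).
Proof. by move=> /is_hart_ex[h hh]; exact: (xgetPex _ (ex_intro _ h hh)). Qed.

Lemma sqint_U f : sqint f -> sqint (U f). Proof. by move=> /U_hart[]. Qed.

Lemma U_ae f h : sqint f -> is_hart f h -> {ae mu, forall x, U f x = h x}.
Proof. by move=> sf; apply: is_hart_uniq => //; exact: U_hart. Qed.

Lemma U_Har f : itg f -> sqint f -> {ae mu, forall x, U f x = Har f x}.
Proof.
move=> hf sf; apply: (U_ae sf); have [sH _] := Har_bessel hf sf; split; first exact: sH.
move=> e e0; have [n0 Hn0] := trunc_cvg sf e0; exists n0 => n hn.
rewrite -HarB//; last exact: itg_trunc.
apply: le_trans (Har_bessel (itgB hf (itg_trunc n sf)) (sqintB sf (sqint_trunc n sf))).2 _.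
exact: Hn0.
Qed.

Lemma U_lin (a b : R) f g : sqint f -> sqint g ->
  {ae mu, forall x, U (fun x => a * f x + b * g x) x = a * U f x + b * U g x}.
Proof.
move=> sf sg; have sfg := sqintD (sqintZ a sf) (sqintZ b sg).
have [sUf Hf] := U_hart sf; have [sUg Hg] := U_hart sg.
apply: (U_ae sfg); split; first exact: sqintD (sqintZ a sUf) (sqintZ b sUg).
move=> e e0; pose c := `|a| + `|b| + 1.
have c0 : 0 < c by rewrite ltr_pwDr// addr_ge0.
have e1 : 0 < e / c by rewrite divr_gt0.
have [n1 H1] := Hf _ e1; have [n2_ H2] := Hg _ e1.
exists (maxn n1 n2_) => n hn.
have {}H1 := H1 n (leq_trans (leq_maxl _ _) hn); have {}H2 := H2 n (leq_trans (leq_maxr _ _) hn).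
have E : (fun x => a * U f x + b * U g x - Har (trunc n (fun x => a * f x + b * g x)) x) =
    (fun x => a * (U f x - Har (trunc n f) x) + b * (U g x - Har (trunc n g) x)).
  have -> : trunc n (fun x => a * f x + b * g x) = (fun x => a * trunc n f x - (- b) * trunc n g x).
    by apply/funext => x; rewrite /trunc; ring.
  rewrite HarB; [|exact: itgZ (itg_trunc n sf)|exact: itgZ (itg_trunc n sg)].
  rewrite !HarZ; [|exact: itg_trunc|exact: itg_trunc].
  by apply/funext => x; move: (U f x) (U g x) (Har _ x) (Har _ x) => u1 u2 u3 u4; ring.
rewrite E.
have s1 := sqintB sUf (sqint_Har_trunc n sf); have s2 := sqintB sUg (sqint_Har_trunc n sg).
apply: le_trans (n2D (sqintZ a s1) (sqintZ b s2)) _; rewrite !n2Z//.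
apply: (@le_trans _ _ (`|a| * (e / c) + `|b| * (e / c))).
  exact: lerD (ler_wpM2l (normr_ge0 a) H1) (ler_wpM2l (normr_ge0 b) H2).
rewrite -mulrDl mulrCA ler_piMr ?(ltW e0)// ler_pdivrMr// mul1r /c lerDl//.
Qed.

Lemma n2_le_lim f g (c : R) : sqint f -> sqint g ->
  (forall e : R, 0 < e -> exists2 k, sqint k & n2 (fun x => f x - k x) <= e /\ n2 k <= c + e) -> n2 f <= c.
Proof.
move=> sf sg h; apply/ler_addgt0Pr => e e0; have e1 : 0 < e / 2 by rewrite divr_gt0.
have [k sk [k1 k2]] := h _ e1.
have -> : f = (fun x => (f x - k x) + k x) by apply/funext => x; rewrite subrK.
apply: le_trans (n2D (sqintB sf sk) sk) _; rewrite [X in c + X]splitr; lra.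
Qed.

Lemma U_bessel f : sqint f -> n2 (U f) <= n2 f.
Proof.
move=> sf; have [sU HU] := U_hart sf.
apply: (n2_le_lim sU sf) => e e0; have [n0 Hn0] := HU _ e0.
exists (Har (trunc n0 f)); first exact: sqint_Har_trunc.
split; first exact: Hn0.
apply: le_trans (Har_bessel (itg_trunc n0 sf) (sqint_trunc n0 sf)).2 _.
apply: (@le_trans _ _ (n2 f)); last by rewrite lerDl ltW.
by apply: n2_le => //; [exact: sqint_trunc|exact: trunc_le].
Qed.

Lemma ip_small f k g (e : R) : sqint f -> sqint k -> sqint g -> n2 (fun x => f x - k x) <= e ->
  `|\int[mu]_x (f x * g x) - \int[mu]_x (k x * g x)| <= e * n2 g.
Proof.
move=> sf sk sg h.
rewrite -(RintegralB measurableT (sqint_mul sf sg) (sqint_mul sk sg)).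
have -> : \int[mu]_x (f x * g x - k x * g x) = \int[mu]_x ((f x - k x) * g x).
  by apply: eq_Rintegral => x _; ring.
apply: le_trans (n2_cauchy (sqintB sf sk) sg) _; apply: ler_wpM2r => //; exact: n2_ge0.
Qed.

(* both sides are continuous in [f] for the L^2 norm *)
Lemma ip_transfer f g k : sqint f -> sqint g -> sqint k ->
  (forall n, \int[mu]_x (Har (trunc n f) x * g x) = \int[mu]_x (trunc n f x * k x)) ->
  \int[mu]_x (U f x * g x) = \int[mu]_x (f x * k x).
Proof.
move=> sf sg sk h; have [sU HU] := U_hart sf.
apply/eqP; rewrite -subr_eq0 -normr_eq0 eq_le normr_ge0 andbT.
pose c := n2 g + n2 k + 1.
have c0 : 0 < c by rewrite ltr_pwDr// addr_ge0 ?n2_ge0.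
apply/ler_addgt0Pr => e e0; rewrite add0r; have e1 : 0 < e / c by rewrite divr_gt0.
have [n1 H1] := HU _ e1; have [n2_ H2] := trunc_cvg sf e1.
pose n := maxn n1 n2_.
have {}H1 := ip_small sU (sqint_Har_trunc n sf) sg (H1 n (leq_maxl _ _)).
have {}H2 := ip_small sf (sqint_trunc n sf) sk (H2 n (leq_maxr _ _)).
rewrite h in H1.
have -> : \int[mu]_x (U f x * g x) - \int[mu]_x (f x * k x) =
  (\int[mu]_x (U f x * g x) - \int[mu]_x (trunc n f x * k x)) -
  (\int[mu]_x (f x * k x) - \int[mu]_x (trunc n f x * k x)) by ring.
apply: le_trans (ler_normB _ _) _; apply: le_trans (lerD H1 H2) _.
rewrite -mulrDr mulrAC ler_pdivrMr// ler_wpM2l ?(ltW e0)// /c lerDl//.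
Qed.

Lemma U_box f (a b : T2) : a.1 < b.1 -> a.2 < b.2 -> sqint f ->
  \int[mu]_x (U f x * Har (\1_(box a b)) x) = \int[mu]_x (f x * \1_(box a b) x).
Proof.
move=> h1 h2 sf; have [sB _] := Har_bessel (itg_box a b) (sqint_box a b).
apply: ip_transfer => //; first exact: sqint_box.
by move=> n; apply: Har_box => //; [exact: itg_trunc|exact: sqint_trunc].
Qed.

Lemma U_sym f g : sqint f -> sqint g -> \int[mu]_x (U f x * g x) = \int[mu]_x (f x * U g x).
Proof.
move=> sf sg; apply: ip_transfer => //; first exact: sqint_U.
move=> n; have sHn := sqint_Har_trunc n sf; have stn := sqint_trunc n sf.
have -> : \int[mu]_x (Har (trunc n f) x * g x) = \int[mu]_x (g x * Har (trunc n f) x).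
  by apply: eq_Rintegral => x _; rewrite mulrC.
have -> : \int[mu]_x (trunc n f x * U g x) = \int[mu]_x (U g x * trunc n f x).
  by apply: eq_Rintegral => x _; rewrite mulrC.
symmetry; apply: ip_transfer => //.
move=> m; rewrite Har_sym//; exact: itg_trunc.
Qed.

(** By symmetry, [U (U f)] tested on a box is [U f] tested on the transform of the box, which is [f]
    tested on the box. The difference with [f] is cut to a large box to become integrable, and
    vanishes there. *)
Lemma UU f : sqint f -> {ae mu, forall x, U (U f) x = f x}.
Proof.
move=> sf; have sU := sqint_U sf; have sUU := sqint_U sU.
have sd := sqintB sUU sf; pose d x := U (U f) x - f x.
have dB (a b : T2) : \int[mu]_x (d x * \1_(box a b) x) = 0.
  have iB := sqint_box a b.
  have [h1|h1] := ltP a.1 b.1; last first.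
    have -> : (fun x => d x * \1_(box a b) x) = (fun=> 0).
      apply/funext => x; rewrite indicE memNset ?mulr0// /box/= !in_itv/=; case=> /andP[u v] _.
      by have := lt_le_trans u (le_trans v h1); rewrite ltxx.
    by rewrite /Rintegral integral0.
  have [h2|h2] := ltP a.2 b.2; last first.
    have -> : (fun x => d x * \1_(box a b) x) = (fun=> 0).
      apply/funext => x; rewrite indicE memNset ?mulr0// /box/= !in_itv/=; case=> _ /andP[u v].
      by have := lt_le_trans u (le_trans v h2); rewrite ltxx.
    by rewrite /Rintegral integral0.
  have -> : (fun x => d x * \1_(box a b) x) =
      (fun x => U (U f) x * \1_(box a b) x - f x * \1_(box a b) x).
    by apply/funext => x; rewrite /d mulrBl.
  rewrite (RintegralB measurableT (sqint_mul sUU iB) (sqint_mul sf iB)).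
  rewrite U_sym// -(U_box h1 h2 sf).
  apply/eqP; rewrite subr_eq0; apply/eqP; apply: ae_Rintegral.
  - by apply: measurable_funM; [case: sU|case: (sqint_U iB)].
  - by apply: measurable_funM; [case: sU|apply: measurable_Har; case: iB].
  - by apply: aeS (U_Har (itg_box a b) iB) => x ->.
have loc (n : nat) : {ae mu, forall x, d x * \1_(box (- n%:R, - n%:R) (n%:R, n%:R)) x = 0}.
  apply: box_eq0; first exact: sqint_mul sd (sqint_box _ _).
  move=> a b; pose p : T2 := (Num.max (- n%:R) a.1, Num.max (- n%:R) a.2).
  pose q : T2 := (Num.min n%:R b.1, Num.min n%:R b.2).
  rewrite -(dB p q); apply: eq_Rintegral => x _; rewrite -mulrA; congr (_ * _).
  rewrite -[RHS]/(\1_(box p q) x); rewrite !indicE -natrM mulnb; congr (nat_of_bool _)%:R.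
  apply/andP/idP; rewrite !inE /box/= !in_itv/= !gt_max !le_min.
    by move=> [[/andP[-> ->] /andP[-> ->]] [/andP[-> ->] /andP[-> ->]]].
  by move=> [/andP[/andP[-> ->] /andP[-> ->]] /andP[/andP[-> ->] /andP[-> ->]]].
have := ae_foralln loc; apply: aeS => x hx.
have [n0 Hn0] := trunc_near x.
have e1 := Hn0 n0 (leqnn _).
have cx (t : R) : `|t| <= enorm x -> - n0.+1%:R < t <= n0.+1%:R.
  move=> h; have : `|t| < n0.+1%:R by apply: le_lt_trans (le_trans h e1) _; rewrite ltr_nat.
  by rewrite ltr_norml => /andP[-> /ltW ->].
have ex : `|x.1| <= enorm x.
  rewrite -(@ler_pXn2r _ 2)// ?nnegrE ?enorm_ge0// enorm_sqr real_normK ?num_real//.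
  by rewrite /dotp -!expr2 lerDl sqr_ge0.
have ey : `|x.2| <= enorm x.
  rewrite -(@ler_pXn2r _ 2)// ?nnegrE ?enorm_ge0// enorm_sqr real_normK ?num_real//.
  by rewrite /dotp -!expr2 lerDr sqr_ge0.
have := hx n0.+1; rewrite indicE mem_set ?mulr1; last first.
  by rewrite /box/= !in_itv/= !cx.
by rewrite /d => /eqP; rewrite subr_eq0 => /eqP.
Qed.

(** A contraction that is its own inverse is an isometry. *)
Lemma n2_U f : sqint f -> n2 (U f) = n2 f.
Proof.
move=> sf; have sU := sqint_U sf; apply/eqP; rewrite eq_le U_bessel//=.
rewrite -(n2_ae (sqint_U sU).1 sf.1 (UU sf)); exact: U_bessel.
Qed.

End HartleyL2.

(** * Sobolev norms, velocity and transport in Hartley variables *)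

Section Dictionary.
Context {R : realType}.
Notation mu := (@mu2 R).
Notation T2 := (plane R).
Implicit Types (f g h : T2 -> R).

Lemma L2n f : sqint f -> L2norm f = (n2 f)%:E. Proof. exact: L2normE. Qed.

(** The even part, and below it minus the odd part: the real and imaginary parts of the Fourier
    transform of a real function with Hartley transform [h]. *)
Definition evp h (x : T2) : R := (h x + h (neg2 x)) / 2.
Definition odp h (x : T2) : R := (h (neg2 x) - h x) / 2.

Lemma sqint_negc h : sqint h -> sqint (fun x => h (neg2 x)).
Proof. by move=> sh; exact: (sqint_preserving (@preserving_neg2 R) sh). Qed.

Lemma sqint_evp h : sqint h -> sqint (evp h).
Proof.
move=> sh; have := sqintZ 2^-1 (sqintD sh (sqint_negc sh)); congr sqint.
by apply/funext => x; rewrite /evp mulrC.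
Qed.

Lemma sqint_odp h : sqint h -> sqint (odp h).
Proof.
move=> sh; have := sqintZ 2^-1 (sqintB (sqint_negc sh) sh); congr sqint.
by apply/funext => x; rewrite /odp mulrC.
Qed.

Lemma n2_evp_odp h : sqint h -> n2 (evp h) <= n2 h /\ n2 (odp h) <= n2 h.
Proof.
move=> sh; have sN := sqint_negc sh.
have e : n2 (fun x => h (neg2 x)) = n2 h by apply: n2_neg; case: sh.
split.
- have -> : evp h = (fun x => 2^-1 * (h x + h (neg2 x))) by apply/funext => x; rewrite /evp mulrC.
  rewrite (n2Z _ (sqintD sh sN)) ger0_norm//.
  by have := n2D sh sN; rewrite e; lra.
- have -> : odp h = (fun x => 2^-1 * (h (neg2 x) - h x)) by apply/funext => x; rewrite /odp mulrC.
  rewrite (n2Z _ (sqintB sN sh)) ger0_norm//.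
  have := n2D sN (sqintZ (-1) sh); rewrite (n2Z _ sh) normrN normr1 mul1r e.
  have -> : (fun x => h (neg2 x) + -1 * h x) = (fun x => h (neg2 x) - h x).
    by apply/funext => x; rewrite mulN1r.
  lra.
Qed.

Lemma Rint_restrict (A : set T2) f : measurable A ->
  \int[leb2]_(x in A) f x = \int[mu]_x (f x * \1_A x).
Proof.
move=> mA; rewrite /Rintegral; congr fine.
rewrite [LHS]integral_mkcond; apply: eq_integral => x _.
by rewrite /patch indicE; case: ifP => _; rewrite ?mulr1 ?mulr0.
Qed.

Lemma trunc_re_im n f (xi : T2) : sqint f ->
  complex.Re (fourier_trunc n f xi) = evp (Har (trunc n f)) xi /\
  complex.Im (fourier_trunc n f xi) = odp (Har (trunc n f)) xi.
Proof.
move=> sf; have it := itg_trunc n sf; have mD := measurable_disk (R := R) n.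
have i1 := itg_cas xi it; have i2 := itg_cas (neg2 xi) it.
have dN (x : T2) : dotp x (neg2 xi) = - dotp x xi by rewrite /dotp /neg2/=; ring.
have eC : \int[mu]_x (trunc n f x * cas (dotp x xi)) + \int[mu]_x (trunc n f x * cas (dotp x (neg2 xi))) =
    2 * \int[mu]_x (f x * cos (dotp x xi) * \1_(disk n) x).
  rewrite -(RintegralD measurableT i1 i2).
  have e : (fun x => trunc n f x * cas (dotp x xi) + trunc n f x * cas (dotp x (neg2 xi))) =
     (fun x => 2 * (f x * cos (dotp x xi) * \1_(disk n) x)).
    by apply/funext => x; rewrite dN /cas cosN sinN /trunc; ring.
  have i3 : itg (fun x => f x * cos (dotp x xi) * \1_(disk n) x).
    have := itgZ 2^-1 (itgD i1 i2); congr itg; apply/funext => x.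
    by have /= -> := congr1 (fun F => F x) e; rewrite mulKf.
  by rewrite e (RintegralZl 2 measurableT i3).
have eS : \int[mu]_x (trunc n f x * cas (dotp x (neg2 xi))) - \int[mu]_x (trunc n f x * cas (dotp x xi)) =
    2 * \int[mu]_x (f x * sin (- dotp x xi) * \1_(disk n) x).
  rewrite -(RintegralB measurableT i2 i1).
  have e : (fun x => trunc n f x * cas (dotp x (neg2 xi)) - trunc n f x * cas (dotp x xi)) =
     (fun x => 2 * (f x * sin (- dotp x xi) * \1_(disk n) x)).
    by apply/funext => x; rewrite dN /cas cosN sinN /trunc; ring.
  have i3 : itg (fun x => f x * sin (- dotp x xi) * \1_(disk n) x).
    have := itgZ 2^-1 (itgB i2 i1); congr itg; apply/funext => x.
    by have /= -> := congr1 (fun F => F x) e; rewrite mulKf.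
  by rewrite e (RintegralZl 2 measurableT i3).
rewrite /evp /odp /Har -mulrDr -mulrBr eC eS /fourier_trunc /Cintegral; split.
- rewrite /= mul0r subr0 -/(@Kc R) -[RHS]mulrA; congr (_ * _).
  rewrite -/(disk n) Rint_restrict// mulrC mulKf//.
  by apply: eq_Rintegral => x _; rewrite /expi /= mul0r subr0 cosN.
- rewrite /= mul0r addr0 -/(@Kc R) -[RHS]mulrA; congr (_ * _).
  rewrite -/(disk n) Rint_restrict// mulrC mulKf//.
  by apply: eq_Rintegral => x _; rewrite /expi /= mul0r addr0.
Qed.

Lemma normc_le (a b : R) : `|a| <= Num.sqrt (a ^+ 2 + b ^+ 2) <= `|a| + `|b|.
Proof.
apply/andP; split.
  by rewrite -[leLHS]sqrtr_sqr ler_sqrt ?addr_ge0 ?sqr_ge0// lerDl sqr_ge0.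
rewrite -(@ler_pXn2r _ 2)// ?nnegrE ?sqrtr_ge0 ?addr_ge0// sqr_sqrtr ?addr_ge0 ?sqr_ge0//.
rewrite sqrrD !real_normK ?num_real// -addrA lerD2l lerDr.
by rewrite mulrn_wge0// mulr_ge0.
Qed.

Definition cdiff n f (F : T2 -> R[i]) (xi : T2) : R :=
  ComplexField.Normc.normc (F xi - fourier_trunc n f xi).

Lemma cdiffE n f F xi : sqint f -> cdiff n f F xi =
  Num.sqrt ((complex.Re (F xi) - evp (Har (trunc n f)) xi) ^+ 2 +
            (complex.Im (F xi) - odp (Har (trunc n f)) xi) ^+ 2).
Proof.
move=> sf; have [e1 e2] := trunc_re_im n xi sf; rewrite /cdiff -e1 -e2.
by case: (F xi) (fourier_trunc n f xi) => a b [c d].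
Qed.

Lemma cdiff_bounds n f F : sqint f -> L2C F ->
  let re xi := complex.Re (F xi) - evp (Har (trunc n f)) xi in
  let im xi := complex.Im (F xi) - odp (Har (trunc n f)) xi in
  [/\ sqint (cdiff n f F), n2 re <= n2 (cdiff n f F), n2 im <= n2 (cdiff n f F) &
      n2 (cdiff n f F) <= n2 re + n2 im].
Proof.
move=> sf [/L2_sqint sr /L2_sqint si] re im.
have sH := sqint_Har_trunc n sf.
have sre : sqint re by exact: sqintB sr (sqint_evp sH).
have sim : sqint im by exact: sqintB si (sqint_odp sH).
have cE : cdiff n f F = (fun xi => (re xi ^+ 2 + im xi ^+ 2) `^ 2^-1).
  by apply/funext => xi; rewrite cdiffE// powR12_sqrt// addr_ge0 ?sqr_ge0.
have cE' : cdiff n f F = (fun xi => Num.sqrt (re xi ^+ 2 + im xi ^+ 2)).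
  by apply/funext => xi; rewrite cdiffE.
have mc : measurable_fun setT (cdiff n f F).
  rewrite cE; apply: (measurableT_comp (measurable_powR _)).
  by apply: measurable_funD; apply: measurable_funX; [case: sre|case: sim].
have sA := sqintD (sqint_abs sre) (sqint_abs sim).
have le xi : `|cdiff n f F xi| <= `| `|re xi| + `|im xi| |.
  rewrite cE' (@ger0_norm _ (Num.sqrt _)) ?sqrtr_ge0// (@ger0_norm _ (_ + _)) ?addr_ge0//.
  by have /andP[] := normc_le (re xi) (im xi).
have sc : sqint (cdiff n f F) := sqint_dom mc le sA.
split; first exact: sc.
- apply: n2_le => // xi; rewrite cE' (@ger0_norm _ (Num.sqrt _)) ?sqrtr_ge0//.
  by have /andP[] := normc_le (re xi) (im xi).
- apply: n2_le => // xi; rewrite cE' (@ger0_norm _ (Num.sqrt _)) ?sqrtr_ge0// addrC.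
  by have /andP[] := normc_le (im xi) (re xi).
- apply: le_trans (n2_le sc sA le) _; apply: le_trans (n2D (sqint_abs sre) (sqint_abs sim)) _.
  by rewrite !n2_abs.
Qed.

Lemma evpB g h x : evp (fun y => g y - h y) x = evp g x - evp h x.
Proof. by rewrite /evp; ring. Qed.

Lemma odpB g h x : odp (fun y => g y - h y) x = odp g x - odp h x.
Proof. by rewrite /odp; ring. Qed.

Lemma is_fourier_U f : sqint f -> is_fourier f (fun xi => evp (U f) xi +i* odp (U f) xi)%C.
Proof.
move=> sf; have sU := sqint_U sf; have [_ HU] := U_hart sf.
set F := (fun xi => _); have lF : L2C F.
  by split; apply/L2_sqint; [exact: sqint_evp|exact: sqint_odp].
split; first exact: lF.
have h (e : R) : 0 < e -> exists n0, forall n, (n0 <= n)%N -> n2 (cdiff n f F) <= e.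
  move=> e0; have e1 : 0 < e / 2 by rewrite divr_gt0.
  have [n0 Hn0] := HU _ e1; exists n0 => n hn.
  have [_ _ _ b] := cdiff_bounds n sf lF; apply: le_trans b _.
  have sd := sqintB sU (sqint_Har_trunc n sf).
  have [b1 b2] := n2_evp_odp sd; have b3 := Hn0 n hn.
  have e1' : (fun xi => complex.Re (F xi) - evp (Har (trunc n f)) xi) = evp (fun x => U f x - Har (trunc n f) x).
    by apply/funext => xi; rewrite evpB.
  have e2' : (fun xi => complex.Im (F xi) - odp (Har (trunc n f)) xi) = odp (fun x => U f x - Har (trunc n f) x).
    by apply/funext => xi; rewrite odpB.
  rewrite e1' e2' [leRHS]splitr; apply: lerD; [exact: le_trans b1 b3|exact: le_trans b2 b3].
have -> : (fun n : nat => L2norm (fun xi => ComplexField.Normc.normc (F xi - fourier_trunc n f xi))) =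
    (fun n : nat => (n2 (cdiff n f F))%:E).
  by apply/funext => n; apply: L2n; have [] := cdiff_bounds n sf lF.
apply: cvg_EFin; first exact: nearW.
apply/cvgrPdist_le => e e0; have [n0 Hn0] := h e e0; exists n0 => // n hn /=.
by rewrite sub0r normrN ger0_norm ?n2_ge0// Hn0.
Qed.

Lemma is_fourier_ae f F : sqint f -> is_fourier f F ->
  {ae mu, forall xi, complex.Re (F xi) = evp (U f) xi} /\
  {ae mu, forall xi, complex.Im (F xi) = odp (U f) xi}.
Proof.
move=> sf [lF cF]; have [/L2_sqint sr /L2_sqint si] := lF.
have sU := sqint_U sf; have [_ HU] := U_hart sf.
have h (e : R) : 0 < e -> exists n0, forall n, (n0 <= n)%N -> n2 (cdiff n f F) <= e.
  move=> e0; have eF : (fun n : nat => L2norm (fun xi => ComplexField.Normc.normc (F xi - fourier_trunc n f xi))) =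
      (fun n : nat => (n2 (cdiff n f F))%:E).
    by apply/funext => n; apply: L2n; have [] := cdiff_bounds n sf lF.
  rewrite eF in cF.
  have cF' : (fine \o (fun n : nat => (n2 (cdiff n f F))%:E)) @ \oo --> (0 : R) by exact: fine_cvg cF.
  move/cvgrPdist_le : cF' => /(_ e e0) [n0 _ Hn0].
  exists n0 => n hn; have := Hn0 n hn; rewrite /= sub0r normrN.
  by apply: le_trans; exact: ler_norm.
have key e : 0 < e -> exists n, n2 (cdiff n f F) <= e / 2 /\ n2 (fun x => U f x - Har (trunc n f) x) <= e / 2.
  move=> e0; have e1 : 0 < e / 2 by rewrite divr_gt0.
  have [n1 H1] := h _ e1; have [n2_ H2] := HU _ e1; exists (maxn n1 n2_).
  by split; [apply: H1; exact: leq_maxl|apply: H2; exact: leq_maxr].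
split; apply: n2_small_ae => //; try exact: sqint_evp; try exact: sqint_odp; move=> e e0.
- have [n [k1 k2]] := key e e0; have [_ b1 _ _] := cdiff_bounds n sf lF.
  have sH := sqint_Har_trunc n sf.
  apply: le_trans (n2_tri sr (sqint_evp sH) (sqint_evp sU)) _; rewrite [leRHS]splitr; apply: lerD.
    exact: le_trans b1 k1.
  have [b _] := n2_evp_odp (sqintB sU sH); apply: le_trans k2; rewrite n2_distC.
  rewrite (_ : (fun x => _) = evp (fun x => U f x - Har (trunc n f) x)); first exact: b.
  by apply/funext => x; rewrite evpB.
- have [n [k1 k2]] := key e e0; have [_ _ b1 _] := cdiff_bounds n sf lF.
  have sH := sqint_Har_trunc n sf.
  apply: le_trans (n2_tri si (sqint_odp sH) (sqint_odp sU)) _; rewrite [leRHS]splitr; apply: lerD.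
    exact: le_trans b1 k1.
  have [_ b] := n2_evp_odp (sqintB sU sH); apply: le_trans k2; rewrite n2_distC.
  rewrite (_ : (fun x => _) = odp (fun x => U f x - Har (trunc n f) x)); first exact: b.
  by apply/funext => x; rewrite odpB.
Qed.

Lemma fourier_spec f : sqint f -> is_fourier f (fourier f).
Proof. by move=> sf; exact: (xgetPex _ (ex_intro _ _ (is_fourier_U sf))). Qed.

Lemma fourier_ae f : sqint f ->
  {ae mu, forall xi, complex.Re (fourier f xi) = evp (U f) xi} /\
  {ae mu, forall xi, complex.Im (fourier f xi) = odp (U f) xi}.
Proof. by move=> sf; exact: is_fourier_ae (fourier_spec sf). Qed.

(** The Hartley transform is the real part minus the imaginary part of the Fourier transform.
    Conversely both parts at [xi] are read off the Hartley transform at [xi] and [-xi], where the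
    even weight takes the same value. *)
Lemma is_besselE (r : R) f g : is_bessel r f g <->
  [/\ sqint f, sqint g & {ae mu, forall xi, U g xi = wt r xi * U f xi}].
Proof.
have jE (xi : T2) : 1 + enorm xi ^+ 2 = jap xi by rewrite enorm_sqr.
split=> [[/L2_sqint sf /L2_sqint sg h]|[sf sg h]].
  split; [exact: sf|exact: sg|].
  have [f1 f2] := fourier_ae sf; have [g1 g2] := fourier_ae sg.
  have k1 := aeS2 (fun x a b => conj a b) f1 f2; have k2 := aeS2 (fun x a b => conj a b) g1 g2.
  have k3 := aeS2 (fun x a b => conj a b) k1 k2.
  apply: aeS2 k3 h => xi [[a1 a2] [b1 b2]] e.
  have UE (k : T2 -> R) : U k xi = evp (U k) xi - odp (U k) xi by rewrite /evp /odp; field.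
  transitivity (complex.Re (fourier g xi) - complex.Im (fourier g xi)); first by rewrite b1 b2 -UE.
  transitivity (wt r xi * (complex.Re (fourier f xi) - complex.Im (fourier f xi))).
    by rewrite e jE; case: (fourier f xi) => u v /=; rewrite !mul0r subr0 addr0 mulrBr.
  by rewrite a1 a2 -UE.
split; [exact/L2_sqint|exact/L2_sqint|].
have [f1 f2] := fourier_ae sf; have [g1 g2] := fourier_ae sg.
have k1 := aeS2 (fun x a b => conj a b) f1 f2; have k2 := aeS2 (fun x a b => conj a b) g1 g2.
have k3 := aeS2 (fun x a b => conj a b) k1 k2.
have hN := ae_preserving (@preserving_neg2 R) h.
have k4 := aeS2 (fun x a b => conj a b) h hN.
apply: aeS2 k3 k4 => xi [[a1 a2] [b1 b2]] [e1 e2]; rewrite jE -/(wt r xi).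
move: a1 a2 b1 b2; case: (fourier f xi) => u v; case: (fourier g xi) => u' v' /= -> -> -> ->.
rewrite /GRing.mul/= !mul0r subr0 addr0 /evp /odp e1 e2 wt_neg; congr (_ +i* _)%C; ring.
Qed.

Lemma HsE (r : R) f : Hs r f <-> sqint f /\ wdom (wt r) (U f).
Proof.
split=> [[g /is_besselE[sf sg h]]|[sf wf]].
  split; first exact: sf.
  apply: sqint_ae h (sqint_U sg); apply: measurable_funM; first exact: measurable_wt.
  by case: (sqint_U sf).
exists (U (fun x => wt r x * U f x)); apply/is_besselE; split; first exact: sf.
- exact: sqint_U.
- exact: UU.
Qed.

(** All competitors in the infimum have the same transform almost everywhere, hence the same norm:
    the infimum is that of a singleton. *)
Lemma HnormE (r : R) f : Hs r f -> Hnorm r f = (wn (wt r) (U f))%:E.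
Proof.
move=> hf; have [sf wf] := (HsE r f).1 hf.
have eN g : is_bessel r f g -> L2norm g = (wn (wt r) (U f))%:E.
  move=> /is_besselE[_ sg h]; rewrite (L2n sg) -(n2_U sg) /wn; congr EFin.
  by apply: n2_ae h; [case: (sqint_U sg)|case: wf].
have [g hg] := hf; rewrite /Hnorm.
have -> : [set L2norm g0 | g0 in [set g0 | is_bessel r f g0]] = [set (wn (wt r) (U f))%:E].
  apply/seteqP; split => y /=; first by move=> [g0 h0 <-]; exact: eN.
  by move=> ->; exists g => //; exact: eN.
by rewrite ereal_inf1.
Qed.

End Dictionary.

(** * Pointwise evaluation of the inverse transform *)

Section Evaluation.
Context {R : realType}.
Notation mu := (@mu2 R).
Notation T2 := (plane R).
Notation leb := (@lebesgue_measure R).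
Notation T1 := (measurableTypeR R).
Implicit Types (f g h q : T2 -> R) (s : R).

(** Both the reflection [cas (- t)] and the derivative of [cas]. *)
Definition casn (t : R) : R := cos t - sin t.

Lemma casN t : cas (- t) = casn t. Proof. by rewrite /cas /casn cosN sinN. Qed.

Lemma casn_bound t : `|casn t| <= 2. Proof. by rewrite -casN; exact: cas_bound. Qed.

Lemma measurable_casn : measurable_fun setT casn.
Proof.
by apply: measurable_funB; apply: continuous_measurable_fun; [exact: continuous_cos|exact: continuous_sin].
Qed.

Lemma measurable_dotp_r (x : T2) : measurable_fun setT (fun y : T2 => dotp y x).
Proof. exact: (measurable_fun_pair1 x (@measurable_dotp2 R)). Qed.

Lemma wt_itg s h : 1 < s -> wdom (wt s) h ->
  itg h /\ n1 h <= n2 (wt (- s) : T2 -> R) * wn (wt s) h.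
Proof.
move=> s1 hh; have le (x : T2) : (1 : R) <= wt (- s) x * wt s x by rewrite wtNK.
have m1 : measurable_fun setT ((fun=> 1) : T2 -> R) by exact: measurable_cst.
have [i n] := itg_weight m1 (fun=> ler01) (sqint_wt s1) (wt_ge0 _) le hh.
have e : (fun x : T2 => 1 * h x) = h by apply/funext => x; rewrite mul1r.
by rewrite e in i n.
Qed.

Lemma enorm_itg s h : 2 < s -> wdom (wt s) h -> itg (fun y => enorm y * h y).
Proof.
move=> s2 hh.
have sr : sqint (wt (- (s - 1)) : T2 -> R) by apply: sqint_wt; rewrite ltrBrDr.
have le (x : T2) : enorm x <= wt (- (s - 1)) x * wt s x.
  by rewrite -wtD (_ : - (s - 1) + s = 1); [exact: enorm_wt1|ring].
exact: (itg_weight (@measurable_enorm R) (@enorm_ge0 R) sr (wt_ge0 _) le hh).1.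
Qed.

Definition evC s : R := 2 * n2 (wt (- s) : T2 -> R).

Lemma evC_ge0 s : 0 <= evC s. Proof. by rewrite mulr_ge0 ?n2_ge0. Qed.

Lemma Har_ev s h (x : T2) : 1 < s -> wdom (wt s) h -> `|Har h x| <= evC s * wn (wt s) h.
Proof.
move=> s1 hh; have [ih nh] := wt_itg s1 hh.
by apply: le_trans (Har_bound x ih) _; rewrite /evC -mulrA; apply: ler_wpM2l.
Qed.

Lemma HarD f g : itg f -> itg g -> Har (fun x => f x + g x) = (fun x => Har f x + Har g x).
Proof.
move=> hf hg; apply/funext => x; rewrite /Har -mulrDr; congr (_ * _).
rewrite -(RintegralD measurableT (itg_cas x hf) (itg_cas x hg)).
by apply: eq_Rintegral => y _; rewrite mulrDl.
Qed.

(** [Har] is its own inverse up to null sets, so this is evaluation at the point [x] of the function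
    whose transform is [h]. These functionals link equations in Sobolev spaces with pointwise
    ones. *)
Lemma Har_bounded_linear s (x : T2) : 1 < s ->
  bounded_linear (wL2 (@wt_gt0 R s)) (fun h => Har h x) (evC s).
Proof.
move=> s1; split; first exact: evC_ge0.
- move=> f g hf hg; have [i1 _] := wt_itg s1 hf; have [i2 _] := wt_itg s1 hg.
  exact: (congr1 (fun F => F x) (HarD i1 i2)).
- move=> r f hf; have [i1 _] := wt_itg s1 hf.
  exact: (congr1 (fun F => F x) (HarZ r i1)).
- by move=> f hf; rewrite hnorm_wL2; exact: Har_ev.
Qed.

Lemma Har_ae f g (x : T2) : measurable_fun setT f -> measurable_fun setT g ->
  {ae mu, forall y, f y = g y} -> Har f x = Har g x.
Proof.
move=> mf mg e; rewrite /Har; congr (_ * _).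
have mc : measurable_fun setT (fun y : T2 => cas (dotp y x)) by exact: (measurable_fun_pair1 x (@measurable_cas2 R)).
by apply: ae_Rintegral; [exact: measurable_funM|exact: measurable_funM|apply: aeS e => y ->].
Qed.

(* the derivative of [Har h] at [x] in the direction [v] *)
Definition dHar h (v x : T2) : R := Kc * \int[mu]_y (dotp y v * casn (dotp y x) * h y).

Lemma dotp_bound (y v : T2) : `|dotp y v| <= enorm y * enorm v.
Proof.
rewrite -(@ler_pXn2r _ 2)// ?nnegrE ?mulr_ge0 ?enorm_ge0//.
rewrite real_normK ?num_real// exprMn !enorm_sqr /dotp.
by have := sqr_ge0 (y.1 * v.2 - y.2 * v.1); lra.
Qed.

(** Differentiation under the integral sign; [s > 2] makes [|y| h(y)] integrable, which dominates
    the derivatives. *)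
Lemma Har_is_derive s h (v x : R * R) : 2 < s -> wdom (wt s) h ->
  is_derive x v (Har h : R * R -> R) (dHar h v x).
Proof.
move=> s2 hh; have s1 : 1 < s := lt_trans (ltr1n _ 2) s2.
have [ih _] := wt_itg s1 hh; have ie := enorm_itg s2 hh.
pose f (t : R) (y : T2) : R := h y * cas (dotp y (t *: v + x)).
have dE (t : R) (y : T2) : dotp y (t *: v + x) = dotp y x + t * dotp y v.
  by rewrite /dotp /GRing.scale/= /GRing.scale/=; ring.
have df (t : R) (y : T2) : is_derive t (1 : R) (f ^~ y) (h y * (dotp y v * casn (dotp y x + t * dotp y v))).
  have d1 : is_derive t (1 : R) (fun u : R => dotp y x + u * dotp y v) (dotp y v).
    have h1 : is_derive t (1 : R) (fun u : R => u * dotp y v) (dotp y v).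
      have := is_derive_scaleZ (dotp y v) (is_derive_id t (1 : R)); rewrite mulr1.
      by congr is_derive; apply/funext => u; rewrite mulrC.
    by have := is_derive_scaleD (is_derive_cst (dotp y x) t (1 : R)) h1; rewrite add0r.
  have d2 : is_derive (dotp y x + t * dotp y v) (1 : R) cas (casn (dotp y x + t * dotp y v)).
    have d0 := is_derive_scaleD (is_derive_cos (dotp y x + t * dotp y v)) (is_derive_sin (dotp y x + t * dotp y v)).
    by apply: (is_derive_eq d0); rewrite addrC.
  have d3 := is_derive_scaleZ (h y) (@is_derive1_comp _ cas (fun u : R => dotp y x + u * dotp y v) t _ _ d2 d1).
  have -> : f ^~ y = (fun u => h y * (cas \o (fun u : R => dotp y x + u * dotp y v)) u).
    by apply/funext => u; rewrite /f dE.
  by apply: (is_derive_eq d3); rewrite [casn _ * _]mulrC.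
pose G (y : T2) := 2 * enorm v * `|enorm y * h y|.
have iG : itg G by apply: itgZ; exact: itg_abs.
have i0 : `](-1 : R), 1[%classic 0 by rewrite /= in_itv/= ltrN10 ltr01.
have := @cvg_differentiation_under_integral R _ T2 mu f setT measurableT 0 (-1) 1 i0 _ _ G _ iG _.
move=> /(_ _ _ _ _) c.
have cv : (h^-1 *: ((fun t => \int[mu]_y f t y) (h + 0) - (fun t => \int[mu]_y f t y) 0) @[h --> (0 : R)^']
    --> \int[mu]_y partial1of2 f 0 y).
  apply: c.
  - move=> t _; exact: itg_cas.
  - by move=> t y _ _; have [] := df t y.
  - by move=> y; rewrite mulr_ge0// mulr_ge0// enorm_ge0.
  - move=> t y _ _; rewrite partial1of2E (@derive_val _ _ _ _ _ _ _ (df t y)) /G.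
    rewrite !normrM (@ger0_norm _ (enorm y)) ?enorm_ge0//.
    have a1 := dotp_bound y v; have a2 := casn_bound (dotp y x + t * dotp y v).
    have : `|dotp y v| * `|casn (dotp y x + t * dotp y v)| <= enorm y * enorm v * 2.
      by apply: ler_pM.
    move=> /(ler_wpM2l (normr_ge0 (h y))) /le_trans; apply.
    rewrite le_eqVlt; apply/orP; left; apply/eqP; ring.
have E : \int[mu]_y partial1of2 f 0 y = \int[mu]_y (dotp y v * casn (dotp y x) * h y).
  apply: eq_Rintegral => y _; rewrite partial1of2E (@derive_val _ _ _ _ _ _ _ (df 0 y)).
  by rewrite mul0r addr0 mulrC.
have cv' : (fun t : R => t^-1 *: ((Har h \o shift x) (t *: v) - Har h x)) @ 0^' --> dHar h v x.
  rewrite /dHar -E.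
  have -> : (fun t : R => t^-1 *: ((Har h \o shift x) (t *: v) - Har h x)) =
     (fun t : R => Kc * (t^-1 *: ((fun t => \int[mu]_y f t y) (t + 0) - (fun t => \int[mu]_y f t y) 0))).
    apply/funext => t; rewrite /= addr0 /GRing.scale/= /Har -mulrBr mulrCA.
    by rewrite /f scale0r add0r.
  by apply: cvgM; [exact: cvg_cst|exact: cv].
split; first by apply/cvg_ex; exists (dHar h v x).
by rewrite /derive; exact: cvg_lim cv'.
Qed.

(** Partial derivatives give continuity along the two axes only, not joint continuity. *)
Definition sep_cont f : Prop := forall (x : T2) (e : R), 0 < e -> exists2 d : R, 0 < d &
  (forall t : R, `|t| < d -> `|f (t + x.1, x.2) - f x| < e) /\
  (forall t : R, `|t| < d -> `|f (x.1, t + x.2) - f x| < e).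

Lemma derivable_cont (f : R * R -> R) (v x : R * R) : derivable f x v ->
  forall e : R, 0 < e -> exists2 d : R, 0 < d & forall t : R, `|t| < d -> `|f (t *: v + x) - f x| < e.
Proof.
move=> /cvg_ex[l c] e e0.
move/cvgrPdist_lt : c => /(_ 1 ltr01) [] d /= d0 H.
pose m := Num.min d (e / (`|l| + 1)).
have l0 : 0 < `|l| + 1 by rewrite ltr_pwDr.
have m0 : 0 < m by rewrite lt_min d0 divr_gt0.
exists m => // t; rewrite lt_min => /andP[td te].
have [->|t0] := eqVneq t 0; first by rewrite scale0r add0r subrr normr0.
have {}H : `|l - t^-1 *: (f (t *: v + x) - f x)| < 1.
  by apply: (H t) => //=; rewrite sub0r normrN.
have q : `|t^-1 *: (f (t *: v + x) - f x)| < `|l| + 1.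
  rewrite (_ : _ *: _ = l - (l - t^-1 *: (f (t *: v + x) - f x))); last by rewrite opprB addrCA subrr addr0.
  by apply: le_lt_trans (ler_normB _ _) _; rewrite ltrD2l.
have -> : f (t *: v + x) - f x = t * (t^-1 *: (f (t *: v + x) - f x)).
  by rewrite /GRing.scale/= mulrA divff ?mul1r.
rewrite normrM; apply: (@le_lt_trans _ _ (`|t| * (`|l| + 1))).
  by apply: ler_wpM2l => //; exact: ltW.
by rewrite -ltr_pdivlMr.
Qed.

Lemma has_partials_cont (f : R * R -> R) : has_partials f -> sep_cont f.
Proof.
move=> hf x e e0; have [h1 h2] := hf x.
have [d1 d10 H1] := derivable_cont h1 e0; have [d2 d20 H2] := derivable_cont h2 e0.
exists (Num.min d1 d2); first by rewrite lt_min d10.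
split=> t; rewrite lt_min => /andP[t1 t2].
- have := H1 t t1; congr (`|f _ - _| < _).
  by rewrite [LHS]surjective_pairing/=; congr (_, _); rewrite /GRing.scale/= ?mulr1 ?mulr0 ?add0r.
- have := H2 t t2; congr (`|f _ - _| < _).
  by rewrite [LHS]surjective_pairing/=; congr (_, _); rewrite /GRing.scale/= ?mulr1 ?mulr0 ?add0r.
Qed.

Lemma sep_contB f g : sep_cont f -> sep_cont g -> sep_cont (fun x => f x - g x).
Proof.
move=> hf hg x e e0; have e1 : 0 < e / 2 by rewrite divr_gt0.
have [d1 d10 [a1 a2]] := hf x _ e1; have [d2 d20 [b1 b2]] := hg x _ e1.
exists (Num.min d1 d2); first by rewrite lt_min d10.
have key (u v w z : R) : `|u - v| < e / 2 -> `|w - z| < e / 2 -> `|u - w - (v - z)| < e.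
  move=> h1 h2; have -> : u - w - (v - z) = (u - v) - (w - z) by ring.
  by apply: le_lt_trans (ler_normB _ _) _; rewrite [ltRHS]splitr; exact: ltrD.
by split=> t; rewrite lt_min => /andP[t1 t2]; apply: key; [exact: a1|exact: b1|exact: a2|exact: b2].
Qed.

Lemma null_section (A : set T2) : measurable A -> mu A = 0%E ->
  {ae leb, forall x, leb (xsection A x) = 0%E}.
Proof.
move=> mA A0.
have mx : measurable_fun setT (leb \o xsection A) by exact: measurable_fun_xsection.
have h : (\int[leb]_x `|(leb \o xsection A) x| = 0)%E.
  rewrite -A0; apply: eq_integral => x _; rewrite gee0_abs//.
by have /(ae_eq_integral_abs leb measurableT mx) := h; apply: filterS => x /(_ I).
Qed.

Lemma itv_pos (a d : R) : 0 < d -> (0 < leb `](a - d)%R, (a + d)%R[%classic)%E.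
Proof.
move=> d0; rewrite lebesgue_measure_itv/= lte_fin ifT; last by lra.
by rewrite -EFinB lte_fin; lra.
Qed.

(** If [f] is nonzero at a point, it is nonzero on a horizontal segment through it, and on a
    vertical segment through each point of that segment. A null set containing all these would have
    sections of positive measure over a whole interval. *)
Lemma sep_cont_ae0 f : sep_cont f -> {ae mu, forall x, f x = 0} -> forall x, f x = 0.
Proof.
move=> cf [A [mA A0 NA]] x; apply/eqP/negPn/negP => fx.
have e0 : 0 < `|f x| / 2 by rewrite divr_gt0// normr_gt0.
have [d d0 [H _]] := cf x _ e0.
have nz (y : R) : `]x.1 - d, (x.1 + d)%R[%classic y -> f (y, x.2) != 0.
  rewrite /= in_itv/= => yd; have := H (y - x.1).
  rewrite subrK => /(_ _) h; apply/eqP => y0.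
  have : `|y - x.1| < d by rewrite ltr_norml; lra.
  move=> /h; rewrite y0 sub0r normrN; have := normr_ge0 (f x); lra.
have pos (y : R) : `]x.1 - d, (x.1 + d)%R[%classic y -> (0 < leb (xsection A y))%E.
  move=> yI; have y0 := nz y yI; have e1 : 0 < `|f (y, x.2)| / 2 by rewrite divr_gt0// normr_gt0.
  have [d' d'0 [_ H']] := cf (y, x.2) _ e1.
  apply: lt_le_trans (itv_pos x.2 d'0) _; apply: le_measure; rewrite ?inE.
  - exact: measurable_itv.
  - exact: measurable_xsection.
  - move=> z; rewrite /= in_itv/= => zd; apply/xsectionP; apply: NA => /= fz.
    have := H' (z - x.2); rewrite /= subrK fz sub0r normrN => h'.
    have : `|z - x.2| < d' by rewrite ltr_norml; lra.
    move=> /h'; have := normr_ge0 (f (y, x.2)); lra.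
have [B [mB B0 NB]] := null_section mA A0.
have : (leb `](x.1 - d)%R, (x.1 + d)%R[%classic <= leb B)%E.
  apply: le_measure; rewrite ?inE; [exact: measurable_itv|exact: mB|].
  move=> y yI; apply: NB => /= h; have := pos y yI; by rewrite h ltxx.
by rewrite B0 leNgt itv_pos.
Qed.

Lemma Har_has_partials s h : 2 < s -> wdom (wt s) h -> has_partials (Har h).
Proof.
move=> s2 hh x; split.
- by have [] := @Har_is_derive s h (1, 0) x s2 hh.
- by have [] := @Har_is_derive s h (0, 1) x s2 hh.
Qed.

Lemma Har_grad s h x : 2 < s -> wdom (wt s) h ->
  grad (Har h) x = (dHar h (1, 0) x, dHar h (0, 1) x).
Proof.
move=> s2 hh; rewrite /grad.
by rewrite (@derive_val _ _ _ _ _ _ _ (@Har_is_derive s h (1, 0) x s2 hh))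
           (@derive_val _ _ _ _ _ _ _ (@Har_is_derive s h (0, 1) x s2 hh)).
Qed.

(** Both sides are separately continuous and agree almost everywhere, hence everywhere. This is
    where the differentiable representative of a solution becomes an absolutely convergent
    integral. *)
Lemma representation s f : 2 < s -> Hs s f -> has_partials f -> f = Har (U f).
Proof.
move=> s2 /HsE[sf wf] pf; have s1 : 1 < s := lt_trans (ltr1n _ 2) s2.
have [iU _] := wt_itg s1 wf; have sU := sqint_U sf.
have e : {ae mu, forall x, f x - Har (U f) x = 0}.
  by apply: aeS2 (UU sf) (U_Har iU sU) => x e1 e2; rewrite -e2 e1 subrr.
have c := sep_contB (has_partials_cont pf) (has_partials_cont (Har_has_partials s2 wf)).
by apply/funext => x; have := sep_cont_ae0 c e x => /eqP; rewrite subr_eq0 => /eqP.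
Qed.

(** Since [m] is odd, the integrand of the multiplier is the average of [m U f casn] at [y] and at
    [-y]. *)
Lemma imultiplier_Har (m : T2 -> R) f x : sqint f -> measurable_fun setT m ->
  (forall y, m (neg2 y) = - m y) -> itg (fun y => m y * U f y) ->
  imultiplier m f x = Kc * \int[mu]_y (m y * casn (dotp y x) * U f y).
Proof.
move=> sf mm mo im; have sU := sqint_U sf; have [mU _] := sU.
have [f1 f2] := fourier_ae sf; have [[/L2_sqint [mr _] /L2_sqint [mi _]] _] := fourier_spec sf.
have mcos : measurable_fun setT (fun y : T2 => cos (dotp y x)).
  by apply: (measurableT_comp (f := @cos R)); [apply: continuous_measurable_fun; exact: continuous_cos|exact: measurable_dotp_r].
have msin : measurable_fun setT (fun y : T2 => sin (dotp y x)).
  by apply: (measurableT_comp (f := @sin R)); [apply: continuous_measurable_fun; exact: continuous_sin|exact: measurable_dotp_r].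
have i1 : itg (fun y => m y * U f y * cas (dotp y x)).
  by apply: (itg_bounded im (C := 2)); [exact: (measurable_fun_pair1 x (@measurable_cas2 R))|move=> y; exact: cas_bound].
have i2 : itg (fun y => m y * U f y * casn (dotp y x)).
  apply: (itg_bounded im (C := 2)); last by move=> y; exact: casn_bound.
  exact: (measurableT_comp measurable_casn (measurable_dotp_r x)).
have dN (y : T2) : dotp (neg2 y) x = - dotp y x by rewrite /dotp /neg2/=; ring.
pose k1 (y : T2) := m y * U f y * casn (dotp y x).
have i1N : itg (fun y => k1 (neg2 y)) by exact: (itg_preserving (@preserving_neg2 R) i2).
rewrite /imultiplier /Cintegral /= mul0r subr0 -/(@Kc R); congr (_ * _).
transitivity (\int[mu]_y (2^-1 * (k1 y + k1 (neg2 y)))); last first.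
  rewrite (RintegralZl _ measurableT (itgD i2 i1N)) (RintegralD measurableT i2 i1N).
  rewrite (Rintegral_preserving (@preserving_neg2 R) (itg_meas i2)).
  have -> : \int[mu]_y (m y * casn (dotp y x) * U f y) = \int[mu]_y k1 y.
    by apply: eq_Rintegral => y _; rewrite /k1 mulrAC.
  by move: (\int[mu]_y k1 y) => t; field.
rewrite -[LHS]/(Rintegral mu setT _).
have E (y : T2) : complex.Re (expi (dotp x y) * ('i%C * (m y)%:C%C * fourier f y)) =
    - m y * (cos (dotp y x) * complex.Im (fourier f y) + sin (dotp y x) * complex.Re (fourier f y)).
  by rewrite /expi dotpC; case: (fourier f y) => a b /=; ring.
transitivity (\int[mu]_y (- m y * (cos (dotp y x) * complex.Im (fourier f y) + sin (dotp y x) * complex.Re (fourier f y)))).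
  by apply: eq_Rintegral => y _; exact: E.
apply: ae_Rintegral.
- apply: measurable_funM; first exact: measurableT_comp.
  by apply: measurable_funD; exact: measurable_funM.
- exact: (itg_meas (itgZ 2^-1 (itgD i2 i1N))).
- apply: aeS2 f1 f2 => y -> ->; rewrite /evp /odp /k1 dN mo /casn cosN sinN.
  move: (m y) (cos _) (sin _) (U f y) (U f _) => *; by field.
Qed.

(** The two components of the velocity with multiplier [q], in terms of the Hartley transform. The
    factor [casn] appears because an odd imaginary symbol exchanges even and odd parts. *)
Definition V1 q h (x : T2) : R := Kc * \int[mu]_y (- y.2 * q y * casn (dotp y x) * h y).
Definition V2 q h (x : T2) : R := Kc * \int[mu]_y (y.1 * q y * casn (dotp y x) * h y).

Lemma coord_le (y : T2) : `|y.1| <= enorm y /\ `|y.2| <= enorm y.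
Proof.
split; rewrite -(@ler_pXn2r _ 2)// ?nnegrE ?enorm_ge0// enorm_sqr real_normK ?num_real// /dotp -!expr2.
- by rewrite lerDl sqr_ge0.
- by rewrite lerDr sqr_ge0.
Qed.

Lemma sing_itg s h : 1 < s -> wdom (wt s) h -> itg (fun y => (wt 0 y + sing y) * hs h y).
Proof.
move=> s1 hh; have rho := sqintD (sqint_wt s1) (@sqint_sing R).
have mv : measurable_fun setT (fun y : T2 => wt 0 y + sing y).
  by apply: measurable_funD; [exact: measurable_wt|exact: measurable_sing].
have p0 (a : R) (y : T2) : 0 <= wt a y + sing y := addr_ge0 (wt_ge0 a y) (sing_ge0 y).
apply: (hs_itg mv (p0 0) rho (p0 (- s)) _ hh).1 => y.
rewrite mulrDl -wtD addNr lerD2l; apply: ler_peMr; first exact: sing_ge0.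
by apply: wt_ge1; exact: ltW (lt_trans _ s1).
Qed.

Lemma wdom_hs_wt s h : wdom (wt s) h -> wdom (wt s) (hs h).
Proof. by move=> hh; have [] := wdom_hs (measurable_wt s) (wt_gt0 s) (wt_neg s) hh. Qed.

Lemma mult_itg s q h (p : T2 -> R) : 1 < s -> goodq q -> wdom (wt s) h -> measurable_fun setT p ->
  (forall y, `|p y| <= enorm y) -> itg (fun y => p y * q y * h y).
Proof.
move=> s1 [mq _ qb _] hh mp pe; have mh := wdom_meas (measurable_wt _) (wt_gt0 _) hh.
apply: itg_dom (sing_itg s1 hh); first by do 2 apply: measurable_funM => //.
move=> y; rewrite !normrM; apply: ler_pM => //.
  by have := qb y; rewrite mul1r; apply: le_trans; apply: ler_wpM2r.
by rewrite /hs lerDl.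
Qed.

(** Fubini and the translation [z -> y + z] separate the two frequencies. The inner integral then
    involves only the cosine and sine moments [C] and [S] of [g], linear in [perp y]; reflecting
    part of the integral in [y] reassembles velocity and gradient. *)
Lemma Har_bil s q h g x : 2 < s -> goodq q -> wdom (wt s) h -> wdom (wt s) g ->
  Har (bil q h g) x = - (V1 q h x * dHar g (1, 0) x + V2 q h x * dHar g (0, 1) x).
Proof.
move=> s2 gq hh hg; have s1 : 1 < s := lt_trans (ltr1n _ 2) s2.
have [mq qe qb _] := gq.
have mh := wdom_meas (measurable_wt _) (wt_gt0 _) hh.
have mg := wdom_meas (measurable_wt _) (wt_gt0 _) hg.
have ieg := enorm_itg s2 hg.
have mcas : measurable_fun setT (fun y : T2 => cas (dotp y x)) by exact: (measurable_fun_pair1 x (@measurable_cas2 R)).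
have mcasn : measurable_fun setT (fun y : T2 => casn (dotp y x)).
  exact: (measurableT_comp measurable_casn (measurable_dotp_r x)).
have mcos : measurable_fun setT (fun y : T2 => cos (dotp y x)).
  by apply: (measurableT_comp (f := @cos R)); [apply: continuous_measurable_fun; exact: continuous_cos|exact: measurable_dotp_r].
have msin : measurable_fun setT (fun y : T2 => sin (dotp y x)).
  by apply: (measurableT_comp (f := @sin R)); [apply: continuous_measurable_fun; exact: continuous_sin|exact: measurable_dotp_r].
have mdl (v : T2) : measurable_fun setT (fun y : T2 => dotp v y) by exact: (measurable_fun_pair2 v (@measurable_dotp2 R)).
have iT (v : T2) (c : R -> R) k : measurable_fun setT (fun y : T2 => c (dotp y x)) -> (forall t, `|c t| <= 1) ->
    measurable_fun setT k -> itg (fun y => enorm y * k y) -> itg (fun y => dotp v y * (c (dotp y x) * k y)).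
  move=> mc c1 mk ik; have iz := itgZ (enorm v) (itg_abs ik).
  apply: itg_dom iz; first by apply: measurable_funM => //; exact: measurable_funM.
  move=> y; rewrite !normrM (@ger0_norm _ (enorm y)) ?enorm_ge0// [leRHS]mulrA.
  apply: ler_pM => //; first exact: dotp_bound.
  by rewrite ler_piMl.
have cos1 (t : R) : `|cos t| <= 1 by rewrite ler_norml cos_geN1 cos_le1.
have sin1 (t : R) : `|sin t| <= 1 by rewrite ler_norml sin_geN1 sin_le1.
pose C (v : T2) := \int[mu]_y (dotp v y * (cos (dotp y x) * g y)).
pose S (v : T2) := \int[mu]_y (dotp v y * (sin (dotp y x) * g y)).
have iC v : itg (fun y => dotp v y * (cos (dotp y x) * g y)) by exact: iT.
have iS v : itg (fun y => dotp v y * (sin (dotp y x) * g y)) by exact: iT.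
have dN (y : T2) : dotp (neg2 y) x = - dotp y x by rewrite /dotp /neg2/=; ring.
have dNr (v y : T2) : dotp v (neg2 y) = - dotp v y by rewrite /dotp /neg2/=; ring.
have iCN v : itg (fun y => dotp v y * (cos (dotp y x) * g (neg2 y))).
  have := itgN (itg_preserving (@preserving_neg2 R) (iC v)); congr itg; apply/funext => y /=.
  by rewrite dN dNr cosN; ring.
have iSN v : itg (fun y => dotp v y * (sin (dotp y x) * g (neg2 y))).
  have := itg_preserving (@preserving_neg2 R) (iS v); congr itg; apply/funext => y /=.
  by rewrite dN dNr sinN; ring.
have CN v : \int[mu]_y (dotp v y * (cos (dotp y x) * g (neg2 y))) = - C v.
  rewrite /C -(Rintegral_preserving (@preserving_neg2 R) (itg_meas (iC v))) -Rint_opp.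
  by apply: eq_Rintegral => y _; rewrite dN dNr cosN; ring.
have SN v : \int[mu]_y (dotp v y * (sin (dotp y x) * g (neg2 y))) = S v.
  rewrite /S -(Rintegral_preserving (@preserving_neg2 R) (itg_meas (iS v))).
  by apply: eq_Rintegral => y _; rewrite dN dNr sinN; ring.
have linC v : C v = v.1 * C (1, 0) + v.2 * C (0, 1).
  rewrite /C -(RintegralZl _ measurableT (iC (1, 0))) -(RintegralZl _ measurableT (iC (0, 1))).
  rewrite -(RintegralD measurableT (itgZ _ (iC (1, 0))) (itgZ _ (iC (0, 1)))).
  by apply: eq_Rintegral => y _; rewrite /dotp/=; ring.
have linS v : S v = v.1 * S (1, 0) + v.2 * S (0, 1).
  rewrite /S -(RintegralZl _ measurableT (iS (1, 0))) -(RintegralZl _ measurableT (iS (0, 1))).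
  rewrite -(RintegralD measurableT (itgZ _ (iS (1, 0))) (itgZ _ (iS (0, 1)))).
  by apply: eq_Rintegral => y _; rewrite /dotp/=; ring.
pose a y := (wt 0 y + sing y) * hs h y; have ia : itg a := sing_itg s1 hh.
pose b y := enorm y * hs g y; have ib : itg b := enorm_itg s2 (wdom_hs_wt hg).
have a0 y : 0 <= a y by exact: (mulr_ge0 (addr_ge0 (wt_ge0 0 y) (sing_ge0 y)) (hs_ge0 h y)).
have b0 y : 0 <= b y by exact: (mulr_ge0 (enorm_ge0 y) (hs_ge0 g y)).
have mk := measurable_ker mq mh mg.
have lek z : `|ker q h g z| <= a z.2 * b (sub2 z.1 z.2).
  apply: le_trans (ker_bound _ _ _ _) _; apply: ler_wpM2r; first exact: b0.
  by apply: ler_wpM2r; [exact: hs_ge0|have := qb z.2; rewrite mul1r].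
pose F (z : T2 * T2) := ker q h g z * cas (dotp z.1 x).
have mF : measurable_fun setT F by apply: measurable_funM; [exact: mk|exact: (measurable_comp_fst mcas)].
have mD : measurable_fun setT (fun z : T2 * T2 => (2 * (a z.2 * b (sub2 z.1 z.2)))%:E).
  apply/measurable_EFinP; apply: measurable_funM; first exact: measurable_cst.
  by apply: measurable_funM; [exact: measurable_comp_snd (itg_meas ia)|exact: measurable_comp_sub2 (itg_meas ib)].
have mFa : measurable_fun setT (fun z : T2 * T2 => `|F z|%:E).
  by apply/measurable_EFinP; apply: measurableT_comp.
have lt : (\int[mu]_z \int[mu]_y `|F (z, y)|%:E < +oo)%E.
  apply: (@le_lt_trans _ _ (\int[mu]_z \int[mu]_y (2 * (a y * b (sub2 z y)))%:E)%E).
    apply: ge0_le_integral.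
    - exact: measurableT.
    - by move=> z _; apply: integral_ge0 => y _; rewrite lee_fin.
    - exact: (tonelli_meas mFa (fun z => normr_ge0 _)).
    - by apply: (tonelli_meas mD) => z; rewrite lee_fin; exact: mulr_ge0 (ler0n _ 2) (mulr_ge0 (a0 _) (b0 _)).
    - move=> z _; apply: ge0_le_integral.
      + exact: measurableT.
      + by move=> y _; rewrite lee_fin.
      + exact: (measurable_fun_pair2 _ mFa).
      + exact: (measurable_fun_pair2 _ mD).
      + move=> y _; rewrite lee_fin /F normrM mulrC.
        exact: (ler_pM (normr_ge0 _) (normr_ge0 _) (cas_bound _) (lek (z, y))).
  rewrite (tonelli2 mD); last by move=> z; rewrite lee_fin; exact: mulr_ge0 (ler0n _ 2) (mulr_ge0 (a0 _) (b0 _)).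
  have ibs y : itg (fun z => b (sub2 z y)) by exact: (itg_preserving (preserving_sub2r y) ib).
  have -> : (fun y => \int[mu]_z (2 * (a y * b (sub2 z y)))%:E)%E = (fun y => (2 * (\int[mu]_z b z) * a y)%:E).
    apply/funext => y; have -> : (fun z => (2 * (a y * b (sub2 z y)))%:E) = (fun z => ((2 * a y) * b (sub2 z y))%:E).
      by apply/funext => z; rewrite mulrA.
    rewrite (itg_EFin (itgZ (2 * a y) (ibs y))) (RintegralZl _ measurableT (ibs y)).
    by rewrite (Rintegral_preserving (preserving_sub2r y) (itg_meas ib)); congr (_%:E); ring.
  by rewrite (itg_EFin (itgZ _ ia)) ltry.
have [_ aeF EF] := fubini_itg mF lt.
have E1 : \int[mu]_z (bil q h g z * cas (dotp z x)) = \int[mu]_y \int[mu]_z F (z, y).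
  rewrite -EF; apply: ae_Rintegral.
  - by apply: measurable_funM; [exact: Rintegral_meas_signed|].
  - exact: Rintegral_meas_signed.
  (* Only the section times [cas] is known to be integrable. Where [cas] vanishes it cannot be
     divided out, but both sides are 0. *)
  - apply: aeS aeF => z hz; have [c0|c0] := eqVneq (cas (dotp z x)) 0.
      rewrite c0 mulr0 /F /= c0; under eq_Rintegral do rewrite mulr0.
      by rewrite /Rintegral integral0.
    have ik : itg (fun y => ker q h g (z, y)).
      have := itgZ (cas (dotp z x))^-1 hz; congr itg; apply/funext => y.
      by rewrite /F /= mulrCA mulVf ?mulr1.
    by rewrite /bil -(RintegralZr _ measurableT ik).
pose A (y : T2) := dotp y x.
have IE y : \int[mu]_z F (z, y) = Kc * q y * (h (neg2 y) * cas (A y) * C (perp y) + h y * casn (A y) * S (perp y)).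
  pose k := Kc * q y / 2; pose p := cas (A y); pose n := casn (A y).
  have mFy : measurable_fun setT (fun z => F (z, y)) by exact: (measurable_fun_pair1 _ mF).
  rewrite -(Rintegral_preserving (preserving_add2 y) mFy).
  have e : (fun z => F (add2 y z, y)) = (fun z =>
    ((k * (h y + h (neg2 y)) * p) * (dotp (perp y) z * (cos (dotp z x) * g z)) +
     (k * (h y + h (neg2 y)) * n) * (dotp (perp y) z * (sin (dotp z x) * g z))) +
    ((k * (h y - h (neg2 y)) * p) * (dotp (perp y) z * (cos (dotp z x) * g (neg2 z))) +
     (k * (h y - h (neg2 y)) * n) * (dotp (perp y) z * (sin (dotp z x) * g (neg2 z))))).
    apply/funext => z; rewrite /F /ker /pairing /=.
    have -> : sub2 (add2 y z) y = z by case: z => z1 z2; rewrite /sub2 /add2/= ![_ + _ - _]addrAC !subrr !add0r.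
    have -> : dotp (add2 y z) x = A y + dotp z x by rewrite /A /dotp /add2/=; ring.
    rewrite /p /n /cas /casn cosD sinD /k.
    move: (cos (A y)) (sin (A y)) (cos (dotp z x)) (sin (dotp z x)) (g z) (g _) (h y) (h _) (dotp _ _) (q y) Kc => *.
    by ring.
  rewrite e.
  have j1 := itgZ (k * (h y + h (neg2 y)) * p) (iC (perp y)).
  have j2 := itgZ (k * (h y + h (neg2 y)) * n) (iS (perp y)).
  have j3 := itgZ (k * (h y - h (neg2 y)) * p) (iCN (perp y)).
  have j4 := itgZ (k * (h y - h (neg2 y)) * n) (iSN (perp y)).
  rewrite (RintegralD measurableT (itgD j1 j2) (itgD j3 j4)).
  rewrite (RintegralD measurableT j1 j2) (RintegralD measurableT j3 j4).
  rewrite (RintegralZl _ measurableT (iC _)) (RintegralZl _ measurableT (iS _)).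
  rewrite (RintegralZl _ measurableT (iCN _)) (RintegralZl _ measurableT (iSN _)) CN SN.
  rewrite -/(C (perp y)) -/(S (perp y)) /k /p /n.
  by move: (C _) (S _) (h y) (h _) (cas _) (casn _) (q y) Kc => *; field.
pose B1 y := - y.2 * q y * casn (dotp y x) * h y.
pose B2 y := y.1 * q y * casn (dotp y x) * h y.
have iB (p : T2 -> R) : measurable_fun setT p -> (forall y, `|p y| <= enorm y) ->
    itg (fun y => p y * q y * casn (dotp y x) * h y).
  move=> mp pe; have ip := mult_itg s1 gq hh mp pe.
  have := itg_bounded ip mcasn (fun y => casn_bound (dotp y x)).
  by congr itg; apply/funext => y; rewrite mulrAC.
have iB1 : itg B1.
  apply: iB; first by apply: measurableT_comp => //; exact: measurable_snd2.
  by move=> y; rewrite normrN; have [] := coord_le y.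
have iB2 : itg B2.
  by apply: iB; [exact: measurable_fst2|move=> y; have [] := coord_le y].
pose K1 y := Kc * S (1, 0) * B1 y + Kc * S (0, 1) * B2 y.
pose K2 y := - Kc * C (1, 0) * B1 y + - Kc * C (0, 1) * B2 y.
have iK1 : itg K1 by exact: itgD (itgZ _ iB1) (itgZ _ iB2).
have iK2 : itg K2 by exact: itgD (itgZ _ iB1) (itgZ _ iB2).
have iK2N : itg (fun y => K2 (neg2 y)) by exact: (itg_preserving (@preserving_neg2 R) iK2).
have E2 : \int[mu]_y \int[mu]_z F (z, y) = \int[mu]_y K1 y + \int[mu]_y K2 y.
  rewrite -(Rintegral_preserving (@preserving_neg2 R) (itg_meas iK2)) -(RintegralD measurableT iK1 iK2N).
  apply: eq_Rintegral => y _; rewrite IE linC linS /K1 /K2 /B1 /B2 /A dN qe.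
  have -> : casn (- dotp y x) = cas (dotp y x) by rewrite -casN opprK.
  rewrite /perp /neg2/=.
  by move: (C _) (C _) (S _) (S _) (h y) (h _) (cas _) (casn _) (q y) Kc => *; ring.
have dE (v : T2) : dHar g v x = Kc * (C v - S v).
  rewrite /dHar -(RintegralB measurableT (iC v) (iS v)); congr (_ * _); apply: eq_Rintegral => y _.
  by rewrite /casn (dotpC y v); ring.
rewrite {1}/Har E1 E2 (RintegralD measurableT (itgZ _ iB1) (itgZ _ iB2)).
rewrite (RintegralD measurableT (itgZ (- Kc * C (1, 0)) iB1) (itgZ (- Kc * C (0, 1)) iB2)).
rewrite !(RintegralZl _ measurableT iB1) !(RintegralZl _ measurableT iB2) !dE /V1 /V2 -/(B1 _).
rewrite -[\int[mu]_y (- y.2 * _ * _ * _)]/(\int[mu]_y B1 y) -[\int[mu]_y (y.1 * _ * _ * _)]/(\int[mu]_y B2 y).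
by move: (C _) (C _) (S _) (S _) (\int[mu]_y B1 y) (\int[mu]_y B2 y) Kc => *; ring.
Qed.

End Evaluation.

(** * Strong solutions *)

Section Strong.
Context {R : realType}.
Notation mu := (@mu2 R).
Notation T2 := (plane R).
Implicit Types (f g h q : T2 -> R) (a s r t : R).

Definition HW r : semiHilbert (T2 -> R) := wL2 (@wt_gt0 R r).

Lemma hnormHW r h : hnorm (HW r) h = wn (wt r) h. Proof. exact: hnorm_wL2. Qed.

Lemma wdom_sqint r h : 0 <= r -> wdom (wt r) h -> sqint h.
Proof. by move=> r0 /(wdom_wt r0); congr sqint; apply/funext => x; rewrite wt0 mul1r. Qed.

Lemma wdom_ae om h h' : measurable_fun setT om -> measurable_fun setT h' ->
  {ae mu, forall x, h x = h' x} -> wdom om h -> wdom om h'.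
Proof.
move=> mom mh' e; apply: sqint_ae; first exact: measurable_funM.
by apply: aeS e => x ->.
Qed.

Lemma wn_ae om h h' : measurable_fun setT om -> measurable_fun setT h -> measurable_fun setT h' ->
  {ae mu, forall x, h x = h' x} -> wn om h = wn om h'.
Proof.
move=> mom mh mh' e; apply: n2_ae; [exact: measurable_funM|exact: measurable_funM|].
by apply: aeS e => x ->.
Qed.

Definition qm a (x : T2) : R := enorm x `^ (- 2 + 2 * a).

Lemma qm_ge0 a x : 0 <= qm a x. Proof. exact: powR_ge0. Qed.

(** At the origin the left side is 0, while on the right [0 ^ 0 = 1] when [a = 1 / 2]; hence the
    indicator. *)
Lemma enorm_qm a (x : T2) : a <= 1 / 2 -> enorm x * qm a x = enorm x `^ (- 1 + 2 * a) * (enorm x != 0)%:R.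
Proof.
move=> a1; rewrite /qm; have [->|e0] := eqVneq (enorm x) 0; first by rewrite mul0r mulr0.
rewrite mulr1 -{1}(powRr1 (enorm_ge0 x)) -powRD ?e0 ?implybT//.
by congr (_ `^ _); ring.
Qed.

Lemma enorm_pos (x : T2) : enorm x != 0 -> 0 < enorm x.
Proof. by move=> h; rewrite lt_neqAle eq_sym h enorm_ge0. Qed.

Lemma powR_le1 (x p : R) : 1 <= x -> p <= 0 -> x `^ p <= 1.
Proof. by move=> x1 p0; rewrite -(powRr0 x); apply: ler_powR. Qed.

Lemma powR_small (x p p' : R) : 0 < x -> x <= 1 -> p' <= p -> x `^ p <= x `^ p'.
Proof.
move=> x0 x1 pp; have x0' := gt_eqF x0; rewrite /powR x0' ler_expR.
by apply: ler_wnM2r => //; exact: ln_le0.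
Qed.

(** Away from 0, [|x| qm a x = |x|^(2 a - 1)] with exponent in [[- 1 / 4, 0]]: at most
    [|x|^(- 1 / 2)] inside the unit disk, at most 1 outside. *)
Lemma goodq_qm a : 3 / 8 <= a -> a <= 1 / 2 -> goodq (qm a).
Proof.
move=> a0 a1; split.
- exact: (measurableT_comp (measurable_powR _) (@measurable_enorm R)).
- by move=> x; rewrite /qm enorm_neg.
- move=> x; rewrite ger0_norm ?qm_ge0// mul1r enorm_qm// wt0 /sing.
  have [->|/enorm_pos e0] := eqVneq (enorm x) 0; first by rewrite mulr0 addr_ge0// mulr_ge0// powR_ge0.
  rewrite mulr1; have [e1|e1] := leP (enorm x) 1.
    rewrite mulr1; apply: (@le_trans _ _ (enorm x `^ (- 2^-1))); last by rewrite lerDr.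
    by apply: powR_small => //; lra.
  by rewrite mulr0 addr0; apply: powR_le1; [exact: ltW|lra].
- move=> x; rewrite ger0_norm ?qm_ge0// expr2 -mulrA enorm_qm//.
  have [->|/enorm_pos e0] := eqVneq (enorm x) 0; first by rewrite mul0r mulr_ge0 ?wt_ge0.
  rewrite mulr1 -{1}(powRr1 (enorm_ge0 x)) -powRD ?(gt_eqF e0) ?implybT//.
  have w1 := wt_ge1 x (@ler01 R); have [e1|e1] := leP (enorm x) 1.
    apply: (@le_trans _ _ (1 : R)); last lra.
    apply: (@le_trans _ _ (enorm x `^ 0)); last by rewrite powRr0.
    by apply: powR_small => //; lra.
  apply: (@le_trans _ _ (enorm x)); last by have := enorm_wt1 x; lra.
  by rewrite -{2}(powRr1 (enorm_ge0 x)); apply: ler_powR; [exact: ltW|lra].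
Qed.

(* [|1 - x^(-2e)| <= 2 e |ln x| max(1, x^(-2e))], and the logarithm costs [x] or [x^(-1/4)] *)
Lemma qm_diff a (x : T2) : 3 / 8 <= a -> a <= 1 / 2 ->
  enorm x * `|qm a x - qm (1 / 2) x| <= (8 * (1 / 2 - a)) * (wt 1 x + sing x).
Proof.
move=> a0 a1; set e := 1 / 2 - a; have e0 : 0 <= e by rewrite subr_ge0.
have [x0|/enorm_pos x0] := eqVneq (enorm x) 0.
  by rewrite x0 mul0r mulr_ge0 ?addr_ge0 ?wt_ge0 ?sing_ge0// mulr_ge0.
have -> : enorm x * `|qm a x - qm (1 / 2) x| = `|enorm x `^ (- (2 * e)) - 1|.
  rewrite -{1}(ger0_norm (enorm_ge0 x)) -normrM mulrBr !enorm_qm// (gt_eqF x0) !mulr1.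
  rewrite (_ : - 1 + 2 * (1 / 2) = 0 :> R); last by field.
  by rewrite powRr0 /e; congr (`| _ `^ _ - _|); field.
have pE (p : R) : enorm x `^ p = expR (p * ln (enorm x)) by rewrite /powR gt_eqF.
have [x1|x1] := leP (enorm x) 1; last first.
  have l0 : 0 <= ln (enorm x) by apply: ln_ge0; exact: ltW.
  have l1 : ln (enorm x) <= enorm x.
    have := expR_ge1Dx (ln (enorm x)); rewrite lnK ?posrE//; lra.
  have h := expR_ge1Dx (- (2 * e) * ln (enorm x)).
  have h1 : enorm x `^ (- (2 * e)) <= 1 by apply: powR_le1; [exact: ltW|lra].
  rewrite ler0_norm ?subr_le0// opprB; rewrite -pE in h.
  have w := enorm_wt1 x; have s := sing_ge0 x.
  have m1 : e * ln (enorm x) <= e * wt 1 x by apply: ler_wpM2l => //; exact: le_trans l1 w.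
  have m2 : 0 <= e * sing x by rewrite mulr_ge0.
  have m3 : 0 <= e * wt 1 x by rewrite mulr_ge0 ?wt_ge0.
  lra.
have l0 : 0 <= - ln (enorm x) by rewrite oppr_ge0 ln_le0.
set L := - ln (enorm x) in l0.
(* One factor [y] pays for the logarithm and one for the power, since [2 e <= 1 / 4] by
   [3 / 8 <= a]; their product is [sing x]. *)
set y := enorm x `^ (- 4^-1).
have y0 : 0 <= y by exact: powR_ge0.
have l1 : L <= 4 * y.
  have : 1 + 4^-1 * L <= y by rewrite /y pE (_ : - 4^-1 * ln (enorm x) = 4^-1 * L); [exact: expR_ge1Dx|rewrite /L; ring].
  lra.
have h1 : 1 <= enorm x `^ (- (2 * e)).
  apply: (@le_trans _ _ (enorm x `^ 0)); first by rewrite powRr0.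
  by apply: powR_small => //; lra.
have h2 : enorm x `^ (- (2 * e)) <= y by apply: powR_small => //; rewrite /e; lra.
have h3 : enorm x `^ (- (2 * e)) - 1 <= 2 * e * L * enorm x `^ (- (2 * e)).
  have := expR_ge1Dx (2 * e * ln (enorm x)); rewrite pE.
  have E : expR (2 * e * ln (enorm x)) * expR (- (2 * e) * ln (enorm x)) = 1.
    by rewrite -expRD -mulrDl subrr mul0r expR0.
  move=> /(ler_wpM2r (expR_ge0 (- (2 * e) * ln (enorm x)))); rewrite E /L.
  move: (expR _) => Z; lra.
rewrite ger0_norm ?subr_ge0//; apply: le_trans h3 _.
have sE : sing x = y * y.
  by rewrite /sing x1 mulr1 /y -powRD ?(gt_eqF x0) ?implybT//; congr (_ `^ _); field.
apply: (@le_trans _ _ (2 * e * (4 * y) * y)).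
  apply: ler_pM => //; first by rewrite !mulr_ge0.
    exact: powR_ge0.
  by apply: ler_wpM2l => //; rewrite mulr_ge0.
rewrite sE; have m3 : 0 <= e * wt 1 x by rewrite mulr_ge0 ?wt_ge0.
have : 8 * e * (wt 1 x + y * y) = 8 * (e * wt 1 x) + 2 * e * (4 * y) * y by ring.
by move=> ->; lra.
Qed.

Lemma bil_bound0 r : 1 < r -> exists2 C : R, 0 <= C & forall q h g, goodq q ->
  wdom (wt r) h -> wdom (wt (r + 1)) g ->
  [/\ {ae mu, forall x, itg (fun y => ker q h g (x, y))}, wdom (wt r) (bil q h g) &
      wn (wt r) (bil q h g) <= C * wn (wt r) h * wn (wt (r + 1)) g].
Proof.
move=> r1; have [C C0 H] := @bil_bound R r 0 r1 (lexx _); exists C => // q h g [mq _ qb _] hh hg.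
by have := H 1 q h g ler01 mq qb; rewrite addr0 mulr1; apply.
Qed.

Lemma wdomB om h g : wdom om h -> wdom om g -> wdom om (fun x => h x - g x).
Proof.
move=> hh hg; have := sqintB hh hg; congr sqint.
by apply/funext => x; rewrite mulrBr.
Qed.

Lemma kerBl q h1 h2 g z : ker q (fun x => h1 x - h2 x) g z = ker q h1 g z - ker q h2 g z.
Proof. by rewrite /ker /pairing; ring. Qed.

Lemma kerBr q h g1 g2 z : ker q h (fun x => g1 x - g2 x) z = ker q h g1 z - ker q h g2 z.
Proof. by rewrite /ker /pairing; ring. Qed.

Lemma ae_and (P Q : T2 -> Prop) : {ae mu, forall x, P x} -> {ae mu, forall x, Q x} ->
  {ae mu, forall x, P x /\ Q x}.
Proof. by move=> p q; apply: aeS2 p q => x. Qed.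

Lemma bil_meas q h g : measurable_fun setT q -> measurable_fun setT h -> measurable_fun setT g ->
  measurable_fun setT (bil q h g).
Proof. by move=> mq mh mg; apply: Rintegral_meas_signed; exact: measurable_ker. Qed.

(** The equality holds at every [x]: for fixed [x] the integrand involves [h] and [g] only through
    reflections and translations of [y], which preserve null sets. *)
Lemma bil_ae q h h' g g' : measurable_fun setT q -> measurable_fun setT h ->
  measurable_fun setT h' -> measurable_fun setT g -> measurable_fun setT g' ->
  {ae mu, forall x, h x = h' x} -> {ae mu, forall x, g x = g' x} -> bil q h g = bil q h' g'.
Proof.
move=> mq mh mh' mg mg' e1 e2; apply/funext => x; apply: ae_Rintegral.
- exact: (measurable_fun_pair2 x (measurable_ker mq mh mg)).
- exact: (measurable_fun_pair2 x (measurable_ker mq mh' mg')).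
- have k1 := ae_and e1 (ae_preserving (@preserving_neg2 R) e1).
  have e3 := ae_preserving (preserving_sub2 x) e2.
  have e4 := ae_preserving (preserving_sub2 x) (ae_preserving (@preserving_neg2 R) e2).
  have k2 := ae_and e3 e4.
  by apply: aeS2 k1 k2 => y [u1 u2] [u3 u4]; rewrite /ker /pairing /= u1 u2 u3 u4.
Qed.

(** Polarisation of the quadratic term. It holds almost everywhere because the separate integrals
    have to converge before they are combined. *)
Lemma bil_diff r q h h' : 1 < r -> goodq q -> wdom (wt (r + 1)) h -> wdom (wt (r + 1)) h' ->
  {ae mu, forall x, bil q h h x - bil q h' h' x =
    bil q h (fun y => h y - h' y) x + bil q (fun y => h y - h' y) h' x}.
Proof.
move=> r1 gq hh hh'; have [C _ H] := bil_bound0 r1.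
have le : r <= r + 1 by rewrite lerDl.
have [a1 _ _] := H q h h gq (wdom_wt le hh) hh.
have [a2 _ _] := H q h h' gq (wdom_wt le hh) hh'.
have [a3 _ _] := H q h' h' gq (wdom_wt le hh') hh'.
have k := ae_and a1 a2.
apply: aeS2 k a3 => x [i1 i2] i3; rewrite /bil.
under [in RHS]eq_Rintegral => y _ do rewrite kerBr.
rewrite (RintegralB measurableT i1 i2).
have -> : (\int[mu]_y ker q (fun y => h y - h' y) h' (x, y) =
  \int[mu]_y ker q h h' (x, y) - \int[mu]_y ker q h' h' (x, y))%R.
  rewrite -(RintegralB measurableT i2 i3); congr Rintegral; apply/funext => y; exact: kerBl.
by rewrite addrA subrK.
Qed.

Lemma HWsub r h g : wdom (wt r) h -> wdom (wt r) g ->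
  wn (wt r) (fun x => h x - g x) <= wn (wt r) h + wn (wt r) g.
Proof.
by move=> hh hg; have := @hnorm_subadd _ _ (HW r) h g hh hg; rewrite !hnormHW.
Qed.

Lemma bil_diff_est r : 1 < r -> exists2 C : R, 0 <= C & forall q h h', goodq q ->
  wdom (wt (r + 1)) h -> wdom (wt (r + 1)) h' ->
  wdom (wt r) (bil q h h) /\
  wn (wt r) (fun x => bil q h h x - bil q h' h' x) <=
  C * (wn (wt (r + 1)) h + wn (wt (r + 1)) h') * wn (wt (r + 1)) (fun x => h x - h' x).
Proof.
move=> r1; have [C C0 H] := bil_bound0 r1; exists C => // q h h' gq hh hh'.
have le : r <= r + 1 by rewrite lerDl.
have hd := wdomB hh hh'.
have [_ d1 _] := H q h h gq (wdom_wt le hh) hh; split; first exact: d1.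
have [_ d1' _] := H q h' h' gq (wdom_wt le hh') hh'.
have [_ d2 n2_] := H q h _ gq (wdom_wt le hh) hd.
have [_ d3 n3] := H q _ h' gq (wdom_wt le hd) hh'.
have E := bil_diff r1 gq hh hh'.
have [mq _ _ _] := gq.
have m1 := wdom_meas (measurable_wt _) (wt_gt0 _) hh.
have m2 := wdom_meas (measurable_wt _) (wt_gt0 _) hh'.
have mdf := wdom_meas (measurable_wt _) (wt_gt0 _) hd.
rewrite (wn_ae (measurable_wt r) _ _ E); last 2 first.
- by apply: measurable_funB; exact: bil_meas.
- by apply: measurable_funD; exact: bil_meas.
have tri := @hnorm_add _ _ (HW r) _ _ d2 d3; rewrite !hnormHW in tri.
apply: le_trans tri _.
have w1 := wn_wt le hh; have w2 := wn_wt le hd; have p1 := wn_ge0 (wt (r + 1)) h'.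
have p2 := wn_ge0 (wt (r + 1)) (fun x => h x - h' x).
rewrite mulrDr mulrDl; apply: lerD.
  by apply: le_trans n2_ _; apply: (ler_wpM2r p2 (ler_wpM2l C0 w1)).
by apply: le_trans n3 _; rewrite mulrAC; exact: (ler_wpM2l (mulr_ge0 C0 p1) w2).
Qed.

End Strong.

(** * Pointwise solutions and solutions in Sobolev spaces *)

Section Equivalence.
Context {R : realType}.
Notation mu := (@mu2 R).
Notation T2 := (plane R).
Implicit Types (f g q : T2 -> R) (a s r t T : R) (h w : R -> T2 -> R).

Lemma n2_0 : n2 ((fun=> 0) : T2 -> R) = 0.
Proof. by rewrite /n2; under eq_Rintegral => x _ do rewrite expr0n /=; rewrite /Rintegral integral0 sqrtr0. Qed.

Lemma deriv_onB (b c : R) (f g f' g' : R -> R) : deriv_on b c f f' -> deriv_on b c g g' ->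
  deriv_on b c (fun t => f t - g t) (fun t => f' t - g' t).
Proof.
move=> hf hg t tab e e0; have e2 : 0 < e / 2 by rewrite divr_gt0.
have [d1 d10 H1] := hf t tab _ e2; have [d2 d20 H2] := hg t tab _ e2.
exists (Num.min d1 d2) => [|u uab]; first by rewrite lt_min d10.
rewrite le_min => /andP[u1 u2].
have -> : f u - g u - (f t - g t) - (u - t) * (f' t - g' t) =
  (f u - f t - (u - t) * f' t) - (g u - g t - (u - t) * g' t) by ring.
have h1 := H1 u uab u1; have h2 := H2 u uab u2.
by apply: le_trans (ler_normB _ _) _; lra.
Qed.

Lemma U_sub f g : sqint f -> sqint g ->
  {ae mu, forall x, U (fun y => f y - g y) x = U f x - U g x}.
Proof.
move=> sf sg; have := U_lin 1 (-1) sf sg.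
have -> : (fun x => 1 * f x + -1 * g x) = (fun x => f x - g x).
  by apply/funext => x; rewrite mul1r mulN1r.
by apply: aeS => x ->; rewrite mul1r mulN1r.
Qed.

Lemma U_eq_ae f g : sqint f -> sqint g -> {ae mu, forall x, f x = g x} ->
  {ae mu, forall x, U f x = U g x}.
Proof.
move=> sf sg e; have sd := sqintB sf sg.
have n0 : n2 (U (fun y => f y - g y)) = 0.
  rewrite (n2_U sd) -n2_0; apply: (n2_ae sd.1); first exact: measurable_cst.
  by apply: aeS e => x ->; rewrite subrr.
by apply: aeS2 (n2_eq0_ae (sqint_U sd) n0) (U_sub sf sg) => x -> /esym/eqP; rewrite subr_eq0 => /eqP.
Qed.

Lemma perp_good a : (forall y : T2, (perp (neg2 y)).1 * enorm (neg2 y) `^ (- 2 + 2 * a) =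
    - ((perp y).1 * enorm y `^ (- 2 + 2 * a))) /\
  (forall y : T2, (perp (neg2 y)).2 * enorm (neg2 y) `^ (- 2 + 2 * a) =
    - ((perp y).2 * enorm y `^ (- 2 + 2 * a))).
Proof. by split=> y; rewrite enorm_neg /= ?opprK ?mulNr ?opprK. Qed.

Lemma measurable_perp1 : measurable_fun setT (fun y : T2 => (perp y).1).
Proof. by apply: measurable_funN; exact: measurable_snd. Qed.

Lemma velocity_Har a s (w : T2 -> R) x : 1 < s -> 3 / 8 <= a -> a <= 1 / 2 -> sqint w ->
  wdom (wt s) (U w) -> velocity a w x = (V1 (qm a) (U w) x, V2 (qm a) (U w) x).
Proof.
move=> s1 a0 a1 sw dw; have gq := goodq_qm a0 a1; have [odd1 odd2] := perp_good a.
have mq : measurable_fun setT (fun y : T2 => enorm y `^ (- 2 + 2 * a)) by case: gq.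
have c1 (y : T2) : `|(perp y).1| <= enorm y by rewrite normrN; have [] := coord_le y.
have c2 (y : T2) : `|(perp y).2| <= enorm y by have [] := coord_le y.
have i1 := mult_itg s1 gq dw measurable_perp1 c1.
have i2 := mult_itg s1 gq dw (@measurable_fst _ _ _ _) c2.
rewrite /velocity; congr (_, _).
  rewrite (imultiplier_Har x sw (measurable_funM measurable_perp1 mq) odd1 i1).
  by congr (_ * _).
rewrite (imultiplier_Har x sw (measurable_funM (@measurable_fst _ _ _ _) mq) odd2 i2).
by congr (_ * _).
Qed.

Lemma rhs_Har a s (w : T2 -> R) x : 2 < s -> 3 / 8 <= a -> a <= 1 / 2 -> Hs s w -> has_partials w ->
  - dotp (velocity a w x) (grad w x) = Har (bil (qm a) (U w) (U w)) x.
Proof.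
move=> s2 a0 a1 hw pw; have /HsE[sw dw] := hw.
rewrite (velocity_Har x (lt_trans (ltr1n _ 2) s2) a0 a1 sw dw).
rewrite (congr1 (grad ^~ x) (representation s2 hw pw)).
by rewrite (Har_grad x s2 dw) (Har_bil x s2 (goodq_qm a0 a1) dw dw).
Qed.

Lemma Hs_sub r f g : Hs r f -> Hs r g ->
  Hs r (f \- g) /\ Hnorm r (f \- g) = (wn (wt r) (fun x => U f x - U g x))%:E.
Proof.
move=> /HsE[sf df] /HsE[sg dg]; have sd := sqintB sf sg; have e := U_sub sf sg.
have dU := wdomB df dg.
have mU := (sqint_U sd).1; have [m1 _] := sqintB (sqint_U sf) (sqint_U sg).
have hd : Hs r (f \- g).
  apply/HsE; split; first exact: sd.
  apply: wdom_ae dU; [exact: measurable_wt|exact: mU|].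
  by apply: aeS e => x ->.
split; first exact: hd.
by rewrite (HnormE hd); congr EFin; exact: (wn_ae (measurable_wt _) mU m1 e).
Qed.

(** The derivative is taken one order lower because the nonlinearity loses one derivative. *)
Definition strong r T q h := [/\ dom_on (HW r) 0 T h, scont_on (HW r) 0 T h &
  sderiv_on (HW (r - 1)) 0 T h (fun t => bil q (h t) (h t))].

Lemma continuous_Hs_strong r T w : continuous_Hs r T w ->
  dom_on (HW r) 0 T (fun t => U (w t)) /\ scont_on (HW r) 0 T (fun t => U (w t)).
Proof.
move=> cw; split=> [t t01|t t01 e e0].
  by have [/HsE[_]] : Hs r (w t) /\ _ := cw t t01.
have [ht c] := cw t t01.
have : nbhs 0%E [set y : \bar R | (y < e%:E)%E].
  by apply: open_nbhs_nbhs; split; [exact: open_ereal_lt_ereal|rewrite /= lte_fin].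
move=> /c; rewrite nbhs_simpl /within /= => /nbhs_ballP[d /= d0 Hd].
exists (d / 2) => [|u u01 ut]; first by rewrite divr_gt0.
have := Hd u _ u01; rewrite -ball_normE /= distrC => /(_ (le_lt_trans ut _)).
have [hu _] := cw u u01; have [_ ->] := Hs_sub hu ht.
rewrite lte_fin hnormHW => H; apply: ltW; apply: H; by rewrite ltr_pdivrMr//; lra.
Qed.

(** The punctured filter within [[0, T]] gives one-sided quotients at 0 and [T], which is what
    [deriv_on] encodes. *)
Lemma quotient_deriv_on T (f g : R -> R) :
  (forall t, t \in `[0, T] ->
     (tau - t)^-1 * (f tau - f t) @[tau --> within `[0, T] t^'] --> g t) <->
  deriv_on 0 T f g.
Proof.
split=> H t t01.
  move=> e e0; have /cvgrPdist_le/(_ e e0) := H t t01.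
  rewrite /within /= => /nbhs_ballP[d /= d0 Hd].
  exists (d / 2) => [|u u01 ut]; first by rewrite divr_gt0.
  have [->|utn] := eqVneq u t; first by rewrite !subrr mul0r !subr0 normr0 mulr0.
  have ub : ball t d u.
    rewrite -ball_normE /= distrC; apply: le_lt_trans ut _; rewrite ltr_pdivrMr//; lra.
  have h := Hd u ub utn u01.
  have n0 : u - t != 0 by rewrite subr_eq0.
  have -> : f u - f t - (u - t) * g t = - ((u - t) * (g t - (u - t)^-1 * (f u - f t))).
    by field.
  by rewrite normrN normrM mulrC; apply: ler_wpM2r.
apply/cvgrPdist_le => e e0; have [d d0 Hd] := H t t01 e e0.
rewrite /within /=; apply/nbhs_ballP; exists d => //= u.
rewrite -ball_normE /= distrC => ut utn u01.
have n0 : u - t != 0 by rewrite subr_eq0.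
rewrite -(ler_pM2r (_ : 0 < `|u - t|)) ?normr_gt0// -normrM.
rewrite (_ : (g t - (u - t)^-1 * (f u - f t)) * (u - t) = - (f u - f t - (u - t) * g t)).
  by rewrite normrN; apply: Hd => //; exact: ltW.
by field.
Qed.

(** Injectivity of the transform, as a consequence of its isometry on L^2. *)
Lemma Har_eq0 s f : 1 < s -> wdom (wt s) f -> (forall x, Har f x = 0) ->
  {ae mu, forall x, f x = 0}.
Proof.
move=> s1 df f0; have [i _] := wt_itg s1 df.
have sf := wdom_sqint (le_trans ler01 (ltW s1)) df.
apply: (n2_eq0_ae sf); rewrite -(n2_U sf).
rewrite -n2_0; apply: (n2_ae (sqint_U sf).1); first exact: measurable_cst.
by apply: aeS (U_Har i sf) => x ->.
Qed.

Lemma bil_scont s T q h : 1 < s -> goodq q -> dom_on (HW (s + 1)) 0 T h ->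
  scont_on (HW (s + 1)) 0 T h ->
  dom_on (HW s) 0 T (fun t => bil q (h t) (h t)) /\
  scont_on (HW s) 0 T (fun t => bil q (h t) (h t)).
Proof.
move=> s1 gq dh ch; have [C C0 H] := bil_diff_est s1.
split=> [t t01|t t01 e e0]; first by have [] := H q (h t) (h t) gq (dh t t01) (dh t t01).
set A := hnorm (HW (s + 1)) (h t); have A0 : 0 <= A := hnorm_ge0 _ _.
pose B := C * (2 * A + 1) + 1.
have B0 : 0 < B by rewrite ltr_wpDl// mulr_ge0// addr_ge0// mulr_ge0.
have m0 : 0 < Num.min 1 (e / B) by rewrite lt_min ltr01 divr_gt0.
have [d d0 Hd] := ch t t01 _ m0; exists d => // u u01 ut.
have [_ k] := H q (h u) (h t) gq (dh u u01) (dh t t01).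
have := Hd u u01 ut; rewrite le_min => /andP[k1 k2].
rewrite hnormHW; apply: le_trans k _; rewrite -!hnormHW -/A.
have k3 : hnorm (HW (s + 1)) (h u) <= A + 1.
  have := hnorm_add (hdomB (dh u u01) (dh t t01)) (dh t t01); rewrite subrK => k3.
  by apply: le_trans k3 _; rewrite addrC lerD2l.
have -> : e = B * (e / B) by rewrite mulrCA divff ?mulr1// gt_eqF.
apply: ler_pM k2; [|exact: hnorm_ge0|].
  by rewrite mulr_ge0// addr_ge0 ?hnorm_ge0.
apply: (@le_trans _ _ (C * (2 * A + 1))); last by rewrite lerDl.
by apply: ler_wpM2l => //; lra.
Qed.

(* [h] and the primitive of its pointwise derivative have the same image under the injective
   family of functionals [Har _ x]. *)
Lemma weak_strong s T h (g : R -> T2 -> R) : 1 < s -> 0 <= T -> dom_on (HW s) 0 T h -> dom_on (HW s) 0 T g ->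
  scont_on (HW s) 0 T g ->
  (forall x, deriv_on 0 T (fun t => Har (h t) x) (fun t => Har (g t) x)) ->
  sderiv_on (HW s) 0 T h g.
Proof.
move=> s1 T0 dh dg cg hg; have [P [dP PP P0]] := sprimitive T0 dg cg.
have d0 : 0 <= (0 : R) <= T by rewrite lexx.
have key t : 0 <= t <= T -> {ae mu, forall x, (P t - (h t - h 0)) x = 0}.
  move=> /andP[t0 tT]; have tt : 0 <= t <= T by rewrite t0.
  have dht := hdomB (dh t tt) (dh 0 d0).
  apply: (Har_eq0 s1 (hdomB (dP t tt) dht)) => x.
  have bl := Har_bounded_linear x s1.
  have dPx := sderiv_on_linear bl dP dg PP.
  have D := deriv_on_sub (lexx 0) tT (deriv_onB dPx (hg x)).
  have := deriv_on_norm_le (c := 0) t0 D; rewrite /= mul0r => k.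
  have {}k : `|Har (P t) x - Har (h t) x - (Har (P 0) x - Har (h 0) x)| <= 0.
    by apply: k => u _; rewrite subrr normr0.
  move: k; rewrite normr_le0 => /eqP k.
  have [_ _ _ lb] := bl; have l0 : Har (P 0) x = 0.
    have := lb (P 0) (dP 0 d0); rewrite P0 hnorm0 mulr0 normr_le0 => /eqP; exact.
  rewrite (bounded_linearB bl (dP t tt) dht) (bounded_linearB bl (dh t tt) (dh 0 d0)).
  by move: k; rewrite l0; lra.
move=> t t01 e e0; have [d dd Hd] := PP t t01 e e0; exists d => // u u01 ut.
have := Hd u u01 ut; rewrite !hnormHW; congr (_ <= _).
have m1 := wdom_meas (measurable_wt _) (wt_gt0 _) (hdomB (hdomB (dP u u01) (dP t t01)) (hdomZ (u - t) (dg t t01))).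
have m2 := wdom_meas (measurable_wt _) (wt_gt0 _) (hdomB (hdomB (dh u u01) (dh t t01)) (hdomZ (u - t) (dg t t01))).
apply: (wn_ae (measurable_wt s) m1 m2).
apply: aeS2 (key u u01) (key t t01) => x.
rewrite !fctE; lra.
Qed.

Lemma solution_strong r T a (w0 : T2 -> R) w : 3 < r -> 0 <= T -> 3 / 8 <= a -> a <= 1 / 2 ->
  gsqg_solution a r T w0 w -> strong r T (qm a) (fun t => U (w t)).
Proof.
move=> r3 T0 a0 a1 [cw _ pw ew]; have [dh ch] := continuous_Hs_strong cw.
split=> //; have gq := goodq_qm a0 a1; have s1 : 1 < r - 1 by lra.
have r2 : 2 < r by lra.
have rE : r - 1 + 1 = r by rewrite subrK.
have [dg cg] : dom_on (HW (r - 1)) 0 T (fun t => bil (qm a) (U (w t)) (U (w t))) /\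
  scont_on (HW (r - 1)) 0 T (fun t => bil (qm a) (U (w t)) (U (w t))).
  by apply: (bil_scont s1 gq); rewrite rE; [exact: dh|exact: ch].
apply: (weak_strong s1 T0 _ dg cg) => [t t01|x].
  by apply: (wdom_wt _ (dh t t01)); rewrite lerBlDr lerDl.
apply/quotient_deriv_on => t t01.
have hw u : u \in `[0, T] -> Hs r (w u) by move=> /cw[].
rewrite -(rhs_Har x r2 a0 a1 (hw t t01) (pw t t01)).
have rep u (u01 : u \in `[0, T]) : w u x = Har (U (w u)) x.
  exact: (congr1 (fun f => f x) (representation r2 (hw u u01) (pw u u01))).
apply: cvg_trans (ew t x t01); apply: near_eq_cvg.
apply: filterS (withinT _ _) => u u01.
by rewrite (rep u u01) (rep t t01).
Qed.

Lemma U_HarK s f : 1 < s -> wdom (wt s) f ->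
  sqint (Har f) /\ {ae mu, forall x, U (Har f) x = f x}.
Proof.
move=> s1 df; have [i _] := wt_itg s1 df.
have sf := wdom_sqint (le_trans ler01 (ltW s1)) df; have [sH _] := Har_bessel i sf.
split; first exact: sH.
have e : {ae mu, forall x, Har f x = U f x} by apply: aeS (U_Har i sf) => x ->.
by apply: aeS2 (U_eq_ae sH (sqint_U sf) e) (UU sf) => x -> ->.
Qed.

(** Evaluation at a point is a bounded functional on H^(r-1), so it carries the derivative in that
    space to the pointwise time derivative. *)
Lemma strong_solution r T a (w0 : T2 -> R) h : 3 < r -> 0 <= T -> 3 / 8 <= a -> a <= 1 / 2 ->
  sqint w0 -> {ae mu, forall x, h 0 x = U w0 x} -> strong r T (qm a) h ->
  gsqg_solution a r T w0 (fun t => Har (h t)).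
Proof.
move=> r3 T0 a0 a1 sw h0 [dh ch eh].
have r1 : 1 < r by lra. have r2 : 2 < r by lra. have s1 : 1 < r - 1 by lra.
have gq := goodq_qm a0 a1; have [mq _ _ _] := gq.
have rE : r - 1 + 1 = r by rewrite subrK.
have mh t : 0 <= t <= T -> measurable_fun setT (h t).
  by move=> t01; exact: (wdom_meas (measurable_wt r) (wt_gt0 r) (dh t t01)).
have hs t : 0 <= t <= T -> Hs r (Har (h t)).
  move=> t01; have [sH e] := U_HarK r1 (dh t t01); apply/HsE; split; first exact: sH.
  apply: wdom_ae (dh t t01); [exact: measurable_wt|exact: (sqint_U sH).1|].
  by apply: aeS e => x ->.
have d0 : 0 <= (0 : R) <= T by rewrite lexx.
split.
- move=> t t01; split; first exact: hs.
  have E u : 0 <= u <= T ->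
      Hnorm r (Har (h u) \- Har (h t)) = (hnorm (HW r) (h u - h t))%:E.
    move=> u01; have [_ ->] := Hs_sub (hs u u01) (hs t t01); rewrite hnormHW; congr EFin.
    have [sH1 e1] := U_HarK r1 (dh u u01); have [sH2 e2] := U_HarK r1 (dh t t01).
    apply: wn_ae; [exact: measurable_wt| | |].
    + by case: (sqintB (sqint_U sH1) (sqint_U sH2)).
    + by apply: measurable_funB; exact: mh.
    + by apply: aeS2 e1 e2 => x -> ->.
  have c : (hnorm (HW r) (h u - h t)) @[u --> within `[0, T] (nbhs t)] --> (0 : R).
    apply/cvgrPdist_le => e e0; have [d dd Hd] := ch t t01 e e0.
    rewrite /within /=; apply/nbhs_ballP; exists d => //= u.
    rewrite -ball_normE /= distrC => ut u01.
    by rewrite sub0r normrN ger0_norm ?hnorm_ge0// Hd// ltW.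
  have {}c : (EFin (hnorm (HW r) (h u - h t))) @[u --> within `[0, T] (nbhs t)] --> 0%E.
    by apply/fine_cvgP; split; [exact: nearW|exact: c].
  apply: cvg_trans c; apply: near_eq_cvg; apply: filterS (withinT _ _) => u u01.
  by rewrite (E u u01).
- have [i _] := wt_itg r1 (dh 0 d0).
  have sU := sqint_U sw; have iU : itg (U w0).
    exact: (itg_ae sU.1 h0 i).
  have e1 := UU sw; have e2 := U_Har iU sU.
  have e : forall x, Har (h 0) x = Har (U w0) x.
    by move=> x; exact: (Har_ae x (mh 0 d0) sU.1 h0).
  by apply: aeS2 e1 e2 => x k1 k2; rewrite e -k2 k1.
- by move=> t t01; exact: (Har_has_partials r2 (dh t t01)).
- move=> t x t01; rewrite (rhs_Har x r2 a0 a1 (hs t t01) (Har_has_partials r2 (dh t t01))).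
  have [sH1 e1] := U_HarK r1 (dh t t01).
  rewrite (bil_ae mq (sqint_U sH1).1 (mh t t01) (sqint_U sH1).1 (mh t t01) e1 e1).
  have dh' : dom_on (HW (r - 1)) 0 T h.
    by move=> u u01; apply: (wdom_wt _ (dh u u01)); rewrite lerBlDr lerDl.
  have [dg cg] : dom_on (HW (r - 1)) 0 T (fun t => bil (qm a) (h t) (h t)) /\
    scont_on (HW (r - 1)) 0 T (fun t => bil (qm a) (h t) (h t)).
    by apply: (bil_scont s1 gq); rewrite rE; [exact: dh|exact: ch].
  have D := sderiv_on_linear (Har_bounded_linear x s1) dh' dg eh.
  exact: ((quotient_deriv_on T _ _).2 D t t01).
Qed.

End Equivalence.

(** * Stability and uniqueness *)

Section Stability.
Context {R : realType}.
Notation mu := (@mu2 R).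
Notation T2 := (plane R).
Implicit Types (q : T2 -> R) (a s r t T : R).

Lemma omega_wt r : omega r 0 = wt r :> (T2 -> R).
Proof. by apply/funext => x; exact: omega0. Qed.

Lemma wt_wt1 r : (fun x : T2 => wt 1 x * wt r x) = wt (r + 1).
Proof. by apply/funext => x; rewrite -wtD addrC. Qed.

Lemma wip_ae r (f g g' : T2 -> R) : measurable_fun setT f -> measurable_fun setT g ->
  measurable_fun setT g' -> {ae mu, forall x, g x = g' x} ->
  hip (HW r) f g = hip (HW r) f g'.
Proof.
move=> mf mg mg' e; have mw := @measurable_wt R r.
apply: ae_Rintegral; [by do !apply: measurable_funM..|].
by apply: aeS e => x ->.
Qed.

Lemma HW_meas r (f : T2 -> R) : wdom (wt r) f -> measurable_fun setT f.
Proof. exact: (wdom_meas (measurable_wt r) (wt_gt0 r)). Qed.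

(** With [d = f - g] the difference is [bil q f d + bil q d g]. The energy estimate handles the
    first term with [f] in H^s; the product estimate handles the second with [g] in H^(s+1). Because
    of this asymmetry the known solution alone carries the higher norm in the bound. *)
Lemma bil_energy_diff s : 2 < s -> exists2 C : R, 0 <= C & forall q (f g : T2 -> R), goodq q ->
  wdom (wt (s + 1)) f -> wdom (wt (s + 1)) g ->
  [/\ wdom (wt s) (bil q f f), wdom (wt s) (bil q g g) &
  `|hip (HW s) (f - g) (bil q f f - bil q g g)| <=
  C * (wn (wt s) f + wn (wt (s + 1)) g) * hnorm (HW s) (f - g) ^+ 2].
Proof.
move=> s2; have s1 : 1 < s by lra. have s1' : 1 <= s := ltW s1.
have aux (C1 C2 x y : R) : 0 <= C1 * y -> 0 <= C2 * x ->
  2 * C1 * x + C2 * y <= (2 * C1 + C2) * (x + y) by lra.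
have [C1 C10 H1] := @bil_energy R s s s2 s1'; have [C2 C20 H2] := @bil_bound0 R s s1.
exists (2 * C1 + C2) => [|q f g gq hf hg]; first by rewrite addr_ge0// mulr_ge0.
have le : s <= s + 1 by rewrite lerDl.
pose d : T2 -> R := f - g; have hd : wdom (wt (s + 1)) d := wdomB hf hg.
have [hf' hg' hd'] := And3 (wdom_wt le hf) (wdom_wt le hg) (wdom_wt le hd).
have [_ b1 _] := H2 q f f gq hf' hf; have [_ b2 _] := H2 q g g gq hg' hg.
have [_ b3 _] := H2 q f d gq hf' hd; have [_ b4 n4] := H2 q d g gq hd' hg.
split; [exact: b1|exact: b2|].
have e := bil_diff s1 gq hf hg.
rewrite (@wip_ae s d _ (bil q f d + bil q d g) _ _ _ e); last 3 first.
- exact: HW_meas hd'.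
- exact: HW_meas (@hdomB _ _ (HW s) _ _ b1 b2).
- exact: HW_meas (@hdomD _ _ (HW s) _ _ b3 b4).
rewrite (hipDr (H := HW s) b3 b4 hd'); apply: le_trans (ler_normD _ _) _.
have k1 : `|hip (HW s) d (bil q f d)| <= 2 * C1 * wn (wt s) f * hnorm (HW s) d ^+ 2.
  have := H1 0 q f d (lexx _) gq hf'; rewrite !omega_wt wt_wt1 => /(_ hf' hd' hd).
  rewrite (hipC (HW s)) (hnormHW s d) => k; apply: le_trans k _.
  by rewrite le_eqVlt; apply/orP; left; apply/eqP; ring.
have k2 : `|hip (HW s) d (bil q d g)| <= C2 * wn (wt (s + 1)) g * hnorm (HW s) d ^+ 2.
  apply: le_trans (hcauchy (H := HW s) hd' b4) _; rewrite hnormHW.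
  have := ler_wpM2l (hnorm_ge0 (HW s) d) n4; rewrite -hnormHW -[wn (wt s) d]hnormHW.
  move=> k; apply: le_trans k _.
  by rewrite le_eqVlt; apply/orP; left; apply/eqP; ring.
have p1 := hnorm_ge0 (HW s) f; rewrite hnormHW in p1.
have p2 := hnorm_ge0 (HW (s + 1)) g; rewrite hnormHW in p2.
have p3 : 0 <= hnorm (HW s) d ^+ 2 by exact: sqr_ge0.
have p4 := mulr_ge0 C10 p2; have p5 := mulr_ge0 C20 p1.
apply: le_trans (lerD k1 k2) _; rewrite -mulrDl; apply: ler_wpM2r => //.
exact: aux p4 p5.
Qed.

(** Here [f] and [g] solve the equation up to residuals, whose difference is at most [eta]. One
    statement thus covers the truncation error, the change of symbol and uniqueness. The [1] in the
    rate absorbs [2 eta n <= eta^2 + n^2], where [n] is the distance. *)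
Lemma stability s : 2 < s -> exists2 C : R, 0 <= C &
  forall q T (f g f' g' : R -> T2 -> R) (B eta : R), goodq q -> 0 <= B ->
  dom_on (HW (s + 1)) 0 T f -> dom_on (HW (s + 1)) 0 T g ->
  dom_on (HW s) 0 T f' -> dom_on (HW s) 0 T g' ->
  sderiv_on (HW s) 0 T f f' -> sderiv_on (HW s) 0 T g g' ->
  (forall t, 0 <= t <= T -> [/\ wn (wt s) (f t) <= B, wn (wt (s + 1)) (g t) <= B &
    hnorm (HW s) ((f' t - bil q (f t) (f t)) - (g' t - bil q (g t) (g t))) <= eta]) ->
  forall t, 0 <= t <= T -> hnorm (HW s) (f t - g t) ^+ 2 <=
    expR ((C * B + 1) * t) * (hnorm (HW s) (f 0 - g 0) ^+ 2 + eta ^+ 2 * t).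
Proof.
move=> s2; have [C C0 H] := bil_energy_diff s2; exists (4 * C) => [|q T f g f' g' B eta]; first exact: mulr_ge0.
move=> gq B0 df dg df' dg' ff gg bd t /andP[t0 tT].
have le : s <= s + 1 by rewrite lerDl.
have sub u : 0 <= u <= t -> 0 <= u <= T by move=> /andP[-> /le_trans]; apply.
have dd : dom_on (HW s) 0 T (fun u => f u - g u).
  by move=> u uT; apply: hdomB; [exact: (wdom_wt le (df u uT))|exact: (wdom_wt le (dg u uT))].
have dd' : dom_on (HW s) 0 T (fun u => f' u - g' u).
  by move=> u uT; apply: hdomB; [exact: df'|exact: dg'].
have dfs : dom_on (HW s) 0 T f by move=> u uT; exact: (wdom_wt le (df u uT)).
have dgs : dom_on (HW s) 0 T g by move=> u uT; exact: (wdom_wt le (dg u uT)).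
have hd := sderiv_onB dfs df' dgs dg' ff gg.
have D := deriv_on_sub (lexx 0) tT (sderiv_on_sqr dd dd' hd).
rewrite !hnorm_sqr; apply: (gronwall t0 _ (sqr_ge0 eta) D) => [|u /sub uT].
  by rewrite addr_ge0// !mulr_ge0.
have [b1 b2 b3] := bd u uT; have [c1 c2 c3] := H q _ _ gq (df u uT) (dg u uT).
rewrite -hnorm_sqr.
have c12 : hdom (HW s) (bil q (f u) (f u) - bil q (g u) (g u)) by exact: hdomB.
have -> : f' u - g' u = (bil q (f u) (f u) - bil q (g u) (g u)) +
  ((f' u - bil q (f u) (f u)) - (g' u - bil q (g u) (g u))).
  by apply/funext => x; rewrite !fctE; ring.
have dE : hdom (HW s) ((f' u - bil q (f u) (f u)) - (g' u - bil q (g u) (g u))).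
  by apply: hdomB; apply: hdomB => //; [exact: df'|exact: dg'].
rewrite (hipDr c12 dE (dd u uT)).
have k1 := le_trans (ler_norm _) c3.
have k2 := le_trans (ler_norm _) (hcauchy (dd u uT) dE).
have N0 := hnorm_ge0 (HW s) (f u - g u); have e0 := hnorm_ge0 (HW s) (f' u - bil q (f u) (f u) - (g' u - bil q (g u) (g u))).
have k3 := ler_wpM2l N0 b3.
have k4 : C * (wn (wt s) (f u) + wn (wt (s + 1)) (g u)) * hnorm (HW s) (f u - g u) ^+ 2 <=
  C * (B + B) * hnorm (HW s) (f u - g u) ^+ 2.
  by apply: (ler_wpM2r (sqr_ge0 _) (ler_wpM2l C0 (lerD b1 b2))).
have k5 := sqr_ge0 (hnorm (HW s) (f u - g u) - eta).
move: (hip (HW s) _ _) (hip (HW s) _ _) k1 k2 => x y k1 k2.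
move: k1 k2 k3 k4 k5; move: (C * _ * _) (_ * hnorm _ (_ - _ - _)) => p p'.
move: (hnorm _ (f u - g u)) => n k1 k2 k3 k4 k5.
have -> : (4 * C * B + 1) * n ^+ 2 + eta ^+ 2 = 2 * (C * (B + B) * n ^+ 2) + (n - eta) ^+ 2 + 2 * (n * eta) by ring.
lra.
Qed.

Lemma scont_norm (V : lmodType R) (H : semiHilbert V) T (f : R -> V) : dom_on H 0 T f ->
  scont_on H 0 T f -> cont_on 0 T (fun t => hnorm H (f t)).
Proof.
move=> df cf t t01 e e0; have [d d0 Hd] := cf t t01 e e0; exists d => // u u01 ut.
exact: le_trans (hnorm_sub (df u u01) (df t t01)) (Hd u u01 ut).
Qed.

Lemma scont_bounded r T (f : R -> T2 -> R) : 0 <= T -> dom_on (HW r) 0 T f ->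
  scont_on (HW r) 0 T f -> exists2 B : R, 0 <= B & forall t, 0 <= t <= T -> wn (wt r) (f t) <= B.
Proof.
move=> T0 df cf; have := EVT_max T0 (cont_on_within T0 (scont_norm df cf)).
move=> [c c01 Hc]; exists (hnorm (HW r) (f c)) => [|t t01]; first exact: hnorm_ge0.
by have := Hc t t01; rewrite hnormHW.
Qed.

Lemma HW_mono a b (f : T2 -> R) : a <= b -> hdom (HW b) f -> hnorm (HW a) f <= hnorm (HW b) f.
Proof. by move=> ab df; rewrite !hnormHW; exact: wn_wt. Qed.

Lemma dom_on_wt a b T (f : R -> T2 -> R) : a <= b -> dom_on (HW b) 0 T f -> dom_on (HW a) 0 T f.
Proof. by move=> ab df t t01; exact: (wdom_wt ab (df t t01)). Qed.

Lemma sderiv_on_wt a b T (f g : R -> T2 -> R) : a <= b -> dom_on (HW b) 0 T f ->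
  dom_on (HW b) 0 T g -> sderiv_on (HW b) 0 T f g -> sderiv_on (HW a) 0 T f g.
Proof.
move=> ab df dg fg t t01 e e0; have [d d0 Hd] := fg t t01 e e0; exists d; [exact: d0|move=> u u01 ut].
apply: (le_trans _ (Hd u u01 ut)); apply: (HW_mono ab).
exact: (@hdomB _ _ (HW b) _ _ (@hdomB _ _ (HW b) _ _ (df u u01) (df t t01))
  (@hdomZ _ _ (HW b) _ _ (dg t t01))).
Qed.

Lemma scont_on_wt a b T (f : R -> T2 -> R) : a <= b -> dom_on (HW b) 0 T f ->
  scont_on (HW b) 0 T f -> scont_on (HW a) 0 T f.
Proof.
move=> ab df cf t t01 e e0; have [d d0 Hd] := cf t t01 e e0; exists d; [exact: d0|move=> u u01 ut].
apply: (le_trans _ (Hd u u01 ut)); apply: (HW_mono ab).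
exact: (@hdomB _ _ (HW b) _ _ (df u u01) (df t t01)).
Qed.

Lemma strong_sderiv r s T q (h : R -> T2 -> R) : s <= r - 1 -> 1 < s -> goodq q -> strong r T q h ->
  [/\ dom_on (HW (s + 1)) 0 T h, dom_on (HW s) 0 T (fun t => bil q (h t) (h t)) &
  sderiv_on (HW s) 0 T h (fun t => bil q (h t) (h t))].
Proof.
move=> sr s1 gq [dh ch eh].
have rE : r - 1 + 1 = r by rewrite subrK.
have r1 : 1 < r - 1 by exact: lt_le_trans s1 sr.
have [dg _] : dom_on (HW (r - 1)) 0 T (fun t => bil q (h t) (h t)) /\
    scont_on (HW (r - 1)) 0 T (fun t => bil q (h t) (h t)).
  by apply: (bil_scont r1 gq); rewrite rE; [exact: dh|exact: ch].
have rr : r - 1 <= r by rewrite lerBlDr lerDl.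
split.
- by apply: dom_on_wt dh; rewrite -lerBrDr.
- exact: dom_on_wt sr dg.
- exact: sderiv_on_wt sr (dom_on_wt rr dh) dg eh.
Qed.

Lemma uniqueness s T q (f g : R -> T2 -> R) : 2 < s -> 0 <= T -> goodq q ->
  strong (s + 2) T q f -> strong (s + 2) T q g -> {ae mu, forall x, f 0 x = g 0 x} ->
  forall t, 0 <= t <= T -> {ae mu, forall x, f t x = g t x}.
Proof.
move=> s2 T0 gq Sf Sg fg0 t t01; have s1 : 1 < s by lra.
have le : s <= s + 2 - 1 by lra. have le2 : s <= s + 2 by lra.
have le1 : s + 1 <= s + 2 by rewrite lerD2l; lra.
have [df db ff] := strong_sderiv le s1 gq Sf; have [dg db' gg] := strong_sderiv le s1 gq Sg.
have [C C0 H] := stability s2; have [df2 cf _] := Sf; have [dg2 cg _] := Sg.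
have [B1 B10 HB1] := scont_bounded T0 (dom_on_wt le2 df2) (scont_on_wt le2 df2 cf).
have [B2 B20 HB2] := scont_bounded T0 dg (scont_on_wt le1 dg2 cg).
have bd u : 0 <= u <= T -> [/\ wn (wt s) (f u) <= B1 + B2, wn (wt (s + 1)) (g u) <= B1 + B2 &
    hnorm (HW s) ((bil q (f u) (f u) - bil q (f u) (f u)) -
      (bil q (g u) (g u) - bil q (g u) (g u))) <= 0].
  move=> u01; split; first by apply: le_trans (HB1 u u01) _; rewrite lerDl.
    by apply: le_trans (HB2 u u01) _; rewrite lerDr.
  by rewrite !subrr hnorm0.
have := H q T f g _ _ (B1 + B2) 0 gq (addr_ge0 B10 B20) df dg db db' ff gg bd t t01.
have d00 : 0 <= (0 : R) <= T by rewrite lexx.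
have -> : hnorm (HW s) (f 0 - g 0) = 0.
  rewrite hnormHW -(wn_ae (measurable_wt s) (@measurable_cst _ _ _ _ setT (0 : R)) (HW_meas (hdomB (df 0 d00) (dg 0 d00)))).
    by rewrite -hnormHW hnorm0.
  by apply: aeS fg0 => x; rewrite !fctE => ->; rewrite subrr.
rewrite expr0n /= mul0r addr0 mulr0 => k.
have {k} : hnorm (HW s) (f t - g t) = 0.
  by apply/eqP; rewrite -sqrf_eq0 eq_le k sqr_ge0.
rewrite hnormHW => /n2_eq0_ae.
have le0 : s <= s + 1 by rewrite lerDl.
have sd := wdom_wt le0 (hdomB (df t t01) (dg t t01)).
move=> /(_ sd); apply: aeS => x /eqP; rewrite mulf_eq0 gt_eqF ?wt_gt0//= subr_eq0 => /eqP.
exact.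
Qed.

End Stability.

(** * Galerkin approximation *)

Section Radial.
Context {R : realType} {V : lmodType R} (H : semiHilbert V) (r : R).
Hypothesis r0 : 0 < r.
Implicit Types x y : V.

(** The retraction onto the ball of radius [r]: after it, a quadratic field bounded on truncated
    functions is globally Lipschitz. *)
Definition radial x : V := (r / Num.max r (hnorm H x)) *: x.

Lemma radial_max x : 0 < Num.max r (hnorm H x). Proof. by rewrite lt_max r0. Qed.

Lemma radial_dom x : hdom H x -> hdom H (radial x). Proof. exact: hdomZ. Qed.

Lemma radial_id x : hnorm H x <= r -> radial x = x.
Proof. by move=> xr; rewrite /radial max_l// divff ?scale1r// gt_eqF. Qed.

Lemma radial_norm x : hdom H x -> hnorm H (radial x) <= r.
Proof.
move=> dx; rewrite hnormZ// ger0_norm; last by rewrite ltW// divr_gt0// radial_max.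
rewrite mulrAC ler_pdivrMr ?radial_max//; apply: ler_wpM2l; first exact: ltW.
by rewrite le_max lexx orbT.
Qed.

Lemma radial_lip x y : hdom H x -> hdom H y ->
  hnorm H (radial x - radial y) <= 2 * hnorm H (x - y).
Proof.
move=> dx dy; set a := Num.max r (hnorm H x); set b := Num.max r (hnorm H y).
have a0 : 0 < a := radial_max x. have b0 : 0 < b := radial_max y.
have dxy := hdomB dx dy.
have -> : radial x - radial y = (r / a) *: (x - y) + (r / a * ((b - a) / b)) *: y.
  rewrite /radial -/a -/b scalerBr -addrA; congr (_ + _).
  have cE : - (r / b) = - (r / a) + r / a * ((b - a) / b) by field; rewrite !gt_eqF.
  by rewrite -[LHS]scaleNr cE scalerDl scaleNr.
apply: le_trans (hnorm_add (hdomZ _ dxy) (hdomZ _ dy)) _; rewrite !hnormZ//.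
have ra : `|r / a| <= 1.
  rewrite ger0_norm; last by rewrite divr_ge0 ?ltW.
  by rewrite ler_pdivrMr// mul1r le_max lexx.
have ab : `|b - a| <= hnorm H (x - y).
  apply: le_trans (hnorm_sub dx dy); rewrite distrC /a /b.
  move: (hnorm H x) (hnorm H y) => u v.
  have [h1|h1] := leP r u; have [h2|h2] := leP r v.
  - by [].
  - by rewrite !ger0_norm; lra.
  - by rewrite !ler0_norm; lra.
  - by rewrite subrr normr0.
have yb : hnorm H y <= b by rewrite le_max lexx orbT.
have N0 := hnorm_ge0 H (x - y); have Ny := hnorm_ge0 H y.
have k1 : `|r / a| * hnorm H (x - y) <= hnorm H (x - y) by rewrite ler_piMl.
have k2 : `|r / a * ((b - a) / b)| * hnorm H y <= hnorm H (x - y).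
  rewrite normrM -mulrA; apply: (@le_trans _ _ (1 * (`|(b - a) / b| * b))).
    apply: (ler_pM _ _ ra (ler_wpM2l _ yb)); rewrite ?normr_ge0//.
    exact: mulr_ge0.
  by rewrite mul1r normrM normfV (gtr0_norm b0) divfK// gt_eqF.
by apply: le_trans (lerD k1 k2) _; lra.
Qed.

End Radial.

Section Galerkin.
Context {R : realType}.
Notation mu := (@mu2 R).
Notation T2 := (plane R).
Implicit Types (q f g h : T2 -> R) (a b s r t T : R) (N : nat).

Lemma trunc_trunc N f : trunc N (trunc N f) = trunc N f.
Proof.
apply/funext => x; rewrite /trunc indicE.
by case: (_ \in _); rewrite ?mulr1 ?mulr0.
Qed.

Lemma trunc_mul N f g (x : T2) : trunc N f x * g x = f x * trunc N g x.
Proof. by rewrite /trunc mulrAC mulrA. Qed.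

Lemma truncD N f g : trunc N (f + g) = trunc N f + trunc N g.
Proof. by apply/funext => x; rewrite /trunc !fctE mulrDl. Qed.

Lemma truncZ N (c : R) f : trunc N (c *: f) = c *: trunc N f.
Proof. by apply/funext => x; rewrite /trunc !fctE -mulrA. Qed.

Lemma truncB N f g : trunc N (f - g) = trunc N f - trunc N g.
Proof. by rewrite -scaleN1r truncD truncZ scaleN1r. Qed.

Lemma wdom_trunc N om f : wdom om f -> wdom om (trunc N f) /\ wn om (trunc N f) <= wn om f.
Proof.
move=> df; have E : (fun x => om x * trunc N f x) = trunc N (fun x => om x * f x).
  by apply/funext => x; rewrite /trunc mulrA.
rewrite /wdom /wn E; split; first exact: sqint_trunc.
by apply: n2_le; [exact: sqint_trunc|exact: df|exact: trunc_le].
Qed.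

(** The maximum of [<x>^b], for [b >= 0], on the disk of radius [N]. *)
Definition truncC N b : R := (1 + N%:R ^+ 2) `^ (b / 2).

Lemma truncC_ge0 N b : 0 <= truncC N b. Proof. exact: powR_ge0. Qed.

Lemma disk_wt N b (x : T2) : 0 <= b -> wt b x * \1_(disk N) x <= truncC N b.
Proof.
move=> b0; rewrite indicE; case: (boolP (x \in _)); last by rewrite mulr0 truncC_ge0.
rewrite inE /disk /= mulr1 => xN; rewrite /wt /truncC ge0_ler_powR ?nnegrE//.
- exact: divr_ge0.
- exact: ltW (jap_gt0 x).
- by rewrite /jap -enorm_sqr lerD2l lerXn2r ?nnegrE ?enorm_ge0.
Qed.

Lemma trunc_smooth N b f : 0 <= b -> wdom (wt 0) f ->
  wdom (wt b) (trunc N f) /\ hnorm (HW b) (trunc N f) <= truncC N b * hnorm (HW 0) f.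
Proof.
move=> b0 df; rewrite !hnormHW.
pose om x := wt b x * \1_(disk N) x.
have mD : measurable_fun setT (\1_(disk N) : T2 -> R) by apply: measurable_indic; exact: measurable_disk.
have mo : measurable_fun setT om by apply: measurable_funM mD; exact: measurable_wt.
have le x : `|om x| <= truncC N b * wt 0 x.
  by rewrite wt0 mulr1 ger0_norm ?mulr_ge0 ?wt_ge0//; exact: disk_wt.
have := wdom_le mo (@measurable_wt R 0) (@wt_gt0 R 0) le (truncC_ge0 N b) df.
rewrite /wdom /wn; have -> : (fun x => om x * f x) = (fun x => wt b x * trunc N f x); last by [].
by apply/funext => x; rewrite /om /trunc -mulrA [f x * _]mulrC.
Qed.

(** Outside the disk [<x> >= N], so a spare derivative buys the factor [1 / N]. *)
Lemma trunc_tail N a f : (0 < N)%N -> wdom (wt (a + 1)) f ->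
  wdom (wt a) (f - trunc N f) /\ hnorm (HW a) (f - trunc N f) <= N%:R^-1 * wn (wt (a + 1)) f.
Proof.
move=> N0 df; rewrite hnormHW; have n0 : (0 : R) < N%:R by rewrite ltr0n.
pose om x := wt a x * (1 - \1_(disk N) x).
have mD : measurable_fun setT (\1_(disk N) : T2 -> R) by apply: measurable_indic; exact: measurable_disk.
have mo : measurable_fun setT om.
  by apply: measurable_funM; [exact: measurable_wt|exact: measurable_funB].
have le x : `|om x| <= N%:R^-1 * wt (a + 1) x.
  rewrite /om normrM (ger0_norm (wt_ge0 a x)) wtD mulrCA; apply: ler_wpM2l; first exact: wt_ge0.
  rewrite indicE mulrC ler_pdivlMr//; case: (boolP (x \in _)) => xN.
    by rewrite subrr normr0 mul0r wt_ge0.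
  rewrite subr0 normr1 mul1r; apply: le_trans (enorm_wt1 x).
  by move: xN; rewrite notin_setE /disk /= => /negP; rewrite -ltNge => /ltW.
have i0 : 0 <= N%:R^-1 :> R by rewrite invr_ge0 ltW.
have := wdom_le mo (@measurable_wt R (a + 1)) (@wt_gt0 R (a + 1)) le i0 df.
rewrite /wdom /wn; have -> : (fun x => om x * f x) = (fun x => wt a x * (f - trunc N f) x); last by [].
by apply/funext => x; rewrite /om /trunc !fctE; ring.
Qed.

(** Picard's theorem applies once the field is truncated in frequency and, by [radial], in L^2 norm.
    Antisymmetry conserves the L^2 norm, which therefore stays below [r], and the second truncation
    is never active. *)
Lemma galerkin q N T h0 : goodq q -> 0 <= T -> wdom (wt 0) h0 -> exists G : R -> T2 -> R,
  [/\ G 0 = trunc N h0, forall t, 0 <= t <= T -> trunc N (G t) = G t,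
      forall b, 0 <= b -> dom_on (HW b) 0 T G &
      forall b, 0 <= b -> sderiv_on (HW b) 0 T G (fun t => trunc N (bil q (G t) (G t)))].
Proof.
move=> gq T0 dh0; pose r := hnorm (HW 0) h0 + 1.
have r0 : 0 < r by rewrite ltr_wpDl// hnorm_ge0.
pose J := trunc N : (T2 -> R) -> T2 -> R; pose H0 := @HW R 0.
have JH f : hdom H0 f -> hdom H0 (J f) /\ hnorm H0 (J f) <= hnorm H0 f.
  by move=> df; rewrite !hnormHW; exact: wdom_trunc.
pose P f : T2 -> R := radial H0 r (J f).
have JP f : J (P f) = P f by rewrite /P /radial /J truncZ trunc_trunc.
have dP f : hdom H0 f -> hdom H0 (P f) by move=> /JH[df _]; exact: radial_dom.
pose F f := J (bil q (P f) (P f)).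
have [C C0 HC] := @bil_diff_est R 2 (ltr1n _ 2).
have l3 : 0 <= 2 + 1 :> R by [].
have dP3 f : hdom H0 f -> wdom (wt (2 + 1)) (P f) /\ wn (wt (2 + 1)) (P f) <= truncC N (2 + 1) * r.
  move=> df; have [k1 k2] := trunc_smooth N l3 (dP f df); rewrite -/J JP in k1 k2.
  split; first exact: k1.
  rewrite -hnormHW; apply: le_trans k2 _; apply: (ler_wpM2l (truncC_ge0 _ _)).
  by apply: radial_norm => //; have [] := JH f df.
have dB2 f : hdom H0 f -> wdom (wt 2) (bil q (P f) (P f)).
  by move=> df; have [k _] := dP3 f df; have [] := HC q _ _ gq k k.
have le02 : (0 : R) <= 2 by [].
have dB f : hdom H0 f -> hdom H0 (bil q (P f) (P f)).
  by move=> /dB2 k; exact: (wdom_wt le02 k).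
have dF f : hdom H0 f -> hdom H0 (F f) by move=> /dB/JH[].
pose c := truncC N (2 + 1) : R; have c0 : 0 <= c := truncC_ge0 _ _.
pose L := C * (c * r + c * r) * (c * 2) + 1.
have L0 : 0 < L by rewrite ltr_wpDl// !mulr_ge0// ?addr_ge0 ?mulr_ge0// ltW.
have lipF f g : hdom H0 f -> hdom H0 g -> hnorm H0 (F f - F g) <= L * hnorm H0 (f - g).
  move=> df dg; have [k1 k1'] := dP3 f df; have [k2 k2'] := dP3 g dg.
  have [_ est] := HC q _ _ gq k1 k2.
  have dfg := hdomB df dg.
  rewrite /F /J -truncB.
  apply: le_trans (JH _ (hdomB (dB f df) (dB g dg))).2 _.
  apply: (@le_trans _ _ (hnorm (HW 2) (bil q (P f) (P f) - bil q (P g) (P g)))).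
    exact: HW_mono le02 (@hdomB _ _ (HW 2) _ _ (dB2 f df) (dB2 g dg)).
  rewrite hnormHW; apply: le_trans est _.
  have d1 := trunc_smooth N l3 (hdomB (dP f df) (dP g dg)).
  rewrite truncB -/J !JP in d1; have {d1} [_ d1] := d1.
  have d2 := radial_lip r0 (JH f df).1 (JH g dg).1; rewrite -/(P f) -/(P g) -truncB in d2.
  have d3 := (JH _ dfg).2.
  have n0 := hnorm_ge0 H0 (f - g).
  have d4 : wn (wt (2 + 1)) (fun x => P f x - P g x) <= c * 2 * hnorm H0 (f - g).
    rewrite -hnormHW; apply: le_trans d1 _; rewrite -mulrA; apply: (ler_wpM2l c0).
    by apply: le_trans d2 _; apply: ler_wpM2l.
  have w1 := wn_ge0 (wt (2 + 1)) (P f); have w2 := wn_ge0 (wt (2 + 1)) (P g).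
  have w3 := wn_ge0 (wt (2 + 1)) (fun x => P f x - P g x).
  apply: le_trans (ler_pM (mulr_ge0 C0 (addr_ge0 w1 w2)) w3 (ler_wpM2l C0 (lerD k1' k2')) d4) _.
  by rewrite mulrA /L mulrDl lerDl mul1r.
have [X [dX eX X0]] := @picard R _ H0 F L T h0 T0 L0 dh0 dF lipF.
(* The field takes its values in truncated functions, so the high frequencies of [X] do not move;
   [G] drops them. *)
pose G t := J (X t).
have JG t : J (G t) = G t by exact: trunc_trunc.
have dG b : 0 <= b -> dom_on (HW b) 0 T G.
  by move=> b0 t t01; have [] := trunc_smooth N b0 (dX t t01).
have eG b : 0 <= b -> sderiv_on (HW b) 0 T G (F \o X).
  move=> b0 t t01 e e0; have k0 : 0 < truncC N b + 1 by rewrite ltr_wpDl// truncC_ge0.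
  have [d d0 Hd] := eX t t01 _ (divr_gt0 e0 k0); exists d; first exact: d0.
  move=> u u01 ut.
  have dd := hdomB (hdomB (dX u u01) (dX t t01)) (hdomZ (u - t) (dF _ (dX t t01))).
  have := (trunc_smooth N b0 dd).2; rewrite truncB truncB truncZ /= /F /J trunc_trunc -/J.
  have := Hd u u01 ut; rewrite /=.
  have := hnorm_ge0 H0 (X u - X t - (u - t) *: F (X t)).
  move: (hnorm H0 _) (hnorm (HW b) _) => y z y0 h1 h2.
  apply: le_trans h2 _; apply: (@le_trans _ _ ((truncC N b + 1) * y)).
    by apply: ler_wpM2r => //; rewrite lerDl.
  apply: le_trans (ler_wpM2l (ltW k0) h1) _.
  by rewrite mulrCA mulrA divfK ?gt_eqF// mulrC.
have l00 : 0 <= (0 : R) <= T by rewrite lexx.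
have D := sderiv_on_sqr (dG 0 (lexx _)) (fun t t01 => dF _ (dX t t01)) (eG 0 (lexx _)).
(* [G t] is a positive multiple of [P (X t)], the function in the nonlinearity, so the cubic
   cancellation applies; the outer truncation moves onto [P (X t)], which it fixes. *)
have cancel t : 0 <= t <= T -> hip (HW 0) (G t) (F (X t)) = 0.
  move=> t01; have dXt := dX t t01; have [dGt _] := JH _ dXt.
  have k0 : 0 < r / Num.max r (hnorm H0 (G t)) by rewrite divr_gt0// radial_max.
  have PE : P (X t) = (r / Num.max r (hnorm H0 (G t))) *: G t by [].
  have -> : G t = (r / Num.max r (hnorm H0 (G t)))^-1 *: P (X t).
    by rewrite PE scalerA mulVf ?scale1r// gt_eqF.
  rewrite (hipZl _ (dP _ dXt) (dF _ dXt)); apply/eqP; rewrite mulf_eq0; apply/orP; right.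
  have [dP3t _] := dP3 _ dXt.
  have l1 : (1 : R) <= 2 + 1 by lra. have l2 : (1 : R) < 2 + 1 by lra.
  apply/eqP; rewrite -(bil_cancel gq (HW_meas dP3t) (sing_itg l2 dP3t) (wdom_wt l1 dP3t)).
  by apply: eq_Rintegral => x _; rewrite wt0 !mul1r mulrC /F trunc_mul [trunc N _]JP.
have cons t : 0 <= t <= T -> hnorm H0 (G t) <= r.
  move=> /andP[t0 tT]; have D' := deriv_on_sub (lexx 0) tT D.
  have := deriv_on_norm_le (c := 0) t0 D'; rewrite /= mul0r normr_le0 => k.
  have /eqP : hip (HW 0) (G t) (G t) - hip (HW 0) (G 0) (G 0) == 0.
    apply: k => u /andP[u0 ut]; have uT : 0 <= u <= T by rewrite u0 (le_trans ut tT).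
    by have := cancel u uT; rewrite /= => ->; rewrite mulr0 normr0.
  move=> /eqP; rewrite subr_eq0 => /eqP k'.
  rewrite /hnorm k' -/(hnorm H0 (G 0)) /G X0.
  by apply: le_trans (JH h0 dh0).2 _; rewrite lerDl.
have FG t : 0 <= t <= T -> F (X t) = trunc N (bil q (G t) (G t)).
  by move=> t01; rewrite /F /P radial_id//; exact: cons.
exists G; split.
- by rewrite /G X0.
- by move=> t _; exact: JG.
- exact: dG.
- by move=> b b0 t t01 e e0; have := eG b b0 t t01 e e0; rewrite /= (FG t t01).
Qed.

End Galerkin.

(** * Chain rule, integrals and logarithmic derivatives *)

Section MoreCalculus.
Context {R : realType}.
Implicit Types (f g : R -> R) (a b t T : R).

Lemma deriv_on_comp a b f f' g g' : deriv_on a b f f' ->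
  (forall y, is_derive y (1 : R) g (g' y)) ->
  deriv_on a b (fun t => g (f t)) (fun t => g' (f t) * f' t).
Proof.
move=> hf hg t tab e e0.
pose k := `|f' t| + 1; have k0 : 0 < k by rewrite ltr_wpDl.
have e2 : 0 < e / (2 * k) by rewrite divr_gt0// mulr_gt0.
have yy : f t - 1 <= f t <= f t + 1 by apply/andP; split; lra.
have [d1 d10 H1] := is_derive_deriv_on (fun y _ => hg y) yy e2.
pose l := `|g' (f t)| + 1; have l0 : 0 < l by rewrite ltr_wpDl.
have e3 : 0 < Num.min 1 (e / (2 * l)) by rewrite lt_min ltr01 divr_gt0// mulr_gt0.
have [d2 d20 H2] := hf t tab _ e3.
exists (Num.min d2 (Num.min d1 1 / k)) => [|u uab].
  by rewrite lt_min d20/= divr_gt0// lt_min d10/=.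
rewrite le_min ler_pdivlMr// => /andP[u2]; rewrite le_min => /andP[u1 u3].
have := H2 u uab u2; set X := f u - f t - (u - t) * f' t => hX.
have hX1 : `|X| <= `|u - t|.
  by apply: le_trans hX _; rewrite ler_piMl// ge_min lexx.
have hX2 : `|X| <= e / (2 * l) * `|u - t|.
  by apply: le_trans hX _; rewrite ler_wpM2r// ge_min lexx orbT.
have hd : `|f u - f t| <= `|u - t| * k.
  have -> : f u - f t = X + (u - t) * f' t by rewrite /X; ring.
  apply: le_trans (ler_normD _ _) _; rewrite normrM /k mulrDr mulr1 addrC lerD2l; exact: hX1.
have fu : f t - 1 <= f u <= f t + 1.
  by move: (le_trans hd u3); rewrite ler_norml; clear; move=> /andP[? ?]; apply/andP; split; lra.
have hY := H1 _ fu (le_trans hd u1).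
have -> : g (f u) - g (f t) - (u - t) * (g' (f t) * f' t) =
  (g (f u) - g (f t) - (f u - f t) * g' (f t)) + g' (f t) * X by rewrite /X; ring.
apply: le_trans (ler_normD _ _) _.
have m1 : e / (2 * k) * `|f u - f t| <= e / 2 * `|u - t|.
  apply: le_trans (ler_wpM2l (ltW e2) hd) _.
  by rewrite (_ : e / (2 * k) * (`|u - t| * k) = e / 2 * `|u - t|)//; field; rewrite gt_eqF.
have m2 : `|g' (f t) * X| <= e / 2 * `|u - t|.
  rewrite normrM; apply: (@le_trans _ _ (l * (e / (2 * l) * `|u - t|))).
    by apply: ler_pM => //; rewrite lerDl.
  by rewrite (_ : l * _ = e / 2 * `|u - t|)//; field; rewrite gt_eqF.
by apply: le_trans (lerD (le_trans hY m1) m2) _; rewrite -mulrDl -splitr.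
Qed.

(** Connects the Lebesgue integral in the hypothesis on [M] with the primitives used for
    differential inequalities. *)
Lemma deriv_on_integral T (a A : R -> R) : 0 < T -> cont_on 0 T a -> deriv_on 0 T A a ->
  (\int[@lebesgue_measure R]_(t in `[0%R, T]) (a t)%:E = (A T - A 0)%:E)%E.
Proof.
move=> T0 ca dA; rewrite EFinB.
have cA := cont_on_within (ltW T0) (deriv_on_cont dA).
have := (continuous_within_itvP A T0).1 cA => -[c1 c2 c3].
apply: continuous_FTC2 => //; first exact: cont_on_within (ltW T0) ca.
  split=> // t; rewrite in_itv /= => tT.
  by have [] := deriv_on_is_derive dA tT.
move=> t; rewrite in_itv /= => tT.
by have D := deriv_on_is_derive dA tT; rewrite derive1E derive_val.
Qed.

Lemma deriv_on_ge a b f g (c : R) : a <= b -> deriv_on a b f g ->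
  (forall t, a <= t <= b -> c <= g t) -> c * (b - a) <= f b - f a.
Proof.
move=> ab fg gc; have := deriv_on_nonincr ab (deriv_onB (deriv_on_linear_nonincr c (a:=a) (b:=b)) fg).
have h t : a <= t <= b -> c - g t <= 0 by move=> /gc; rewrite subr_le0.
move=> /(_ h); lra.
Qed.

(* [z exp (- A)] decreases and [z exp A] increases *)
Lemma log_lipschitz T (z z' a A : R -> R) : deriv_on 0 T A a -> deriv_on 0 T z z' ->
  (forall t, 0 <= t <= T -> `|z' t| <= a t * z t) ->
  forall t u, 0 <= t <= T -> 0 <= u <= T -> 0 <= z u -> z t <= z u * expR `|A t - A u|.
Proof.
move=> dA dz H.
move=> t u /andP[t0 tT] /andP[u0 uT] zu.
have E (c : R) := deriv_onM dz (deriv_on_comp dA (is_derive_expM c)).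
have fin (c : R) : z t * expR (c * A t) <= z u * expR (c * A u) -> `|c| = 1 ->
    z t <= z u * expR `|A t - A u|.
  move=> h c1; apply: (@le_trans _ _ (z u * expR (c * (A u - A t)))).
    rewrite mulrBr expRB mulrA ler_pdivlMr ?expR_gt0//.
  apply: (ler_wpM2l zu); rewrite ler_expR; apply: le_trans (ler_norm _) _.
  by rewrite normrM c1 mul1r distrC.
have [tu|ut] := leP t u.
  apply: (fin 1); last exact: normr1.
  have D := deriv_on_sub t0 uT (E 1); have := deriv_on_ge (c := 0) tu D.
  rewrite mul0r subr_ge0; apply=> x /andP[tx xu].
  have xT : 0 <= x <= T by rewrite (le_trans t0 tx) (le_trans xu uT).
  have := H x xT; rewrite ler_norml => /andP[h _].
  have e0 := expR_ge0 (1 * A x); move: (expR _) e0 => e e0.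
  have := ler_wpM2r e0 h; nra.
apply: (fin (-1)); last by rewrite normrN normr1.
have D := deriv_on_sub u0 tT (E (-1)); have := deriv_on_nonincr (ltW ut) D.
apply=> x /andP[tx xu].
have xT : 0 <= x <= T by rewrite (le_trans u0 tx) (le_trans xu tT).
have := H x xT; rewrite ler_norml => /andP[_ h].
have e0 := expR_ge0 (-1 * A x); move: (expR _) e0 => e e0.
have := ler_wpM2r e0 h; nra.
Qed.

End MoreCalculus.

(** * Uniform bounds *)

Section Growth.
Context {R : realType}.
Notation mu := (@mu2 R).
Notation T2 := (plane R).
Implicit Types (q f g h : T2 -> R) (a b r s t T K : R) (N : nat).

Lemma sup_bound s : 2 < s -> exists2 C : R, 0 <= C & forall q T (h : R -> T2 -> R) (M : R),
  goodq q -> 0 < T -> strong (s + 2) T q h ->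
  (\int[@lebesgue_measure R]_(t in `[0%R, T]) (wn (wt (s + 2)) (h t))%:E = M%:E)%E ->
  forall t, 0 <= t <= T -> wn (wt (s + 1)) (h t) ^+ 2 <= (M / T + 1) ^+ 2 * expR (C * M).
Proof.
move=> s2; have r1 : 1 <= s + 1 by lra. have s1 : 1 < s + 1 by lra.
have aux (C x w : R) : C * (x * w + w * x) * w = C * 2 * x * w ^+ 2 by ring.
have [C C0 HC] := @bil_energy R s (s + 1) s2 r1.
exists (4 * C) => [|q T h M gq T0 Sh IM]; first exact: mulr_ge0.
have [dh2 ch2 _] := Sh.
have le : s + 1 <= s + 2 - 1 by lra.
have [_ db eh] := strong_sderiv le s1 gq Sh.
have le1 : s + 1 <= s + 2 by lra. have le2 : s <= s + 2 by lra.
have dh1 := dom_on_wt le1 dh2.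
pose a t := hnorm (HW (s + 2)) (h t).
have aE : a = (fun t => wn (wt (s + 2)) (h t)) by apply/funext => t; exact: hnormHW.
have ca : cont_on 0 T a := scont_norm dh2 ch2.
have [A dA] := cont_on_primitive (ltW T0) ca.
have MA : M = A T - A 0.
  have := deriv_on_integral T0 ca dA; rewrite aE.
  by rewrite IM => -[].
have a0 t : 0 <= a t := hnorm_ge0 _ _.
have [t0 t0T at0] : exists2 t0, 0 <= t0 <= T & a t0 <= M / T + 1.
  (* If the norm exceeded [M / T + 1] at all times, its integral would be at least [M + T]. *)
  apply: contrapT => H.
  have : (M / T + 1) * (T - 0) <= A T - A 0.
    apply: (deriv_on_ge (ltW T0) dA) => t tT; apply: ltW; rewrite ltNge; apply/negP => h'.
    by apply: H; exists t.
  by rewrite -MA subr0 mulrDl divfK ?gt_eqF// mul1r gerDl leNgt T0.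
have D := sderiv_on_sqr dh1 db eh.
have z0 t : 0 <= hip (HW (s + 1)) (h t) (h t) := hip_ge0 _ _.
have zE t : hip (HW (s + 1)) (h t) (h t) = wn (wt (s + 1)) (h t) ^+ 2.
  by rewrite -hnorm_sqr hnormHW.
have zder t : 0 <= t <= T ->
    `|2 * hip (HW (s + 1)) (h t) (bil q (h t) (h t))| <= 4 * C * a t * hip (HW (s + 1)) (h t) (h t).
  move=> tT; have d2 := dh2 t tT.
  have := HC 0 q (h t) (h t) (lexx _) gq; rewrite !omega_wt wt_wt1 -addrA.
  move=> /(_ (wdom_wt le2 d2) (wdom_wt le1 d2) (wdom_wt le2 d2) d2).
  rewrite (hipC (HW (s + 1))) zE normrM (ger0_norm (ler0n _ 2)).
  have w2 := wn_wt le2 d2; have w0 := wn_ge0 (wt (s + 1)) (h t).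
  rewrite /a hnormHW.
  have k : C * (wn (wt s) (h t) * wn (wt (s + 1)) (h t) + wn (wt (s + 1)) (h t) * wn (wt s) (h t)) *
      wn (wt (s + 1)) (h t) <= C * 2 * wn (wt (s + 2)) (h t) * wn (wt (s + 1)) (h t) ^+ 2.
    by rewrite aux; exact: (ler_wpM2r (sqr_ge0 _) (ler_wpM2l (mulr_ge0 C0 (ler0n _ 2)) w2)).
  move=> h1; have := ler_wpM2l (ler0n R 2) (le_trans h1 k).
  move=> h2; apply: le_trans h2 _.
  move: (wn _ _) (wn _ _) => x y.
  by rewrite le_eqVlt; apply/orP; left; apply/eqP; ring.
have dA' : deriv_on 0 T (fun t => 4 * C * A t) (fun t => 4 * C * a t).
  move=> t tT e e0; have k0 : 0 < 4 * C + 1 by rewrite ltr_wpDl// mulr_ge0.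
  have [d d0 Hd] := dA t tT _ (divr_gt0 e0 k0); exists d => // u uT ut.
  have -> : 4 * C * A u - 4 * C * A t - (u - t) * (4 * C * a t) =
    4 * C * (A u - A t - (u - t) * a t) by ring.
  rewrite normrM ger0_norm ?mulr_ge0//.
  apply: (@le_trans _ _ ((4 * C + 1) * `|A u - A t - (u - t) * a t|)).
    by apply: ler_wpM2r => //; rewrite lerDl.
  apply: le_trans (ler_wpM2l (ltW k0) (Hd u uT ut)) _.
  by rewrite mulrA [_ * (e / _)]mulrC divfK ?gt_eqF.
move=> t tT; rewrite -zE; have := log_lipschitz dA' D zder tT t0T (z0 t0).
move=> k; apply: le_trans k _; apply: ler_pM; [exact: z0|exact: expR_ge0| |].
  rewrite zE !expr2; have h1 : wn (wt (s + 1)) (h t0) <= M / T + 1.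
    by apply: (le_trans _ at0); rewrite aE; exact: (wn_wt le1 (dh2 t0 t0T)).
  exact: (ler_pM (wn_ge0 _ _) (wn_ge0 _ _) h1 h1).
rewrite ler_expR -mulrBr normrM ger0_norm ?mulr_ge0//; apply: ler_wpM2l; first exact: mulr_ge0.
have Amono x y : 0 <= x -> x <= y -> y <= T -> 0 <= A y - A x.
  move=> x0 xy yT; have := deriv_on_ge (c := 0) xy (deriv_on_sub x0 yT dA).
  by rewrite mul0r; apply=> v _; exact: a0.
move: (tT) (t0T) => /andP[t1 t2] /andP[t3 t4].
rewrite MA ler_norml; have := Amono 0 t (lexx _) t1 t2; have := Amono 0 t0 (lexx _) t3 t4.
have := Amono t T t1 t2 (lexx _); have := Amono t0 T t3 t4 (lexx _).
by clear; move=> *; apply/andP; split; lra.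
Qed.

(* The cutoff costs nothing because [G] is supported where it equals 1. *)
Lemma growth s r : 2 < s -> 1 <= r -> exists2 C : R, 0 <= C &
  forall q N T K (B : R) (G : R -> T2 -> R), goodq q -> 0 <= B -> 0 <= K ->
  (forall t, 0 <= t <= T -> trunc N (G t) = G t) ->
  (forall b, 0 <= b -> dom_on (HW b) 0 T G) ->
  (forall b, 0 <= b -> sderiv_on (HW b) 0 T G (fun t => trunc N (bil q (G t) (G t)))) ->
  forall t, 0 <= t <= T -> (forall u, 0 <= u <= t -> wn (wt s) (G u) <= B) ->
  wn (omega r K) (G t) <= expR (C * B * t) * wn (omega r K) (G 0).
Proof.
move=> s2 r1; have [C C0 HC] := @bil_energy R s r s2 r1.
have s1 : 1 < s by lra. have s0 : 0 <= s by lra. have r0 : 0 <= r by lra.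
exists (2 * C) => [|q N T K B G gq B0 K0 JG dG eG t /andP[t0 tT] HB]; first exact: mulr_ge0.
have o0 x := omega_gt0 r x K0; have mo := measurable_omega r K0.
pose HO := wL2 o0.
have le1 (f : T2 -> R) : wdom (wt r) f -> wdom (omega r K) f /\ wn (omega r K) f <= wn (wt r) f.
  move=> df; have := wdom_le mo (measurable_wt r) (wt_gt0 r) _ ler01 df; rewrite mul1r; apply=> x.
  by rewrite mul1r ger0_norm; [exact: omega_le|exact: ltW (o0 x)].
have s1' : 0 <= s + 1 by lra. have r1' : 0 <= r + 1 by lra.
have db b : 1 < b -> dom_on (HW b) 0 T (fun t => bil q (G t) (G t)).
  move=> b1; have [C' _ H'] := @bil_bound0 R b b1 => u uT.
  have b0 : 0 <= b by lra. have b0' : 0 <= b + 1 by lra.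
  by have [_ k _] := H' q (G u) (G u) gq (dG b b0 u uT) (dG (b + 1) b0' u uT).
have db' b : 1 < b -> dom_on (HW b) 0 T (fun t => trunc N (bil q (G t) (G t))).
  by move=> b1 u uT; have [] := wdom_trunc N (db b b1 u uT).
pose b := r + 1; have b1 : 1 < b by rewrite /b; lra. have b0 : 0 <= b by rewrite /b; lra.
have rb : r <= b by rewrite /b; lra.
have dO : dom_on HO 0 T G by move=> u uT; have [] := le1 _ (wdom_wt rb (dG b b0 u uT)).
have dO' : dom_on HO 0 T (fun t => trunc N (bil q (G t) (G t))).
  by move=> u uT; have [] := le1 _ (wdom_wt rb (db' b b1 u uT)).
have eO : sderiv_on HO 0 T G (fun t => trunc N (bil q (G t) (G t))).
  move=> u uT e e0; have [d d0 Hd] := eG b b0 u uT e e0; exists d; first exact: d0.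
  move=> v vT uv; apply: le_trans (Hd v vT uv).
  have dd := @hdomB _ _ (HW b) _ _ (@hdomB _ _ (HW b) _ _ (dG b b0 v vT) (dG b b0 u uT))
    (@hdomZ _ _ (HW b) (v - u) _ (db' b b1 u uT)).
  rewrite (hnorm_wL2 o0) hnormHW.
  by apply: le_trans (le1 _ (wdom_wt rb dd)).2 _; exact: (wn_wt rb dd).
have D := deriv_on_sub (lexx 0) tT (sderiv_on_sqr dO dO' eO).
have zE u : hip HO (G u) (G u) = wn (omega r K) (G u) ^+ 2 by rewrite -hnorm_sqr (hnorm_wL2 o0).
have A0 : 0 <= 4 * C * B by rewrite !mulr_ge0.
have := gronwall t0 A0 (lexx 0) D.
have Z u : 0 <= u <= t -> 2 * hip HO (G u) (trunc N (bil q (G u) (G u))) <=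
    4 * C * B * hip HO (G u) (G u) + 0.
  move=> /andP[u0 ut]; have uT : 0 <= u <= T by rewrite u0 (le_trans ut).
  have hu : wn (wt s) (G u) <= B by apply: HB; rewrite u0.
  rewrite addr0 zE.
  have -> : hip HO (G u) (trunc N (bil q (G u) (G u))) =
      \int[mu]_x (omega r K x * bil q (G u) (G u) x * (omega r K x * G u x)).
    have e x : trunc N (bil q (G u) (G u)) x * G u x = bil q (G u) (G u) x * G u x.
      by rewrite trunc_mul (JG u uT).
    by apply: eq_Rintegral => x _; rewrite mulrACA [G u x * _]mulrC e mulrACA.
  have ho : wdom (fun x => wt 1 x * omega r K x) (G u).
    have d := dG (r + 1) r1' u uT.
    have := wdom_le (measurable_funM (@measurable_wt R 1) mo) (measurable_wt (r + 1)) (wt_gt0 (r + 1)) _ ler01 d.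
    move=> k; apply: (k _).1 => x; rewrite mul1r ger0_norm; last by rewrite mulr_ge0 ?wt_ge0 ?ltW.
    by rewrite addrC wtD; exact: (ler_wpM2l (wt_ge0 1 x) (omega_le r x K0)).
  have dsu := dG s s0 u uT; have dou := dO u uT.
  have := HC K q (G u) (G u) K0 gq dsu dou dsu ho.
  move=> /(le_trans (ler_norm _)) k.
  have w0 := wn_ge0 (omega r K) (G u); have k' := ler_wpM2l C0 hu.
  have k2 := ler_wpM2r (sqr_ge0 (wn (omega r K) (G u))) k'.
  move: k k2; move: (Rintegral _ _ _) (wn (omega r K) (G u)) (wn (wt s) (G u)) => X x y.
  by clear; move=> k k2; lra.
move=> /(_ Z); rewrite !zE mul0r addr0 => k.
rewrite -(@ler_pXn2r _ 2)// ?nnegrE ?wn_ge0// ?mulr_ge0 ?wn_ge0 ?expR_ge0//.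
apply: le_trans k _; rewrite exprMn -expRM_natr; apply: ler_wpM2r; first exact: sqr_ge0.
by rewrite ler_expR; have -> : 4 * C * B * t = 2 * C * B * t * 2%:R by ring.
Qed.

End Growth.

(** * Passing to the limit in a derivative *)

Section SderivLimit.
Context {R : realType} {V : lmodType R} (H : semiHilbert V).
Implicit Types (t e T c : R) (P p : R -> V).

Lemma sderiv_on_lip T P p c : 0 <= c -> dom_on H 0 T P -> dom_on H 0 T p ->
  sderiv_on H 0 T P p -> (forall t, 0 <= t <= T -> hnorm H (p t) <= c) ->
  forall t u, 0 <= t <= T -> 0 <= u <= T -> hnorm H (P u - P t) <= c * `|u - t|.
Proof.
move=> c0 dP dp Pp pc.
have main t u : 0 <= t -> t <= u -> u <= T -> hnorm H (P u - P t) <= c * `|u - t|.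
  move=> t0 tu uT; have tT : 0 <= t <= T by rewrite t0 (le_trans tu).
  have uT' : 0 <= u <= T by rewrite uT (le_trans t0).
  apply: hnorm_le_dual; [exact: hdomB (dP u uT') (dP t tT)|exact: mulr_ge0|move=> v dv].
  have Hl := bounded_linear_ip dv.
  have D := deriv_on_sub t0 uT (sderiv_on_linear Hl dP dp Pp).
  rewrite (hipBr (dP u uT') (dP t tT) dv).
  apply: le_trans (deriv_on_le (c := c * hnorm H v) tu D _) _; last first.
    by rewrite ger0_norm ?subr_ge0// mulrAC.
  move=> x /andP[tx xu]; have xT : 0 <= x <= T by rewrite (le_trans t0 tx) (le_trans xu uT).
  apply: le_trans (ler_norm _) _; apply: le_trans (hcauchy dv (dp x xT)) _.
  by rewrite mulrC; exact: (ler_wpM2r (hnorm_ge0 H v) (pc x xT)).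
move=> t u /andP[t0 tT] /andP[u0 uT].
have [tu|ut] := leP t u; first exact: main.
rewrite distrC hnorm_distC; [|apply: dP; rewrite u0//|apply: dP; rewrite t0//].
by apply: main => //; exact: ltW.
Qed.

(** Uniform convergence of the derivatives makes [P m - P n] Lipschitz with a small constant.
    Letting [m] grow gives the same for [F - P n], and the differentiability of one fixed [P n] then
    suffices. *)
Lemma sderiv_on_limit T (P p : nat -> R -> V) (F f : R -> V) :
  (forall n, dom_on H 0 T (P n)) -> (forall n, dom_on H 0 T (p n)) ->
  dom_on H 0 T F -> dom_on H 0 T f -> (forall n, sderiv_on H 0 T (P n) (p n)) ->
  (forall e, 0 < e -> exists n0, forall n, (n0 <= n)%N -> forall t, 0 <= t <= T ->
    hnorm H (P n t - F t) <= e) ->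
  (forall e, 0 < e -> exists n0, forall n, (n0 <= n)%N -> forall t, 0 <= t <= T ->
    hnorm H (p n t - f t) <= e) ->
  sderiv_on H 0 T F f.
Proof.
move=> dP dp dF df Pp cP cp t tT e e0.
have e4 : 0 < e / 4 by rewrite divr_gt0.
have e8 : 0 < e / 8 by rewrite divr_gt0.
have [n Hn] := cp _ e8.
have [d d0 Hd] := Pp n t tT _ e4; exists d; first exact: d0.
move=> u uT ut; have A0 := normr_ge0 (u - t).
have key : hnorm H ((F u - P n u) - (F t - P n t)) <= e / 4 * `|u - t|.
  apply/ler_addgt0Pr => k k0; have k2 : 0 < k / 2 by rewrite divr_gt0.
  have [m1 Hm1] := cP _ k2; pose m := maxn n m1.
  have dm := hdomB (dP m u uT) (dP n u uT); have dm' := hdomB (dP m t tT) (dP n t tT).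
  have dmF := hdomB (dP m u uT) (dF u uT); have dmF' := hdomB (dP m t tT) (dF t tT).
  have -> : F u - P n u - (F t - P n t) =
    ((P m u - P n u) - (P m t - P n t)) - ((P m u - F u) - (P m t - F t)).
    move: (F u) (P n u) (F t) (P n t) (P m u) (P m t) => a b c b' x y.
    rewrite !opprB !addrA [RHS](ACl (7*2*3*6*(1*8)*(4*5)))/=.
    by rewrite subrr addNr !addr0.
  apply: le_trans (hnorm_subadd (hdomB dm dm') (hdomB dmF dmF')) _; apply: lerD.
    have dmm : dom_on H 0 T (fun v => P m v - P n v).
      by move=> v vT; exact: hdomB (dP m v vT) (dP n v vT).
    have dpp : dom_on H 0 T (fun v => p m v - p n v).
      by move=> v vT; exact: hdomB (dp m v vT) (dp n v vT).
    have D := sderiv_onB (dP m) (dp m) (dP n) (dp n) (Pp m) (Pp n).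
    apply: (sderiv_on_lip (ltW e4) dmm dpp D _ tT uT) => v vT.
    have h1 := Hn m (leq_maxl _ _) v vT; have h2 := Hn n (leqnn _) v vT.
    have := hdist_tri (dp m v vT) (df v vT) (dp n v vT).
    rewrite (hnorm_distC (df v vT) (dp n v vT)); move: h1 h2.
    move: (hnorm H _) (hnorm H _) (hnorm H _) => x y z; lra.
  apply: le_trans (hnorm_subadd dmF dmF') _.
  have h1 := Hm1 m (leq_maxr _ _) u uT; have h2 := Hm1 m (leq_maxr _ _) t tT.
  by apply: le_trans (lerD h1 h2) _; lra.
have dd1 := hdomB (hdomB (dF u uT) (dP n u uT)) (hdomB (dF t tT) (dP n t tT)).
have dd2 := hdomB (hdomB (dP n u uT) (dP n t tT)) (hdomZ (u - t) (dp n t tT)).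
have dd3 := hdomZ (u - t) (hdomB (dp n t tT) (df t tT)).
have -> : F u - F t - (u - t) *: f t = ((F u - P n u) - (F t - P n t)) +
  (P n u - P n t - (u - t) *: p n t) + (u - t) *: (p n t - f t).
  rewrite scalerBr !opprB !addrA [RHS](ACl (1*4*9*(2*5)*(3*6)*(7*8)))/=.
  by rewrite subrr !addNr !addr0.
apply: le_trans (hnorm_add (hdomD dd1 dd2) dd3) _.
have h3 : hnorm H ((u - t) *: (p n t - f t)) <= e / 8 * `|u - t|.
  rewrite (hnormZ _ (hdomB (dp n t tT) (df t tT))) mulrC.
  by apply: (ler_wpM2r A0); exact: Hn.
have h4 := hnorm_add dd1 dd2; have h5 := Hd u uT ut.
move: key h3 h4 h5 A0; move: (hnorm H _) (hnorm H _) (hnorm H _) (hnorm H _) => x y z w.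
by move: `|u - t| => v; nra.
Qed.

End SderivLimit.

(** * Interpolation and high-frequency weights *)

Section Weights.
Context {R : realType}.
Notation mu := (@mu2 R).
Notation T2 := (plane R).
Implicit Types (q f g h : T2 -> R) (a b r s t T K : R) (N : nat).

Lemma wn_comb (om om1 om2 : T2 -> R) a b f : measurable_fun setT om -> 0 <= a -> 0 <= b ->
  measurable_fun setT f -> (forall x, 0 <= om x) -> (forall x, om x <= a * `|om1 x| + b * `|om2 x|) ->
  wdom om1 f -> wdom om2 f -> wn om f <= a * wn om1 f + b * wn om2 f.
Proof.
move=> mo a0 b0 mf o0 le d1 d2.
have s1 := sqintZ a (sqint_abs d1); have s2 := sqintZ b (sqint_abs d2).
have le' x : `|om x * f x| <= `|(a * `|om1 x * f x| + b * `|om2 x * f x|)|.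
  rewrite [leRHS]ger0_norm ?addr_ge0 ?mulr_ge0// !normrM !mulrA -mulrDl.
  by apply: ler_wpM2r => //; rewrite ger0_norm.
have ms : measurable_fun setT (fun x => om x * f x) by exact: measurable_funM.
apply: le_trans (n2_le (sqint_dom ms le' (sqintD s1 s2)) (sqintD s1 s2) le') _.
apply: le_trans (n2D s1 s2) _.
by rewrite (n2Z a (sqint_abs d1)) (n2Z b (sqint_abs d2)) !n2_abs !ger0_norm.
Qed.

(** With [w = <x>], the inequality [w <= w^2 / k + k] holds according to whether [w] is below or
    above [k]. *)
Lemma interpolation s k f : 0 < k -> wdom (wt (s + 2)) f ->
  wn (wt (s + 1)) f <= k^-1 * wn (wt (s + 2)) f + k * wn (wt s) f.
Proof.
move=> k0 df; have le : s <= s + 2 by rewrite lerDl.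
apply: wn_comb => //; [exact: measurable_wt|by rewrite invr_ge0 ltW|exact: ltW|exact: HW_meas df| | |exact: wdom_wt le df].
- by move=> x; exact: wt_ge0.
move=> x; rewrite !(ger0_norm (wt_ge0 _ x)) (wtD s 1) (wtD s 2).
rewrite [k^-1 * _]mulrCA [k * _]mulrC -mulrDr; apply: (ler_wpM2l (wt_ge0 s x)).
have -> : wt 2 x = wt 1 x ^+ 2 by rewrite wt1_sqr wt2E.
have w0 := wt_gt0 1 x; move: (wt 1 x) w0 => w w0; rewrite mulrC.
have [wk|kw] := leP w k.
  by apply: (le_trans wk); rewrite lerDr divr_ge0 ?sqr_ge0 ?ltW.
apply: (@le_trans _ _ (w ^+ 2 / k)); last by rewrite lerDl ltW.
by rewrite ler_pdivlMr// expr2 ler_wpM2l ?ltW.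
Qed.

Lemma wdom_omega r K f : 0 <= K -> wdom (wt r) f -> wdom (omega r K) f.
Proof.
move=> K0 df; apply: (wdom_le (c := 1) (measurable_omega r K0) (measurable_wt r) (wt_gt0 r) _ ler01 df).1.
by move=> x; rewrite mul1r ger0_norm; [exact: omega_le|exact: ltW (omega_gt0 r x K0)].
Qed.

(** Above frequency [K] the weight [omega] is at least half of [<x>^(s+2)]; below it,
    [<x>^2 <= K^2]. *)
Lemma split_weight s K f : 0 < K -> wdom (wt (s + 2)) f ->
  wn (wt (s + 2)) f <= 2 * wn (omega (s + 2) K) f + K ^+ 2 * wn (wt s) f.
Proof.
move=> K0 df; have le : s <= s + 2 by rewrite lerDl.
apply: wn_comb => //; [exact: measurable_wt|exact: sqr_ge0|exact: HW_meas df| | |exact: wdom_omega (ltW K0) df|exact: wdom_wt le df].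
- by move=> x; exact: wt_ge0.
move=> x; rewrite (ger0_norm (wt_ge0 s x)) ger0_norm; last exact: ltW (omega_gt0 _ _ (ltW K0)).
rewrite /omega /psi mulrCA -(wtE (s + 2) x) (wtD s 2).
have -> : wt 2 x = wt 1 x ^+ 2 by rewrite wt1_sqr wt2E.
have w0 := wt_gt0 1 x; have ws := wt_ge0 s x; move: (wt 1 x) w0 (wt s x) ws => w w0 v v0.
have [wk|kw] := leP w K.
  apply: (@le_trans _ _ (K ^+ 2 * v)).
    by rewrite mulrC; apply: (ler_wpM2r v0); rewrite !expr2; apply: ler_pM => //; exact: ltW.
  have i0 : 0 <= (K + w)^-1 by rewrite invr_ge0 addr_ge0 ?ltW.
  by rewrite lerDr (mulr_ge0 (ltW w0))// mulr_ge0// (mulr_ge0 (mulr_ge0 v0 (sqr_ge0 w)) i0).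
apply: (@le_trans _ _ (w * (2 * (v * w ^+ 2 / (K + w))))); last first.
  by rewrite lerDl mulr_ge0 ?sqr_ge0.
rewrite !mulrA ler_pdivlMr ?addr_gt0// [leRHS](_ : _ = v * w ^+ 2 * (2 * w)); last by ring.
by rewrite -[v * w * w]mulrA -expr2; apply: ler_wpM2l; [rewrite mulr_ge0 ?sqr_ge0|lra].
Qed.

(** As [K] grows the weights tend to 0 pointwise and stay below [<x>^r], so convergence is
    dominated. *)
Lemma omega_tail r f : wdom (wt r) f -> forall e : R, 0 < e ->
  exists2 K : R, 0 < K & wn (omega r K) f <= e.
Proof.
move=> df e e0; have mf := HW_meas df.
have n0 n : 0 <= n.+1%:R :> R by [].
have [|||n0' Hn] := @n2_cvg0 R (fun n x => omega r n.+1%:R x * f x) (fun x => wt r x * f x) _ df _ _ e e0.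
- by move=> n; apply: measurable_funM mf; exact: measurable_omega.
- move=> n x; rewrite normrM [leRHS]normrM; apply: ler_wpM2r => //.
  by rewrite !ger0_norm; [exact: omega_le|exact: wt_ge0|exact: ltW (omega_gt0 r x (n0 n))].
- apply: aeW => x; rewrite -(mul0r (f x)); apply: cvgM; last exact: cvg_cst.
  rewrite -(mulr0 (wt 1 x)); apply: cvgM; first exact: cvg_cst.
  rewrite -(mulr0 (wt 1 x `^ r)) /psi; apply: cvgM; first exact: cvg_cst.
  apply/cvgrPdist_le => d d0; exists (Num.truncn d^-1) => // n /= hn.
  rewrite sub0r normrN ger0_norm ?invr_ge0 ?addr_ge0 ?wt_ge0//.
  rewrite -[leRHS]invrK lef_pV2 ?posrE ?invr_gt0 ?ltr_wpDr ?wt_ge0//.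
  apply: (@le_trans _ _ n.+1%:R); last by rewrite lerDl wt_ge0.
  apply: ltW; apply: lt_le_trans (truncnS_gt _) _; by rewrite ler_nat.
by exists n0'.+1%:R => //; exact: Hn.
Qed.

(** On a disk the weight [om] is bounded by a constant times [<x>^s], so convergence in H^s carries
    the bound to the limit there. Fatou then lets the disk grow. *)
Lemma wdom_limit s b (om : T2 -> R) (G : nat -> T2 -> R) F (c : R) : 0 <= s -> 0 <= b -> 0 <= c ->
  measurable_fun setT om -> (forall x, 0 < om x) -> (forall x, om x <= wt b x) ->
  (forall n, wdom om (G n)) -> (forall n, wn om (G n) <= c) -> (forall n, wdom (wt s) (G n)) ->
  wdom (wt s) F ->
  (forall e : R, 0 < e -> exists n, wn (wt s) (fun x => F x - G n x) <= e) ->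
  wdom om F /\ wn om F <= c.
Proof.
move=> s0 b0 c0 mo o0 le dG bG sG dF cF; have mF := HW_meas dF.
have mD m : measurable_fun setT (\1_(disk m) : T2 -> R) by apply: measurable_indic; exact: measurable_disk.
have loc m f : wdom (wt s) f -> sqint (fun x => om x * trunc m f x) /\
    n2 (fun x => om x * trunc m f x) <= truncC m b * wn (wt s) f.
  move=> df; pose om' x := om x * \1_(disk m) x.
  have mo' : measurable_fun setT om' by exact: measurable_funM (mD m).
  have le' x : `|om' x| <= truncC m b * wt s x.
    rewrite ger0_norm ?mulr_ge0 ?(ltW (o0 x))//; apply: (@le_trans _ _ (truncC m b)); last first.
      by rewrite ler_peMr ?truncC_ge0 ?wt_ge1.
    by apply: le_trans (disk_wt m x b0); apply: ler_wpM2r.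
  have := wdom_le mo' (@measurable_wt R s) (@wt_gt0 R s) le' (truncC_ge0 m b) df.
  rewrite /wdom /wn; have -> : (fun x => om' x * f x) = (fun x => om x * trunc m f x); last by [].
  by apply/funext => x; rewrite /om' /trunc -mulrA [f x * _]mulrC.
have bd m : n2 (fun x => om x * trunc m F x) <= c.
  apply: (n2_le_lim (loc m F dF).1 (g := fun x => om x * trunc m F x)); first exact: (loc m F dF).1.
  move=> e e0; have k0 : 0 < truncC m b + 1 by rewrite ltr_wpDl// truncC_ge0.
  have [n Hn] := cF _ (divr_gt0 e0 k0).
  exists (fun x => om x * trunc m (G n) x); first exact: (loc m _ (sG n)).1.
  split; last first.
    by apply: le_trans (wdom_trunc m (dG n)).2 _; apply: le_trans (bG n) _; rewrite lerDl ltW.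
  have := (loc m _ (wdomB dF (sG n))).2.
  have -> : (fun x => om x * trunc m (fun x => F x - G n x) x) =
    (fun x => om x * trunc m F x - om x * trunc m (G n) x).
    by apply/funext => x; rewrite /trunc; ring.
  move=> k; apply: le_trans k _; have w0 := wn_ge0 (wt s) (fun x => F x - G n x).
  apply: (@le_trans _ _ ((truncC m b + 1) * wn (wt s) (fun x => F x - G n x))).
    by apply: (ler_wpM2r w0); rewrite lerDl.
  apply: le_trans (ler_wpM2l (ltW k0) Hn) _.
  by rewrite mulrC divfK// gt_eqF.
apply: sqint_bound c0 _; first exact: measurable_funM.
apply: (@fatou_real R (fun m x => (om x * trunc m F x) ^+ 2)).
- by move=> m; apply: measurable_funX; case: (loc m F dF) => -[].
- by apply: measurable_funX; exact: measurable_funM.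
- by move=> m x; exact: sqr_ge0.
- by move=> x; exact: sqr_ge0.
- apply: aeW => x; have [n0 Hn0] := trunc_near x; apply: cvg_near_cst; exists n0 => // n hn /=.
  by rewrite /trunc indicE mem_set ?mulr1//; exact: Hn0.
- apply: nearW => m; have [_ i] := (loc m F dF).1; rewrite (itg_EFin i) lee_fin -n2_sqr.
  by rewrite !expr2; exact: (ler_pM (n2_ge0 _) (n2_ge0 _) (bd m) (bd m)).
Qed.

End Weights.

(** * Limit of the approximations *)

Section Limit.
Context {R : realType}.
Notation mu := (@mu2 R).
Notation T2 := (plane R).
Implicit Types (q f h : T2 -> R) (a b s t K : R) (n : nat).
Variables (s T A : R) (q h0 : T2 -> R) (G g : nat -> R -> T2 -> R).
Hypotheses (s2 : 2 < s) (T0 : 0 <= T) (A0 : 0 <= A) (gq : goodq q) (dh0 : wdom (wt (s + 2)) h0).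
Hypothesis dG : forall n, dom_on (HW (s + 2)) 0 T (G n).
Hypothesis dg : forall n, dom_on (HW s) 0 T (g n).
Hypothesis eG : forall n, sderiv_on (HW s) 0 T (G n) (g n).
Hypothesis cG : forall e : R, 0 < e -> exists n0, forall n m, (n0 <= n)%N -> (n0 <= m)%N ->
  forall t, 0 <= t <= T -> hnorm (HW s) (G n t - G m t) <= e.
Hypothesis bG : forall e : R, 0 < e -> exists n0, forall n, (n0 <= n)%N -> forall t, 0 <= t <= T ->
  hnorm (HW s) (g n t - bil q (G n t) (G n t)) <= e.
(** One bound for all [K] with the same factor [A]: at [K = 0] it bounds the H^(s+2) norm, and for
    large [K] it makes the high frequencies small uniformly in [n] and [t]. *)
Hypothesis tG : forall n t K, 0 <= t <= T -> 0 <= K ->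
  wn (omega (s + 2) K) (G n t) <= A * wn (omega (s + 2) K) h0.

Let s1 : 1 < s. Proof. by move: s2 => ?; lra. Qed.
Let s0 : 0 <= s. Proof. by move: s2 => ?; lra. Qed.
Let r0 : 0 <= s + 2. Proof. by move: s2 => ?; lra. Qed.
Let le1 : s + 1 <= s + 2. Proof. by lra. Qed.
Let le2 : s <= s + 2. Proof. by lra. Qed.
Let le3 : s <= s + 1. Proof. by lra. Qed.

Lemma frac_le (x y : R) : 0 <= y -> 0 <= x -> y * (x / (x + 1)) <= y.
Proof.
move=> y0 x0; rewrite -[leRHS]mulr1; apply: (ler_wpM2l y0).
by rewrite ler_pdivrMr ?ltr_wpDl// mul1r lerDl.
Qed.

Definition Hs_limit (F : R -> T2 -> R) := dom_on (HW s) 0 T F /\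
  forall e : R, 0 < e -> exists n0, forall n, (n0 <= n)%N -> forall t, 0 <= t <= T ->
  hnorm (HW s) (G n t - F t) <= e.

Lemma Hs_limit_ex : exists F, Hs_limit F.
Proof.
have dGs n := dom_on_wt le2 (dG n).
have pt t : exists v, 0 <= t <= T -> hdom (HW s) v /\
    forall e : R, 0 < e -> exists n0, forall n, (n0 <= n)%N -> hnorm (HW s) (G n t - v) <= e.
  have [tT|nt] := pselect (0 <= t <= T); last by exists 0.
  have [||v dv Hv] := @hcomplete _ _ (HW s) (fun n => G n t).
  - by move=> n; exact: dGs.
  - move=> e e0; have [n0 Hn] := cG e0.
    pose d := Num.sqrt e; have d0 : 0 < d by rewrite sqrtr_gt0.
    have [n1 Hn1] := cG d0; exists n1 => p r hp hr.
    have h := Hn1 p r hp hr t tT; rewrite -hnorm_sqr -(sqr_sqrtr (ltW e0)) !expr2.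
    exact: (ler_pM (hnorm_ge0 _ _) (hnorm_ge0 _ _) h h).
  exists v => _; split; first exact: dv.
  move=> e e0; have [n0 Hn] := Hv _ (exprn_gt0 2 e0); exists n0 => n hn.
  by rewrite (hnorm_le _ _ (ltW e0)); exact: Hn.
have [F HF] := boolp.choice pt; exists F; split; first by move=> t /HF[].
move=> e e0; have e2 : 0 < e / 2 by rewrite divr_gt0.
have [n0 Hn0] := cG e2; exists n0 => n hn t tT.
have [dF cF] := HF t tT; have [m1 Hm1] := cF _ e2.
have h1 := Hn0 n (maxn n0 m1) hn (leq_maxl _ _) t tT; have h2 := Hm1 (maxn n0 m1) (leq_maxr _ _).
apply: le_trans (hdist_tri (dGs n t tT) (dGs (maxn n0 m1) t tT) dF) _.
by apply: le_trans (lerD h1 h2) _; rewrite -splitr.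
Qed.

Variable F : R -> T2 -> R.
Hypothesis HF : Hs_limit F.

Lemma limit_omega t K : 0 <= t <= T -> 0 <= K ->
  wdom (omega (s + 2) K) (F t) /\ wn (omega (s + 2) K) (F t) <= A * wn (omega (s + 2) K) h0.
Proof.
move=> tT K0; have [dF cF] := HF.
apply: (@wdom_limit R s (s + 2) (omega (s + 2) K) (fun n => G n t)) => //.
- exact: mulr_ge0 A0 (wn_ge0 _ _).
- exact: measurable_omega.
- by move=> x; exact: omega_gt0.
- by move=> x; exact: omega_le.
- by move=> n; exact: wdom_omega K0 (dG n tT).
- by move=> n; exact: tG.
- by move=> n; exact: wdom_wt le2 (dG n tT).
- exact: dF.
- move=> e e0; have [n0 Hn] := cF e e0; exists n0; have := Hn n0 (leqnn _) t tT.
  by rewrite hnorm_distC ?hnormHW//; [exact: wdom_wt le2 (dG n0 tT)|exact: dF].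
Qed.

Let Q := A * wn (wt (s + 2)) h0.

Lemma limit_dom : dom_on (HW (s + 2)) 0 T F /\ forall t, 0 <= t <= T -> wn (wt (s + 2)) (F t) <= Q.
Proof.
split=> t tT; have := limit_omega tT (lexx 0); rewrite omega_wt => -[]; [by []|].
by move=> _; apply.
Qed.

Lemma limit_bound n t : 0 <= t <= T -> wn (wt (s + 2)) (G n t) <= Q.
Proof. by move=> tT; have := tG n tT (lexx 0); rewrite omega_wt. Qed.

Let Q0 : 0 <= Q. Proof. by rewrite mulr_ge0// wn_ge0. Qed.

(** Interpolation between the bound in H^(s+2) and the convergence in H^s. *)
Lemma limit_cvg1 (e : R) : 0 < e -> exists n0, forall n, (n0 <= n)%N -> forall t, 0 <= t <= T ->
  wn (wt (s + 1)) (fun x => G n t x - F t x) <= e.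
Proof.
move=> e0; have [dF bF] := limit_dom; have [_ cF] := HF.
pose k := (4 * (Q + 1)) / e; have k0 : 0 < k by rewrite divr_gt0// mulr_gt0// ltr_wpDl.
have ek : 0 < e / (2 * k) by rewrite divr_gt0// mulr_gt0.
have [n0 Hn] := cF _ ek; exists n0 => n hn t tT.
have dd := wdomB (dG n tT) (dF t tT).
apply: le_trans (interpolation k0 dd) _.
have h1 := HWsub (dG n tT) (dF t tT); have h2 := limit_bound n tT; have h3 := bF t tT.
have h4 : wn (wt s) (fun x => G n t x - F t x) <= e / (2 * k) by have := Hn n hn t tT; rewrite hnormHW.
have h5 : wn (wt (s + 2)) (fun x => G n t x - F t x) <= Q + Q.
  exact: le_trans h1 (lerD h2 h3).
have i0 : 0 <= k^-1 by rewrite invr_ge0 ltW.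
apply: le_trans (lerD (ler_wpM2l i0 h5) (ler_wpM2l (ltW k0) h4)) _.
have -> : k * (e / (2 * k)) = e / 2 by field; rewrite gt_eqF.
have -> : k^-1 * (Q + Q) = e / 2 * (Q / (Q + 1)).
  by rewrite /k; field; rewrite !gt_eqF// ltr_wpDl.
have : e / 2 * (Q / (Q + 1)) <= e / 2.
  by apply: frac_le => //; rewrite divr_ge0 ?ltW.
move=> k1; apply: le_trans (lerD k1 (lexx _)) _; by rewrite -splitr.
Qed.

Lemma limit_cvg_bil (e : R) : 0 < e -> exists n0, forall n, (n0 <= n)%N -> forall t, 0 <= t <= T ->
  hnorm (HW s) (g n t - bil q (F t) (F t)) <= e.
Proof.
move=> e0; have [dF bF] := limit_dom; have [C C0 HC] := bil_diff_est s1.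
have e2 : 0 < e / 2 by rewrite divr_gt0.
pose k := C * (Q + Q) + 1; have k0 : 0 < k by rewrite ltr_wpDl// mulr_ge0// addr_ge0.
have [n1 H1] := limit_cvg1 (divr_gt0 e2 k0); have [n2 H2] := bG e2.
exists (maxn n1 n2) => n; rewrite geq_max => /andP[h1 h2] t tT.
have d1 := wdom_wt le1 (dG n tT); have d2 := wdom_wt le1 (dF t tT).
have [db est] := HC q _ _ gq d1 d2; have [db' _] := HC q _ _ gq d2 d2.
apply: le_trans (@hdist_tri _ _ (HW s) _ _ _ (dg n tT) db db') _.
have h3 := H2 n h2 t tT; have h4 := H1 n h1 t tT.
have w1 := le_trans (wn_wt le1 (dG n tT)) (limit_bound n tT).
have w2 := le_trans (wn_wt le1 (dF t tT)) (bF t tT).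
have h5 : hnorm (HW s) (bil q (G n t) (G n t) - bil q (F t) (F t)) <= e / 2.
  rewrite hnormHW; apply: le_trans est _.
  have p := wn_ge0 (wt (s + 1)) (fun x => G n t x - F t x).
  have z := addr_ge0 (wn_ge0 (wt (s + 1)) (G n t)) (wn_ge0 (wt (s + 1)) (F t)).
  apply: le_trans (ler_pM (mulr_ge0 C0 z) p (ler_wpM2l C0 (lerD w1 w2)) h4) _.
  apply: (@le_trans _ _ (k * (e / 2 / k))); last by rewrite mulrC divfK// gt_eqF.
  by apply: ler_wpM2r; [rewrite divr_ge0 ?ltW|rewrite lerDl].
by apply: le_trans (lerD h3 h5) _; rewrite -splitr.
Qed.

(** A uniform bound in H^(s+2) does not give continuity there. The increment is split by the weight:
    its high frequencies are small uniformly in time for large [K], and the rest is at most [K^2]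
    times the increment in H^s. *)
Lemma limit_strong : strong (s + 2) T q F.
Proof.
have [dF bF] := limit_dom; have [dFs cF] := HF.
have dF1 := dom_on_wt le1 dF.
have db : dom_on (HW s) 0 T (fun t => bil q (F t) (F t)).
  have [C C0 HC] := bil_diff_est s1 => t tT.
  by have [] := HC q _ _ gq (dF1 t tT) (dF1 t tT).
have eF : sderiv_on (HW s) 0 T F (fun t => bil q (F t) (F t)).
  apply: (sderiv_on_limit (fun n => dom_on_wt le2 (dG n)) dg dFs db eG cF).
  exact: limit_cvg_bil.
have cFs := sderiv_on_cont dFs db eF.
have cF2 : scont_on (HW (s + 2)) 0 T F.
  move=> t tT e e0; pose k := 8 * (A + 1); have k0 : 0 < k by rewrite mulr_gt0// ltr_wpDl.
  have [K K0 HK] := omega_tail dh0 (divr_gt0 e0 k0).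
  have K2 : 0 < K ^+ 2 by rewrite exprn_gt0.
  have [d d0 Hd] := cFs t tT _ (divr_gt0 e0 (mulr_gt0 (ltr0n _ 2 : 0 < 2%:R) K2)).
  exists d; first exact: d0.
  move=> u uT ut; have dd := wdomB (dF u uT) (dF t tT).
  rewrite hnormHW; apply: le_trans (split_weight K0 dd) _.
  have := Hd u uT ut; rewrite hnormHW => h1.
  have [w1 b1] := limit_omega uT (ltW K0); have [w2 b2] := limit_omega tT (ltW K0).
  have h2 : wn (omega (s + 2) K) (fun x => F u x - F t x) <= A * (e / k) + A * (e / k).
    have p x := omega_gt0 (s + 2) x (ltW K0).
    have := @hnorm_subadd _ _ (wL2 p) (F u) (F t) w1 w2; rewrite !(hnorm_wL2 p) => h.
    apply: le_trans h _; apply: lerD.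
      exact: le_trans b1 (ler_wpM2l A0 HK).
    exact: le_trans b2 (ler_wpM2l A0 HK).
  apply: le_trans (lerD (ler_wpM2l (ler0n _ 2) h2) (ler_wpM2l (ltW K2) h1)) _.
  have -> : K ^+ 2 * (e / (2 * K ^+ 2)) = e / 2 by field; rewrite gt_eqF.
  have -> : 2%:R * (A * (e / k) + A * (e / k)) = e / 2 * (A / (A + 1)).
    by rewrite /k; field; rewrite gt_eqF// ltr_wpDl.
  have : e / 2 * (A / (A + 1)) <= e / 2.
    by apply: frac_le => //; rewrite divr_ge0 ?ltW.
  by move=> k1; lra.
split; [exact: dF|exact: cF2|].
have rE : s + 2 - 1 = s + 1 by ring.
have rE' : s + 1 + 1 = s + 2 by ring.
have s11 : 1 < s + 1 := lt_le_trans s1 le3.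
have [db1 cb1] : dom_on (HW (s + 1)) 0 T (fun t => bil q (F t) (F t)) /\
    scont_on (HW (s + 1)) 0 T (fun t => bil q (F t) (F t)).
  by apply: (bil_scont s11 gq); rewrite rE'; [exact: dF|exact: cF2].
(* The derivative is known in H^s; pointwise evaluation and injectivity of the transform raise it to
   H^(s+1). *)
rewrite rE; apply: (weak_strong s11 T0 dF1 db1 cb1) => x.
exact: (sderiv_on_linear (Har_bounded_linear x s1) dFs db eF).
Qed.

End Limit.

Section Restriction.
Context {R : realType} {V : lmodType R} (H : semiHilbert V).

Lemma dom_on_sub (T t : R) (f : R -> V) : t <= T -> dom_on H 0 T f -> dom_on H 0 t f.
Proof. by move=> tT df u /andP[u0 ut]; apply: df; rewrite u0 (le_trans ut). Qed.

Lemma sderiv_on_sub (T t : R) (f g : R -> V) : t <= T -> sderiv_on H 0 T f g -> sderiv_on H 0 t f g.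
Proof.
move=> tT fg u /andP[u0 ut] e e0; have uT : 0 <= u <= T by rewrite u0 (le_trans ut).
have [d d0 Hd] := fg u uT e e0; exists d; first exact: d0.
by move=> v /andP[v0 vt]; apply: Hd; rewrite v0 (le_trans vt).
Qed.

End Restriction.

(** The improvement from 1 to 3/4 leaves a margin 1/4 that continuity spends to the right of [t]. At
    [t] itself, a value above 1 would persist slightly before [t]. *)
Lemma continuity_method {R : realType} (T : R) (D : R -> R) : 0 <= T -> cont_on 0 T D -> D 0 <= 1 ->
  (forall t, 0 <= t <= T -> (forall u, 0 <= u <= t -> D u <= 1) -> D t <= 3 / 4) ->
  forall t, 0 <= t <= T -> D t <= 1.
Proof.
move=> T0 cD D0 step; apply: (interval_induction T0) => t tT IH.
have [t0 tT'] := andP tT.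
have Dt : D t <= 1.
  rewrite leNgt; apply/negP => D1.
  have tpos : 0 < t.
    by rewrite lt_neqAle t0 andbT; apply/eqP => t00; move: D1; rewrite -t00 ltNge D0.
  have e0 : 0 < (D t - 1) / 2 by rewrite divr_gt0// subr_gt0.
  have [d d0 Hd] := cD t tT _ e0; pose u := Num.max 0 (t - d).
  have ut : u < t by rewrite gt_max tpos/= gtrBl.
  have u0 : 0 <= u by rewrite le_max lexx.
  have uT : 0 <= u <= T by rewrite u0 (le_trans (ltW ut)).
  have ud : `|u - t| <= d.
    rewrite distrC ger0_norm; last by rewrite subr_ge0 ltW.
    by rewrite lerBlDr -lerBlDl le_max lexx orbT.
  have := Hd u uT ud; have ut' : 0 <= u < t by rewrite u0.
  have := IH u ut'; rewrite ler_norml => h /andP[h1 _]; lra.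
have below u : 0 <= u <= t -> D u <= 1.
  move=> /andP[u0]; rewrite le_eqVlt => /orP[/eqP->//|ut]; by apply: IH; rewrite u0.
have D34 := step t tT below.
have [d d0 Hd] := cD t tT (1 / 4) (divr_gt0 ltr01 (ltr0n _ 4)).
exists d => // u uT ud; have [ut|tu] := leP u t.
  by apply: below; have [-> _] := andP uT.
have ud' : `|u - t| <= d by rewrite ger0_norm; [rewrite lerBlDl|rewrite subr_ge0 ltW].
by have := Hd u uT ud'; rewrite ler_norml => /andP[_ h]; lra.
Qed.

(** * Solutions near an approximate solution *)

Section Existence.
Context {R : realType}.
Notation mu := (@mu2 R).
Notation T2 := (plane R).
Implicit Types (f h : T2 -> R) (b t K : R) (N n : nat).

(** The constant is extracted by choice so that the smallness hypothesis on [eta] can mention it. *)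
Definition stabC (s : R) (s2 : 2 < s) : R := s2val (cid2 (stability s2)).

(** The function [w] solves the equation with symbol [q] up to a residual of size [eta]; in the
    application it is the SQG solution. Over [[0, T]] only its H^(s+1) norm is bounded, by [Kb];
    H^(s+2) is asked at time 0. *)
Variables (s T Kb eta : R) (q : T2 -> R) (w w' : R -> T2 -> R).
Hypotheses (s2 : 2 < s) (T0 : 0 < T) (Kb0 : 0 <= Kb) (gq : goodq q).
Hypotheses (dw : dom_on (HW (s + 1)) 0 T w) (dw0 : wdom (wt (s + 2)) (w 0)).
Hypotheses (dw' : dom_on (HW s) 0 T w') (ew : sderiv_on (HW s) 0 T w w').
Hypothesis bw : forall t, 0 <= t <= T -> wn (wt (s + 1)) (w t) <= Kb.
Hypothesis aw : forall t, 0 <= t <= T -> hnorm (HW s) (w' t - bil q (w t) (w t)) <= eta.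

Let B := Kb + 1.
Let E := expR ((stabC s2 * B + 1) * T).
Hypothesis small : E * (eta ^+ 2 * T) <= 1 / 8.

Let s1 : 1 < s. Proof. by move: s2 => ?; lra. Qed.
Let s0 : 0 <= s. Proof. by move: s2 => ?; lra. Qed.
Let r1 : 1 <= s + 2. Proof. by move: s2 => ?; lra. Qed.
Let r0 : 0 <= s + 2. Proof. by move: s2 => ?; lra. Qed.
Let s10 : 0 <= s + 1. Proof. by move: s2 => ?; lra. Qed.
Let s11 : 1 < s + 1. Proof. by move: s2 => ?; lra. Qed.
Let le1 : s + 1 <= s + 2. Proof. by lra. Qed.
Let le2 : s <= s + 2. Proof. by lra. Qed.
Let le3 : s <= s + 1. Proof. by lra. Qed.
Let rE : s + 1 + 1 = s + 2. Proof. by ring. Qed.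
Let B0 : 0 <= B. Proof. by rewrite addr_ge0. Qed.
Let BK : Kb <= B. Proof. by rewrite lerDl. Qed.
Let T0' : 0 <= T. Proof. exact: ltW. Qed.
Let l00 : 0 <= (0 : R) <= T. Proof. by rewrite lexx ltW. Qed.
Let C0 : 0 <= stabC s2. Proof. exact: s2valP (cid2 (stability s2)). Qed.
Let stab := s2valP' (cid2 (stability s2)).

Let Cg := s2val (cid2 (growth s2 r1)).
Let Cg0 : 0 <= Cg. Proof. exact: s2valP (cid2 (growth s2 r1)). Qed.
Let grow := s2valP' (cid2 (growth s2 r1)).
Let Cb := s2val (cid2 (@bil_bound0 R (s + 1) s11)).
Let Cb0 : 0 <= Cb. Proof. exact: s2valP (cid2 (@bil_bound0 R (s + 1) s11)). Qed.
Let bilb := s2valP' (cid2 (@bil_bound0 R (s + 1) s11)).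

Let A := expR (Cg * B * T).
Let Q := A * wn (wt (s + 2)) (w 0).
Let c0 := wn (wt (s + 1)) (w 0).
Let c1 := Cb * Q * Q.
Let Q0 : 0 <= Q. Proof. exact: mulr_ge0 (expR_ge0 _) (wn_ge0 _ _). Qed.
Let c10 : 0 <= c1. Proof. exact: mulr_ge0 (mulr_ge0 Cb0 Q0) Q0. Qed.
Let c00 : 0 <= c0. Proof. exact: wn_ge0. Qed.

Definition is_galerkin N (G : R -> T2 -> R) :=
  [/\ G 0 = trunc N (w 0), forall t, 0 <= t <= T -> trunc N (G t) = G t,
      forall b, 0 <= b -> dom_on (HW b) 0 T G &
      forall b, 0 <= b -> sderiv_on (HW b) 0 T G (fun t => trunc N (bil q (G t) (G t)))].

Lemma galerkin_ex N : exists G, is_galerkin N G.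
Proof. by apply: galerkin => //; apply: wdom_wt dw0. Qed.

Section OneGalerkin.
Variables (N : nat) (G : R -> T2 -> R).
Hypotheses (N0 : (0 < N)%N) (HG : is_galerkin N G).

Lemma galerkin_start : hnorm (HW s) (G 0 - w 0) <= N%:R^-1 * c0.
Proof.
have [-> _ _ _] := HG; have [d k] := trunc_tail N0 (dw l00).
apply: le_trans k; rewrite hnorm_distC//; last exact: (wdom_wt le3 (dw l00)).
by have [] := wdom_trunc N (wdom_wt le3 (dw l00)).
Qed.

Lemma galerkin_omega t K : 0 <= K -> 0 <= t <= T ->
  (forall u, 0 <= u <= t -> wn (wt s) (G u) <= B) ->
  wn (omega (s + 2) K) (G t) <= A * wn (omega (s + 2) K) (w 0).
Proof.
move=> K0 tT Hu; have [G0 JG dG eG] := HG.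
apply: le_trans (grow gq B0 K0 JG dG eG tT Hu) _.
apply: ler_pM; [exact: expR_ge0|exact: wn_ge0| |].
  by rewrite ler_expR; apply: ler_wpM2l; [exact: mulr_ge0|case/andP: tT].
by rewrite G0; have [] := wdom_trunc N (wdom_omega K0 dw0).
Qed.

Lemma galerkin_bil t : 0 <= t <= T ->
  wdom (wt s) (bil q (G t) (G t)) /\ wdom (wt s) (trunc N (bil q (G t) (G t))).
Proof.
move=> tT; have [_ _ dG _] := HG; have [C _ H] := @bil_bound0 R s s1.
have [_ d _] := H q (G t) (G t) gq (dG s s0 t tT) (dG (s + 1) s10 t tT).
by split; [exact: d|have [] := wdom_trunc N d].
Qed.

Lemma galerkin_dom : dom_on (HW s) 0 T (fun t => trunc N (bil q (G t) (G t))).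
Proof. by move=> t tT; have [] := galerkin_bil tT. Qed.

Lemma galerkin_error t : 0 <= t <= T -> wn (wt (s + 2)) (G t) <= Q ->
  hnorm (HW s) (trunc N (bil q (G t) (G t)) - bil q (G t) (G t)) <= N%:R^-1 * c1.
Proof.
move=> tT GQ; have [_ _ dG _] := HG; have [d d'] := galerkin_bil tT.
have d2 : wdom (wt (s + 1 + 1)) (G t) by rewrite rE; exact: dG (s + 2) r0 t tT.
have d1 := dG (s + 1) s10 t tT.
have [_ db nb] := bilb gq d1 d2.
have [_ k] := trunc_tail N0 db; rewrite hnorm_distC//.
apply: le_trans k _; apply: ler_wpM2l; first by rewrite invr_ge0.
apply: le_trans nb _; have GQ1 : wn (wt (s + 1)) (G t) <= Q.
  by apply: le_trans GQ; exact: wn_wt le1 (dG _ r0 t tT).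
have GQ2 : wn (wt (s + 1 + 1)) (G t) <= Q by rewrite rE; exact: GQ.
apply: ler_pM (wn_ge0 _ _) _ GQ2; first exact: mulr_ge0 Cb0 (wn_ge0 _ _).
exact: ler_wpM2l.
Qed.

Lemma galerkin_dist : cont_on 0 T (fun t => hnorm (HW s) (G t - w t)).
Proof.
have [_ _ dG eG] := HG; have db := galerkin_dom.
have D := sderiv_onB (dG s s0) db (dom_on_wt le3 dw) dw' (eG s s0) ew.
have d1 : dom_on (HW s) 0 T (fun t => G t - w t).
  by move=> t tT; exact: hdomB (dG s s0 t tT) (wdom_wt le3 (dw tT)).
apply: (scont_norm d1); apply: (sderiv_on_cont d1 _ D).
by move=> t tT; exact: (@hdomB _ _ (HW s) _ _ (db t tT) (dw' tT)).
Qed.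

Lemma galerkin_near t : 0 <= t <= T -> hnorm (HW s) (G t - w t) <= 1 -> wn (wt s) (G t) <= B.
Proof.
move=> tT h; have [_ _ dG _] := HG.
have := hnorm_add (hdomB (dG s s0 t tT) (wdom_wt le3 (dw tT))) (wdom_wt le3 (dw tT)).
rewrite subrK !hnormHW => k; apply: le_trans k _; rewrite /B addrC -hnormHW.
apply: lerD h; exact: le_trans (wn_wt le3 (dw tT)) (bw tT).
Qed.

Hypothesis Nbig : N%:R^-1 * (E * (c0 ^+ 2 + 2 * c1 ^+ 2 * T)) <= 1 / 4.

(** A bootstrap. While the distance to [w] is at most 1, the H^s norm of [G] is at most [B], hence
    its H^(s+2) norm is at most [Q] and the truncation error is of order [1 / N]. The stability
    estimate then bounds the squared distance by [1 / 4 + 2 / 8], less than [(3 / 4)^2]. *)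
Lemma galerkin_close t : 0 <= t <= T -> hnorm (HW s) (G t - w t) <= 1.
Proof.
have [_ JG dG eG] := HG.
have n1 : N%:R^-1 <= 1 :> R by rewrite invf_le1 ?ltr0n// ler1n.
have n0 : 0 <= N%:R^-1 :> R by rewrite invr_ge0.
have E1 : 1 <= E.
  by rewrite /E -expR0 ler_expR; rewrite mulr_ge0// addr_ge0// mulr_ge0.
have sq (x y : R) : 0 <= x -> x <= y -> x ^+ 2 <= y ^+ 2.
  by move=> x0 xy; rewrite !expr2; exact: ler_pM.
have nsq (c : R) : (N%:R^-1 * c) ^+ 2 <= N%:R^-1 * c ^+ 2.
  rewrite exprMn; apply: ler_wpM2r; first exact: sqr_ge0.
  by rewrite expr2 ler_piMl.
have start2 : hnorm (HW s) (G 0 - w 0) ^+ 2 <= N%:R^-1 * c0 ^+ 2.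
  by apply: le_trans (nsq c0); apply: sq galerkin_start; exact: hnorm_ge0.
have P0 : 0 <= c1 ^+ 2 * T by rewrite mulr_ge0// sqr_ge0.
have P1 := sqr_ge0 c0.
have fromsq (x y : R) : 0 <= y -> x ^+ 2 <= y ^+ 2 -> x <= y.
  move=> y0; rewrite -[leRHS]real_normK ?num_real// -[X in X <= _]real_normK ?num_real//.
  by rewrite ler_pXn2r ?nnegrE// (ger0_norm y0); apply: le_trans (ler_norm _).
apply: (continuity_method T0' galerkin_dist) => [|{}t tT below].
  apply: fromsq => //; apply: (le_trans start2); rewrite expr1n.
  have : N%:R^-1 * c0 ^+ 2 <= N%:R^-1 * (E * (c0 ^+ 2 + 2 * c1 ^+ 2 * T)).
    apply: (ler_wpM2l n0); apply: (@le_trans _ _ (1 * (c0 ^+ 2 + 2 * c1 ^+ 2 * T))).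
      by rewrite mul1r lerDl -mulrA mulr_ge0.
    by apply: ler_wpM2r => //; rewrite addr_ge0// -mulrA mulr_ge0.
  by move=> k; have := le_trans k Nbig; lra.
have [t0 tT'] := andP tT.
have sub u : 0 <= u <= t -> 0 <= u <= T by move=> /andP[-> /le_trans]; apply.
have GB u : 0 <= u <= t -> wn (wt s) (G u) <= B.
  by move=> ut; apply: galerkin_near; [exact: sub|exact: below].
have GQ u : 0 <= u <= t -> wn (wt (s + 2)) (G u) <= Q.
  move=> ut; have := galerkin_omega (lexx 0) (sub u ut); rewrite omega_wt; apply=> v /andP[v0 vu].
  by apply: GB; rewrite v0 (le_trans vu)//; case/andP: ut.
have tt : 0 <= t <= t by rewrite t0 lexx.
have bd u : 0 <= u <= t -> [/\ wn (wt s) (G u) <= B, wn (wt (s + 1)) (w u) <= B &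
    hnorm (HW s) ((trunc N (bil q (G u) (G u)) - bil q (G u) (G u)) - (w' u - bil q (w u) (w u)))
    <= N%:R^-1 * c1 + eta].
  move=> ut; have uT := sub u ut; split; first exact: GB.
    exact: le_trans (bw uT) BK.
  have [d1 d2] := galerkin_bil uT.
  have [C' _ H'] := @bil_bound0 R s s1.
  have [_ d3 _] := H' q (w u) (w u) gq (wdom_wt le3 (dw uT)) (dw uT).
  apply: le_trans (@hnorm_subadd _ _ (HW s) _ _ (@hdomB _ _ (HW s) _ _ d2 d1) (hdomB (dw' uT) d3)) _.
  by apply: lerD; [exact: galerkin_error uT (GQ u ut)|exact: aw].
have := stab gq B0 (dom_on_sub tT' (dG _ s10)) (dom_on_sub tT' dw)
  (dom_on_sub tT' galerkin_dom) (dom_on_sub tT' dw')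
  (sderiv_on_sub tT' (eG s s0)) (sderiv_on_sub tT' ew) bd tt.
move=> k; apply: fromsq; first by rewrite divr_ge0.
apply: le_trans k _.
have e1 : expR ((stabC s2 * B + 1) * t) <= E.
  by rewrite ler_expR; apply: ler_wpM2l => //; rewrite addr_ge0// mulr_ge0.
have e2 : (N%:R^-1 * c1 + eta) ^+ 2 * t <= (2 * (N%:R^-1 * c1 ^+ 2) + 2 * eta ^+ 2) * T.
  apply: ler_pM => //; first exact: sqr_ge0.
  have := nsq c1; have := sqr_ge0 (N%:R^-1 * c1 - eta).
  move: (N%:R^-1 * c1) (N%:R^-1 * c1 ^+ 2) => x y h1 h2; nra.
have e3 := lerD start2 e2.
have p0 : 0 <= hnorm (HW s) (G 0 - w 0) ^+ 2 + (N%:R^-1 * c1 + eta) ^+ 2 * t.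
  by rewrite addr_ge0 ?sqr_ge0// mulr_ge0// sqr_ge0.
apply: le_trans (ler_pM (expR_ge0 _) p0 e1 e3) _.
have -> : E * (N%:R^-1 * c0 ^+ 2 + (2 * (N%:R^-1 * c1 ^+ 2) + 2 * eta ^+ 2) * T) =
  N%:R^-1 * (E * (c0 ^+ 2 + 2 * c1 ^+ 2 * T)) + 2 * (E * (eta ^+ 2 * T)).
  by move: (N%:R^-1) => n; ring.
apply: le_trans (lerD Nbig (ler_wpM2l (ler0n _ 2) small)) _; lra.
Qed.

Lemma galerkin_bounds t : 0 <= t <= T -> [/\ wn (wt s) (G t) <= B, wn (wt (s + 2)) (G t) <= Q &
  forall K, 0 <= K -> wn (omega (s + 2) K) (G t) <= A * wn (omega (s + 2) K) (w 0)].
Proof.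
move=> tT; have GB u : 0 <= u <= T -> wn (wt s) (G u) <= B.
  by move=> uT; apply: (galerkin_near uT); exact: galerkin_close.
have H K : 0 <= K -> wn (omega (s + 2) K) (G t) <= A * wn (omega (s + 2) K) (w 0).
  move=> K0; apply: galerkin_omega => // u /andP[u0 ut]; apply: GB; rewrite u0 (le_trans ut)//.
  by case/andP: tT.
by split; [exact: GB|have := H 0 (lexx _); rewrite omega_wt|exact: H].
Qed.

End OneGalerkin.

Lemma inv_small (d : R) : 0 < d -> exists n0 : nat, forall n, (n0 <= n)%N -> n.+1%:R^-1 <= d.
Proof.
move=> d0; exists (Num.truncn d^-1) => n hn.
rewrite -[leRHS]invrK lef_pV2 ?posrE ?invr_gt0//.
by apply: ltW; apply: lt_le_trans (truncnS_gt _) _; rewrite ler_nat.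
Qed.

(** The cutoffs depend on the H^(s+2) norm of the datum through [c1]; the smallness asked of [eta]
    does not. *)
Lemma galerkin_family : exists (N : nat -> nat) (G : nat -> R -> T2 -> R),
  [/\ forall n, (n < N n)%N, forall n, is_galerkin (N n) (G n) &
      forall n, (N n)%:R^-1 * (E * (c0 ^+ 2 + 2 * c1 ^+ 2 * T)) <= 1 / 4].
Proof.
pose D := E * (c0 ^+ 2 + 2 * c1 ^+ 2 * T).
have D0 : 0 <= D.
  by rewrite mulr_ge0 ?expR_ge0// addr_ge0 ?sqr_ge0// mulr_ge0// mulr_ge0// sqr_ge0.
have d0 : 0 < (4 * (D + 1))^-1 by rewrite invr_gt0 mulr_gt0// ltr_wpDl.
have [n0 Hn] := inv_small d0.
have [G HG] := boolp.choice galerkin_ex.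
exists (fun n => (n + n0).+1), (fun n => G (n + n0).+1); split=> n.
- by rewrite ltnS leq_addr.
- exact: HG.
- apply: le_trans (ler_wpM2r D0 (Hn _ (leq_addl n n0))) _.
  rewrite -/D; clearbody D; rewrite ler_pdivrMl ?mulr_gt0 ?ltr_wpDl//; lra.
Qed.

(** Stability between two approximations makes them Cauchy in H^s. Stability between their limit and
    [w], now without truncation error and with equal initial values, gives the final distance. *)
Theorem existence : exists F, [/\ strong (s + 2) T q F, {ae mu, forall x, F 0 x = w 0 x} &
  forall t, 0 <= t <= T -> hnorm (HW s) (F t - w t) ^+ 2 <= E * (eta ^+ 2 * T)].
Proof.
have aux (x : R) : 0 <= x -> x <= (x + 1) ^+ 2 by move=> x0; have := sqr_ge0 x; lra.
have [N [G [Nn HG Nbig]]] := galerkin_family.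
have Npos n : (0 < N n)%N by exact: leq_ltn_trans (Nn n).
have bds n t (tT : 0 <= t <= T) := galerkin_bounds (Npos n) (HG n) (Nbig n) tT.
have Ninv n : (N n)%:R^-1 <= n.+1%:R^-1 :> R.
  by rewrite lef_pV2 ?posrE ?ltr0n// ler_nat.
have dG n b : 0 <= b -> dom_on (HW b) 0 T (G n) by have [_ _ d _] := HG n; exact: d.
have eG n : sderiv_on (HW s) 0 T (G n) (fun t => trunc (N n) (bil q (G n t) (G n t))).
  by have [_ _ _ e] := HG n; exact: e.
have dg n := galerkin_dom (HG n).
have err n t : 0 <= t <= T -> hnorm (HW s)
    (trunc (N n) (bil q (G n t) (G n t)) - bil q (G n t) (G n t)) <= n.+1%:R^-1 * c1.
  move=> tT; have [_ k _] := bds n t tT.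
  by apply: le_trans (galerkin_error (Npos n) (HG n) tT k) _; apply: ler_wpM2r.
have start n : hnorm (HW s) (G n 0 - w 0) <= n.+1%:R^-1 * c0.
  by apply: le_trans (galerkin_start (Npos n) (HG n)) _; apply: ler_wpM2r.
(* Two approximations are compared here, so the bound has to cover [B] for one in H^s and [Q] for
   the other in H^(s+1). *)
pose BQ := B + Q; have BQ0 : 0 <= BQ by exact: addr_ge0.
pose E' := expR ((stabC s2 * BQ + 1) * T); have E'0 : 0 <= E' := expR_ge0 _.
pose D' := E' * (c0 ^+ 2 + c1 ^+ 2 * T).
have D'0 : 0 <= D' by rewrite mulr_ge0// addr_ge0 ?sqr_ge0// mulr_ge0// sqr_ge0.
have cauchy n m t (d : R) : 0 <= t <= T -> n.+1%:R^-1 <= d -> m.+1%:R^-1 <= d ->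
    hnorm (HW s) (G n t - G m t) ^+ 2 <= (2 * d) ^+ 2 * D'.
  move=> tT hn hm; have d0 : 0 <= d by apply: le_trans hn; rewrite invr_ge0.
  have sumc (c : R) : 0 <= c -> n.+1%:R^-1 * c + m.+1%:R^-1 * c <= 2 * d * c.
    by move=> cc; rewrite -mulrDl; apply: (ler_wpM2r cc); rewrite mulr_natl mulr2n; exact: lerD.
  have bd u : 0 <= u <= T -> [/\ wn (wt s) (G n u) <= BQ, wn (wt (s + 1)) (G m u) <= BQ &
    hnorm (HW s) ((trunc (N n) (bil q (G n u) (G n u)) - bil q (G n u) (G n u)) -
      (trunc (N m) (bil q (G m u) (G m u)) - bil q (G m u) (G m u))) <= 2 * d * c1].
    move=> uT; have [k1 _ _] := bds n u uT; have [_ k2 _] := bds m u uT; split.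
    - by apply: le_trans k1 _; rewrite lerDl.
    - by apply: le_trans (wn_wt le1 (dG m _ r0 u uT)) _; apply: le_trans k2 _; rewrite lerDr.
    - have [a1 a2] := galerkin_bil (HG n) uT; have [a3 a4] := galerkin_bil (HG m) uT.
      apply: le_trans (@hnorm_subadd _ _ (HW s) _ _ (@hdomB _ _ (HW s) _ _ a2 a1) (@hdomB _ _ (HW s) _ _ a4 a3)) _.
      by apply: le_trans (lerD (err n u uT) (err m u uT)) _; exact: sumc.
  have := stab gq BQ0 (dG n _ s10) (dG m _ s10) (dg n) (dg m) (eG n) (eG m) bd tT.
  move=> k; apply: le_trans k _.
  have e0 : expR ((stabC s2 * BQ + 1) * t) <= E'.
    rewrite ler_expR; apply: ler_wpM2l; last by case/andP: tT.
    by rewrite addr_ge0// mulr_ge0.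
  have st : hnorm (HW s) (G n 0 - G m 0) <= 2 * d * c0.
    have dw0' : hdom (HW s) (w 0) := wdom_wt le2 dw0.
    apply: le_trans (hdist_tri (dG n _ s0 0 l00) dw0' (dG m _ s0 0 l00)) _.
    rewrite (hnorm_distC dw0' (dG m _ s0 0 l00)).
    by apply: le_trans (lerD (start n) (start m)) _; exact: sumc.
  have st2 : hnorm (HW s) (G n 0 - G m 0) ^+ 2 <= (2 * d * c0) ^+ 2.
    by rewrite !expr2; exact: (ler_pM (hnorm_ge0 _ _) (hnorm_ge0 _ _) st st).
  have st3 : (2 * d * c1) ^+ 2 * t <= (2 * d * c1) ^+ 2 * T.
    by apply: (ler_wpM2l (sqr_ge0 _)); case/andP: tT.
  have p0 : 0 <= hnorm (HW s) (G n 0 - G m 0) ^+ 2 + (2 * d * c1) ^+ 2 * t.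
    by rewrite addr_ge0 ?sqr_ge0// mulr_ge0 ?sqr_ge0//; case/andP: tT.
  apply: le_trans (ler_pM (expR_ge0 _) p0 e0 (lerD st2 st3)) _.
  by rewrite le_eqVlt; apply/orP; left; apply/eqP; rewrite /D'; ring.
have cG (e : R) : 0 < e -> exists n0, forall n m, (n0 <= n)%N -> (n0 <= m)%N ->
    forall t, 0 <= t <= T -> hnorm (HW s) (G n t - G m t) <= e.
  move=> e0; have p : 0 < 2 * (D' + 1) by rewrite mulr_gt0// ltr_wpDl.
  have [n0 Hn] := inv_small (divr_gt0 e0 p); exists n0 => n m hn hm t tT.
  have := cauchy n m t _ tT (Hn n hn) (Hn m hm) => k.
  rewrite -(@ler_pXn2r _ 2)// ?nnegrE ?hnorm_ge0 ?(ltW e0)//; apply: le_trans k _.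
  have -> : (2 * (e / (2 * (D' + 1)))) ^+ 2 * D' = e ^+ 2 * (D' / (D' + 1) ^+ 2).
    by field; rewrite gt_eqF// ltr_wpDl.
  rewrite ler_piMr ?sqr_ge0// ler_pdivrMr ?exprn_gt0 ?ltr_wpDl// mul1r.
  exact: aux.
have bG (e : R) : 0 < e -> exists n0, forall n, (n0 <= n)%N -> forall t, 0 <= t <= T ->
    hnorm (HW s) (trunc (N n) (bil q (G n t) (G n t)) - bil q (G n t) (G n t)) <= e.
  move=> e0; have p : 0 < c1 + 1 by rewrite ltr_wpDl.
  have [n0 Hn] := inv_small (divr_gt0 e0 p); exists n0 => n hn t tT.
  apply: le_trans (err n t tT) _; apply: le_trans (ler_wpM2r c10 (Hn n hn)) _.
  by rewrite mulrAC -mulrA; exact: frac_le (ltW e0) c10.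
have tG n t K : 0 <= t <= T -> 0 <= K ->
    wn (omega (s + 2) K) (G n t) <= A * wn (omega (s + 2) K) (w 0).
  by move=> tT K0; have [_ _ H] := bds n t tT; exact: H.
have A0 : 0 <= A := expR_ge0 _.
have dGr n : dom_on (HW (s + 2)) 0 T (G n) by exact: dG.
have [F HF] := Hs_limit_ex dGr cG.
have SF := limit_strong s2 T0' A0 gq dw0 dGr dg eG bG tG HF.
have [dF cF] := HF.
have F0 : hnorm (HW s) (F 0 - w 0) = 0.
  apply/eqP; rewrite eq_le hnorm_ge0 andbT; apply/ler_addgt0Pr => e e0; rewrite add0r.
  have e2 : 0 < e / 2 by rewrite divr_gt0.
  have p : 0 < c0 + 1 by rewrite ltr_wpDl.
  have [n1 H1] := cF _ e2; have [n2 H2] := inv_small (divr_gt0 e2 p).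
  pose n := maxn n1 n2; have dw0' : hdom (HW s) (w 0) := wdom_wt le2 dw0.
  apply: le_trans (hdist_tri (dF 0 l00) (dG n _ s0 0 l00) dw0') _.
  rewrite (hnorm_distC (dF 0 l00) (dG n _ s0 0 l00)).
  have h1 := H1 n (leq_maxl _ _) 0 l00.
  have h2 : hnorm (HW s) (G n 0 - w 0) <= e / 2.
    apply: le_trans (start n) _; apply: le_trans (ler_wpM2r c00 (H2 n (leq_maxr _ _))) _.
    by rewrite mulrAC -mulrA; exact: frac_le (ltW e2) c00.
  by apply: le_trans (lerD h1 h2) _; rewrite -splitr.
have Fnear t : 0 <= t <= T -> hnorm (HW s) (F t - w t) <= 1.
  move=> tT; apply/ler_addgt0Pr => e e0; have [n1 H1] := cF e e0.
  have h1 := H1 n1 (leqnn _) t tT; have h2 := galerkin_close (Npos n1) (HG n1) (Nbig n1) tT.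
  have dwt := wdom_wt le3 (dw tT).
  apply: le_trans (hdist_tri (dF t tT) (dG n1 _ s0 t tT) dwt) _.
  by rewrite (hnorm_distC (dF t tT) (dG n1 _ s0 t tT)) addrC; exact: lerD h2 h1.
have le : s <= s + 2 - 1 by lra.
have [dF1 db eF] := strong_sderiv le s1 gq SF.
exists F; split; first exact: SF.
  have d0 : wdom (wt s) (fun x => F 0 x - w 0 x) := wdomB (dF 0 l00) (wdom_wt le2 dw0).
  move: F0; rewrite hnormHW => /(n2_eq0_ae d0); apply: aeS => x /eqP.
  by rewrite mulf_eq0 gt_eqF ?wt_gt0//= subr_eq0 => /eqP.
move=> t tT.
have bd u : 0 <= u <= T -> [/\ wn (wt s) (F u) <= B, wn (wt (s + 1)) (w u) <= B &
    hnorm (HW s) ((bil q (F u) (F u) - bil q (F u) (F u)) - (w' u - bil q (w u) (w u))) <= eta].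
  move=> uT; have dwu := wdom_wt le3 (dw uT); split.
  - have := hnorm_add (hdomB (dF u uT) dwu) dwu.
    rewrite subrK !hnormHW => k; apply: le_trans k _; rewrite /B addrC -hnormHW.
    apply: lerD (Fnear u uT); exact: le_trans (wn_wt le3 (dw uT)) (bw uT).
  - exact: le_trans (bw uT) BK.
  - have [C' _ H'] := @bil_bound0 R s s1.
    have [_ d3 _] := H' q (w u) (w u) gq dwu (dw uT).
    by rewrite subrr sub0r hnorm_opp; [exact: aw|exact: hdomB (dw' uT) d3].
have := stab gq B0 dF1 dw db dw' eF ew bd tT; rewrite F0 expr0n /= add0r => k.
apply: le_trans k _; have [t0 tT'] := andP tT.
apply: ler_pM; [exact: expR_ge0|by rewrite mulr_ge0 ?sqr_ge0| |].
  by rewrite ler_expR; apply: ler_wpM2l => //; rewrite addr_ge0// mulr_ge0.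
by apply: (ler_wpM2l (sqr_ge0 _)).
Qed.

End Existence.

(** * Dependence of the nonlinearity on [alpha] *)

Section Comparison.
Context {R : realType}.
Notation mu := (@mu2 R).
Notation T2 := (plane R).

Lemma strong_sub (r T t : R) (q : T2 -> R) h : t <= T -> strong r T q h -> strong r t q h.
Proof.
move=> tT [dh ch eh]; split; [exact: dom_on_sub tT dh| |exact: sderiv_on_sub tT eh].
move=> u /andP[u0 ut] e e0; have uT : 0 <= u <= T by rewrite u0 (le_trans ut).
have [d d0 Hd] := ch u uT e e0; exists d; first exact: d0.
by move=> v /andP[v0 vt]; apply: Hd; rewrite v0 (le_trans vt).
Qed.

Lemma bil_subl (s : R) (q q' h : T2 -> R) : 1 < s -> goodq q -> goodq q' -> wdom (wt (s + 1)) h ->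
  {ae mu, forall x, bil q h h x - bil q' h h x = bil (fun y => q y - q' y) h h x}.
Proof.
move=> s1 gq gq' dh; have [C _ H] := bil_bound0 s1.
have le : s <= s + 1 by rewrite lerDl.
have [a1 _ _] := H q h h gq (wdom_wt le dh) dh; have [a2 _ _] := H q' h h gq' (wdom_wt le dh) dh.
apply: aeS2 a1 a2 => x i1 i2; rewrite /bil -(RintegralB measurableT i1 i2).
by apply: eq_Rintegral => y _; rewrite /ker; ring.
Qed.

(** The product estimate at [j = 1], applied to the difference of the two symbols: its linear growth
    costs one derivative of the factor [h] that generates the velocity. *)
Lemma bil_perturbation (s : R) : 1 < s -> exists2 C : R, 0 <= C & forall a (h : T2 -> R),
  3 / 8 <= a -> a <= 1 / 2 -> wdom (wt (s + 1)) h ->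
  hnorm (HW s) (bil (qm (1 / 2)) h h - bil (qm a) h h) <= C * (1 / 2 - a) * wn (wt (s + 1)) h ^+ 2.
Proof.
move=> s1; have [C C0 H] := @bil_bound R s 1 s1 ler01; exists (8 * C) => [|a h a0 a1 dh].
  exact: mulr_ge0.
have h0 : 3 / 8 <= 1 / 2 :> R by lra.
have ga := goodq_qm a0 a1; have gh := goodq_qm h0 (lexx (1 / 2)).
have [ma _ _ _] := ga; have [mh _ _ _] := gh.
have [C' _ H'] := bil_bound0 s1; have le : s <= s + 1 by rewrite lerDl.
have [_ d1 _] := H' _ h h gh (wdom_wt le dh) dh; have [_ d2 _] := H' _ h h ga (wdom_wt le dh) dh.
have c0 : 0 <= 8 * (1 / 2 - a) by rewrite mulr_ge0// subr_ge0.
have qb x : enorm x * `|qm (1 / 2) x - qm a x| <= 8 * (1 / 2 - a) * (wt 1 x + sing x).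
  by rewrite distrC; exact: qm_diff.
have mq : measurable_fun setT (fun x : T2 => qm (1 / 2) x - qm a x) by exact: measurable_funB.
have [_ d3 est] := H _ _ h h c0 mq qb dh dh.
rewrite hnormHW (wn_ae (measurable_wt s) (HW_meas (wdomB d1 d2)) (HW_meas d3) (bil_subl s1 gh ga dh)).
apply: le_trans est _; move: (wn _ h) => x.
by rewrite le_eqVlt; apply/orP; left; apply/eqP; ring.
Qed.

Lemma Hs_le (r r' : R) (f : T2 -> R) : r <= r' -> Hs r' f -> Hs r f.
Proof. by move=> le /HsE[sf df]; apply/HsE; split; [exact: sf|exact: wdom_wt le df]. Qed.

End Comparison.

Theorem theorem1p4 (R : realType) (s : R) (hs : 2 < s) (T : R) (hT : 0 < T)
    (M : R) :
  exists delta C : R, 0 < delta /\ 0 < C /\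
    forall (w0 : R * R -> R) (w : R -> R * R -> R),
      Hs (s + 2) w0 ->
      gsqg_solution (1 / 2) (s + 2) T w0 w ->
      (\int[@lebesgue_measure R]_(t in `[0%R, T]) Hnorm (s + 2)%R (w t))%E = M%:E ->
      forall alpha : R, 0 < alpha -> alpha < 1 / 2 ->
        0 < 1 / 2 - alpha -> 1 / 2 - alpha < delta ->
        exists wa : R -> R * R -> R,
          gsqg_solution alpha (s + 2) T w0 wa /\
          (forall (T' : R) (wb : R -> R * R -> R), 0 < T' -> T' <= T ->
             gsqg_solution alpha (s + 2) T' w0 wb ->
             forall t : R, t \in `[0, T'] -> forall x : R * R, wb t x = wa t x) /\
          (forall t : R, t \in `[0, T] ->
             (Hnorm s (wa t \- w t)%R <=
              (C * ((1 / 2 - alpha)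
                    + (1 / 2 - alpha) * ln (1 / 2 - alpha) ^+ 2))%R%:E)%E).
Proof.
have s1 : 1 < s by lra. have r3 : 3 < s + 2 by lra. have r2 : 2 < s + 2 by lra.
have r1 : 1 < s + 2 by lra.
have le0 : s <= s + 2 - 1 by lra. have le2 : s <= s + 2 by lra.
have h38 : 3 / 8 <= 1 / 2 :> R by lra.
have T0 : 0 <= T := ltW hT.
have eighth_le1 (x : R) : x < 1 / 8 -> x <= 1 by lra.
have eighth (x y z : R) : 0 < x -> x * (8 * (y + 1)) < 1 -> z <= y * x -> z <= 1 / 8 by lra.
have [Cs Cs0 HCs] := sup_bound hs; have [Cp Cp0 HCp] := bil_perturbation s1.
(* A bound on the squared H^(s+1) norm of any SQG solution with this [M], fixed before the solution
   is introduced. *)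
pose K2 := (M / T + 1) ^+ 2 * expR (Cs * M).
have K20 : 0 <= K2 by rewrite mulr_ge0 ?sqr_ge0 ?expR_ge0.
pose Kb := Num.sqrt K2; have Kb0 : 0 <= Kb := sqrtr_ge0 _.
have KbE : Kb ^+ 2 = K2 by rewrite sqr_sqrtr.
pose E := expR ((stabC hs * (Kb + 1) + 1) * T).
have E0 : 0 <= E := expR_ge0 _.
(* With [e = 1 / 2 - alpha] the residual is [eta = Cp e K2], so [E eta^2 T] is [c e^2]. The choice
   of [delta] makes this at most 1/8, and keeps [alpha] above 3/8. *)
pose c := E * ((Cp * K2) ^+ 2 * T).
have c0 : 0 <= c by rewrite mulr_ge0// mulr_ge0 ?sqr_ge0.
pose delta := Num.min (1 / 8) (8 * (c + 1))^-1.
have C0 : 0 < Num.sqrt c + 1 by rewrite ltr_wpDl// sqrtr_ge0.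
exists delta, (Num.sqrt c + 1); split.
  by rewrite lt_min divr_gt0//= invr_gt0 mulr_gt0// ltr_wpDl.
split=> // w0 w Hw0 Sw IM alpha _ alt e0; rewrite lt_min => /andP[e1 e2].
set e := 1 / 2 - alpha in e0 e1 e2 *.
have a38 : 3 / 8 <= alpha by rewrite /e in e1; lra.
have a12 : alpha <= 1 / 2 := ltW alt.
have gq0 := goodq_qm h38 (lexx (1 / 2)); have gq := goodq_qm a38 a12.
pose h t := U (w t).
have Sh : strong (s + 2) T (qm (1 / 2)) h := solution_strong r3 T0 h38 (lexx _) Sw.
have [cw w00 pw ew] := Sw.
have hw t : 0 <= t <= T -> Hs (s + 2) (w t) by move=> tT; have [] := cw t tT.
have [sw0 dw0] := (HsE _ _).1 Hw0.
have l00 : 0 <= (0 : R) <= T by rewrite lexx.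
have IM' : (\int[@lebesgue_measure R]_(t in `[0%R, T]) (wn (wt (s + 2)) (h t))%:E = M%:E)%E.
  by rewrite -IM; apply: eq_integral => t; rewrite inE /= in_itv /= => tT; rewrite (HnormE (hw t tT)).
have bK t : 0 <= t <= T -> wn (wt (s + 1)) (h t) <= Kb.
  move=> tT; have k := HCs _ _ _ _ gq0 hT Sh IM' t tT.
  by rewrite -(ger0_norm (wn_ge0 _ _)) -sqrtr_sqr; exact: ler_wsqrtr.
have [dh1 db eh] := strong_sderiv le0 s1 gq0 Sh; have [dh2 _ _] := Sh.
pose eta := Cp * e * K2.
have aw t : 0 <= t <= T -> hnorm (HW s) (bil (qm (1 / 2)) (h t) (h t) - bil (qm alpha) (h t) (h t)) <= eta.
  move=> tT; apply: le_trans (HCp alpha (h t) a38 a12 (dh1 t tT)) _.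
  apply: ler_wpM2l; first by rewrite mulr_ge0// ltW.
  by rewrite -KbE !expr2; exact: (ler_pM (wn_ge0 _ _) (wn_ge0 _ _) (bK t tT) (bK t tT)).
have cE : E * (eta ^+ 2 * T) = c * e ^+ 2 by rewrite /c /eta; ring.
have small : E * (eta ^+ 2 * T) <= 1 / 8.
  have p : 0 < 8 * (c + 1) by rewrite mulr_gt0// ltr_wpDl.
  move: e2; rewrite -[X in _ < X]mul1r ltr_pdivlMr// => e2.
  have ee : e ^+ 2 <= e by rewrite expr2 ler_piMr ?(ltW e0)//; exact: eighth_le1.
  rewrite cE; exact: eighth e0 e2 (ler_wpM2l c0 ee).
have [F [SF F0 HF]] := existence hT Kb0 gq dh1 (dh2 0 l00) db eh bK aw small.
have U0 : {ae mu2, forall x, F 0 x = U w0 x}.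
  have [sw _] := (HsE _ _).1 (hw 0 l00).
  by apply: aeS2 F0 (U_eq_ae sw sw0 w00) => x ->.
have Swa := strong_solution r3 T0 a38 a12 sw0 U0 SF.
have [dF _ _] := SF.
exists (fun t => Har (F t)); split; first exact: Swa.
split=> [T' wb T'0 T'T Sb t tT x|t tT].
  (* Uniqueness compares transforms almost everywhere; writing both functions as inverse transforms
     turns it into equality at every point. *)
  have Sb' := solution_strong r3 (ltW T'0) a38 a12 Sb.
  have [cb b0 pb _] := Sb.
  have hb u : 0 <= u <= T' -> Hs (s + 2) (wb u) by move=> uT; have [] := cb u uT.
  have l00' : 0 <= (0 : R) <= T' by rewrite lexx ltW.
  have [sb _] := (HsE _ _).1 (hb 0 l00'); have [sbt _] := (HsE _ _).1 (hb t tT).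
  have i0 : {ae mu2, forall x, F 0 x = U (wb 0) x}.
    by apply: aeS2 U0 (U_eq_ae sb sw0 b0) => y -> ->.
  have k := uniqueness hs (ltW T'0) gq (strong_sub T'T SF) Sb' i0 tT.
  have tT1 : 0 <= t <= T by move: tT; rewrite in_itv /= => /andP[-> /le_trans]; apply.
  rewrite (congr1 (fun f => f x) (representation r2 (hb t tT) (pb t tT))).
  by apply/esym; exact: (Har_ae x (HW_meas (dF t tT1)) (sqint_U sbt).1 k).
have [cwa _ _ _] := Swa; have hwa : Hs (s + 2) (Har (F t)) by have [] := cwa t tT.
have [_ ->] := Hs_sub (Hs_le le2 hwa) (Hs_le le2 (hw t tT)).
rewrite lee_fin; have [sHF eF] := U_HarK r1 (dF t tT).
have d1 : wdom (wt s) (fun x => F t x - h t x).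
  exact: wdomB (wdom_wt le2 (dF t tT)) (wdom_wt le2 (dh2 t tT)).
have sU : sqint (fun x => U (Har (F t)) x - U (w t) x).
  by apply: sqintB; [exact: sqint_U sHF|exact: wdom_sqint (ltW (lt_trans ltr01 r1)) (dh2 t tT)].
rewrite (wn_ae (measurable_wt s) sU.1 (HW_meas d1)); last by apply: aeS eF => x ->.
have := HF t tT; rewrite -/E cE hnormHW => k.
have k' : wn (wt s) (fun x => F t x - h t x) <= Num.sqrt c * e.
  rewrite -(ger0_norm (wn_ge0 _ _)) -sqrtr_sqr -[X in _ <= _ * X](ger0_norm (ltW e0)) -sqrtr_sqr -sqrtrM//.
  exact: ler_wsqrtr.
(* The distance is at most [sqrt c] times [1 / 2 - alpha]; the logarithmic term is nonnegative and
   only enlarges the right side. *)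
apply: le_trans k' _; apply: ler_pM; [exact: sqrtr_ge0|exact: ltW|by rewrite lerDl|].
by rewrite lerDl mulr_ge0 ?sqr_ge0// ltW.
Qed.
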